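(* Let $P$ be a triangulated pseudo-manifold (possibly with boundary). Let $S_0$ and $S_1$ be normal subsets in $P$ with the property that for any type of normal disc, $S_0$ and $S_1$ contain the same (not necessarily finite) number of normal discs of this type. Then $S_0$ and $S_1$ are normally isotopic.
   Context: Pseudo-manifolds. Let $\widetilde{\Delta}$ be a disjoint union of finitely many regular Euclidean 3-simplices of edge length one and $\Phi$ a collection of Euclidean isometries between 2-dimensional faces such that each face is the range or domain (not both) of at most one element of $\Phi$. The quotient $P=\widetilde{\Delta}/\Phi$, with quotient map $p$, is a pseudo-manifold if $p$ is injective on the interior of each 1-simplex. $P$ is closed if every face is the range or domain of an element of $\Phi$, otherwise it has boundary. The image under $p$ of an $n$-simplex is an $n$-singlex; $P^{(n)}$ is the $n$-skeleton. Normal subsets. A normal corner is an interior point of a 1-simplex; a normal arc in a 2-simplex is a straight arc joining normal corners on distinct edges; a normal disc in a 3-simplex is a properly embedded disc whose boundary is made of normal arcs, no two on the same face, and which is the cone on its boundary from the barycentre of its normal corners. It is a normal triangle or a normal quadrilateral. A normal isotopy of a simplex (of $P$) is an isotopy preserving all subsimplices (all singlices). Up to normal isotopy a 3-simplex has four triangle types and three quadrilateral types; normal discs in $P$ are images under $p$ of normal discs in $\widetilde\Delta$, and two are of the same type if they are images of normally isotopic normal discs in $\widetilde\Delta$. A subset $S\subset P$ is normal if (1) $S$ meets each 3-singlex in a (possibly empty) countable union of pairwise disjoint normal discs; (2) the accumulation points of $S\cap P^{(1)}$ lie in $P^{(0)}$; (3) if $\{x_i\}\subset S$ has accumulation point $x\in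 P$, then $x\in S$ or $x\in P^{(0)}$.
   Formalization: Condition (1) of a normal subset is read in the unglued simplices: the preimage of S in each 3-simplex is a countable union of disjoint normal discs. Read literally in P, the lemma fails when two faces of one 3-simplex are glued. *)

(* Defs.v *)
From HB Require Import structures.
From Stdlib Require Import Relations.
From mathcomp Require Import all_boot all_order all_algebra.
From mathcomp Require Import all_classical all_reals all_analysis.
Import Order.TTheory GRing.Theory Num.Theory.
Import numFieldNormedType.Exports.

Set Implicit Arguments.
Unset Strict Implicit.
Unset Printing Implicit Defensive.

Local Open Scope classical_set_scope.
Local Open Scope ring_scope.
Local Open Scope quotient_scope.

Section Isotopy.
Context {R : realType} {X : topologicalType}.

Definition homeomorphism (h : X -> X) : Prop :=
  exists g : X -> X,
    [/\ cancel h g, cancel g h, continuous h & continuous g].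

Definition isotopy (H : R -> X -> X) : Prop :=
  [/\ {within [set: X] `*` `[0 : R, 1], continuous (fun z => H z.2 z.1)},
      H 0 = id
    & forall t, 0 <= t <= 1 -> homeomorphism (H t)].

Definition isotopy_preserving (F : set (set X)) (H : R -> X -> X) : Prop :=
  isotopy H /\
  forall A, F A -> forall t, 0 <= t <= 1 -> H t @` A = A.

Definition isotopic_preserving (F : set (set X)) (A B : set X) : Prop :=
  exists2 H : R -> X -> X, isotopy_preserving F H & H 1 @` A = B.

End Isotopy.

Section Simplex.
Variable R : realType.

(* The regular 3-simplex of edge length one, in barycentric coordinates.
   Its Euclidean metric is [euclid_dist]; see [euclid_dist_vertex]. *)
Definition simplex3 : set 'rV[R]_4 :=
  [set x | (forall i, 0 <= x 0 i) /\ \sum_i x 0 i = 1].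

Definition tetrahedron : topologicalType := set_type simplex3.

Definition bary (x : tetrahedron) : 'rV[R]_4 := set_val x.

Definition euclid_dist (x y : 'rV[R]_4) : R :=
  Num.sqrt (2^-1 * \sum_i (x 0 i - y 0 i) ^+ 2).

Lemma euclid_dist_vertex (i j : 'I_4) :
  i != j -> euclid_dist (delta_mx 0 i) (delta_mx 0 j) = 1.
Proof.
move=> ij; rewrite /euclid_dist (bigD1 i)//= (bigD1 j) 1?eq_sym//= big1 => [|k].
  rewrite !mxE !eqxx /= (negbTE ij) eq_sym (negbTE ij) subr0 sub0r sqrrN.
  by rewrite expr1n addr0 mulVf ?sqrtr1// pnatr_eq0.
by case/andP=> ki kj; rewrite !mxE (negbTE ki) (negbTE kj) /= subrr expr0n.
Qed.

(* The simplex spanned by the set of vertices J. *)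
Definition subsimplex (J : {set 'I_4}) : set tetrahedron :=
  [set x | forall i, i \notin J -> bary x 0 i = 0].

Definition open_subsimplex (J : {set 'I_4}) : set tetrahedron :=
  [set x | subsimplex J x /\ forall i, i \in J -> 0 < bary x 0 i].

Definition subsimplices : set (set tetrahedron) :=
  [set subsimplex J | J in [set J | J != finset.set0]].

(* The 2-simplex opposite to the vertex i. *)
Definition face (i : 'I_4) : set tetrahedron := subsimplex [set~ i]%SET.

Definition segment (a b : 'rV[R]_4) : set tetrahedron :=
  [set x | exists2 s, 0 <= s <= 1 & bary x = (1 - s) *: a + s *: b].

Definition cone (c : 'rV[R]_4) (B : set tetrahedron) : set tetrahedron :=
  \bigcup_(y in B) segment c (bary y).

(* a and b are normal corners on distinct edges of face i, so that the
   segment from a to b is a normal arc in that face. *)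
Definition normal_arc_ends (i : 'I_4) (a b : tetrahedron) : Prop :=
  exists e e' : {set 'I_4},
    [/\ #|e| = 2%N /\ #|e'| = 2%N, e != e',
        e \subset [set~ i]%SET /\ e' \subset [set~ i]%SET,
        open_subsimplex e a & open_subsimplex e' b].

Definition disk : set (R * R) := [set z | z.1 ^+ 2 + z.2 ^+ 2 <= 1].
Definition circle : set (R * R) := [set z | z.1 ^+ 2 + z.2 ^+ 2 = 1].

(* A continuous injection of the compact disk is an embedding. *)
Definition embedded_disc (D B : set tetrahedron) : Prop :=
  exists f : R * R -> tetrahedron,
    [/\ {within disk, continuous f}, {in disk &, injective f},
        f @` disk = D & f @` circle = B].

Definition barycentre (s : seq 'rV[R]_4) : 'rV[R]_4 :=
  (size s)%:R^-1 *: \sum_(x <- s) x.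

(* J is the set of faces carrying an arc of the boundary, and the arc in the
   face i \in J has end points a i and b i: there is at most one arc in a face.
   Each corner is shared by several arcs, hence [undup]. *)
Definition normal_disc (D : set tetrahedron) : Prop :=
  exists (J : {set 'I_4}) (a b : 'I_4 -> tetrahedron),
    let bd := \bigcup_(i in [set` J]) segment (bary (a i)) (bary (b i)) in
    let corners := undup ([seq bary (a i) | i <- enum J] ++
                          [seq bary (b i) | i <- enum J]) in
    [/\ forall i, i \in J -> normal_arc_ends i (a i) (b i),
        embedded_disc D bd,
        D `&` \bigcup_(i in [set: 'I_4]) face i = bd
      & D = cone (barycentre corners) bd].

End Simplex.

Section Quotient.
Variables (R : realType) (n : nat).

Local Notation tetrahedron := (tetrahedron R).

Definition tetrahedra : topologicalType := {_ : 'I_n & tetrahedron}.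

(* A Euclidean isometry from a 2-dimensional face onto another. Faces are given
   as (tetrahedron, opposite vertex); only the restriction of [fi_map] to the
   domain matters. *)
Record face_isometry := FaceIsometry {
  fi_dom : 'I_n * 'I_4;
  fi_cod : 'I_n * 'I_4;
  fi_map : tetrahedron -> tetrahedron;
  fi_image : fi_map @` face fi_dom.2 = face fi_cod.2;
  fi_isometry : forall x y, face fi_dom.2 x -> face fi_dom.2 y ->
    euclid_dist (bary (fi_map x)) (bary (fi_map y)) = euclid_dist (bary x) (bary y) }.

Variable Phi : set face_isometry.

Definition face_pairing : Prop :=
  (forall g, Phi g -> fi_dom g != fi_cod g) /\
  (forall (F : 'I_n * 'I_4) g h, Phi g -> Phi h ->
     F \in [:: fi_dom g; fi_cod g] -> F \in [:: fi_dom h; fi_cod h] -> g = h).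

Definition glued (x y : tetrahedra) : Prop :=
  exists2 g, Phi g & exists2 a, face (fi_dom g).2 a &
    x = existT _ (fi_dom g).1 a /\ y = existT _ (fi_cod g).1 (fi_map g a).

Definition glue_rel : rel tetrahedra :=
  fun x y => `[< clos_refl_sym_trans _ glued x y >].

Lemma glue_rel_equiv : equiv_class_of glue_rel.
Proof.
split=> [x|x y|y x z].
- exact/asboolP/rst_refl.
- by apply/asboolP/asboolP => ?; exact: rst_sym.
- by move=> /asboolP xy /asboolP yz; apply/asboolP; apply: rst_trans xy yz.
Qed.

Canonical glue_equiv := EquivRelPack glue_rel_equiv.

Definition glued_space : topologicalType :=
  quotient_topology {eq_quot glue_equiv}.

Definition quotient_map (t : 'I_n) (x : tetrahedron) : glued_space :=
  \pi_glued_space (existT _ t x : tetrahedra).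

Definition pseudo_manifold : Prop :=
  face_pairing /\
  forall (t : 'I_n) (e : {set 'I_4}), #|e| = 2%N ->
    {in open_subsimplex e &, injective (quotient_map t)}.

Definition singlices : set (set glued_space) :=
  [set A | exists t : 'I_n, exists2 B, subsimplices B & A = quotient_map t @` B].

Definition skeleton (k : nat) : set glued_space :=
  [set x | exists t (J : {set 'I_4}),
     (#|J| <= k.+1)%N /\ (quotient_map t @` subsimplex J) x].

(* The decomposition into discs is imposed on the preimage of S in each
   tetrahedron, where the discs are disjoint: their images in the quotient may meet along the
   boundary when two faces of one tetrahedron are identified. *)
Definition normal_subset (S : set glued_space) : Prop :=
  [/\ forall t : 'I_n, exists DD : set (set tetrahedron),
        [/\ countable DD, forall D, DD D -> normal_disc D, trivIset DD id
          & quotient_map t @^-1` S = \bigcup_(D in DD) D],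
      limit_point (S `&` skeleton 1) `<=` skeleton 0
    & forall x : nat -> glued_space, range x `<=` S ->
        limit_point (range x) `<=` S `|` skeleton 0].

Definition normal_disc_in (E : set glued_space) : Prop :=
  exists t : 'I_n, exists2 D, normal_disc D & E = quotient_map t @` D.

Definition same_type (E E' : set glued_space) : Prop :=
  exists (t : 'I_n) (D D' : set tetrahedron),
    [/\ normal_disc D, normal_disc D', E = quotient_map t @` D, E' = quotient_map t @` D'
      & isotopic_preserving (R := R) (@subsimplices R) D D'].

Definition discs_of_type (E S : set glued_space) : set (set glued_space) :=
  [set E' | [/\ normal_disc_in E', same_type E E' & E' `<=` S]].

Definition normally_isotopic (S S' : set glued_space) : Prop :=
  isotopic_preserving (R := R) singlices S S'.

End Quotient.

(* Main.v *)
(** A normal disc is the cone determined by its type, a set A of vertices that it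
separates from the others, and by the positions of its corners on the edges from A
to the complement of A; it meets each ray from the face spanned by A to the opposite
face exactly once. In a tetrahedron, the order along an edge of the corners of disjoint
discs of different types is dictated by the types. Conditions (2) and (3) on a normal
subset imply that, up to finitely many discs, it consists of arbitrarily small triangles
around the vertices; so the discs of a type can be ranked from the outermost one inwards.

Matching by rank the discs of S0 and of S1 of the same type therefore preserves the
order on all edges. It is also compatible with the gluing, for the arcs around a
vertex of a face can be ranked as well, and these ranks are the same on both sides.
It remains to move the corners of S0 to the positions of the matching corners of S1.
An infinite tail of triangles around a vertex is moved all at once by rescaling the
rays from the vertex. Once the two families of positions agree near the vertices, finitely
many discs have to be moved, which is done in small linear steps, each supported in
thin disjoint neighbourhoods of the discs. In each tetrahedron, such a move is a
map h that commutes with the gluing, for which the straight homotopies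
(1 - s) id + s h consist of bijections; they induce the isotopy. *)
Require Import Defs.
From HB Require Import structures.
From Stdlib Require Import Relations.
From mathcomp Require Import fingroup perm all_boot all_order all_algebra.
From mathcomp Require Import finmap.
From mathcomp Require Import all_classical all_reals all_analysis.
From mathcomp Require Import ring lra.
Import Order.TTheory GRing.Theory Num.Theory.
Import numFieldNormedType.Exports.

Set Implicit Arguments.
Unset Strict Implicit.
Unset Printing Implicit Defensive.

Local Open Scope classical_set_scope.
Local Open Scope ring_scope.
Local Open Scope quotient_scope.

(** * Barycentric coordinates *)

(** The choice of rays is dictated by the gluing: on the face opposite to [f], the types [[set k]]
    and [[set k; f]] leave the same arcs around [k] and have the same heights and rays. A move along
    rays near a disc thus restricts to a face in a way that depends only on the arc, so that the
    moves of a triangle and of a quadrilateral sharing an arc agree. A quadrilateral, being a cone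
    over a skew quadrangle, is not flat; that it meets each ray once is extracted from the weights
    of its corners, by rigidity ([quad_rigid]) for uniqueness and by explicit solutions
    ([quad_solve]) for existence. A chain of triangles is rescaled with all other discs held fixed.
    Its outermost triangle therefore stays in place, and the new positions must keep their order
    relative to everything else on the edges. A [blend] of the two systems of positions, the minimum
    near one end of an edge and the maximum near the other, has this property and agrees, for all
    but finitely many discs, with the blend taken in the other order. *)

Section RealValued.
Context {R : realType} {T : topologicalType}.
Implicit Types (f g : T -> R) (t : T).

Lemma contD f g t : continuous_at t f -> continuous_at t g ->
  continuous_at t (fun z => f z + g z).
Proof. exact: cvgD. Qed.

Lemma contB f g t : continuous_at t f -> continuous_at t g ->
  continuous_at t (fun z => f z - g z).
Proof. exact: cvgB. Qed.

Lemma contM f g t : continuous_at t f -> continuous_at t g ->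
  continuous_at t (fun z => f z * g z).
Proof. exact: cvgM. Qed.

Lemma contV f t : f t != 0 -> continuous_at t f -> continuous_at t (fun z => (f z)^-1).
Proof. exact: cvgV. Qed.

Lemma contP f t : (forall e, 0 < e -> \forall z \near t, `|f t - f z| < e) -> continuous_at t f.
Proof. by move=> h; apply/cvgrPdist_lt. Qed.

Lemma cont_lt f t c : continuous_at t f -> f t < c -> \forall z \near t, f z < c.
Proof. by move=> cf; apply: (cvgr_lt (f t)). Qed.

Lemma cont_gt f t c : continuous_at t f -> c < f t -> \forall z \near t, c < f z.
Proof. by move=> cf; apply: (cvgr_gt (f t)). Qed.

Lemma contmax f g t : continuous_at t f -> continuous_at t g ->
  continuous_at t (fun z => Num.max (f z) (g z)).
Proof. exact: (@continuous_max R T). Qed.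

Lemma contmin f g t : continuous_at t f -> continuous_at t g ->
  continuous_at t (fun z => Num.min (f z) (g z)).
Proof. exact: (@continuous_min R T). Qed.

Lemma contc (c : R) t : continuous_at t (fun=> c).
Proof. exact: cvg_cst. Qed.

Lemma cont_sum (I : Type) (r : seq I) (P : pred I) (F : I -> T -> R) t :
  (forall i, P i -> continuous_at t (F i)) ->
  continuous_at t (fun z => \sum_(i <- r | P i) F i z).
Proof.
move=> cF; elim: r => [|a r IH].
  rewrite (_ : (fun _ => _) = cst 0); first exact: cvg_cst.
  by apply/funext => z; rewrite big_nil.
rewrite (_ : (fun _ => _) = if P a then F a \+ (fun z => \sum_(i <- r | P i) F i z)
    else (fun z => \sum_(i <- r | P i) F i z)); last first.
  by apply/funext => z; rewrite big_cons; case: ifP.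
by case: ifPn => Pa; [apply: contD; [exact: cF|exact: IH]|exact: IH].
Qed.

End RealValued.

Lemma cont_near (T U : topologicalType) (f g : T -> U) (t : T) :
  (\forall z \near t, g z = f z) -> continuous_at t f -> continuous_at t g.
Proof.
move=> e cf; have et := nbhs_singleton e; rewrite /continuous_at et.
by apply: cvg_trans cf; apply: near_eq_cvg; apply: filterS e => z ->.
Qed.

Lemma pairl_continuous (X Y : topologicalType) (y : Y) : continuous (fun x : X => (x, y)).
Proof. by move=> x; exact: (cvg_pair cvg_id (cvg_cst y)). Qed.

Lemma pairr_continuous (X Y : topologicalType) (y : Y) : continuous (fun x : X => (y, x)).
Proof. by move=> x; exact: (cvg_pair (cvg_cst y) cvg_id). Qed.

Section TetrahedronTopology.
Variable R : realType.
Notation tet := (tetrahedron R).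

Definition crd (x : tet) (i : 'I_4) : R := bary x 0 i.

Lemma crd_ge0 x i : 0 <= crd x i.
Proof. by have [h _] := set_mem (valP x); exact: h. Qed.

Lemma crd_sum x : \sum_i crd x i = 1.
Proof. by have [_ h] := set_mem (valP x). Qed.

Lemma crd_inj (x y : tet) : (forall i, crd x i = crd y i) -> x = y.
Proof.
by move=> e; apply: val_inj; apply/rowP => i; exact: e.
Qed.

Lemma crd_le1 x i : crd x i <= 1.
Proof.
rewrite -(crd_sum x) (bigD1 i)//= lerDl sumr_ge0// => j _; exact: crd_ge0.
Qed.

Definition point_of (v : 'rV[R]_4) (H : simplex3 v) : tet :=
  @exist 'rV[R]_4 (fun x => x \in simplex3 (R:=R)) v (mem_set H).

Lemma vertex_subproof (k : 'I_4) : simplex3 (\row_i (i == k)%:R : 'rV[R]_4).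
Proof.
split=> [i|]; first by rewrite mxE ler0n.
rewrite (bigD1 k)//= mxE eqxx big1 ?addr0// => i ik.
by rewrite mxE (negbTE ik).
Qed.

Definition vtx (k : 'I_4) : tet := point_of (vertex_subproof k).

(** Total in [f], so that maps into the simplex are given by formulas for their coordinates and
    membership is checked only where [crd_mkt] is applied. *)
Definition mkt (f : 'I_4 -> R) : tet :=
  match pselect (simplex3 (\row_i f i)) with
  | left H => point_of H
  | right _ => vtx ord0
  end.

Lemma crd_mkt (f : 'I_4 -> R) : (forall i, 0 <= f i) -> \sum_i f i = 1 ->
  forall i, crd (mkt f) i = f i.
Proof.
move=> f0 f1 i; rewrite /mkt; case: pselect => [H|nH].
  by rewrite /crd /bary set_valE /= mxE.
exfalso; apply: nH; split=> [j|]; first by rewrite mxE.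
by rewrite -f1; apply: eq_bigr => j _; rewrite mxE.
Qed.

Lemma crd_continuous i : continuous (crd^~ i).
Proof.
move=> x; rewrite /crd /bary.
apply: (@continuous_comp _ _ _ (fun x : tet => set_val x) (fun M : 'rV[R]_4 => M 0 i)).
  exact: initial_continuous.
exact: coord_continuous.
Qed.

(** The topology is induced from row vectors, whose norm is the maximum of the coordinates. *)
Lemma tet_cvg (T : topologicalType) (F : T -> tet) (t : T) :
  (forall i, {for t, continuous (fun z => crd (F z) i)}) -> {for t, continuous F}.
Proof.
move=> cF.
have c1 : {for t, continuous (fun z => set_val (F z) : 'rV[R]_4)}.
  apply/cvgrPdist_lt => e e0.
  have : \forall z \near t, forall i, `|crd (F t) i - crd (F z) i| < e.
    by apply: filter_forall => i; have /cvgrPdist_lt/(_ e e0) := cF i.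
  apply: filterS => z Hz.
  rewrite /Num.Def.normr/= mx_normrE.
  apply/bigmax_ltP; split => // -[j i] _ /=.
  by rewrite !mxE (ord1 j); exact: Hz.
move=> U [?/= [[W oW <-]]] /= Wsfz /filterS; apply; apply: c1.
exact: open_nbhs_nbhs.
Qed.

Lemma tet_continuous (T : topologicalType) (F : T -> tet) :
  (forall i, continuous (fun z => crd (F z) i)) -> continuous F.
Proof. by move=> cF t; apply: tet_cvg => i; exact: cF. Qed.

Lemma tet_hausdorff : hausdorff_space tet.
Proof.
move=> x y xy; apply: crd_inj => i.
apply: (@norm_hausdorff R R^o); move=> A B xA yB.
have [z [zA zB]] := xy _ _ (@crd_continuous i x A xA) (@crd_continuous i y B yB).
by exists (crd z i).
Qed.

Lemma simplex3_compact : compact (simplex3 (R:=R)).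
Proof.
apply: bounded_closed_compact.
  exists 1; split=> // M M1 v [v0 v1] /=.
  rewrite /Num.Def.normr/= mx_normrE; apply/bigmax_leP; split.
    by rewrite ltW// (lt_trans _ M1).
  move=> [j i] _ /=; rewrite (ord1 j) ger0_norm// (le_trans _ (ltW M1))//.
  by rewrite -v1 (bigD1 i)//= lerDl sumr_ge0.
rewrite (_ : @simplex3 R = (\bigcap_i [set x : 'rV[R]_4 | 0 <= x 0 i]) `&` [set x | \sum_i x 0 i = 1]); last first.
  by apply/seteqP; split=> [x [a b]|x [a b]]; split=> //= i; [move=> _; exact: (a i)|exact: (a i)].
apply: closedI.
  apply: closed_bigI => i _.
  apply: (@preimage_closed _ _ (fun x : 'rV[R]_4 => x 0 i) [set r | 0 <= r]).
    by move=> x _; exact: coord_continuous.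
  exact: closed_ge.
apply: (@preimage_closed _ _ (fun x : 'rV[R]_4 => \sum_i x 0 i) [set r | r = 1]).
  move=> x _; apply: cont_sum => i _; exact: coord_continuous.
exact: closed_eq.
Qed.

(** The topology being induced, a cluster point of the image filter in [simplex3] is the image of a
    cluster point of the filter itself. *)
Lemma tet_compact : compact [set: tet].
Proof.
have c : compact (set_val @` [set: tet]).
  rewrite (_ : _ @` _ = simplex3 (R:=R)); first exact: simplex3_compact.
  apply/seteqP; split=> [_ [x _ <-]|x sx]; first exact: set_mem (valP x).
  by exists (point_of sx).
move=> F FF _.
have Fr : ((set_val : tet -> 'rV[R]_4) @ F) (set_val @` [set: tet]).
  by apply: (@filterS _ F _ setT) filterT => x _; exists x.
have [_ [[x _ <-] xF]] := c _ (fmap_proper_filter _ FF) Fr.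
exists x; split=> // A B FA [_ [/= [W oW <-]]] Wx WB.
have : ((set_val : tet -> 'rV[R]_4) @ F) (set_val @` A).
  by apply: (@filterS _ F _ A) FA => z Az; exists z.
move=> /xF/(_ (open_nbhs_nbhs (conj oW Wx))) [_ [[z Az <-] Wz]].
by exists z; split=> //; exact: WB.
Qed.

(** A continuous map from a compact space to a Hausdorff one is closed. No formula for the inverse
    of a slide is therefore needed. *)
Lemma tet_bij_homeo (f : tet -> tet) : continuous f -> bijective f -> homeomorphism f.
Proof.
move=> cf [g fK gK]; exists g; split=> //.
apply/continuous_closedP => A cA.
rewrite (_ : g @^-1` A = f @` A); last first.
  by apply/seteqP; split=> [x Ax|_ [x Ax <-]] /=; [exists (g x)|rewrite fK].
apply: compact_closed; first exact: tet_hausdorff.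
apply: continuous_compact; first exact: continuous_subspaceT.
exact: (subclosed_compact cA tet_compact).
Qed.

End TetrahedronTopology.

(** * Slides along rays *)

Section RayMaps.
Variable R : realType.
Notation tet := (tetrahedron R).
Implicit Types (A : {set 'I_4}) (x y : tet).

Definition lam (A : {set 'I_4}) (x : tet) : R := \sum_(i | i \notin A) crd x i.

Lemma lam_ge0 A x : 0 <= lam A x.
Proof. by apply: sumr_ge0 => i _; exact: crd_ge0. Qed.

Lemma lamC A x : \sum_(i in A) crd x i = 1 - lam A x.
Proof. by apply/eqP; rewrite -(crd_sum x) [X in X - _](bigID (mem A))/= /lam addrK. Qed.

Lemma lam_setC A x : lam (~: A)%SET x = 1 - lam A x.
Proof.
by rewrite -lamC; apply: eq_bigl => i; rewrite inE negbK.
Qed.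

Lemma lam_le1 A x : lam A x <= 1.
Proof. by rewrite -subr_ge0 -lamC sumr_ge0// => i _; exact: crd_ge0. Qed.

Lemma lam_continuous A : continuous (lam A).
Proof. by move=> x; apply: (@cont_sum R tet) => i _; exact: crd_continuous. Qed.

(* The point at height m on the ray through x that joins the simplex spanned by A,
   of height 0, to the opposite one, of height 1; x itself is at height [lam A x]. *)
Definition ray (A : {set 'I_4}) (x : tet) (m : R) : tet :=
  mkt (fun i => if i \in A then crd x i * ((1 - m) / (1 - lam A x))
                else crd x i * (m / lam A x)).

Lemma crd_ray A x m : 0 < lam A x < 1 -> 0 <= m <= 1 -> forall i,
  crd (ray A x m) i = if i \in A then crd x i * ((1 - m) / (1 - lam A x))
                else crd x i * (m / lam A x).
Proof.
move=> /andP[l0 l1] /andP[m0 m1]; apply: crd_mkt.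
  move=> i; case: ifP => _; rewrite mulr_ge0 ?crd_ge0// divr_ge0//.
  - by rewrite subr_ge0.
  - by rewrite subr_ge0 ltW.
  - exact: ltW.
rewrite (bigID (mem A))/=.
under eq_bigr => i iA do rewrite iA.
under [X in _ + X]eq_bigr => i iA do rewrite (negbTE iA).
rewrite -!mulr_suml lamC -/(lam A x).
have : 1 - lam A x != 0 by rewrite subr_eq0 gt_eqF.
have : lam A x != 0 by rewrite gt_eqF.
by move=> ? ?; field; apply/andP; split.
Qed.

Lemma lam_ray A x m : 0 < lam A x < 1 -> 0 <= m <= 1 -> lam A (ray A x m) = m.
Proof.
move=> l m01; rewrite {1}/lam.
under eq_bigr => i iA do rewrite (crd_ray l m01) (negbTE iA).
rewrite -mulr_suml -/(lam A x) mulrC divfK// gt_eqF//.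
by case/andP: l.
Qed.

Lemma ray_lam A x : 0 < lam A x < 1 -> ray A x (lam A x) = x.
Proof.
move=> l; apply: crd_inj => i; rewrite (crd_ray l); last first.
  by case/andP: l => a b; rewrite !ltW.
case/andP: l => a b.
by rewrite !divff ?mulr1 ?if_same// ?gt_eqF// subr_gt0.
Qed.

Lemma ray_ray A x m m' : 0 < lam A x < 1 -> 0 < m < 1 -> 0 <= m' <= 1 ->
  ray A (ray A x m) m' = ray A x m'.
Proof.
move=> l m01 m'01; have m01' : 0 <= m <= 1 by case/andP: m01 => *; rewrite !ltW.
apply: crd_inj => i; rewrite !crd_ray ?lam_ray//.
case/andP: l => l0 l1; case/andP: m01 => m0 m1.
have ? : 1 - lam A x != 0 by rewrite subr_eq0 gt_eqF.
have ? : 1 - m != 0 by rewrite subr_eq0 gt_eqF.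
have ? : lam A x != 0 by rewrite gt_eqF.
have ? : m != 0 by rewrite gt_eqF.
by case: (i \in A); field; apply/andP; split.
Qed.

(** Seen from the opposite side the rays are the same and the heights are reversed. This allows a
    quadrilateral type to be replaced by its complement. *)
Lemma ray_setC A x m : ray (~: A)%SET x (1 - m) = ray A x m.
Proof.
rewrite /ray; congr mkt; apply/funext => i; rewrite inE lam_setC !subKr.
by case: (i \in A).
Qed.

(** The straight homotopy from the identity to [h]; for a constant [h] it also parametrises
    segments. *)
Definition slide (h : tet -> tet) (s : R) (x : tet) : tet :=
  mkt (fun i => (1 - s) * crd x i + s * crd (h x) i).

Lemma crd_slide h s x : 0 <= s <= 1 -> forall i,
  crd (slide h s x) i = (1 - s) * crd x i + s * crd (h x) i.
Proof.
move=> /andP[s0 s1]; apply: crd_mkt => [i|].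
  by rewrite addr_ge0// mulr_ge0 ?crd_ge0// subr_ge0.
by rewrite big_split/= -!mulr_sumr !crd_sum; ring.
Qed.

Lemma slide0 h x : slide h 0 x = x.
Proof. by apply: crd_inj => i; rewrite crd_slide ?lexx ?ler01// subr0 mul1r mul0r addr0. Qed.

Lemma slide1 h x : slide h 1 x = h x.
Proof. by apply: crd_inj => i; rewrite crd_slide ?lexx ?ler01// subrr mul1r mul0r add0r. Qed.

Lemma slide_fix h s x : 0 <= s <= 1 -> h x = x -> slide h s x = x.
Proof. by move=> s01 e; apply: crd_inj => i; rewrite crd_slide// e; ring. Qed.

Lemma lam_slide A h s x : 0 <= s <= 1 ->
  lam A (slide h s x) = (1 - s) * lam A x + s * lam A (h x).
Proof.
move=> s01; rewrite {1}/lam; under eq_bigr do rewrite crd_slide//.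
by rewrite big_split/= -!mulr_sumr.
Qed.

(** Monotonicity along the rays gives injectivity ([slide_inj]); continuity and the fixed end points
    of the rays give surjectivity ([slide_bij]). *)
Definition ray_map (A : {set 'I_4}) (K : tet -> tet) : Prop :=
  [/\ continuous K,
      (forall x, ~~ (0 < lam A x < 1) -> K x = x),
      (forall x, 0 < lam A x < 1 ->
         0 < lam A (K x) < 1 /\ K x = ray A x (lam A (K x)))
    & (forall x m, 0 < lam A x < 1 -> lam A x < m < 1 ->
         lam A (K x) < lam A (K (ray A x m)))].

Section one.
Variables (A : {set 'I_4}) (K : tet -> tet).
Hypothesis KA : ray_map A K.

(** A ray is affinely parametrised by its height, hence the straight homotopy moves each point along
    its own ray. *)
Lemma slide_ray s x : 0 <= s <= 1 -> 0 < lam A x < 1 ->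
  slide K s x = ray A x ((1 - s) * lam A x + s * lam A (K x)).
Proof.
case: KA => _ _ rK _ s01 l; have [/andP[k0 k1] Kx] := rK _ l.
case/andP: (s01) => s0 s1; case/andP: (l) => l0 l1.
apply: crd_inj => i; rewrite crd_slide// crd_ray//; last first.
  apply/andP; split; first by rewrite addr_ge0// mulr_ge0// ?subr_ge0// ltW.
  have : (1 - s) * lam A x <= (1 - s) * 1 by rewrite ler_wpM2l ?subr_ge0// ltW.
  have : s * lam A (K x) <= s * 1 by rewrite ler_wpM2l// ltW.
  lra.
rewrite {1}Kx crd_ray//; last by rewrite !ltW.
have ? : 1 - lam A x != 0 by rewrite subr_eq0 gt_eqF.
have ? : lam A x != 0 by rewrite gt_eqF.
by case: ifP => _; field.
Qed.

Lemma slide_lam01 s x : 0 <= s <= 1 -> 0 < lam A x < 1 ->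
  0 < (1 - s) * lam A x + s * lam A (K x) < 1.
Proof.
case: KA => _ _ rK _ /andP[s0 s1] l; have [/andP[k0 k1] _] := rK _ l.
case/andP: l => l0 l1; have [->|sn0] := eqVneq s 0; first by nra.
have s00 : 0 < s by rewrite lt_def sn0.
by nra.
Qed.

Lemma slide_incr s x m : 0 <= s <= 1 -> 0 < lam A x < 1 -> lam A x < m < 1 ->
  lam A (slide K s x) < lam A (slide K s (ray A x m)).
Proof.
move=> s01 l /andP[m0 m1]; have := KA; case=> _ _ _ /(_ x m l); rewrite m0 m1 => /(_ isT) H.
rewrite !lam_slide// lam_ray//; last by case/andP: l => l0 l1; rewrite (ltW m1) (ltW (lt_trans l0 m0)).
case/andP: s01 => s0 s1; have [->|sn0] := eqVneq s 0; first by nra.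
have s00 : 0 < s by rewrite lt_def sn0.
by nra.
Qed.

Lemma slide_inj s : 0 <= s <= 1 -> injective (slide K s).
Proof.
move=> s01 x y e.
have ns z : ~~ (0 < lam A z < 1) -> slide K s z = z.
  by move=> h; apply: slide_fix => //; case: KA => _ + _ _; exact.
have ys z : 0 < lam A z < 1 -> 0 < lam A (slide K s z) < 1.
  by move=> l; rewrite lam_slide//; exact: slide_lam01.
case: (boolP (0 < lam A x < 1)) => lx; last first.
  case: (boolP (0 < lam A y < 1)) => ly; last by rewrite -(ns x)// -(ns y).
  by have := ys _ ly; rewrite -e (ns x)// (negbTE lx).
case: (boolP (0 < lam A y < 1)) => ly; last first.
  by have := ys _ lx; rewrite e (ns y)// (negbTE ly).
(* Both points are on the ray of their common image, hence on the same ray, where only the heights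
   can differ. *)
have yx : y = ray A x (lam A y).
  have ly' : 0 <= lam A y <= 1 by rewrite lam_ge0 lam_le1.
  have := congr1 (fun z => ray A z (lam A y)) e.
  rewrite (slide_ray s01 lx) (slide_ray s01 ly).
  rewrite (ray_ray lx (slide_lam01 s01 lx) ly') (ray_ray ly (slide_lam01 s01 ly) ly').
  by rewrite (ray_lam ly).
have xy : x = ray A y (lam A x) by rewrite yx ray_ray ?ray_lam//; case/andP: lx => *; rewrite !ltW.
case/andP: (lx) => lx0 lx1; case/andP: (ly) => ly0 ly1.
case: (ltgtP (lam A x) (lam A y)) => c.
- by have := @slide_incr s x (lam A y) s01 lx; rewrite c ly1 -yx e ltxx => /(_ isT).
- by have := @slide_incr s y (lam A x) s01 ly; rewrite c lx1 -xy e ltxx => /(_ isT).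
- by rewrite yx -c ray_lam.
Qed.

End one.

(** Extends to all real parameters the maps that make sense on the unit interval only, so that
    continuity can be stated globally. *)
Definition clamp (s : R) : R := Num.max 0 (Num.min 1 s).

Lemma clamp01 s : 0 <= clamp s <= 1.
Proof. by rewrite /clamp le_max lexx/= ge_max ler01/= ge_min lexx. Qed.

Lemma clamp_id s : 0 <= s <= 1 -> clamp s = s.
Proof. by move=> /andP[s0 s1]; rewrite /clamp min_r// max_r. Qed.

Lemma clamp_continuous : continuous clamp.
Proof.
move=> s; rewrite (_ : clamp = (cst 0) \max ((cst 1) \min id))//.
apply: continuous_max; first exact: cvg_cst.
by apply: continuous_min; [exact: cvg_cst|exact: cvg_id].
Qed.

Lemma ray_continuous A (z : tet * R) : 0 < lam A z.1 < 1 ->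
  {for z, continuous (fun z => ray A z.1 (clamp z.2))}.
Proof.
move=> /andP[l0 l1]; apply: tet_cvg => i.
have clam : (lam A y.1) @[y --> z] --> lam A z.1.
  by apply: (@continuous_comp _ _ _ fst (lam A)); [exact: cvg_fst|exact: lam_continuous].
have ccl : (clamp y.2) @[y --> z] --> clamp z.2.
  by apply: (@continuous_comp _ _ _ snd clamp); [exact: cvg_snd|exact: clamp_continuous].
have cc : (crd y.1 i) @[y --> z] --> crd z.1 i.
  by apply: (@continuous_comp _ _ _ fst (fun x => crd x i)); [exact: cvg_fst|exact: crd_continuous].
have nl : \forall y \near z, 0 < lam A y.1 < 1.
  near=> y; apply/andP; split; near: y.
    by apply: (cvgr_gt (lam A z.1)).
  by apply: (cvgr_lt (lam A z.1)).
rewrite /prop_for /continuous_at (crd_ray _ (clamp01 _)) ?l0//.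
apply: cvg_trans; first apply: near_eq_cvg.
  by apply: filterS nl => y ly; rewrite crd_ray// clamp01.
rewrite /=; case: (i \in A); apply: cvgM => //; apply: cvgM => //.
- by apply: cvgB => //; exact: cvg_cst.
- apply: cvgV; first by rewrite subr_eq0 gt_eqF.
  by apply: cvgB => //; exact: cvg_cst.
- by apply: cvgV; first by rewrite gt_eqF.
Unshelve. all: by end_near. Qed.

Lemma slide_bij A K s : ray_map A K -> 0 <= s <= 1 -> bijective (slide K s).
Proof.
move=> KA s01; have inj := slide_inj KA s01.
suff sur : forall y, exists x, slide K s x = y.
  have [g gK] := choice sur; exists g => // x.
  by apply: inj; rewrite gK.
move=> y; case: (boolP (0 < lam A y < 1)) => ly; last first.
  by exists y; apply: slide_fix => //; case: KA => _ + _ _; exact.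
(* The height of the slide along the ray of [y]. It fixes 0 and 1, so the intermediate value theorem
   yields a preimage of [y]. *)
pose f m := (1 - s) * m + s * lam A (K (ray A y (clamp m))).
have [cK fK rK _] := KA.
have cf : continuous f.
  move=> m; apply: cvgD; first by apply: cvgM; [exact: cvg_cst|exact: cvg_id].
  apply: cvgM; first exact: cvg_cst.
  apply: (@continuous_comp _ _ _ (fun m => K (ray A y (clamp m))) (lam A)); last exact: lam_continuous.
  apply: (@continuous_comp _ _ _ (fun m => ray A y (clamp m)) K); last exact: cK.
  apply: (@continuous_comp _ _ _ (fun m : R => (y, m)) (fun z => ray A z.1 (clamp z.2))).
    exact: (cvg_pair (cvg_cst y) cvg_id).
  exact: ray_continuous.
have f0 : f 0 = 0.
  have r0 : lam A (ray A y 0) = 0 by rewrite lam_ray// lexx ler01.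
  by rewrite /f clamp_id ?lexx ?ler01// fK r0 ?ltxx//; ring.
have f1 : f 1 = 1.
  have r1 : lam A (ray A y 1) = 1 by rewrite lam_ray// lexx ler01.
  by rewrite /f clamp_id ?lexx ?ler01// fK r1 ?ltxx ?andbF//; ring.
case/andP: (ly) => l0 l1.
have [||m m01 fm] := @IVT R f 0 1 (lam A y) ler01.
- exact: continuous_subspaceT.
- by rewrite f0 f1 min_l ?max_r ?ler01// !ltW.
have mm : 0 <= m <= 1 by move: m01; rewrite in_itv.
have m0 : m != 0 by apply/eqP => e; move: fm; rewrite e f0 => e'; rewrite -e' ltxx in l0.
have m1 : m != 1 by apply/eqP => e; move: fm; rewrite e f1 => e'; rewrite -e' ltxx in l1.
have ms : 0 < m < 1 by case/andP: mm => a b; rewrite !lt_def m0 a b eq_sym m1.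
exists (ray A y m); rewrite (slide_ray KA)// lam_ray// .
rewrite (_ : _ + _ = lam A y) ?ray_ray ?ray_lam// ?lam_ge0 ?lam_le1//.
by rewrite -fm /f clamp_id.
Qed.

(** Along a ray the coordinates are rescaled by positive factors, so no subsimplex is left or
    entered. *)
Lemma ray_map_support A K x i : ray_map A K -> (crd (K x) i == 0) = (crd x i == 0).
Proof.
case=> _ fK rK _; case: (boolP (0 < lam A x < 1)) => l; last by rewrite fK.
have [/andP[k0 k1] ->] := rK _ l; case/andP: (l) => l0 l1.
rewrite crd_ray//; last by rewrite !ltW.
by case: ifP => _; rewrite mulf_eq0 orbC mulf_eq0 invr_eq0 ?subr_eq0 ?(gt_eqF k0) ?(gt_eqF k1) ?(gt_eqF l1) ?(gt_eqF l0).
Qed.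

(* The straight homotopy from the identity to such a map is an isotopy; being linear
   in h, it is compatible with the gluing as soon as h is. *)
Definition sliding (h : tet -> tet) : Prop :=
  [/\ continuous h, (forall s, 0 <= s <= 1 -> bijective (slide h s))
    & (forall x i, (crd (h x) i == 0) = (crd x i == 0))].

(** The choice made by [pick] is forced as soon as each point is moved by at most one of the
    maps. *)
Definition combine (I : finType) (K : I -> tet -> tet) (x : tet) : tet :=
  if [pick i | `[< K i x <> x >]] is Some i then K i x else x.

Section combine.
Variables (I : finType) (A : I -> {set 'I_4}) (K : I -> tet -> tet).
Hypothesis KA : forall i, ray_map (A i) (K i).
Hypothesis disj : forall i j x, i != j -> K i x <> x -> K j x = x.

Lemma combine_moved i x : K i x <> x -> combine K x = K i x.
Proof.
move=> mi; rewrite /combine; case: pickP => [j /asboolP mj|/(_ i)/asboolP//].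
by have [->//|ji] := eqVneq j i; have := disj ji mj.
Qed.

Lemma combine_fixed x : (forall i, K i x = x) -> combine K x = x.
Proof. by move=> fx; rewrite /combine; case: pickP => [j /asboolP mj|//]; rewrite fx. Qed.

(** At most one summand is nonzero. In this additive form the continuity of [combine] needs no
    discussion of supports. *)
Lemma combine_sum x c : crd (combine K x) c = crd x c + \sum_i (crd (K i x) c - crd x c).
Proof.
case: (pselect (exists i, K i x <> x)) => [[i mi]|/forallNP fx].
  rewrite (combine_moved mi) (bigD1 i)//= big1 => [|j ji]; first by ring.
  by rewrite (disj _ mi) ?subrr// eq_sym.
rewrite combine_fixed ?big1 ?addr0// => [i _|i]; last by have /contrapT := fx i.
by have /contrapT -> := fx i; rewrite subrr.
Qed.

Lemma combine_sliding : sliding (combine K).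
Proof.
split.
- apply: (@tet_continuous R tet) => c.
  have -> : (fun z : tet => crd (combine K z) c) =
      (fun z : tet => crd z c + \sum_i (crd (K i z) c - crd z c)).
    by apply/funext => y; exact: combine_sum.
  suff cs : continuous (fun z : tet => \sum_i (crd (K i z) c - crd z c)).
    by move=> x; apply: (@contD R tet); [exact: crd_continuous|exact: cs].
  move=> x; apply: (@cont_sum R tet) => i _.
  suff ck : continuous (fun z : tet => crd (K i z) c).
    by apply: (@contB R tet); [exact: ck|exact: crd_continuous].
  move=> z; apply: (@continuous_comp _ _ _ (K i) (fun x => crd x c)); last exact: crd_continuous.
  by have [+ _ _ _] := KA i; exact.
- move=> s s01.
  have sm i x : K i x <> x -> slide (combine K) s x = slide (K i) s x.
    by move=> mi; apply: crd_inj => c; rewrite !crd_slide// (combine_moved mi).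
  have sf x : (forall i, K i x = x) -> slide (combine K) s x = x.
    by move=> fx; apply: slide_fix => //; exact: combine_fixed.
  (* The homotopy keeps a point inside the set moved by the same [K i], so pieces with disjoint
     supports never collide. *)
  have ms i x : K i x <> x -> K i (slide (K i) s x) <> slide (K i) s x.
    by move=> mi e; have e2 := slide_inj (KA i) s01 (slide_fix s01 e); rewrite e2 in e.
  have inj : injective (slide (combine K) s).
    move=> x y; case: (pselect (exists i, K i x <> x)) => [[i mi]|/forallNP fx].
      rewrite (sm _ _ mi); case: (pselect (exists j, K j y <> y)) => [[j mj]|/forallNP fy].
        rewrite (sm _ _ mj) => e; have [ij|ij] := eqVneq i j.
          by subst j; exact: (slide_inj (KA i) s01).
        by have := ms _ _ mj; rewrite -e (disj ij (ms _ _ mi)).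
      rewrite (sf y) => [e|j]; last by have /contrapT := fy j.
      by have := ms _ _ mi; rewrite e; have := fy i.
    rewrite (sf x) => [|i]; last by have /contrapT := fx i.
    case: (pselect (exists j, K j y <> y)) => [[j mj]|/forallNP fy].
      by rewrite (sm _ _ mj) => e; have := ms _ _ mj; rewrite -e; have := fx j.
    by rewrite (sf y)// => j; have /contrapT := fy j.
  suff sur : forall y, exists x, slide (combine K) s x = y.
    have [g gK] := choice sur; exists g => // x; by apply: inj; rewrite gK.
  move=> y; case: (pselect (exists i, K i y <> y)) => [[i mi]|/forallNP fy]; last first.
    by exists y; apply: sf => i; have /contrapT := fy i.
  have [g _ gK] := slide_bij (KA i) s01.
  exists (g y); rewrite (sm i) ?gK// => e; apply: mi.
  by rewrite -(gK y) slide_fix.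
- move=> x c; case: (pselect (exists i, K i x <> x)) => [[i mi]|/forallNP fx].
    by rewrite (combine_moved mi) (ray_map_support _ _ (KA i)).
  by rewrite combine_fixed// => i; have /contrapT := fx i.
Qed.

End combine.
End RayMaps.

(** * Isometries between faces as permutations of the vertices *)

Section Permutations.
Variable R : realType.
Notation tet := (tetrahedron R).
Implicit Types (x y : tet) (s : {perm 'I_4}).

Definition act s x : tet := mkt (fun i => crd x ((s^-1)%g i)).

Lemma crd_actV s x i : crd (act s x) i = crd x ((s^-1)%g i).
Proof.
rewrite crd_mkt// => [j|]; first exact: crd_ge0.
by rewrite -(crd_sum x) [RHS](reindex_inj (@perm_inj _ (s^-1)%g)).
Qed.

Lemma crd_act s x i : crd (act s x) (s i) = crd x i.
Proof. by rewrite crd_actV permK. Qed.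

Lemma actK s : cancel (act s) (act s^-1%g).
Proof. by move=> x; apply: crd_inj => i; rewrite !crd_actV invgK permK. Qed.

Lemma actKV s : cancel (act s^-1%g) (act s).
Proof. by move=> x; apply: crd_inj => i; rewrite !crd_actV invgK permKV. Qed.

Lemma face_crd i x : face i x <-> crd x i = 0.
Proof.
split=> [|x0 j]; first by apply; rewrite !inE eqxx.
by rewrite !inE negbK => /eqP ->.
Qed.

Lemma face_act s i x : face i x -> face (s i) (act s x).
Proof. by move=> /face_crd fx; apply/face_crd; rewrite crd_act. Qed.

Lemma crd_vtx k i : crd (vtx R k) i = (i == k)%:R.
Proof. by rewrite /crd /bary /= mxE. Qed.

(** Twice the square of the Euclidean distance: two distinct vertices are at [sqd] equal to 2. *)
Definition sqd x y : R := \sum_i (crd x i - crd y i) ^+ 2.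

Lemma sqd_dist x y x' y' :
  euclid_dist (bary x) (bary y) = euclid_dist (bary x') (bary y') -> sqd x y = sqd x' y'.
Proof.
move=> /(congr1 (fun r => r ^+ 2)); rewrite /euclid_dist !sqr_sqrtr.
- by apply: mulfI; rewrite invr_eq0 pnatr_eq0.
- by rewrite mulr_ge0 ?invr_ge0 ?ler0n// sumr_ge0// => i _; rewrite sqr_ge0.
- by rewrite mulr_ge0 ?invr_ge0 ?ler0n// sumr_ge0// => i _; rewrite sqr_ge0.
Qed.

Definition nrm x : R := \sum_i crd x i ^+ 2.

Lemma nrm_vtx k : nrm (vtx R k) = 1.
Proof.
rewrite /nrm (bigD1 k)//= crd_vtx eqxx expr1n big1 ?addr0// => i ik.
by rewrite crd_vtx (negbTE ik) expr0n.
Qed.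

Lemma sqdE x y : sqd x y = nrm x + nrm y - 2 * \sum_i crd x i * crd y i.
Proof.
rewrite /sqd /nrm mulr_sumr -big_split/= -sumrB; apply: eq_bigr => i _; ring.
Qed.

Lemma sqd_vtx x k : sqd x (vtx R k) = nrm x + 1 - 2 * crd x k.
Proof.
rewrite sqdE nrm_vtx (bigD1 k)//= crd_vtx eqxx mulr1 big1 ?addr0// => i ik.
by rewrite crd_vtx (negbTE ik) mulr0.
Qed.

Lemma nrm_le1 x : nrm x <= 1.
Proof.
rewrite -(crd_sum x); apply: ler_sum => i _.
by rewrite expr2 -[leRHS]mulr1 ler_wpM2l ?crd_ge0 ?crd_le1.
Qed.

(** As the coordinates lie between 0 and 1 and have sum 1, sum of squares 1 forces each of them to
    equal its square. *)
Lemma nrm1_vtx x : nrm x = 1 -> exists k, x = vtx R k.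
Proof.
move=> n1.
have e i : crd x i ^+ 2 = crd x i.
  have : \sum_i (crd x i - crd x i ^+ 2) = 0 by rewrite sumrB crd_sum -/(nrm x) n1 subrr.
  move=> /psumr_eq0P => /(_ _ i isT) H; apply/esym/eqP; rewrite -subr_eq0 H// => j _.
  by rewrite subr_ge0 expr2 -[leRHS]mulr1 ler_wpM2l ?crd_ge0 ?crd_le1.
have c01 i : crd x i = 0 \/ crd x i = 1.
  have /eqP := e i; rewrite -subr_eq0 expr2 -[X in _ - X]mulr1 -mulrBr mulf_eq0 subr_eq0.
  by move=> /orP[] /eqP; [left|right].
have [k xk] : exists k, crd x k = 1.
  apply/not_existsP => h; have := crd_sum x; rewrite big1 => [/eqP|i _].
    by rewrite eq_sym oner_eq0.
  by case: (c01 i) => // xi; case: (h i).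
exists k; apply: crd_inj => i; rewrite crd_vtx; have [->//|ik] := eqVneq i k.
have := crd_sum x; rewrite (bigD1 k)//= xk -[RHS]addr0 => /addrI/eqP.
rewrite psumr_eq0 => [|j _]; last exact: crd_ge0.
by move=> /allP/(_ i); rewrite mem_index_enum ik => /(_ isT)/eqP.
Qed.

(** The value 2 is the maximum of [sqd], reached only if both norms are 1 and the scalar product is
    0. *)
Lemma sqd_max_vtx x y : sqd x y = 2 -> exists k, x = vtx R k.
Proof.
move=> e; apply: nrm1_vtx; move: e; rewrite sqdE.
have : 0 <= \sum_i crd x i * crd y i by apply: sumr_ge0 => i _; rewrite mulr_ge0 ?crd_ge0.
by have := nrm_le1 x; have := nrm_le1 y; lra.
Qed.

Lemma sqd_vtx2 k l : k != l -> sqd (vtx R k) (vtx R l) = 2.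
Proof. by move=> kl; rewrite sqd_vtx nrm_vtx crd_vtx eq_sym (negbTE kl) mulr0 subr0. Qed.

(** Vertices of a face are recognised metrically as ends of segments of maximal length, so an
    isometry permutes them; the distances to the vertices then determine the coordinates of any
    point. *)
Lemma face_isometry_act n (g : face_isometry R n) :
  exists s : {perm 'I_4}, s (fi_dom g).2 = (fi_cod g).2 /\
    forall x, face (fi_dom g).2 x -> fi_map g x = act s x.
Proof.
case: g => [[t i] [t' j] f im iso] /=; rewrite /= in im iso.
have fv k : k != i -> face i (vtx R k).
  by move=> ki; apply/face_crd; rewrite crd_vtx eq_sym (negbTE ki).
have d2 x y : face i x -> face i y -> sqd (f x) (f y) = sqd x y.
  by move=> fx fy; apply: sqd_dist; exact: iso.
have ff x : face i x -> face j (f x) by move=> fx; rewrite -im; exists x.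
have ex k : exists m, k != i -> f (vtx R k) = vtx R m.
  have [->|ki] := eqVneq k i; first by exists i.
  have [l] : exists l, l \notin [:: i; k].
    apply/not_existsP => h; have : (#|'I_4| <= size [:: i; k])%N.
      rewrite cardE; apply: uniq_leq_size; first exact: enum_uniq.
      by move=> l _; apply/negPn/negP; exact: h.
    by rewrite card_ord.
  rewrite !inE negb_or => /andP[li lk].
  have e2 : sqd (f (vtx R k)) (f (vtx R l)) = 2.
    by rewrite (d2 _ _ (fv _ ki) (fv _ li)) sqd_vtx2// eq_sym.
  by have [m ->] := sqd_max_vtx e2; exists m.
have [tau tauE] := choice ex.
have tauj k : k != i -> tau k != j.
  move=> ki; apply/eqP => e; have := ff _ (fv _ ki); rewrite tauE// e => /face_crd.
  by rewrite crd_vtx eqxx => /eqP; rewrite oner_eq0.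
have inj : injective (fun k => if k == i then j else tau k).
  move=> k l /=; have [->|ki] := eqVneq k i; have [->|li] := eqVneq l i => //.
  - by move=> e; have := tauj _ li; rewrite -e eqxx.
  - by move=> e; have := tauj _ ki; rewrite e eqxx.
  - move=> e; apply/eqP/negPn/negP => kl.
    have := d2 _ _ (fv _ ki) (fv _ li); rewrite sqd_vtx2// !tauE// e.
    by rewrite /sqd big1 => [/eqP|m _]; [rewrite eq_sym pnatr_eq0|rewrite subrr expr0n].
exists (perm inj); split; first by rewrite permE eqxx.
move=> x fx.
have c k : k != i -> nrm (f x) - 2 * crd (f x) (perm inj k) = nrm x - 2 * crd x k.
  move=> ki; have := d2 _ _ fx (fv _ ki); rewrite tauE// !sqd_vtx permE (negbTE ki).
  by lra.
have sx : \sum_(k | k != i) crd x k = 1.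
  by rewrite -(crd_sum x) [RHS](bigD1 i)//= (_ : crd x i = 0) ?add0r//; exact/face_crd.
have sfx : \sum_(k | k != i) crd (f x) (perm inj k) = 1.
  rewrite -(crd_sum (f x)) [RHS](reindex_inj (@perm_inj _ (perm inj)))/=.
  rewrite [RHS](bigD1 i)//= permE eqxx (_ : crd (f x) j = 0) ?add0r//.
  by apply/face_crd; exact: ff.
have ci : #|[pred k : 'I_4 | k != i]| = 3%N.
  by apply: etrans (etrans (cardC1 i) _); [apply: eq_card => k; rewrite !inE|rewrite card_ord].
(* Summed over the three vertices of the face, the relation [c] becomes [3 * nrm - 2] on both
   sides. *)
have nn : nrm (f x) = nrm x.
  have : \sum_(k | k != i) (nrm (f x) - 2 * crd (f x) (perm inj k)) = \sum_(k | k != i) (nrm x - 2 * crd x k).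
    by apply: eq_bigr => k ki; exact: c.
  rewrite !sumrB -!mulr_sumr sx sfx !sumr_const.
  rewrite (_ : #|_| = 3%N)//; lra.
apply: crd_inj => m; rewrite -[m](permKV (perm inj)) crd_act.
set k := (_ m); have [ki|ki] := eqVneq k i.
  rewrite ki permE eqxx (_ : crd x i = 0); last exact/face_crd.
  by apply/face_crd; exact: ff.
by have := c _ ki; rewrite nn; lra.
Qed.

End Permutations.

(** * Gluing *)

Section Quotient.
Variables (R : realType) (n : nat) (Phi : set (face_isometry R n)).
Notation tet := (tetrahedron R).
Notation q := (quotient_map (R:=R) (n:=n) Phi).
Notation P := (glued_space Phi).
Implicit Types (x y : tet) (t : 'I_n).

Lemma q_eqP t x t' y : q t x = q t' y <->
  clos_refl_sym_trans _ (glued Phi) (existT _ t x) (existT _ t' y).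
Proof.
split; first by move=> /eqmodP /asboolP.
by move=> h; apply/eqmodP/asboolP.
Qed.

Lemma q_surj (y : P) : exists t x, y = q t x.
Proof.
exists (projT1 (repr y)), (projT2 (repr y)).
by rewrite /quotient_map -[LHS]reprK; case: (repr y).
Qed.

Lemma q_continuous t : continuous (q t).
Proof.
move=> x; apply: (@continuous_comp _ _ _ (existT (fun _ => tet) t) (\pi_(glued_space Phi))).
  exact: existT_continuous.
exact: pi_continuous.
Qed.

Lemma glued_q g x : Phi g -> face (fi_dom g).2 x ->
  q (fi_dom g).1 x = q (fi_cod g).1 (fi_map g x).
Proof. by move=> gP fx; apply/q_eqP/rst_step; exists g => //; exists x. Qed.

(** Induction on the generation of the gluing relation, with the tetrahedron and the point as
    separate arguments in order to avoid dependent pairs. *)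
Lemma q_ind (Q : forall t, tet -> forall t, tet -> Prop) :
  (forall t x, Q t x t x) -> (forall t x t' y, Q t x t' y -> Q t' y t x) ->
  (forall t x t' y t'' z, Q t x t' y -> Q t' y t'' z -> Q t x t'' z) ->
  (forall g x, Phi g -> face (fi_dom g).2 x -> Q (fi_dom g).1 x (fi_cod g).1 (fi_map g x)) ->
  forall t x t' y, q t x = q t' y -> Q t x t' y.
Proof.
move=> qr qs qt qg t x t' y /q_eqP.
set u := existT _ t x; set v := existT _ t' y.
rewrite -[t]/(projT1 u) -[x]/(projT2 u) -[t']/(projT1 v) -[y]/(projT2 v).
elim=> {u v} [u v [g gP [a fa [-> ->]]]|u|u v _|u v w _ h _]; first exact: qg.
- exact: qr.
- exact: qs.
- exact: qt.
Qed.

(** Stated through [q] and not through [Phi], the relation forgets the direction of the pairing and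
    is symmetric ([matched_inv]). *)
Definition matched t (f : 'I_4) t' (s : {perm 'I_4}) : Prop :=
  forall x, face f x -> q t x = q t' (act s x).

Lemma matched_inv t f t' s : matched t f t' s -> matched t' (s f) t s^-1%g.
Proof.
move=> m x /face_crd fx; rewrite -{1}[x](actKV s); apply/esym/m/face_crd.
by rewrite crd_actV invgK.
Qed.

Lemma face_isometry_matched g : Phi g -> exists s : {perm 'I_4},
  matched (fi_dom g).1 (fi_dom g).2 (fi_cod g).1 s /\
  forall x, face (fi_dom g).2 x -> fi_map g x = act s x.
Proof.
move=> gP; have [s [_ e]] := face_isometry_act g; exists s; split=> // x fx.
by rewrite (glued_q gP fx) e.
Qed.

Definition supp x : {set 'I_4} := [set i | crd x i != 0]%SET.

Lemma supp_act s x : supp (act s x) = [set s i | i in supp x]%SET.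
Proof.
apply/finset.setP => i; rewrite !inE crd_actV; apply/idP/imsetP.
  by move=> h; exists ((s^-1)%g i); rewrite ?inE ?permKV.
by move=> [j]; rewrite inE => h ->; rewrite permK.
Qed.

(** The gluing permutes coordinates, so the number of nonzero ones is well defined on the
    quotient. *)
Lemma q_supp t x t' y : q t x = q t' y -> #|supp x| = #|supp y|.
Proof.
move: t x t' y; apply: q_ind => [//|//|t x t' y t'' z -> ->//|g x gP fx].
have [s [_ ->//]] := face_isometry_matched gP.
by rewrite supp_act card_imset//; exact: perm_inj.
Qed.

(** A generator of the gluing relation only involves points that have a zero coordinate. *)
Lemma q_interior t x t' y : (forall i, crd x i != 0) -> q t x = q t' y -> t = t' /\ x = y.
Proof.
move=> ix e; move: ix.
suff : (t = t' /\ x = y) \/ (~ (forall i, crd x i != 0) /\ ~ (forall i, crd y i != 0)).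
  by case=> // -[].
move: t x t' y e; apply: q_ind.
- by move=> t x; left.
- by move=> t x t' y [[-> ->]|[? ?]]; [left|right].
- by move=> t x t' y t'' z [[-> ->]|[? ?]] [[<- <-]|[? ?]]; [left|right|right|right].
- move=> g x gP fx; right; have [s [_ e]] := face_isometry_matched gP.
  have x0 : crd x (fi_dom g).2 = 0 by exact/face_crd.
  split; first by move=> /(_ (fi_dom g).2); rewrite x0 eqxx.
  by rewrite e// => /(_ (s (fi_dom g).2)); rewrite crd_act x0 eqxx.
Qed.

Section descend.
Variable H : R -> 'I_n -> tet -> tet.
Hypothesis Hq : forall s g x, Phi g -> face (fi_dom g).2 x ->
  q (fi_cod g).1 (H s (fi_cod g).1 (fi_map g x)) = q (fi_dom g).1 (H s (fi_dom g).1 x).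

(** Evaluated on a chosen representative; [Hq] makes the result independent of the choice
    ([descendE]). *)
Definition descend (s : R) (y : P) : P :=
  q (projT1 (repr y)) (H s (projT1 (repr y)) (projT2 (repr y))).

Lemma descendE s t x : descend s (q t x) = q t (H s t x).
Proof.
rewrite /descend; set y := repr _.
have : q (projT1 y) (projT2 y) = q t x.
  rewrite -[RHS]reprK /quotient_map -/y; by case: y.
move: (projT1 y) (projT2 y) => t' x'; move: t' x' t x {y}.
apply: (q_ind (Q := fun t' x' t x => q t' (H s t' x') = q t (H s t x))) => //.
  by move=> t x t' y t'' z -> ->.
by move=> g x gP fx; rewrite Hq.
Qed.

Hypothesis Hc : forall t, continuous (fun z : tet * R => H z.2 t z.1).

(** Continuity on the product with time is not formal for a quotient. A closed interval of times
    around [s0] is compact, so the points whose track over it stays in [W'] form an open set in each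
    tetrahedron; being defined on the quotient, this set is saturated. *)
Lemma descend_continuous : continuous (fun z : P * R => descend z.2 z.1).
Proof.
move=> [y0 s0] W /= nW.
have [t0 [x0 y0E]] := q_surj y0; subst y0.
rewrite /= descendE in nW.
have [W' [oW' W'x W'W]] : exists W', [/\ open W', W' (q t0 (H s0 t0 x0)) & W' `<=` W].
  by exists (interior W); split; [exact: open_interior|exact: nW|exact: interior_subset].
have [e /= e0 He] : exists2 e, 0 < e & forall s, `[s0 - e, s0 + e]%classic s -> W' (q t0 (H s t0 x0)).
  have cs : continuous (fun s => q t0 (H s t0 x0)).
    move=> s; apply: (@continuous_comp _ _ _ (fun s => H s t0 x0) (q t0)); last exact: q_continuous.
    apply: (@continuous_comp _ _ _ (fun s : R => (x0, s)) (fun z : tet * R => H z.2 t0 z.1)); last exact: Hc.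
    exact: (cvg_pair (cvg_cst x0) cvg_id).
  have /nbhs_ballP[e /= e0 be] : nbhs s0 ((fun s => q t0 (H s t0 x0)) @^-1` W').
    by apply: cs; apply: open_nbhs_nbhs.
  exists (e / 2); first by rewrite divr_gt0.
  move=> s /=; rewrite in_itv/= => /andP[a b]; apply: be.
  by rewrite /ball/= ltr_distl; lra.
pose U := [set y : P | forall s, `[s0 - e, s0 + e]%classic s -> W' (descend s y)].
have oU : open U.
  suff : open ((\pi_(glued_space Phi) : tetrahedra R n -> glued_space Phi) @^-1` U) by [].
  apply/sigT_openP => t; rewrite openE => x Ux /=.
  have /compact_near_coveringP K : compact `[s0 - e, s0 + e]%classic by exact: segment_compact.
  suff Q : \forall z \near x, `[s0 - e, s0 + e]%classic `<=` (fun s => W' (q t (H s t z))).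
    by apply: filterS Q => z Hz s /Hz; rewrite -descendE.
  apply: (K tet (nbhs x) (fun z s => W' (q t (H s t z)))) => s Is.
  have cq : continuous (fun z : tet * R => q t (H z.2 t z.1)).
    by move=> z; apply: (@continuous_comp _ _ _ (fun z : tet * R => H z.2 t z.1) (q t)); [exact: Hc|exact: q_continuous].
  have : nbhs (x, s) ((fun z : tet * R => q t (H z.2 t z.1)) @^-1` W').
    apply: cq; apply: open_nbhs_nbhs; split=> //=.
    by have := Ux _ Is; rewrite -[\pi _]/(q t x) descendE.
  move=> [[A B] [/= nA nB] AB]; exists (B, A) => // -[b a] [/= Bb Aa].
  exact: (AB (a, b)).
have Ux : U (q t0 x0) by move=> s Is; rewrite descendE; exact: He.
exists (U, `]s0 - e, s0 + e[%classic) => /=.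
  split; first by apply: (@open_nbhs_nbhs P).
  by apply: near_in_itvoo; rewrite in_itv/=; apply/andP; split; lra.
move=> [y s] [/= Uy]; rewrite in_itv/= => /andP[a b]; apply: W'W; apply: Uy.
by rewrite /= in_itv/= !ltW.
Qed.

End descend.
End Quotient.

(** * Isotopies of the quotient induced by slides *)

Section SlidingIsotopy.
Variable R : realType.
Notation tet := (tetrahedron R).
Implicit Types (x y : tet) (h : tet -> tet).

Lemma slide_support h s x i : sliding h -> 0 <= s <= 1 ->
  (crd (slide h s x) i == 0) = (crd x i == 0).
Proof.
case=> _ _ sp s01; rewrite crd_slide//; case/andP: s01 => s0 s1.
have := sp x i; have := crd_ge0 x i; have := crd_ge0 (h x) i.
have [->|xi] := eqVneq (crd x i) 0; first by move=> _ _ /eqP ->; rewrite !mulr0 addr0 eqxx.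
move=> h0 x0 hi; apply: negbTE.
have hp : 0 < crd (h x) i by rewrite lt_def hi h0.
have xp : 0 < crd x i by rewrite lt_def xi x0.
rewrite gt_eqF//; have [->|sn] := eqVneq s 0; first by lra.
have sp' : 0 < s by rewrite lt_def sn.
by nra.
Qed.

Lemma slide_subsimplex h s J : sliding h -> 0 <= s <= 1 ->
  slide h s @` subsimplex J = subsimplex J.
Proof.
move=> sh s01; have [_ /(_ _ s01) [g gK Kg] _] := sh.
apply/seteqP; split=> [_ [x xJ <-] i iJ|x xJ].
  by apply/eqP; rewrite (slide_support _ _ sh s01); apply/eqP; exact: xJ.
exists (g x); last exact: Kg.
by move=> i iJ; apply/eqP; rewrite -(slide_support _ _ sh s01) Kg; apply/eqP; exact: xJ.
Qed.

Lemma slide_continuous h : continuous h ->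
  continuous (fun z : tet * R => slide h (clamp z.2) z.1).
Proof.
move=> ch; apply: tet_continuous => i.
rewrite (_ : (fun _ => _) = fun z : tet * R => (1 - clamp z.2) * crd z.1 i + clamp z.2 * crd (h z.1) i); last first.
  by apply/funext => z; rewrite crd_slide// clamp01.
have cc : continuous (fun z : tet * R => clamp z.2).
  by move=> z; apply: (@continuous_comp _ _ _ snd (@clamp R)); [exact: cvg_snd|exact: clamp_continuous].
have c1 : continuous (fun z : tet * R => crd z.1 i).
  by move=> z; apply: (@continuous_comp _ _ _ fst (fun x : tet => crd x i)); [exact: cvg_fst|exact: crd_continuous].
have c2 : continuous (fun z : tet * R => crd (h z.1) i).
  move=> z; apply: (@continuous_comp _ _ _ (fun z : tet * R => h z.1) (fun x : tet => crd x i)); last exact: crd_continuous.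
  by apply: (@continuous_comp _ _ _ fst h); [exact: cvg_fst|exact: ch].
move=> z; apply: contD; apply: contM; [|exact: c1|exact: cc|exact: c2].
by apply: contB; [exact: cvg_cst|exact: cc].
Qed.

Lemma slide_homeo h s : sliding h -> 0 <= s <= 1 -> homeomorphism (slide h s).
Proof.
move=> [ch bh _] s01; apply: tet_bij_homeo; last exact: bh.
rewrite -(clamp_id s01) => x.
apply: (@continuous_comp _ _ _ (fun x => (x, s)) (fun z : tet * R => slide h (clamp z.2) z.1)).
  exact: pairl_continuous.
exact: slide_continuous.
Qed.

Lemma sliding_isotopic h D : sliding h ->
  isotopic_preserving (R := R) (@subsimplices R) D (h @` D).
Proof.
move=> sh; have [ch _ _] := sh.
exists (fun s => slide h (clamp s)); last first.
  rewrite clamp_id ?lexx ?ler01//; congr image; apply/funext => x; exact: slide1.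
split; first split.
- exact/continuous_subspaceT/slide_continuous.
- by rewrite clamp_id ?lexx ?ler01//; apply/funext => x; rewrite slide0.
- by move=> t t01; rewrite clamp_id//; exact: slide_homeo.
- by move=> _ [J _ <-] t t01; rewrite clamp_id//; exact: slide_subsimplex.
Qed.

Lemma slide_act h h' (s : {perm 'I_4}) r x : 0 <= r <= 1 ->
  h' (act s x) = act s (h x) -> slide h' r (act s x) = act s (slide h r x).
Proof.
move=> r01 e; apply: crd_inj => i; rewrite -[i](permKV s) crd_act !crd_slide//.
by rewrite e !crd_act.
Qed.

Section quotient.
Variables (n : nat) (Phi : set (face_isometry R n)) (h : 'I_n -> tet -> tet).
Notation q := (quotient_map (R:=R) (n:=n) Phi).
Notation P := (glued_space Phi).
Hypothesis hs : forall t, sliding (h t).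
Hypothesis hm : forall t f t' (s : {perm 'I_4}) x, matched Phi t f t' s -> face f x ->
  h t' (act s x) = act s (h t x).

Let slide_face t r x i : 0 <= r <= 1 -> face i (slide (h t) r x) <-> face i x.
Proof.
by move=> r01; split=> /face_crd/eqP e; apply/face_crd/eqP; move: e; rewrite (slide_support _ _ (hs t) r01).
Qed.

(** The straight homotopies are affine in [h], so the compatibility of [h] with the gluing passes to
    all of them, and also to their inverses. *)
Lemma sliding_normally_isotopic (T : 'I_n -> set tet) :
  normally_isotopic (\bigcup_t (q t @` T t)) (\bigcup_t (q t @` (h t @` T t))).
Proof.
pose H (s : R) t := slide (h t) (clamp s).
have Hq s g x : Phi g -> face (fi_dom g).2 x ->
    q (fi_cod g).1 (H s (fi_cod g).1 (fi_map g x)) = q (fi_dom g).1 (H s (fi_dom g).1 x).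
  move=> gP fx; have [p [m e]] := face_isometry_matched gP.
  rewrite /H e// (slide_act (clamp01 s) (hm m fx)) -m//.
  by apply/slide_face => //; exact: clamp01.
have Hc t : continuous (fun z : tet * R => H z.2 t z.1).
  by apply: slide_continuous; have [] := hs t.
have dE := descendE Hq.
exists (@descend R n Phi H); last first.
  apply/seteqP; split.
    move=> _ [_ [t _ [x Tx <-]] <-]; rewrite dE; exists t => //; exists (h t x); first by exists x.
    by rewrite /H clamp_id ?lexx ?ler01// slide1.
  move=> _ [t _ [_ [x Tx <-] <-]]; exists (q t x); first by exists t => //; exists x.
  by rewrite dE /H clamp_id ?lexx ?ler01// slide1.
split; first split.
- exact/continuous_subspaceT/descend_continuous.
- apply/funext => y; have [t [x ->]] := q_surj y.
  by rewrite dE /H clamp_id ?lexx ?ler01// slide0.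
- move=> s s01.
  have Hh t : homeomorphism (H s t) by apply: slide_homeo => //; exact: clamp01.
  have [g gP] := choice Hh.
  have dcont : continuous (@descend R n Phi H s).
    move=> y; apply: (@continuous_comp _ _ _ (fun y : P => (y, s)) (fun z : P * R => @descend R n Phi H z.2 z.1)).
      exact: pairl_continuous.
    exact: descend_continuous.
  (* The inverse at a fixed time is regarded as a family constant in time, so that
     [descend_continuous] applies to it as well. *)
  pose G (_ : R) t := g t.
  have Gq r f x : Phi f -> face (fi_dom f).2 x ->
      q (fi_cod f).1 (G r (fi_cod f).1 (fi_map f x)) = q (fi_dom f).1 (G r (fi_dom f).1 x).
    move=> fP fx; have [p [m e]] := face_isometry_matched fP.
    have [K1 K2 _ _] := gP (fi_dom f).1; have [K3 K4 _ _] := gP (fi_cod f).1.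
    rewrite /G; set y := g _ x.
    have xy : x = slide (h (fi_dom f).1) (clamp s) y by rewrite -[LHS]K2.
    have fy : face (fi_dom f).2 y by apply/(@slide_face (fi_dom f).1 _ y _ (clamp01 s)); rewrite -xy.
    rewrite (m _ fy); congr (q _ _).
    by rewrite e// xy -(slide_act (clamp01 s) (hm m fy)) -[RHS]K3.
  have Gc t : continuous (fun z : tet * R => G z.2 t z.1).
    move=> z; apply: (@continuous_comp _ _ _ fst (g t)); first exact: cvg_fst.
    by have [_ _ _] := gP t; apply.
  have gE := descendE Gq.
  exists (@descend R n Phi G s); split=> //.
  + move=> y; have [t [x ->]] := q_surj y; rewrite dE gE /G.
    by have [-> _ _ _] := gP t.
  + move=> y; have [t [x ->]] := q_surj y; rewrite gE dE /G.
    by have [_ -> _ _] := gP t.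
  + move=> y; apply: (@continuous_comp _ _ _ (fun y : P => (y, s)) (fun z : P * R => @descend R n Phi G z.2 z.1)).
      exact: pairl_continuous.
    exact: descend_continuous.
- move=> _ [t [_ [J _ <-] ->]] s s01.
  rewrite -[X in _ = q t @` X](slide_subsimplex J (hs t) s01).
  apply/seteqP; split.
    move=> _ [_ [x xJ <-] <-]; exists (H s t x); last by rewrite dE.
    by exists x => //; rewrite /H clamp_id.
  move=> _ [_ [x xJ <-] <-]; exists (q t x); first by exists x.
  by rewrite dE /H clamp_id.
Qed.

End quotient.
End SlidingIsotopy.

(** * Slides carrying one surface onto another *)

Section TentFunction.
Variable R : realType.
Implicit Types a b c l : R.

Definition tent a b c l : R := Num.max 0 (Num.min ((l - a) / (b - a)) ((c - l) / (c - b))).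

(** A piecewise linear map of the line that carries [b] to [b'] and is the identity outside the
    interval from [a] to [c]. *)
Definition tentmap a b b' c l : R := l + (b' - b) * tent a b c l.

Lemma tent_peak a b c : a < b < c -> tent a b c b = 1.
Proof.
move=> /andP[ab bc]; rewrite /tent !divff ?subr_eq0 ?gt_eqF//.
by rewrite min_l// max_r.
Qed.

Lemma tent_gt0 a b c l : a < b < c -> tent a b c l != 0 -> a < l < c.
Proof.
move=> /andP[ab bc]; apply: contraNT; rewrite negb_and -!leNgt => lac.
apply/eqP/max_l; rewrite ge_min; case/orP: lac => h.
  by rewrite mulr_le0_ge0 ?invr_ge0 ?subr_ge0 ?subr_le0// ltW.
by rewrite [X in _ || X]mulr_le0_ge0 ?orbT ?invr_ge0 ?subr_ge0 ?subr_le0// ltW.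
Qed.

Lemma tent_out a b c l : a < b < c -> ~~ (a < l < c) -> tent a b c l = 0.
Proof. by move=> abc; apply: contraNeq => /(tent_gt0 abc). Qed.

(** The slopes of [tent] lie between [- 1 / (c - b)] and [1 / (b - a)]. Multiplied by [b' - b] they
    stay above -1 because [b'] is strictly between [a] and [c]. *)
Lemma tentmap_incr a b b' c l l' : a < b < c -> a < b' < c -> l < l' ->
  tentmap a b b' c l < tentmap a b b' c l'.
Proof.
move=> /andP[ab bc] /andP[ab' bc'] ll'.
have h1 : 0 < (l' - l) / (b - a) by rewrite divr_gt0 ?subr_gt0.
have h2 : 0 < (l' - l) / (c - b) by rewrite divr_gt0 ?subr_gt0.
have e1 : (l' - a) / (b - a) = (l - a) / (b - a) + (l' - l) / (b - a) by rewrite -mulrDl; congr (_ / _); ring.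
have e2 : (c - l') / (c - b) = (c - l) / (c - b) - (l' - l) / (c - b) by rewrite -mulrBl; congr (_ / _); ring.
have mins (x y : R) : Num.min x y = x \/ Num.min x y = y by rewrite /Num.min; case: ifP; [left|right].
have maxs (x y : R) : Num.max x y = x \/ Num.max x y = y by rewrite /Num.max; case: ifP; [right|left].
have minle (x y : R) : Num.min x y <= x /\ Num.min x y <= y by rewrite !ge_min; split; rewrite lexx ?orbT.
have maxle (x y : R) : x <= Num.max x y /\ y <= Num.max x y by rewrite !le_max; split; rewrite lexx ?orbT.
have up : tent a b c l' <= tent a b c l + (l' - l) / (b - a).
  rewrite /tent e1 e2; move: h1 h2; set u := (l' - l) / _; set v := (l' - l) / _.
  set w := (l - a) / _; set z := (c - l) / _ => u0 v0.
  have [m1 m2] := minle (w + u) (z - v); have [m3 m4] := maxle 0 (Num.min w z).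
  case: (mins w z) => e; rewrite e in m3 m4 *; case: (maxs 0 (Num.min (w + u) (z - v))) => ->; lra.
have dn : tent a b c l - (l' - l) / (c - b) <= tent a b c l'.
  rewrite /tent e1 e2; move: h1 h2; set u := (l' - l) / _; set v := (l' - l) / _.
  set w := (l - a) / _; set z := (c - l) / _ => u0 v0.
  have [m1 m2] := minle w z; have [m3 m4] := maxle 0 (Num.min (w + u) (z - v)).
  case: (mins (w + u) (z - v)) => e; rewrite e in m3 m4 *; case: (maxs 0 (Num.min w z)) => ->; lra.
rewrite /tentmap; have [bb'|bb'] := leP b b'.
  have : (b' - b) * ((l' - l) / (c - b)) < l' - l.
    by rewrite mulrCA -[ltRHS]mulr1 ltr_pM2l ?subr_gt0// ltr_pdivrMr ?subr_gt0// mul1r; lra.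
  have : (b' - b) * (tent a b c l - (l' - l) / (c - b)) <= (b' - b) * tent a b c l'.
    by rewrite ler_wpM2l// subr_ge0.
  by rewrite mulrBr; lra.
have : (b - b') * ((l' - l) / (b - a)) < l' - l.
  by rewrite mulrCA -[ltRHS]mulr1 ltr_pM2l ?subr_gt0// ltr_pdivrMr ?subr_gt0// mul1r; lra.
have : (b - b') * tent a b c l' <= (b - b') * (tent a b c l + (l' - l) / (b - a)).
  by rewrite ler_wpM2l// subr_ge0 ltW.
by rewrite mulrDr; lra.
Qed.

Lemma tentmap_out a b b' c l : a < b < c -> ~~ (a < l < c) -> tentmap a b b' c l = l.
Proof. by move=> abc o; rewrite /tentmap tent_out// mulr0 addr0. Qed.

Lemma tentmap_in a b b' c l : a < b < c -> a < b' < c -> a < l < c ->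
  a < tentmap a b b' c l < c.
Proof.
move=> abc abc' /andP[al lc].
have := tentmap_incr abc abc' al; have := tentmap_incr abc abc' lc.
rewrite (@tentmap_out a b b' c a) ?ltxx// (@tentmap_out a b b' c c) ?ltxx ?andbF//.
by move=> -> ->.
Qed.

Lemma tentmap_peak a b b' c : a < b < c -> tentmap a b b' c b = b'.
Proof. by move=> abc; rewrite /tentmap tent_peak// mulr1 addrC subrK. Qed.

Lemma tentmap_sym a b b' c l :
  tentmap (1 - c) (1 - b) (1 - b') (1 - a) (1 - l) = 1 - tentmap a b b' c l.
Proof.
rewrite /tentmap (_ : tent (1 - c) _ _ _ = tent a b c l); first by ring.
rewrite /tent minC; congr (Num.max _ (Num.min (_ / _) (_ / _))); ring.
Qed.

End TentFunction.

Section Surfaces.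
Variable R : realType.
Notation tet := (tetrahedron R).
Implicit Types (A : {set 'I_4}) (x y : tet) (S : set tet).

(* S meets each ray in a single point, whose height is [level A S x]. *)
Definition surface A S : Prop :=
  [/\ closed S,
      (exists m M, [/\ 0 < m, M < 1 & forall x, S x -> m <= lam A x <= M])
    & forall x, 0 < lam A x < 1 ->
        exists2 m, 0 < m < 1 /\ S (ray A x m) &
          forall m', 0 < m' < 1 -> S (ray A x m') -> m' = m].

Definition level A S x : R := xget (2^-1) [set m | 0 < m < 1 /\ S (ray A x m)].

Lemma lam_near A x : 0 < lam A x < 1 -> \forall y \near x, 0 < lam A y < 1.
Proof.
case/andP => l0 l1; have cl := @lam_continuous R A x.
apply: filterS2 (@cont_gt R tet _ _ _ cl l0) (@cont_lt R tet _ _ _ cl l1).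
by move=> y -> ->.
Qed.

Section one.
Variables (A : {set 'I_4}) (S : set tet).
Hypothesis surfS : surface A S.

Lemma levelP x : 0 < lam A x < 1 -> 0 < level A S x < 1 /\ S (ray A x (level A S x)).
Proof.
move=> l; have [_ _ /(_ _ l)[m mS _]] := surfS.
by rewrite /level; case: xgetP => [y _ //|/(_ m)].
Qed.

Lemma level_uniq x m : 0 < lam A x < 1 -> 0 < m < 1 -> S (ray A x m) -> level A S x = m.
Proof.
move=> l m01 mS; have [_ _ /(_ _ l)[k _ ku]] := surfS.
by have [a b] := levelP l; rewrite (ku _ a b) (ku _ m01 mS).
Qed.

Lemma surface_lam x : S x -> 0 < lam A x < 1.
Proof.
have [_ [m [M [m0 M1 h]]] _] := surfS.
by move=> /h /andP[a b]; rewrite (lt_le_trans m0 a) (le_lt_trans b M1).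
Qed.

Lemma level_lam x : S x -> level A S x = lam A x.
Proof.
move=> Sx; have l := surface_lam Sx.
by apply: level_uniq => //; rewrite ray_lam.
Qed.

Lemma level_ray x m : 0 < lam A x < 1 -> 0 < m < 1 -> level A S (ray A x m) = level A S x.
Proof.
move=> l m01; have [a b] := levelP l; apply: level_uniq => //.
  by rewrite lam_ray//; case/andP: m01 => *; rewrite !ltW.
by rewrite ray_ray//; case/andP: a => *; rewrite !ltW.
Qed.

Lemma level_bounds : exists m M, [/\ 0 < m, M < 1 &
  forall x, 0 < lam A x < 1 -> m <= level A S x <= M].
Proof.
have [_ [m [M [m0 M1 h]]] _] := surfS; exists m, M; split => // x l.
have [a /h] := levelP l; rewrite lam_ray//.
by case/andP: a => *; rewrite !ltW.
Qed.

(** The heights at distance at least [e] from the level form a compact set, over which the ray of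
    [x] avoids the closed set [S]; nearby rays avoid it there as well, so their levels are close. *)
Lemma level_continuous x : 0 < lam A x < 1 -> continuous_at x (level A S).
Proof.
move=> l; have [cS _ _] := surfS; apply: (@contP R tet) => e e0.
pose K := `[0 : R, 1]%classic `&` [set m | e <= `|level A S x - m|].
have cK : compact K.
  apply: compact_closedI; first exact: segment_compact.
  apply: (@preimage_closed _ _ (fun m => `|level A S x - m|) [set r | e <= r]).
    move=> m _; apply: cvg_norm; apply: cvgB; [exact: cvg_cst|exact: cvg_id].
  exact: closed_ge.
have /compact_near_coveringP nK := cK.
have n1 : \forall y \near x, K `<=` (fun m => ~ S (ray A y (clamp m))).
  apply: (nK tet (nbhs x) (fun y m => ~ S (ray A y (clamp m)))) => m [].
  rewrite /= in_itv/= => m01 em.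
  have nS : ~ S (ray A x (clamp m)).
    rewrite clamp_id// => Sm; have := surface_lam Sm; rewrite lam_ray// => ms.
    by move: em; rewrite (level_uniq l ms Sm) subrr normr0 leNgt e0.
  have : nbhs (x, m) ((fun z : tet * R => ray A z.1 (clamp z.2)) @^-1` (~` S)).
    apply: (ray_continuous (z := (x, m)) l); apply: open_nbhs_nbhs; split=> //.
    exact: closed_openC.
  move=> [[B C] [/= nB nC] BC]; exists (C, B) => // -[b a] [/= Cb Ba].
  exact: (BC (a, b)).
have n2 : \forall y \near x, 0 < lam A y < 1.
  exact: lam_near.
apply: filterS2 n1 n2 => y H ly; have [a b] := levelP ly.
rewrite ltNge; apply/negP => c.
case/andP: (a) => a0 a1.
apply: (H (level A S y)); last by rewrite clamp_id// !ltW.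
by split=> //=; rewrite in_itv/= !ltW.
Qed.

End one.

(* Moves S onto S' along the rays, with support between Sm and Sp. *)
Definition tent_slide A Sm S S' Sp x : tet :=
  if 0 < lam A x < 1 then
    ray A x (tentmap (level A Sm x) (level A S x) (level A S' x) (level A Sp x) (lam A x))
  else x.

Section tent.
Variables (A : {set 'I_4}) (Sm S S' Sp : set tet).
Hypotheses (sm : surface A Sm) (ss : surface A S) (ss' : surface A S') (sp : surface A Sp).
Hypothesis ord : forall x, 0 < lam A x < 1 -> level A Sm x < level A S x < level A Sp x.
Hypothesis ord' : forall x, 0 < lam A x < 1 -> level A Sm x < level A S' x < level A Sp x.

Notation K := (tent_slide A Sm S S' Sp).
Notation phi x := (tentmap (level A Sm x) (level A S x) (level A S' x) (level A Sp x) (lam A x)).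

Let phi01 x : 0 < lam A x < 1 -> 0 < phi x < 1.
Proof.
move=> l; case: (boolP (level A Sm x < lam A x < level A Sp x)) => o.
  have /andP[a b] := tentmap_in (ord l) (ord' l) o.
  have [/andP[m0 _] _] := levelP sm l; have [/andP[_ p1] _] := levelP sp l.
  by rewrite (lt_trans m0 a) (lt_trans b p1).
by rewrite tentmap_out// ord.
Qed.

Let lamK x : 0 < lam A x < 1 -> lam A (K x) = phi x.
Proof.
move=> l; rewrite /tent_slide l lam_ray//; have /andP[a b] := phi01 l.
by rewrite !ltW.
Qed.

Lemma tent_slide_fixed x : (0 < lam A x < 1 -> level A Sm x < lam A x < level A Sp x ->
  level A S x = level A S' x) -> K x = x.
Proof.
rewrite /tent_slide; case: ifP => // l h.
case: (boolP (level A Sm x < lam A x < level A Sp x)) => o.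
  by rewrite /tentmap (h _ o)// subrr mul0r addr0 ray_lam.
by rewrite tentmap_out ?ord// ray_lam.
Qed.

Lemma tent_slide_ray_map : ray_map A K.
Proof.
split.
- move=> x; case: (boolP (0 < lam A x < 1)) => l.
    have cl := @lam_continuous R A x.
    have cphi : continuous_at x (fun x => phi x).
      have c1 := level_continuous sm l; have c2 := level_continuous ss l.
      have c3 := level_continuous ss' l; have c4 := level_continuous sp l.
      have /andP[ab1 ab2] := ord l.
      apply: (@contD R tet) => //; apply: (@contM R tet); first exact: (@contB R tet).
      have cu : continuous_at x (fun x => (lam A x - level A Sm x) / (level A S x - level A Sm x)).
        apply: (@contM R tet); first exact: (@contB R tet).
        by apply: (@contV R tet); [rewrite subr_eq0 gt_eqF|exact: (@contB R tet)].
      have cv : continuous_at x (fun x => (level A Sp x - lam A x) / (level A Sp x - level A S x)).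
        apply: (@contM R tet); first exact: (@contB R tet).
        by apply: (@contV R tet); [rewrite subr_eq0 gt_eqF|exact: (@contB R tet)].
      by apply: (@contmax R tet); [exact: (@contc R tet)|exact: (@contmin R tet)].
    have n2 : \forall y \near x, 0 < lam A y < 1.
      exact: lam_near.
    have cr : (fun y => ray A y (clamp (phi y))) @ x --> ray A x (clamp (phi x)).
      apply: (@continuous_comp _ _ _ (fun y => (y, phi y)) (fun z : tet * R => ray A z.1 (clamp z.2))).
        exact: (cvg_pair cvg_id cphi).
      exact: (ray_continuous (z := (x, phi x)) l).
    have Kx y : 0 < lam A y < 1 -> K y = ray A y (clamp (phi y)).
      by move=> ly; rewrite /tent_slide ly clamp_id//; have /andP[? ?] := phi01 ly; rewrite !ltW.
    by apply: (@cont_near tet tet) cr; apply: filterS n2.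
  (* Near the ends of the rays the heights are outside the range between the levels of [Sm] and
     [Sp], which are bounded away from 0 and 1. *)
  suff e : \forall y \near x, K y = y.
    by apply: (@cont_near tet tet) e _; exact: cvg_id.
  have [m [M0 [m0 _ hm]]] := level_bounds sm; have [m2 [M [_ M1 hM]]] := level_bounds sp.
  have [lx|lx] : lam A x = 0 \/ lam A x = 1.
    move: l; rewrite negb_and -!leNgt => /orP[] h; [left|right]; apply/le_anti.
      by rewrite h lam_ge0.
    by rewrite h lam_le1.
  + have : \forall y \near x, lam A y < m.
      by apply: (@cont_lt R tet); [exact: lam_continuous|rewrite lx].
    apply: filterS => y ym; apply/tent_slide_fixed => ly /andP[h _].
    by have /andP[/le_lt_trans/(_ h)] := hm _ ly; rewrite ltNge (ltW ym).
  + have : \forall y \near x, M < lam A y.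
      by apply: (@cont_gt R tet); [exact: lam_continuous|rewrite lx].
    apply: filterS => y ym; apply/tent_slide_fixed => ly /andP[_ h].
    by have /andP[_ /(lt_le_trans h)] := hM _ ly; rewrite ltNge (ltW ym).
- by move=> x l; rewrite /tent_slide (negbTE l).
- by move=> x l; rewrite lamK// phi01//; split=> //; rewrite /tent_slide l.
- move=> x m l /andP[m0 m1]; have lx := l; case/andP: l => l0 l1.
  have ms : 0 < m < 1 by rewrite (lt_trans l0 m0).
  have ms' : 0 <= m <= 1 by case/andP: ms => *; rewrite !ltW.
  rewrite !lamK ?lam_ray// !level_ray//; exact: tentmap_incr (ord lx) (ord' lx) m0.
Qed.

Lemma tent_slide_image : K @` S = S'.
Proof.
apply/seteqP; split=> [_ [x Sx <-]|y Sy].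
  have l := surface_lam ss Sx.
  rewrite /tent_slide l -(level_lam ss Sx) tentmap_peak ?ord//.
  by have [] := levelP ss' l.
have l := surface_lam ss' Sy; have [b01 Sb] := levelP ss l.
have b01' : 0 <= level A S y <= 1 by case/andP: b01 => *; rewrite !ltW.
exists (ray A y (level A S y)) => //.
rewrite /tent_slide lam_ray// b01 !level_ray// tentmap_peak ?ord//.
rewrite ray_ray// ?(level_lam ss' Sy) ?ray_lam// ?lam_ge0 ?lam_le1//.
Qed.

End tent.

Lemma surface_setC A S : surface A S -> surface (~: A)%SET S.
Proof.
case=> cS [m [M [m0 M1 b]]] u; split=> //.
  exists (1 - M), (1 - m); split; [by rewrite subr_gt0|by rewrite ltrBlDr ltrDl|].
  by move=> x /b; rewrite lam_setC; lra.
move=> x; rewrite lam_setC => l; have [|k [k01 Sk] ku] := u x; first by lra.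
exists (1 - k); first by rewrite ray_setC; split=> //; lra.
move=> m' m01 Sm'; rewrite -(ku (1 - m')); [by rewrite subKr|lra|].
by rewrite -ray_setC subKr.
Qed.

Lemma level_setC A S x : surface A S -> 0 < lam A x < 1 ->
  level (~: A)%SET S x = 1 - level A S x.
Proof.
move=> sS l; have [k01 Sk] := levelP sS l.
apply: level_uniq; [exact: surface_setC|by rewrite lam_setC; lra|lra|by rewrite ray_setC].
Qed.

Lemma tent_slide_setC A Sm S S' Sp x : surface A Sm -> surface A S ->
  surface A S' -> surface A Sp ->
  tent_slide (~: A)%SET Sp S S' Sm x = tent_slide A Sm S S' Sp x.
Proof.
move=> sm ss ss' sp; rewrite /tent_slide lam_setC.
rewrite (_ : 0 < 1 - _ < 1 = (0 < lam A x < 1)); last by apply/idP/idP; lra.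
case: ifP => // l; rewrite !level_setC// tentmap_sym ray_setC//.
Qed.

End Surfaces.

(** * Discs with given corners *)

Section QuadrilateralAlgebra.
Variable R : realFieldType.
Implicit Types w p z : R.

Lemma ltD_cancel (a b c d : R) : a + b <= c + d -> c < a -> b < d.
Proof. lra. Qed.

Lemma leD_squeeze (a b c d : R) : a <= b -> c <= d -> b + d <= a + c -> b = a /\ d = c.
Proof. by move=> h1 h2 h3; split; lra. Qed.

Lemma leD_swap (a b c d : R) : a + b <= c + d -> b + a <= d + c.
Proof. by rewrite addrC [leRHS]addrC. Qed.

(* Going once around the four corners, a decrease of one weight forces
   both weights of its diagonal to decrease and those of the other diagonal to
   increase, which the equality of the two minima forbids. *)
Lemma quad_weight_le w1 w2 w3 w4 z1 z2 z3 z4 p1 p2 p3 p4 r1 r2 r3 r4 :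
  0 <= w1 -> 0 <= w2 -> 0 <= w3 -> 0 <= w4 ->
  0 <= z1 -> 0 <= z2 -> 0 <= z3 -> 0 <= z4 ->
  0 < r1 /\ r1 <= p1 /\ p1 < 1 -> 0 < r2 /\ r2 <= p2 /\ p2 < 1 ->
  0 < r3 /\ r3 <= p3 /\ p3 < 1 -> 0 < r4 /\ r4 <= p4 /\ p4 < 1 ->
  z1 * (1 - r1) + z2 * (1 - r2) <= w1 * (1 - p1) + w2 * (1 - p2) ->
  z3 * (1 - r3) + z4 * (1 - r4) <= w3 * (1 - p3) + w4 * (1 - p4) ->
  w1 * p1 + w3 * p3 <= z1 * r1 + z3 * r3 ->
  w2 * p2 + w4 * p4 <= z2 * r2 + z4 * r4 ->
  Num.min w1 w4 = Num.min w2 w3 -> Num.min z1 z4 = Num.min z2 z3 -> w1 <= z1.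
Proof.
move=> w1_ge0 w2_ge0 w3_ge0 w4_ge0 z1_ge0 z2_ge0 z3_ge0 z4_ge0.
move=> [r1_gt0 [rp1 p1_lt1]] [r2_gt0 [rp2 p2_lt1]] [r3_gt0 [rp3 p3_lt1]] [r4_gt0 [rp4 p4_lt1]].
move=> row1 row2 col1 col2 minw minz.
rewrite leNgt; apply/negP => lt1.
have ltm z w r p : 0 <= z -> z < w -> 0 < p -> r <= p -> z * r < w * p.
  by move=> z0 zw p0 rp; rewrite (le_lt_trans (ler_wpM2l z0 rp))// ltr_pM2r.
have lem z w r p : 0 <= z -> z <= w -> 0 < r -> r <= p -> z * r <= w * p.
  by move=> z0 zw r0 rp; rewrite ler_pM// ltW.
have c1 := ltm _ _ _ _ z1_ge0 lt1 (lt_le_trans r1_gt0 rp1) rp1.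
have c3 := ltD_cancel col1 c1.
have lt3 : w3 < z3 by rewrite ltNge; apply/negP => h; have := lem _ _ _ _ z3_ge0 h r3_gt0 rp3; rewrite leNgt c3.
have d3 : w3 * (1 - p3) < z3 * (1 - r3).
  by apply: ltm => //; [rewrite subr_gt0; exact: le_lt_trans rp3 p3_lt1|rewrite lerD2l lerN2].
have d4 := ltD_cancel row2 d3.
have lt4 : z4 < w4.
  rewrite ltNge; apply/negP => h; move: d4; rewrite ltNge lem//; first by rewrite subr_gt0.
  by rewrite lerD2l lerN2.
have c4 := ltm _ _ _ _ z4_ge0 lt4 (lt_le_trans r4_gt0 rp4) rp4.
have c2 := ltD_cancel (leD_swap col2) c4.
have lt2 : w2 < z2 by rewrite ltNge; apply/negP => h; have := lem _ _ _ _ z2_ge0 h r2_gt0 rp2; rewrite leNgt c2.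
have : Num.min z1 z4 < Num.min w1 w4 by rewrite lt_min !gt_min lt1 lt4 orbT.
have : Num.min w2 w3 < Num.min z2 z3 by rewrite lt_min !gt_min lt2 lt3 orbT.
by rewrite minw minz => a /(lt_trans a); rewrite ltxx.
Qed.

(** The symmetries of the square turn [quad_weight_le] into the comparison of all four weights; the
    inequalities between row sums are then squeezed to equalities. *)
Lemma quad_rigid w1 w2 w3 w4 z1 z2 z3 z4 p1 p2 p3 p4 r1 r2 r3 r4 :
  0 <= w1 -> 0 <= w2 -> 0 <= w3 -> 0 <= w4 ->
  0 <= z1 -> 0 <= z2 -> 0 <= z3 -> 0 <= z4 ->
  0 < r1 /\ r1 <= p1 /\ p1 < 1 -> 0 < r2 /\ r2 <= p2 /\ p2 < 1 ->
  0 < r3 /\ r3 <= p3 /\ p3 < 1 -> 0 < r4 /\ r4 <= p4 /\ p4 < 1 ->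
  z1 * (1 - r1) + z2 * (1 - r2) <= w1 * (1 - p1) + w2 * (1 - p2) ->
  z3 * (1 - r3) + z4 * (1 - r4) <= w3 * (1 - p3) + w4 * (1 - p4) ->
  w1 * p1 + w3 * p3 <= z1 * r1 + z3 * r3 ->
  w2 * p2 + w4 * p4 <= z2 * r2 + z4 * r4 ->
  Num.min w1 w4 = Num.min w2 w3 -> Num.min z1 z4 = Num.min z2 z3 ->
  [/\ z1 * (1 - r1) = w1 * (1 - p1), z2 * (1 - r2) = w2 * (1 - p2),
      z3 * (1 - r3) = w3 * (1 - p3) & z4 * (1 - r4) = w4 * (1 - p4)] /\
  [/\ w1 = z1, w2 = z2, w3 = z3 & w4 = z4].
Proof.
move=> a1 a2 a3 a4 b1 b2 b3 b4 c1 c2 c3 c4 d1 d2 e1 e2 m1 m2.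
have m1' : Num.min w4 w1 = Num.min w3 w2 by rewrite minC m1 minC.
have m2' : Num.min z4 z1 = Num.min z3 z2 by rewrite minC m2 minC.
have [[d1' d2'] [e1' e2']] := ((leD_swap d1, leD_swap d2), (leD_swap e1, leD_swap e2)).
have l1 := quad_weight_le a1 a2 a3 a4 b1 b2 b3 b4 c1 c2 c3 c4 d1 d2 e1 e2 m1 m2.
have l2 := quad_weight_le a2 a1 a4 a3 b2 b1 b4 b3 c2 c1 c4 c3 d1' d2' e2 e1 (esym m1) (esym m2).
have l3 := quad_weight_le a3 a4 a1 a2 b3 b4 b1 b2 c3 c4 c1 c2 d2 d1 e1' e2' (esym m1') (esym m2').
have l4 := quad_weight_le a4 a3 a2 a1 b4 b3 b2 b1 c4 c3 c2 c1 d2' d1' e2' e1' m1' m2'.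
have s w z p r : 0 <= w -> 0 < r /\ r <= p /\ p < 1 -> w <= z -> w * (1 - p) <= z * (1 - r).
  move=> w0 [_ [rp lp1]] wz; apply: ler_pM => //; first by rewrite subr_ge0 ltW.
  by rewrite lerD2l lerN2.
have [E1 E2] := leD_squeeze (s _ _ _ _ a1 c1 l1) (s _ _ _ _ a2 c2 l2) d1.
have [E3 E4] := leD_squeeze (s _ _ _ _ a3 c3 l3) (s _ _ _ _ a4 c4 l4) d2.
have t w z p r : 0 < r /\ r <= p /\ p < 1 -> 0 <= z -> w <= z -> z * (1 - r) = w * (1 - p) -> w = z.
  move=> [_ [rp pl1]] z0 wz h; apply/le_anti; rewrite wz/= leNgt; apply/negP => wz'.
  have g1 : w * (1 - p) < z * (1 - p) by rewrite ltr_pM2r// subr_gt0.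
  have g2 : z * (1 - p) <= z * (1 - r) by rewrite ler_wpM2l// lerD2l lerN2.
  by move: (lt_le_trans g1 g2); rewrite h ltxx.
split=> //; split; [exact: t c1 b1 l1 E1|exact: t c2 b2 l2 E2|exact: t c3 b3 l3 E3|exact: t c4 b4 l4 E4].
Qed.

(** The corners 1, 2, 3, 4 are those on the edges ua, ub, va, vb of the type uv | ab, and the [X]
    are the coordinates of a point at u, v, a, b. The factors [k] and [l] express that only the ray
    of this point is prescribed. *)
Definition quad_solvable p1 p2 p3 p4 (X1 X2 X3 X4 : R) : Prop :=
  exists w1 w2 w3 w4 k l, [/\ [/\ 0 <= w1, 0 <= w2, 0 <= w3 & 0 <= w4],
    Num.min w1 w4 = Num.min w2 w3, 0 < k, 0 < l &
    [/\ w1 * (1 - p1) + w2 * (1 - p2) = k * X1, w3 * (1 - p3) + w4 * (1 - p4) = k * X2,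
        w1 * p1 + w3 * p3 = l * X3 & w2 * p2 + w4 * p4 = l * X4]].

Lemma quad_solvable_rows p1 p2 p3 p4 X1 X2 X3 X4 :
  quad_solvable p3 p4 p1 p2 X2 X1 X3 X4 -> quad_solvable p1 p2 p3 p4 X1 X2 X3 X4.
Proof.
case=> w1 [w2 [w3 [w4 [k [l [[a b c d] m k0 l0 [e1 e2 e3 e4]]]]]]].
by exists w3, w4, w1, w2, k, l; split=> //; [rewrite minC -m minC|split=> //; lra].
Qed.

Lemma quad_solvable_cols p1 p2 p3 p4 X1 X2 X3 X4 :
  quad_solvable p2 p1 p4 p3 X1 X2 X4 X3 -> quad_solvable p1 p2 p3 p4 X1 X2 X3 X4.
Proof.
case=> w1 [w2 [w3 [w4 [k [l [[a b c d] m k0 l0 [e1 e2 e3 e4]]]]]]].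
by exists w2, w1, w4, w3, k, l; split=> //; split=> //; lra.
Qed.

Lemma quad_solvable_tr p1 p2 p3 p4 X1 X2 X3 X4 :
  quad_solvable (1 - p1) (1 - p3) (1 - p2) (1 - p4) X3 X4 X1 X2 ->
  quad_solvable p1 p2 p3 p4 X1 X2 X3 X4.
Proof.
case=> w1 [w2 [w3 [w4 [k [l [[a b c d] m k0 l0 [e1 e2 e3 e4]]]]]]].
by exists w1, w3, w2, w4, l, k; split=> //; [rewrite m minC|split=> //; lra].
Qed.

(** With [X2 = 0] the corners 3 and 4 get no weight; both minima are 0 and the two other weights are
    read off from [X3] and [X4]. *)
Lemma quad_solve_edge p1 p2 p3 p4 X1 X2 X3 X4 :
  0 < p1 < 1 -> 0 < p2 < 1 -> 0 < p3 < 1 -> 0 < p4 < 1 ->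
  0 < X1 -> X2 = 0 -> 0 <= X3 -> 0 <= X4 -> 0 < X3 + X4 ->
  quad_solvable p1 p2 p3 p4 X1 X2 X3 X4.
Proof.
move=> h1 h2 h3 h4 x1 -> x3 x4 x34.
have p1n : p1 != 0 by lra. have p2n : p2 != 0 by lra.
have e1 : 0 <= X3 / p1 by rewrite divr_ge0//; lra.
have e2 : 0 <= X4 / p2 by rewrite divr_ge0//; lra.
exists (X3 / p1), (X4 / p2), 0, 0, ((X3 / p1 * (1 - p1) + X4 / p2 * (1 - p2)) / X1), 1.
split=> //.
- by rewrite !min_r.
- rewrite divr_gt0//; case: (ltrP 0 X3) => h.
    by have : 0 < X3 / p1; [rewrite divr_gt0//; lra|nra].
  by have : 0 < X4 / p2; [rewrite divr_gt0//; lra|nra].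
- by split; rewrite ?mul0r ?addr0 ?mulr0 ?mul1r ?divfK// gt_eqF.
Qed.

(* The centre weights (1,1,1,1) are increased on the corners 1 and 2. *)
Lemma quad_solve_row p1 p2 p3 p4 X1 X2 X3 X4 :
  0 < p1 < 1 -> 0 < p2 < 1 -> 0 < p3 < 1 -> 0 < p4 < 1 ->
  0 < X1 -> 0 < X2 -> 0 < X3 -> 0 < X4 ->
  let e := X1 * ((1 - p3) + (1 - p4)) / X2 - ((1 - p1) + (1 - p2)) in
  let f := X3 * (p2 + p4) / X4 - (p1 + p3) in
  0 <= e -> 0 <= f -> f * (1 - p1) <= e * p1 -> quad_solvable p1 p2 p3 p4 X1 X2 X3 X4.
Proof.
move=> h1 h2 h3 h4 x1 x2 x3 x4 e f e0 f0 fe.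
(* With weights [1 + sig], [1 + tau], 1, 1 the equations become
   [sig * (1 - p1) + tau * (1 - p2) = e] and [X4 * (sig * p1 - f) = tau * p2 * X3]. Elimination of
   [sig] leaves [D] as the coefficient of [tau]; the last hypothesis makes [tau] nonnegative. *)
pose D := X4 * p1 / (1 - p1) * (1 - p2) + p2 * X3.
have q1 : 0 < 1 - p1 by lra. have q2 : 0 < 1 - p2 by lra.
have D0 : 0 < D by rewrite addr_gt0// ?mulr_gt0// ?invr_gt0//; lra.
pose tau := X4 * (e * p1 / (1 - p1) - f) / D.
have fe' : f <= e * p1 / (1 - p1) by rewrite ler_pdivlMr.
have tau0 : 0 <= tau by apply: divr_ge0; [apply: mulr_ge0; [exact: ltW|rewrite subr_ge0]|exact: ltW].
have tauD : tau * D = X4 * (e * p1 / (1 - p1) - f) by rewrite divfK// gt_eqF.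
pose sig := (e - tau * (1 - p2)) / (1 - p1).
have sigE : sig * (1 - p1) + tau * (1 - p2) = e by rewrite divfK ?subrK// gt_eqF.
have X4n : X4 != 0 by rewrite gt_eqF.
have key : X4 * (sig * p1 - f) = tau * p2 * X3.
  have : tau * D = tau * (X4 * p1 / (1 - p1) * (1 - p2)) + tau * p2 * X3 by rewrite /D; ring.
  rewrite tauD => k.
  have -> : sig * p1 = e * p1 / (1 - p1) - tau * p1 / (1 - p1) * (1 - p2).
    by rewrite /sig; field; rewrite gt_eqF.
  have : tau * (X4 * p1 / (1 - p1) * (1 - p2)) = X4 * (tau * p1 / (1 - p1) * (1 - p2)) by ring.
  by lra.
have sig0 : 0 <= sig.
  have : 0 <= sig * p1.
    have a : 0 <= X4 * (sig * p1 - f) by rewrite key; apply: mulr_ge0; [apply: mulr_ge0 => //; lra|exact: ltW].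
    have b : 0 <= sig * p1 - f by move: a; rewrite pmulr_rge0.
    by lra.
  by rewrite pmulr_lge0//; lra.
exists (1 + sig), (1 + tau), 1, 1, (((1 - p3) + (1 - p4)) / X2), ((p2 + p4 + tau * p2) / X4).
have sum3 : e = X1 * ((1 - p3) + (1 - p4)) / X2 - ((1 - p1) + (1 - p2)) by [].
have sum4 : f = X3 * (p2 + p4) / X4 - (p1 + p3) by [].
split.
- by split=> //; rewrite addr_ge0.
- by rewrite !min_r ?lerDl.
- by rewrite divr_gt0//; lra.
- by rewrite divr_gt0//; nra.
- split.
  + rewrite (_ : _ / X2 * X1 = X1 * ((1 - p3) + (1 - p4)) / X2); last by rewrite mulrAC [in LHS](mulrC _ X1).
    by lra.
  + by rewrite divfK ?gt_eqF//; lra.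
  + apply: (mulIf X4n).
    have k3 : f * X4 = X3 * (p2 + p4) - (p1 + p3) * X4 by rewrite sum4 mulrBl divfK.
    have -> : (p2 + p4 + tau * p2) / X4 * X3 * X4 = (p2 + p4 + tau * p2) * X3 by field.
    by nra.
  + by rewrite divfK//; lra.
Qed.

(** [quad_solve_row] increases the weights of the corners 1 and 2; where its last hypothesis fails,
    transposition increases those of the corners 1 and 3. *)
Lemma quad_solve_quadrant p1 p2 p3 p4 X1 X2 X3 X4 :
  0 < p1 < 1 -> 0 < p2 < 1 -> 0 < p3 < 1 -> 0 < p4 < 1 ->
  0 < X1 -> 0 < X2 -> 0 < X3 -> 0 < X4 ->
  X2 * ((1 - p1) + (1 - p2)) <= X1 * ((1 - p3) + (1 - p4)) ->
  X4 * (p1 + p3) <= X3 * (p2 + p4) -> quad_solvable p1 p2 p3 p4 X1 X2 X3 X4.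
Proof.
move=> h1 h2 h3 h4 x1 x2 x3 x4 a b.
have e0 : 0 <= X1 * ((1 - p3) + (1 - p4)) / X2 - ((1 - p1) + (1 - p2)).
  by rewrite subr_ge0 ler_pdivlMr// mulrC.
have f0 : 0 <= X3 * (p2 + p4) / X4 - (p1 + p3) by rewrite subr_ge0 ler_pdivlMr// mulrC.
have [c|c] := leP ((X3 * (p2 + p4) / X4 - (p1 + p3)) * (1 - p1))
                  ((X1 * ((1 - p3) + (1 - p4)) / X2 - ((1 - p1) + (1 - p2))) * p1).
  exact: quad_solve_row.
apply: quad_solvable_tr; apply: quad_solve_row => //; rewrite ?subKr//; try lra.
Qed.

(** If no coordinate vanishes, the signs of the excesses over the centre weights define four
    quadrants, which the symmetries of the square exchange. *)
Lemma quad_solve p1 p2 p3 p4 X1 X2 X3 X4 :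
  0 < p1 < 1 -> 0 < p2 < 1 -> 0 < p3 < 1 -> 0 < p4 < 1 ->
  0 <= X1 -> 0 <= X2 -> 0 <= X3 -> 0 <= X4 -> 0 < X1 + X2 -> 0 < X3 + X4 ->
  quad_solvable p1 p2 p3 p4 X1 X2 X3 X4.
Proof.
move=> h1 h2 h3 h4 x1 x2 x3 x4 x12 x34.
case: (ltrP 0 X2) => x2p; last first.
  by apply: quad_solve_edge => //; lra.
case: (ltrP 0 X1) => x1p; last first.
  by apply: quad_solvable_rows; apply: quad_solve_edge => //; lra.
case: (ltrP 0 X4) => x4p; last first.
  by apply: quad_solvable_tr; apply: quad_solve_edge => //; lra.
case: (ltrP 0 X3) => x3p; last first.
  by apply: quad_solvable_cols; apply: quad_solvable_tr; apply: quad_solve_edge => //; lra.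
have [a|a] := leP (X2 * ((1 - p1) + (1 - p2))) (X1 * ((1 - p3) + (1 - p4)));
have [b|b] := leP (X4 * (p1 + p3)) (X3 * (p2 + p4)).
- exact: quad_solve_quadrant.
- by apply: quad_solvable_cols; apply: quad_solve_quadrant => //; lra.
- by apply: quad_solvable_rows; apply: quad_solve_quadrant => //; lra.
- by apply: quad_solvable_rows; apply: quad_solvable_cols; apply: quad_solve_quadrant => //; lra.
Qed.

End QuadrilateralAlgebra.

Section Discs.
Variable R : realType.
Notation tet := (tetrahedron R).
Implicit Types (A : {set 'I_4}) (x y : tet) (p : 'I_4 -> 'I_4 -> R).

Lemma sum4P (V : nmodType) (u v a b : 'I_4) (P : pred 'I_4) (F : 'I_4 -> V) :
  uniq [:: u; v; a; b] -> \sum_(i | P i) F i = \sum_(i <- [:: u; v; a; b] | P i) F i.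
Proof.
move=> un; apply: perm_big; apply: uniq_perm => //; first exact: index_enum_uniq.
have e : [:: u; v; a; b] =i 'I_4.
  apply/subset_cardP; last exact/subset_predT.
  by rewrite card_ord; apply/card_uniqP.
by move=> i; rewrite e mem_index_enum.
Qed.

Lemma all4P (u v a b i : 'I_4) : uniq [:: u; v; a; b] -> i \in [:: u; v; a; b].
Proof.
move=> un; have e : [:: u; v; a; b] =i 'I_4.
  apply/subset_cardP; last exact/subset_predT.
  by rewrite card_ord; apply/card_uniqP.
by rewrite e.
Qed.

(* The normal disc of type A | ~A with corner at weight [p i j] towards j on
   each edge from i \in A to j \notin A. Its points are the combinations, with
   weights [w i j], of its corners, where in the quadrilateral case the cone
   structure says that two consecutive corners carry the least weight. *)
Definition disc A p : set tet := [set x | exists w : 'I_4 -> 'I_4 -> R,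
  [/\ forall i j, 0 <= w i j,
      forall i, i \in A -> crd x i = \sum_(j | j \notin A) w i j * (1 - p i j),
      forall j, j \notin A -> crd x j = \sum_(i | i \in A) w i j * p i j
    & forall i i' j j', i \in A -> i' \in A -> j \notin A -> j' \notin A ->
        i != i' -> j != j' ->
        Num.min (w i j) (w i' j') = Num.min (w i j') (w i' j)]].

Definition unit_pos p : Prop := forall i j, 0 < p i j < 1.

(** Each corner is recorded from both ends of its edge. *)
Definition antisym p : Prop := forall i j, p j i = 1 - p i j.

Lemma disc_setC A p : antisym p -> disc (~: A)%SET p = disc A p.
Proof.
move=> ap; suff H B : disc B p `<=` disc (~: B)%SET p.
  by apply/seteqP; split=> //; rewrite -{2}[A]finset.setCK; exact: H.
move=> x [w [w0 hA hB hm]]; exists (fun i j => w j i); split=> //.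
- move=> i; rewrite inE => iB; rewrite hB//; apply: eq_big => j; first by rewrite inE negbK.
  by move=> _; rewrite (ap j i) subKr.
- move=> j; rewrite inE negbK => jB; rewrite hA//; apply: eq_big => i; first by rewrite inE.
  by move=> _; rewrite (ap j i).
- move=> i i' j j'; rewrite !inE !negbK => iB i'B jB j'B ii' jj'.
  by rewrite (hm j j' i i')// minC.
Qed.

(** The intercept form of a plane: for a triangle the weights are forced to be [crd x j / p u j],
    and the only remaining condition is that their sum is 1. *)
Lemma disc_tri u v a b p x : uniq [:: u; v; a; b] -> unit_pos p ->
  disc [set u]%SET p x <->
  crd x v / p u v + crd x a / p u a + crd x b / p u b = 1.
Proof.
move=> un pp; have S4 := fun P F => @sum4P R u v a b P F un.
move: (un); rewrite /= !inE !negb_or => /and4P[/and3P[uv ua ub] /andP[va vb] ab _].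
have n i j : p i j != 0 by have /andP[h _] := pp i j; rewrite gt_eqF.
have sx : crd x u + crd x v + crd x a + crd x b = 1.
  by rewrite -(crd_sum x) S4 !big_cons big_nil /=; ring.
split.
- move=> [w [w0 hA hB _]].
  have h j : j != u -> crd x j / p u j = w u j.
    move=> ju; rewrite hB ?inE// (eq_bigl (pred1 u)) => [|i]; last by rewrite inE.
    by rewrite big_pred1_eq mulfK.
  have hj j : j != u -> crd x j = w u j * p u j by move=> ju; rewrite -h// divfK.
  rewrite !h 1?eq_sym//; move: sx; rewrite (hA u) ?inE// (hj v) 1?eq_sym// (hj a) 1?eq_sym// (hj b) 1?eq_sym//.
  rewrite S4 !big_cons big_nil !inE eqxx /= ![_ == u]eq_sym uv ua ub /=; lra.
- move=> e; exists (fun i j => crd x j / p u j); split.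
  + by move=> i j; rewrite divr_ge0 ?crd_ge0//; have /andP[h _] := pp u j; rewrite ltW.
  + move=> i; rewrite inE => /eqP ->.
    rewrite S4 !big_cons big_nil !inE eqxx /= ![_ == u]eq_sym uv ua ub /=.
    rewrite !mulrBr !mulr1 !divfK//; lra.
  + move=> j; rewrite inE => ju; rewrite (eq_bigl (pred1 u)) => [|i]; last by rewrite inE.
    by rewrite big_pred1_eq divfK.
  + by move=> i i' j j'; rewrite !inE => /eqP -> /eqP ->; rewrite eqxx.
Qed.

Lemma disc_quad u v a b p x : uniq [:: u; v; a; b] ->
  disc [set u; v]%SET p x <-> exists w1 w2 w3 w4,
   [/\ [/\ 0 <= w1, 0 <= w2, 0 <= w3 & 0 <= w4],
      Num.min w1 w4 = Num.min w2 w3,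
      crd x u = w1 * (1 - p u a) + w2 * (1 - p u b) /\
      crd x v = w3 * (1 - p v a) + w4 * (1 - p v b),
      crd x a = w1 * p u a + w3 * p v a & crd x b = w2 * p u b + w4 * p v b].
Proof.
move=> un; have S4 := fun P F => @sum4P R u v a b P F un.
move: (un); rewrite /= !inE !negb_or => /and4P[/and3P[uv ua ub] /andP[va vb] ab _].
have inA i : (i \in [set u; v]%SET) = (i == u) || (i == v) by rewrite !inE.
have [uvF uaF ubF] := And3 (negbTE uv) (negbTE ua) (negbTE ub).
have [vaF vbF abF] := And3 (negbTE va) (negbTE vb) (negbTE ab).
have E := (inA, eqxx, uvF, uaF, ubF, vaF, vbF, abF, eq_sym a u, eq_sym b u, eq_sym v u, eq_sym a v, eq_sym b v, eq_sym b a).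
split.
- move=> [w [w0 hA hB hm]]; exists (w u a), (w u b), (w v a), (w v b); split=> //.
  + by apply: hm; rewrite ?E.
  + by split; rewrite hA ?E// S4 !big_cons big_nil ?E /= addr0.
  + by rewrite hB ?E// S4 !big_cons big_nil ?E /= addr0.
  + by rewrite hB ?E// S4 !big_cons big_nil ?E /= addr0.
- move=> [w1 [w2 [w3 [w4 [[a1 a2 a3 a4] m [eu ev] ea eb]]]]].
  pose w i j := if i == u then (if j == a then w1 else w2) else (if j == a then w3 else w4).
  exists w; split.
  + by move=> i j; rewrite /w; case: ifP => _; case: ifP.
  + move=> i; rewrite inA => /orP[] /eqP ->; rewrite S4 !big_cons big_nil /w ?E /= addr0//.
  + move=> j jA; have : j \in [:: u; v; a; b] by exact: all4P.
    move: jA; rewrite inA !inE => /norP[/negbTE -> /negbTE ->] /= /orP[] /eqP ->; rewrite S4 !big_cons big_nil /w ?E /= addr0//.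
  + move=> i i' j j'; rewrite !inA => iA iA' jA jA' ii' jj'.
    have := all4P j un; have := all4P j' un; rewrite !inE.
    move: jA jA' => /norP[/negbTE -> /negbTE ->] /norP[/negbTE -> /negbTE ->] /=.
    move: iA iA' ii' jj' => /orP[] /eqP -> /orP[] /eqP ->; rewrite ?eqxx// => _ + /orP[] /eqP -> /orP[] /eqP ->; rewrite ?eqxx// => _; rewrite /w ?E /=//.
    all: by rewrite ?[Num.min w3 w2]minC ?[Num.min w4 w1]minC m.
Qed.

End Discs.

Section DiscSurfaces.
Variable R : realType.
Notation tet := (tetrahedron R).
Implicit Types (A : {set 'I_4}) (x y : tet) (p : 'I_4 -> 'I_4 -> R).

(** Oriented types: a quadrilateral type occurs twice, as a set and as its complement. *)
Definition dtype A := (#|A| == 1%N) || (#|A| == 2%N).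

Lemma dtypeP A : dtype A -> exists u v a b, uniq [:: u; v; a; b] /\
  (A = [set u]%SET \/ A = [set u; v]%SET).
Proof.
have cC (B : {set 'I_4}) : (#|B| + #|~: B|)%N = 4%N by rewrite cardsC card_ord.
move=> /orP[/cards1P[u ->]|/cards2P[u [v [uv ->]]]].
  have := cC [set u]%SET; rewrite cards1 => /eqP; rewrite eqn_add2l => c3.
  have : size (enum (~: [set u])%SET) == 3%N by rewrite -cardE.
  case E : (enum _) => [|v [|a [|b []]]]// _.
  have := enum_uniq (~: [set u])%SET; have m i := mem_enum (~: [set u])%SET i.
  rewrite E => un; exists u, v, a, b; split; last by left.
  by rewrite cons_uniq un andbT -E m !inE eqxx.
have := cC [set u; v]%SET; rewrite cards2 uv => /eqP; rewrite eqn_add2l => c2.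
have : size (enum (~: [set u; v])%SET) == 2%N by rewrite -cardE.
case E : (enum _) => [|a [|b []]]// _.
have := enum_uniq (~: [set u; v])%SET; have m i := mem_enum (~: [set u; v])%SET i.
rewrite E => un; exists u, v, a, b; split; last by right.
rewrite cons_uniq cons_uniq un andbT in_cons negb_or uv -E !m !inE !eqxx orbT.
by rewrite orTb.
Qed.

Lemma crd_sum4 x u v a b : uniq [:: u; v; a; b] -> crd x u + crd x v + crd x a + crd x b = 1.
Proof.
by move=> un; rewrite -(crd_sum x) (sum4P _ _ un) !big_cons big_nil /=; ring.
Qed.

Lemma lam_tri x u v a b : uniq [:: u; v; a; b] -> lam [set u]%SET x = crd x v + crd x a + crd x b.
Proof.
move=> un; have := crd_sum4 x un; rewrite -[lam _ _]subr0 -(subrr 1) opprB addrCA.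
rewrite -opprB -lamC (eq_bigl (pred1 u)) => [|i]; last by rewrite inE.
by rewrite big_pred1_eq; lra.
Qed.

Lemma lam_quad x u v a b : uniq [:: u; v; a; b] -> lam [set u; v]%SET x = crd x a + crd x b.
Proof.
move=> un; rewrite /lam (sum4P _ _ un) !big_cons big_nil !inE !eqxx orbT /=.
move: un; rewrite /= !inE !negb_or => /and4P[/and3P[_ ua ub] /andP[va vb] _ _].
by rewrite ![_ == u]eq_sym ![_ == v]eq_sym (negbTE ua) (negbTE ub) (negbTE va) (negbTE vb) /= addr0.
Qed.

Lemma crd_inj4 x y u v a b : uniq [:: u; v; a; b] ->
  crd x v = crd y v -> crd x a = crd y a -> crd x b = crd y b -> x = y.
Proof.
move=> un ev ea eb; have sx := crd_sum4 x un; have sy := crd_sum4 y un.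
have eu : crd x u = crd y u by lra.
by apply: crd_inj => i; have := all4P i un; rewrite !inE => /or4P[] /eqP ->.
Qed.

Lemma uniq4 (u v a b : 'I_4) : uniq [:: u; v; a; b] ->
  [/\ v != u, a != u & b != u] /\ [/\ a != v, b != v & b != a].
Proof.
rewrite /= !inE !negb_or => /and4P[/and3P[uv ua ub] /andP[va vb] ab _].
by split; split; rewrite eq_sym.
Qed.

(** With [p = p'] this is the uniqueness of the intersection with a ray; with [p <= p'] it says that
    the disc whose corners are further from [A] cannot be met nearer to [A]. *)
Lemma disc_rigid A p p' x y : dtype A -> unit_pos p -> unit_pos p' ->
  (forall i j, i \in A -> j \notin A -> p i j <= p' i j) ->
  disc A p' x -> disc A p y ->
  (forall i, i \in A -> crd y i <= crd x i) -> (forall j, j \notin A -> crd x j <= crd y j) ->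
  x = y /\ ~ (forall i j, i \in A -> j \notin A -> p i j < p' i j).
Proof.
move=> /dtypeP[u [v [a [b [un]]]]] tA pp pp' le dx dy hA hB.
have P i j : 0 < p i j /\ p i j < 1 by apply/andP.
have P' i j : 0 < p' i j /\ p' i j < 1 by apply/andP.
have [[vu au bu] [av bv ba]] := uniq4 un.
case: tA => e; subst A.
- have m0 : u \in [set u]%SET by rewrite inE.
  have m1 : v \notin [set u]%SET by rewrite inE.
  have m2 : a \notin [set u]%SET by rewrite inE.
  have m3 : b \notin [set u]%SET by rewrite inE.
  have /(disc_tri _ un pp') ex := dx; have /(disc_tri _ un pp) ey := dy.
  (* Each quotient in the intercept equation of [x] is at most its counterpart for [y]; as both sums
     are 1, all of them are equal. *)
  have t (r s q q' : R) : 0 <= r -> r <= s -> 0 < q -> q <= q' ->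
      r / q' <= s / q /\ (s / q <= r / q' -> r = s /\ (q < q' -> s = 0)).
    move=> r0 rs q0 qq'; have q'0 := lt_le_trans q0 qq'.
    have i1 : q'^-1 <= q^-1 by rewrite lef_pV2 ?posrE.
    have i0 : 0 < q'^-1 by rewrite invr_gt0.
    have i2 : r / q' <= s / q' by rewrite ler_pM2r.
    have s0 : 0 <= s by exact: le_trans rs.
    have i3 : s / q' <= s / q by rewrite ler_wpM2l.
    split; first exact: le_trans i3.
    move=> i4; have e1 : r / q' = s / q' by apply/le_anti; rewrite i2 (le_trans i3).
    have e2 : s / q' = s / q by apply/le_anti; rewrite i3 (le_trans i4).
    split; first by move: e1; apply: mulIf; rewrite gt_eqF.
    move=> qq; apply/eqP; move/eqP: e2; rewrite -subr_eq0 -mulrBr mulf_eq0 => /orP[//|].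
    by rewrite subr_eq0 => /eqP/invr_inj e3; rewrite e3 ltxx in qq.
  have [le1 eq1] := t _ _ _ _ (crd_ge0 x v) (hB _ m1) (P u v).1 (le _ _ m0 m1).
  have [le2 eq2] := t _ _ _ _ (crd_ge0 x a) (hB _ m2) (P u a).1 (le _ _ m0 m2).
  have [le3 eq3] := t _ _ _ _ (crd_ge0 x b) (hB _ m3) (P u b).1 (le _ _ m0 m3).
  have [|e1 z1] := eq1; first by move: le1 le2 le3 ex ey; clear; lra.
  have [|e2 z2] := eq2; first by move: le1 le2 le3 ex ey; clear; lra.
  have [|e3 z3] := eq3; first by move: le1 le2 le3 ex ey; clear; lra.
  split; first exact: (crd_inj4 un).
  move=> lt; move: ey; rewrite z1 ?z2 ?z3 ?mul0r ?addr0; try exact: lt.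
  by move=> /eqP; rewrite eq_sym oner_eq0.
- have m0 : u \in [set u; v]%SET by rewrite !inE eqxx.
  have m1 : v \in [set u; v]%SET by rewrite !inE eqxx orbT.
  have m2 : a \notin [set u; v]%SET by rewrite !inE negb_or au av.
  have m3 : b \notin [set u; v]%SET by rewrite !inE negb_or bu bv.
  have /(disc_quad _ _ un)[w1 [w2 [w3 [w4 [[a1 a2 a3 a4] mw [xu xv] xa xb]]]]] := dx.
  have /(disc_quad _ _ un)[z1 [z2 [z3 [z4 [[b1 b2 b3 b4] mz [yu yv] ya yb]]]]] := dy.
  have pi i j : i \in [set u; v]%SET -> j \notin [set u; v]%SET -> 0 < p i j /\ p i j <= p' i j /\ p' i j < 1.
    by move=> iA jA; split; [case: (P i j)|split; [exact: le|case: (P' i j)]].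
  have hu := hA _ m0; have hv := hA _ m1; have ha := hB _ m2; have hb := hB _ m3.
  rewrite xu yu in hu; rewrite xv yv in hv; rewrite xa ya in ha; rewrite xb yb in hb.
  have [[r1 r2 r3 r4] [e1 e2 e3 e4]] := quad_rigid a1 a2 a3 a4 b1 b2 b3 b4
    (pi _ _ m0 m2) (pi _ _ m0 m3) (pi _ _ m1 m2) (pi _ _ m1 m3) hu hv ha hb mw mz.
  subst z1 z2 z3 z4.
  have k (w q q' : R) : w * (1 - q) = w * (1 - q') -> w * q = w * q'.
    by rewrite !mulrBr !mulr1 => /addrI/oppr_inj.
  split.
    apply: (crd_inj4 un).
    + by rewrite xv yv r3 r4.
    + by rewrite xa ya (k _ _ _ r1) (k _ _ _ r3).
    + by rewrite xb yb (k _ _ _ r2) (k _ _ _ r4).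
  move=> lt; have z (w q q' : R) : w * (1 - q) = w * (1 - q') -> q < q' -> w = 0.
    move=> /k e qq; have : w * (q' - q) = 0 by rewrite mulrBr e subrr.
    by move=> /eqP; rewrite mulf_eq0 subr_eq0 (gt_eqF qq) orbF => /eqP.
  have sx := crd_sum4 x un; move: sx; rewrite xu xv xa xb.
  rewrite (z _ _ _ r1) ?(z _ _ _ r2) ?(z _ _ _ r3) ?(z _ _ _ r4); try exact: lt.
  by rewrite !mul0r !addr0 => /eqP; rewrite eq_sym oner_eq0.
Qed.

Lemma common_bounds (q1 q2 q3 q4 : R) : 0 < q1 < 1 -> 0 < q2 < 1 -> 0 < q3 < 1 -> 0 < q4 < 1 ->
  exists m M, [/\ 0 < m, M < 1 & [/\ m <= q1 <= M, m <= q2 <= M, m <= q3 <= M & m <= q4 <= M]].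
Proof.
move=> /andP[a1 b1] /andP[a2 b2] /andP[a3 b3] /andP[a4 b4].
pose m := Num.min (Num.min q1 q2) (Num.min q3 q4); pose M := Num.max (Num.max q1 q2) (Num.max q3 q4).
have : m <= m by []. have : M <= M by [].
rewrite {1}/M {2}/m !le_min !ge_max => /andP[/andP[c1 c2] /andP[c3 c4]] /andP[/andP[d1 d2] /andP[d3 d4]].
exists m, M; rewrite c1 c2 c3 c4 d1 d2 d3 d4; split=> //.
- by rewrite /m !lt_min a1 a2 a3.
- by rewrite /M !gt_max b1 b2 b3.
Qed.

Lemma surface_disc A p : dtype A -> unit_pos p -> surface A (disc A p).
Proof.
move=> tA pp; have := dtypeP tA; move=> [u [v [a [b [un]]]]] tA'.
have P i j : 0 < p i j /\ p i j < 1 by apply/andP.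
(* Of two points of the disc on a ray, the lower one has the larger coordinates on [A] and the
   smaller ones off [A]: the situation of [disc_rigid] with equal positions. *)
have uni x : 0 < lam A x < 1 -> forall m m', 0 < m < 1 -> 0 < m' < 1 ->
    disc A p (ray A x m) -> disc A p (ray A x m') -> m <= m' -> m = m'.
  move=> l m m' m01 m'01 dm dm' mm.
  have mi : 0 <= m <= 1 by case/andP: m01 => *; rewrite !ltW.
  have mi' : 0 <= m' <= 1 by case/andP: m'01 => *; rewrite !ltW.
  suff [e _] : ray A x m = ray A x m' /\ ~ (forall i j, i \in A -> j \notin A -> p i j < p i j).
    by rewrite -(lam_ray l mi) e lam_ray.
  apply: (disc_rigid tA pp pp) => // [i iA|j jA]; rewrite !crd_ray//.
    by rewrite iA ler_wpM2l ?crd_ge0// ler_wpM2r ?invr_ge0//; lra.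
  by rewrite (negbTE jA) ler_wpM2l ?crd_ge0// ler_wpM2r ?invr_ge0//; lra.
suff [cS bS ex] : [/\ closed (disc A p), (exists m M, [/\ 0 < m, M < 1 & forall x, disc A p x -> m <= lam A x <= M])
    & forall x, 0 < lam A x < 1 -> exists2 m, 0 < m < 1 & disc A p (ray A x m)].
  split=> // x l; have [m m01 dm] := ex _ l; exists m => // m' m'01 dm'.
  by have [/ltW h|h] := ltP m m'; [apply/esym; apply: (uni x l)|apply: (uni x l)].
have mM := @common_bounds.
have [[vu au bu] [av bv ba]] := uniq4 un.
case: tA' => e; subst A.
- split.
  + pose F x := crd x v / p u v + crd x a / p u a + crd x b / p u b.
    have cF : continuous F.
      move=> x; have c j : continuous_at x (fun x : tet => crd x j / p u j).
        by apply: (@contM R tet); [exact: crd_continuous|exact: (@contc R tet)].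
      by apply: (@contD R tet) => //; exact: (@contD R tet).
    rewrite (_ : disc _ p = F @^-1` [set r | r = 1]).
      by apply: preimage_closed; [move=> x _; exact: cF|exact: closed_eq].
    by apply/seteqP; split=> x; rewrite (disc_tri x un pp).
  + have [m [M [m0 M1 [h1 h2 h3 _]]]] := mM _ _ _ _ (pp u v) (pp u a) (pp u b) (pp u b).
    exists m, M; split => // x /(disc_tri _ un pp); rewrite (lam_tri _ un) => e.
    have k (q r : R) : 0 < q -> m <= q <= M -> 0 <= r -> m * (r / q) <= r <= M * (r / q).
      move=> q0 mqM r0; rewrite !mulrA ler_pdivlMr// ler_pdivrMr//.
      by rewrite [r * q]mulrC; case/andP: mqM => *; rewrite !ler_wpM2r.
    have := k _ _ (P u v).1 h1 (crd_ge0 x v); have := k _ _ (P u a).1 h2 (crd_ge0 x a).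
    have := k _ _ (P u b).1 h3 (crd_ge0 x b); move: e.
    set s := _ / _; set t := crd x a / _; set r := crd x b / _ => e k1 k2 k3.
    have e1 : m * s + m * t + m * r = m by rewrite -!mulrDr e mulr1.
    have e2 : M * s + M * t + M * r = M by rewrite -!mulrDr e mulr1.
    by move: k1 k2 k3 e1 e2; clear; lra.
  + move=> x l; have := l; rewrite (lam_tri _ un) => l'.
    pose F := crd x v / p u v + crd x a / p u a + crd x b / p u b.
    have k (r q : R) : 0 < q /\ q < 1 -> 0 <= r -> r <= r / q /\ (0 < r -> r < r / q).
      move=> [q0 q1] r0; rewrite ler_pdivlMr// ltr_pdivlMr//; split=> [|r1]; nra.
    have [i1 s1] := k _ _ (P u v) (crd_ge0 x v); have [i2 s2] := k _ _ (P u a) (crd_ge0 x a).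
    have [i3 s3] := k _ _ (P u b) (crd_ge0 x b).
    have lF : lam [set u]%SET x < F.
      rewrite (lam_tri _ un) /F.
      have := crd_ge0 x v; have := crd_ge0 x a; have := crd_ge0 x b.
      case: (ltrP 0 (crd x v)) => [/s1|]; first by lra.
      case: (ltrP 0 (crd x a)) => [/s2|]; first by lra.
      case: (ltrP 0 (crd x b)) => [/s3|]; first by lra.
      by lra.
    have F0 : 0 < F by apply: lt_trans lF; case/andP: l.
    have m01 : 0 < lam [set u]%SET x / F < 1.
      by rewrite divr_gt0 ?ltr_pdivrMr ?mul1r//; case/andP: l.
    (* The intercept form is linear and vanishes at [u], so at height [m] it takes the value
       [m * F / lam]. *)
    exists (lam [set u]%SET x / F) => //; apply/(disc_tri _ un pp).
    have mi : 0 <= lam [set u]%SET x / F <= 1 by lra.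
    rewrite !(crd_ray l mi) !inE (negbTE vu) (negbTE au) (negbTE bu).
    have -> : lam [set u]%SET x / F / lam [set u]%SET x = F^-1.
      by field; rewrite !gt_eqF//; case/andP: l.
    by rewrite ![_ * F^-1 / _]mulrAC -!mulrDl -/F divff// gt_eqF.
- split.
  (* The weights of the four corners are themselves barycentric coordinates: the disc is the image
     under an affine map of a closed subset of the simplex, hence compact. *)
  + pose W := (fun w : tet => Num.min (crd w u) (crd w b) - Num.min (crd w v) (crd w a)) @^-1` [set r | r = 0].
    pose f (i : 'I_4) (w : tet) := if i == u then crd w u * (1 - p u a) + crd w v * (1 - p u b)
       else if i == v then crd w a * (1 - p v a) + crd w b * (1 - p v b)
       else if i == a then crd w u * p u a + crd w a * p v a
       else crd w v * p u b + crd w b * p v b.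
    pose T (w : tet) := mkt (f^~ w).
    have E := (eqxx, negbTE vu, negbTE au, negbTE bu, negbTE av, negbTE bv, negbTE ba).
    have f0 i w : 0 <= f i w.
      have q0 j k : 0 <= p j k by have [/ltW] := P j k.
      have q1 j k : 0 <= 1 - p j k by have [_ /ltW] := P j k; rewrite subr_ge0.
      by rewrite /f; do 3?[case: (_ == _)]; apply: addr_ge0; (apply: mulr_ge0; first exact: crd_ge0).
    have f1 w : \sum_i f i w = 1.
      rewrite (sum4P _ _ un) !big_cons big_nil /f !E /=.
      by have := crd_sum4 w un; clear; lra.
    have cT w i : crd (T w) i = f i w by apply: crd_mkt.
    have cont : continuous T.
      apply: (@tet_continuous R tet) => i.
      have -> : (fun z : tet => crd (T z) i) = f i by apply/funext => z.
      move=> w; have c j (r : R) : continuous_at w (fun x : tet => crd x j * r).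
        by apply: (@contM R tet); [exact: crd_continuous|exact: (@contc R tet)].
      by rewrite /f; case: (i == u); last case: (i == v); last case: (i == a); apply: (@contD R tet); exact: c.
    have -> : disc [set u; v]%SET p = T @` W.
      apply/seteqP; split.
        move=> x /(disc_quad _ _ un)[w1 [w2 [w3 [w4 [[a1 a2 a3 a4] m [eu ev] ea eb]]]]].
        pose g i := if i == u then w1 else if i == v then w2 else if i == a then w3 else w4.
        have g0 i : 0 <= g i by rewrite /g; do 3?[case: (_ == _)]; assumption.
        have g1 : \sum_i g i = 1.
          rewrite (sum4P _ _ un) !big_cons big_nil /g !E /= addr0.
          by have := crd_sum4 x un; rewrite eu ev ea eb; clear; lra.
        have cg := crd_mkt g0 g1.
        exists (mkt g); first by rewrite /W /= !cg /g !E m subrr.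
        apply: (crd_inj4 un); rewrite cT /f !E !cg /g !E ?ev ?ea ?eb//.
      move=> _ [w Ww <-]; apply/(disc_quad _ _ un); exists (crd w u), (crd w v), (crd w a), (crd w b).
      split; rewrite ?cT /f ?E//; first by split; exact: crd_ge0.
      by apply/eqP; rewrite -subr_eq0; apply/eqP.
    apply: compact_closed; first exact: tet_hausdorff.
    apply: continuous_compact; first exact: continuous_subspaceT.
    apply: subclosed_compact (@tet_compact R) _ => //.
    apply: preimage_closed; last exact: closed_eq.
    move=> w _; apply: (@contB R tet); apply: (@contmin R tet); exact: crd_continuous.
  + have [m [M [m0 M1 [h1 h2 h3 h4]]]] := mM _ _ _ _ (pp u a) (pp u b) (pp v a) (pp v b).
    exists m, M; split => // x /(disc_quad _ _ un)[w1 [w2 [w3 [w4 [[a1 a2 a3 a4] _ [eu ev] ea eb]]]]].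
    rewrite (lam_quad _ un) ea eb.
    have s : w1 + w2 + w3 + w4 = 1 by have := crd_sum4 x un; rewrite eu ev ea eb; clear; lra.
    have k (w q : R) : 0 <= w -> m <= q <= M -> m * w <= w * q <= M * w.
      by move=> w0 /andP[q0 q1]; rewrite [m * _]mulrC [M * _]mulrC !ler_wpM2l.
    have := k _ _ a1 h1; have := k _ _ a2 h2; have := k _ _ a3 h3; have := k _ _ a4 h4.
    have : m * w1 + m * w2 + m * w3 + m * w4 = m by rewrite -!mulrDr s mulr1.
    have : M * w1 + M * w2 + M * w3 + M * w4 = M by rewrite -!mulrDr s mulr1.
    by clear; lra.
  + move=> x l; have := l; rewrite (lam_quad _ un) => l'.
    have sx := crd_sum4 x un.
    have [||w1 [w2 [w3 [w4 [k [m [[a1 a2 a3 a4] mw k0 m0 [e1 e2 e3 e4]]]]]]]] :=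
      @quad_solve R (p u a) (p u b) (p v a) (p v b) (crd x u) (crd x v) (crd x a) (crd x b)
      (pp _ _) (pp _ _) (pp _ _) (pp _ _) (crd_ge0 _ _) (crd_ge0 _ _) (crd_ge0 _ _) (crd_ge0 _ _); try by move: sx l'; clear; lra.
    pose L := lam [set u; v]%SET x.
    have LE : L = crd x a + crd x b by rewrite /L (lam_quad _ un).
    have LE' : 1 - L = crd x u + crd x v by rewrite LE; move: sx; clear; lra.
    have L0 : 0 < L by case/andP: l. have L1 : 0 < 1 - L by rewrite subr_gt0; case/andP: l.
    (* The weights found by [quad_solve] have total [T]; divided by it they describe the point of
       the ray at height [m * L / T]. *)
    pose T := k * (1 - L) + m * L.
    have T0 : 0 < T by rewrite addr_gt0// mulr_gt0.
    have m01 : 0 < m * L / T < 1.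
      rewrite divr_gt0 ?mulr_gt0// ltr_pdivrMr// mul1r /T ltrDr mulr_gt0//.
    exists (m * L / T) => //; apply/(disc_quad _ _ un).
    exists (w1 / T), (w2 / T), (w3 / T), (w4 / T).
    have mi : 0 <= m * L / T <= 1 by case/andP: m01 => *; rewrite !ltW.
    have f1 : (1 - m * L / T) / (1 - L) = k / T.
      rewrite (_ : 1 - m * L / T = k * (1 - L) / T); first by field; rewrite !gt_eqF.
      by apply: (mulIf (lt0r_neq0 T0)); rewrite mulrBl !divfK ?gt_eqF// mul1r /T; ring.
    have f2 : m * L / T / L = m / T by field; rewrite !gt_eqF.
    rewrite !crd_ray// !inE !eqxx orbT ?(negbTE vu) ?(negbTE au) ?(negbTE bu) ?(negbTE av) ?(negbTE bv) /= -/L f1 f2.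
    have minT (w z : R) : Num.min (w / T) (z / T) = Num.min w z / T.
      by rewrite minr_pMl// ?invr_ge0 ltW.
    split.
    * by split; rewrite divr_ge0// ltW.
    * by rewrite !minT mw.
    * by split; rewrite mulrA [crd x _ * k]mulrC -?e1 -?e2; ring.
    * by rewrite mulrA [crd x _ * m]mulrC -e3; ring.
    * by rewrite mulrA [crd x _ * m]mulrC -e4; ring.
Qed.

Section levels.
Variables (A : {set 'I_4}) (p p' : 'I_4 -> 'I_4 -> R).
Hypotheses (tA : dtype A) (pp : unit_pos p) (pp' : unit_pos p').
Variable x : tet.
Hypothesis l : 0 < lam A x < 1.

Lemma level_disc_le : (forall i j, i \in A -> j \notin A -> p i j <= p' i j) ->
  level A (disc A p) x <= level A (disc A p') x.
Proof.
move=> le; rewrite leNgt; apply/negP => lt.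
have [m01 dm] := levelP (surface_disc tA pp) l.
have [m01' dm'] := levelP (surface_disc tA pp') l.
move: m01 dm m01' dm' lt; set m := level _ _ _; set m' := level _ _ _ => m01 dm m01' dm' lt.
have mi : 0 <= m <= 1 by case/andP: m01 => *; rewrite !ltW.
have mi' : 0 <= m' <= 1 by case/andP: m01' => *; rewrite !ltW.
have lx0 : 0 < lam A x by case/andP: l. have lx1 : 0 < 1 - lam A x by rewrite subr_gt0; case/andP: l.
have [|j jA|e _] := disc_rigid tA pp pp' le dm' dm.
- move=> i iA; rewrite !crd_ray// iA ler_wpM2l ?crd_ge0// ler_wpM2r ?invr_ge0 ?(ltW lx1)//.
  by rewrite lerD2l lerN2 ltW.
- by rewrite !crd_ray// (negbTE jA) ler_wpM2l ?crd_ge0// ler_wpM2r ?invr_ge0 ?(ltW lx0)// ltW.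
- by have := lt; rewrite -(lam_ray l mi) -(lam_ray l mi') e ltxx.
Qed.

Lemma level_disc_lt : (forall i j, i \in A -> j \notin A -> p i j < p' i j) ->
  level A (disc A p) x < level A (disc A p') x.
Proof.
move=> lt; rewrite lt_def level_disc_le ?andbT; last by move=> i j iA jA; apply: ltW; exact: lt.
apply/eqP => e.
have [m01 dm] := levelP (surface_disc tA pp) l.
have [m01' dm'] := levelP (surface_disc tA pp') l.
rewrite e in dm'.
by have [||] := disc_rigid tA pp pp' (fun i j iA jA => ltW (lt i j iA jA)) dm' dm.
Qed.

End levels.
End DiscSurfaces.

Lemma complete2 (u v : 'I_4) : u != v -> exists a b, uniq [:: u; v; a; b].
Proof.
move=> uv; have : size (enum (~: [set u; v])%SET) == 2%N.
  rewrite -cardE; have := cardsC [set u; v]%SET.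
  by rewrite cards2 uv card_ord => /eqP; rewrite eqn_add2l.
case E : (enum _) => [|a [|b []]]// _; exists a, b.
have := enum_uniq (~: [set u; v])%SET; have m i := mem_enum (~: [set u; v])%SET i.
rewrite E => un; rewrite cons_uniq cons_uniq un andbT in_cons negb_or uv -E !m !inE !eqxx orbT.
by [].
Qed.

(** * Traces of discs on the faces *)

Section FaceTraces.
Variable R : realType.
Notation tet := (tetrahedron R).
Implicit Types (A B : {set 'I_4}) (x y : tet) (p q r : 'I_4 -> 'I_4 -> R).

Definition sep A (i j : 'I_4) : bool := (i \in A) != (j \in A).

Lemma sepC A i j : sep A i j = sep A j i.
Proof. by rewrite /sep eq_sym. Qed.

Lemma sep_setC A i j : sep (~: A)%SET i j = sep A i j.
Proof. by rewrite /sep !inE; case: (i \in A); case: (j \in A). Qed.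

Lemma sep_in A i j : i \in A -> j \notin A -> sep A i j.
Proof. by rewrite /sep => -> /negbTE ->. Qed.

Lemma disc_ext A p p' : (forall i j, i \in A -> j \notin A -> p i j = p' i j) ->
  disc A p = disc A p'.
Proof.
suff H (q q' : 'I_4 -> 'I_4 -> R) : (forall i j, i \in A -> j \notin A -> q i j = q' i j) -> disc A q `<=` disc A q'.
  by move=> e; apply/seteqP; split; apply: H => // i j iA jA; rewrite e.
move=> e x [w [w0 hA hB hm]]; exists w; split=> //.
- by move=> i iA; rewrite hA//; apply: eq_bigr => j jA; rewrite e.
- by move=> j jA; rewrite hB//; apply: eq_bigr => i iA; rewrite e.
Qed.

Lemma ray_crd0 A x m i : 0 < lam A x < 1 -> 0 <= m <= 1 -> crd x i = 0 -> crd (ray A x m) i = 0.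
Proof. by move=> l m01 xi; rewrite crd_ray// xi !mul0r if_same. Qed.

Section face.
Variables (k l m f : 'I_4).
Hypothesis un : uniq [:: k; l; m; f].

(* The two oriented types leaving an arc around k in the face opposite to f. *)
Definition around A := A = [set k]%SET \/ A = [set k; f]%SET.

(** On the face only the splitting of [k] from [l] and [m] is visible; what remains open is the side
    on which [f] lies and which side is called [A]. *)
Lemma around_orient A : dtype A -> sep A k l -> sep A k m -> around A \/ around (~: A)%SET.
Proof.
move=> tA skl skm; have [[lk mk fk] [ml fl fm]] := uniq4 un.
have four i : i \in [:: k; l; m; f] by exact: all4P.
have setE B (P : pred 'I_4) : (k \in B) = P k -> (l \in B) = P l -> (m \in B) = P m ->
    (f \in B) = P f -> forall i, (i \in B) = P i.
  by move=> e1 e2 e3 e4 i; have := four i; rewrite !inE => /or4P[] /eqP ->.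
move: skl skm; rewrite /sep; case kA : (k \in A) => /=; rewrite ?eqb_id ?eqbF_neg ?negbK => lA mA.
  left; case fA : (f \in A); [right|left]; apply/finset.setP => i.
    rewrite !inE; apply: (setE A (fun i => (i == k) || (i == f))); rewrite ?kA ?fA ?eqxx ?orbT//.
      by rewrite (negbTE lk) eq_sym (negbTE fl); exact: negbTE.
    by rewrite (negbTE mk) eq_sym (negbTE fm); exact: negbTE.
  rewrite !inE; apply: (setE A (pred1 k)) => /=; rewrite ?kA ?fA ?eqxx//.
  - by rewrite (negbTE lk); exact: negbTE.
  - by rewrite (negbTE mk); exact: negbTE.
  - by rewrite (negbTE fk).
have fA : f \notin A.
  apply/negP => fA; have : (3 <= #|A|)%N.
    rewrite cardE -[3%N]/(size [:: l; m; f]); apply: uniq_leq_size => [|i].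
      by move: un => /= /andP[].
    by rewrite mem_enum !inE => /or3P[] /eqP ->.
  by move: tA => /orP[] /eqP ->.
right; right; apply/finset.setP => i.
apply: (setE (~: A)%SET (fun i => i \in [set k; f]%SET)); rewrite !inE ?kA ?eqxx ?orbT//.
- by rewrite lA (negbTE lk) eq_sym (negbTE fl).
- by rewrite mA (negbTE mk) eq_sym (negbTE fm).
Qed.

Lemma around_in A : around A -> [/\ k \in A, l \notin A & m \notin A].
Proof.
have [[lk mk fk] [ml fl fm]] := uniq4 un; rewrite ![f == _]eq_sym in fl fm.
by case=> ->; rewrite !inE eqxx ?(negbTE lk) ?(negbTE mk) ?(negbTE fl) ?(negbTE fm).
Qed.

Lemma around_dtype A : around A -> dtype A.
Proof.
have [[lk mk fk] _] := uniq4 un.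
have kf : k != f by rewrite eq_sym.
by case=> ->; rewrite /dtype ?cards1 ?cards2 ?kf.
Qed.

(** On the face, the corners of a quadrilateral that lie on edges ending at [f] carry no weight.
    What is left is the segment between its other two corners, exactly as for a triangle. *)
Lemma disc_around A p x : around A -> unit_pos p -> crd x f = 0 ->
  disc A p x <-> crd x l / p k l + crd x m / p k m = 1.
Proof.
move=> arA pp xf.
have P i j : 0 < p i j /\ p i j < 1 by apply/andP.
have n i j : p i j != 0 by rewrite gt_eqF//; case: (P i j).
case: arA => ->.
  rewrite (disc_tri x un pp) xf mul0r addr0//.
have un' : uniq [:: k; f; l; m].
  have [[lk mk fk] [ml fl fm]] := uniq4 un.
  by rewrite /= !inE !negb_or !(eq_sym k) fk lk mk fl fm eq_sym ml.
rewrite (disc_quad p x un'); split.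
  move=> [w1 [w2 [w3 [w4 [[a1 a2 a3 a4] _ [ek ef] el em]]]]].
  rewrite xf in ef.
  have [w30 w40] : w3 = 0 /\ w4 = 0.
    have q1 : 0 < 1 - p f l by rewrite subr_gt0; case: (P f l).
    have q2 : 0 < 1 - p f m by rewrite subr_gt0; case: (P f m).
    have b1 : 0 <= w3 * (1 - p f l) by rewrite mulr_ge0// ltW.
    have b2 : 0 <= w4 * (1 - p f m) by rewrite mulr_ge0// ltW.
    have c1 : w3 * (1 - p f l) = 0 by lra.
    have c2 : w4 * (1 - p f m) = 0 by lra.
    by move/eqP: c1; move/eqP: c2; rewrite !mulf_eq0 (gt_eqF q1) (gt_eqF q2) !orbF => /eqP -> /eqP ->.
  rewrite w30 mul0r addr0 in el; rewrite w40 mul0r addr0 in em.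
  have := crd_sum4 x un; rewrite xf el em ek !mulfK//; lra.
move=> e; exists (crd x l / p k l), (crd x m / p k m), 0, 0.
have := crd_sum4 x un; rewrite xf => s.
split.
- by split; rewrite // divr_ge0 ?crd_ge0//; rewrite ltW//; case: (P k l); case: (P k m).
- rewrite !min_r// divr_ge0 ?crd_ge0// ltW//; [by case: (P k m)|by case: (P k l)].
- by rewrite !mul0r addr0; split=> //; rewrite !mulrBr !divfK// !mulr1; lra.
- by rewrite divfK// mul0r addr0.
- by rewrite divfK// mul0r addr0.
Qed.

(** The height as well does not depend on the side of [f]. Together with [disc_around] this lets a
    triangle and a quadrilateral glued along an arc move alike. *)
Lemma lam_around A x : around A -> crd x f = 0 -> lam A x = crd x l + crd x m.
Proof.
move=> arA xf; have un' : uniq [:: k; f; l; m].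
  have [[lk mk fk] [ml fl fm]] := uniq4 un.
  by rewrite /= !inE !negb_or !(eq_sym k) fk lk mk fl fm eq_sym ml.
case: arA => ->; last by rewrite (lam_quad x un').
by rewrite (lam_tri x un) xf addr0.
Qed.

Lemma disc_face A p x : dtype A -> unit_pos p -> antisym p -> sep A k l -> sep A k m ->
  crd x f = 0 -> disc A p x <-> crd x l / p k l + crd x m / p k m = 1.
Proof.
move=> tA pp ap s1 s2 xf; have [arA|arA] := around_orient tA s1 s2.
  exact: disc_around.
by rewrite -(disc_setC A ap); exact: disc_around.
Qed.

End face.

(** Pushes the corners by [e] away from [A], adjusting both records of each corner so that
    antisymmetry is kept. *)
Definition pshift A (e : R) p (i j : 'I_4) : R :=
  if (i \in A) && (j \notin A) then p i j + e
  else if (i \notin A) && (j \in A) then p i j - e else p i j.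

Lemma shift_setC A e p : pshift (~: A)%SET e p = pshift A (- e) p.
Proof.
apply/funext => i; apply/funext => j; rewrite /pshift !inE.
by case: (i \in A); case: (j \in A); rewrite /= ?opprK.
Qed.

Lemma shift_antisym A e p : antisym p -> antisym (pshift A e p).
Proof.
move=> ap i j; rewrite /pshift (ap i j).
by case: (i \in A); case: (j \in A) => /=; rewrite ?opprD ?opprK ?addrA.
Qed.

Lemma shift_in A e p i j : i \in A -> j \notin A -> pshift A e p i j = p i j + e.
Proof. by rewrite /pshift => -> ->. Qed.

Lemma shift_unit_pos A e p : unit_pos p ->
  (forall i j, i \in A -> j \notin A -> 0 < p i j + e < 1) -> antisym p ->
  unit_pos (pshift A e p).
Proof.
move=> pp h ap i j; rewrite /pshift; case iA: (i \in A); case jA: (j \in A) => //=.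
  by apply: h => //; rewrite jA.
by have := h j i; rewrite iA jA => /(_ isT isT); rewrite (ap i j); lra.
Qed.

(** Supported in the collar between the translates of the disc by [- e] and [e]. *)
Definition tdisc A e p p' x : tet :=
  tent_slide A (disc A (pshift A (- e) p)) (disc A p) (disc A p') (disc A (pshift A e p)) x.

Lemma tdisc_setC A e p p' x : antisym p -> antisym p' ->
  surface A (disc A (pshift A (- e) p)) -> surface A (disc A p) -> surface A (disc A p') ->
  surface A (disc A (pshift A e p)) ->
  tdisc (~: A)%SET e p p' x = tdisc A e p p' x.
Proof.
move=> ap ap' s1 s2 s3 s4.
rewrite /tdisc !shift_setC opprK !(disc_setC A)//; try exact: shift_antisym.
exact: tent_slide_setC.
Qed.

(** Since the coordinate at [f] vanishes, only the positions of [k], [l] and [m] with respect to the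
    type matter, so [A] and [A'] may be of different shapes. *)
Lemma ray_act k l m f A A' (s : {perm 'I_4}) x (r : R) : uniq [:: k; l; m; f] ->
  around k f A -> around (s k) (s f) A' -> crd x f = 0 -> 0 < lam A x < 1 -> 0 <= r <= 1 ->
  lam A' (act s x) = lam A x /\ ray A' (act s x) r = act s (ray A x r).
Proof.
move=> un arA arA' xf lx r01.
have un' : uniq [:: s k; s l; s m; s f] by rewrite -[[:: _; _; _; _]]/(map s [:: k; l; m; f]) map_inj_uniq//; exact: perm_inj.
have xf' : crd (act s x) (s f) = 0 by rewrite crd_act.
have lE : lam A' (act s x) = lam A x by rewrite (lam_around un arA xf) (lam_around un' arA' xf') !crd_act.
split=> //; apply: crd_inj => i; rewrite -[i](permKV s); move: (_ i) => {}i.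
rewrite crd_act !crd_ray ?lE// crd_act.
have [k1 k2 k3] := around_in un arA; have [k1' k2' k3'] := around_in un' arA'.
have := all4P i un; rewrite !inE => /or4P[] /eqP ->.
- by rewrite k1 k1'.
- by rewrite (negbTE k2) (negbTE k2').
- by rewrite (negbTE k3) (negbTE k3').
- by rewrite xf !mul0r !if_same.
Qed.

Lemma level_act k l m f A A' (s : {perm 'I_4}) x p p' : uniq [:: k; l; m; f] ->
  around k f A -> around (s k) (s f) A' -> crd x f = 0 -> 0 < lam A x < 1 ->
  unit_pos p -> unit_pos p' -> p k l = p' (s k) (s l) -> p k m = p' (s k) (s m) ->
  level A' (disc A' p') (act s x) = level A (disc A p) x.
Proof.
move=> un arA arA' xf lx pp pp' e1 e2.
have un' : uniq [:: s k; s l; s m; s f] by rewrite -[[:: _; _; _; _]]/(map s [:: k; l; m; f]) map_inj_uniq//; exact: perm_inj.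
have xf' : crd (act s x) (s f) = 0 by rewrite crd_act.
have tA := around_dtype un arA; have tA' := around_dtype un' arA'.
have [m01 dm] := levelP (surface_disc tA pp) lx.
have mi : 0 <= level A (disc A p) x <= 1 by case/andP: m01 => *; rewrite !ltW.
have [le re] := ray_act un arA arA' xf lx mi.
apply: level_uniq => //; [exact: surface_disc|by rewrite le|rewrite re].
apply/(disc_around un' arA' pp'); first by rewrite crd_act; exact: ray_crd0.
by rewrite !crd_act -e1 -e2; apply/(disc_around un arA pp) => //; exact: ray_crd0.
Qed.

(** All ingredients of the tent slide at a point of the face, namely its ray, its height and the
    four levels, are determined by the ends of the arc. *)
Lemma tdisc_around k l m f A A' (s : {perm 'I_4}) x e p q p' q' : uniq [:: k; l; m; f] ->
  around k f A -> around (s k) (s f) A' -> crd x f = 0 ->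
  unit_pos p -> unit_pos q -> unit_pos p' -> unit_pos q' ->
  unit_pos (pshift A e p) -> unit_pos (pshift A (- e) p) ->
  unit_pos (pshift A' e p') -> unit_pos (pshift A' (- e) p') ->
  p k l = p' (s k) (s l) -> p k m = p' (s k) (s m) ->
  q k l = q' (s k) (s l) -> q k m = q' (s k) (s m) ->
  (forall y, 0 < lam A y < 1 -> 0 <= tentmap (level A (disc A (pshift A (- e) p)) y) (level A (disc A p) y)
     (level A (disc A q) y) (level A (disc A (pshift A e p)) y) (lam A y) <= 1) ->
  tdisc A' e p' q' (act s x) = act s (tdisc A e p q x).
Proof.
move=> un arA arA' xf pp qq pp' qq' sp sm sp' sm' e1 e2 e3 e4 t01.
have un' : uniq [:: s k; s l; s m; s f] by rewrite -[[:: _; _; _; _]]/(map s [:: k; l; m; f]) map_inj_uniq//; exact: perm_inj.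
have xf' : crd (act s x) (s f) = 0 by rewrite crd_act.
have lE : lam A' (act s x) = lam A x by rewrite (lam_around un arA xf) (lam_around un' arA' xf') !crd_act.
rewrite /tdisc /tent_slide lE; case: ifP => // lx.
have [k1 k2 k3] := around_in un arA; have [k1' k2' k3'] := around_in un' arA'.
rewrite (@level_act k l m f A A' s x (pshift A (- e) p) (pshift A' (- e) p')) ?shift_in ?e1 ?e2//.
rewrite (@level_act k l m f A A' s x (pshift A e p) (pshift A' e p')) ?shift_in ?e1 ?e2//.
rewrite (@level_act k l m f A A' s x p p')// (@level_act k l m f A A' s x q q')//.
by have [_ ->] := ray_act un arA arA' xf lx (t01 _ lx).
Qed.

(* At most 1 exactly on the part of the simplex that the triangle cuts off at u. *)
Definition tri_form (u : 'I_4) p x : R := \sum_(j | j != u) crd x j / p u j.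

Lemma tri_form4 u v a b p x : uniq [:: u; v; a; b] ->
  tri_form u p x = crd x v / p u v + crd x a / p u a + crd x b / p u b.
Proof.
move=> un; have [[vu au bu] _] := uniq4 un.
by rewrite /tri_form (sum4P _ _ un) !big_cons big_nil eqxx vu au bu /= addr0 addrA.
Qed.

Lemma disc_tri_form u p x : unit_pos p -> disc [set u]%SET p x <-> tri_form u p x = 1.
Proof.
move=> pp; have [v uv] : exists v, u != v.
  have [->|u0] := eqVneq u ord0; last by exists ord0.
  by exists ord_max; apply/eqP => /(congr1 val).
have [a [b un]] := complete2 uv.
by rewrite (disc_tri x un pp) (tri_form4 _ _ un).
Qed.

(** An affine function of the height, so bounds at two heights carry over to those in between. *)
Lemma tri_form_ray u A p x m : 0 < lam A x < 1 -> 0 <= m <= 1 ->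
  tri_form u p (ray A x m) = (1 - m) / (1 - lam A x) * \sum_(j | (j != u) && (j \in A)) crd x j / p u j
    + m / lam A x * \sum_(j | (j != u) && (j \notin A)) crd x j / p u j.
Proof.
move=> l m01; rewrite /tri_form (bigID (mem A))/= !mulr_sumr.
by congr (_ + _); apply: eq_bigr => j /andP[_ jA]; rewrite crd_ray// ?jA ?(negbTE jA); ring.
Qed.

(** The form is linear and exceeds 1 at every corner of the disc: on edges at [u] by the hypothesis
    on positions, on the other edges because it exceeds 1 at both ends. Points of a disc are convex
    combinations of its corners. *)
Lemma tri_outside u A p r x : dtype A -> A != [set u]%SET -> A != (~: [set u])%SET ->
  unit_pos p -> unit_pos r -> antisym r -> (forall j, sep A u j -> p u j < r u j) ->
  disc A r x -> 1 < tri_form u p x.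
Proof.
move=> tA nA nA' pp rr ar lt dx.
have inv i j : 1 < (p i j)^-1 by rewrite invf_gt1//; case/andP: (pp i j).
have ri i j : 0 < r i j /\ r i j < 1 by apply/andP.
have P i j : 0 < p i j by case/andP: (pp i j).
have lti j : p u j < r u j -> 1 < r u j * (p u j)^-1 by move=> h; rewrite ltr_pdivlMr// mul1r.
(* A quadrilateral type can be replaced by its complement so as to contain [u]; a triangle is cut
   off at another vertex. *)
wlog uA : A tA nA nA' lt dx / (u \in A) \/ (#|A| = 1%N).
  move=> H; case uA : (u \in A); first by apply: (H A) => //; left.
  move: (tA) => /orP[/eqP c1|/eqP c2]; first by apply: (H A) => //; right.
  have := cardsC A; rewrite c2 card_ord => /eqP; rewrite -[4%N]/(2 + 2)%N eqn_add2l => /eqP c2'.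
  apply: (H (~: A)%SET).
  - by rewrite /dtype c2' orbT.
  - by rewrite -(inj_eq (can_inj (@finset.setCK _))) finset.setCK.
  - by rewrite (inj_eq (can_inj (@finset.setCK _))).
  - by move=> j; rewrite sep_setC; exact: lt.
  - by rewrite disc_setC.
  - by left; rewrite inE uA.
have mixed (s q Q1 Q2 : R) : 0 <= s -> 0 < q /\ q < 1 -> 1 < Q1 -> 1 < Q2 -> s <= s * ((1 - q) * Q1 + q * Q2) /\ (0 < s -> s < s * ((1 - q) * Q1 + q * Q2)).
  move=> s0 [q0 q1] h1 h2; have : 1 < (1 - q) * Q1 + q * Q2 by nra.
  by move=> h; split=> [|s1]; nra.
have lone (s c : R) : 0 <= s -> 1 < c -> s <= s * c /\ (0 < s -> s < s * c).
  by move=> s0 c1; split=> [|s1]; nra.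
have [c1|c1] := eqVneq (#|A|) 1%N.
- move/eqP/cards1P: c1 => [v e]; subst A.
  have vu : v != u by apply: contraNneq nA => ->.
  have [a' [b' un]] := complete2 vu.
  have un' : uniq [:: u; v; a'; b'].
    move: un; rewrite /= !inE !negb_or => /and4P[/and3P[h1 h2 h3] /andP[h4 h5] h6 _].
    by rewrite eq_sym h1 h2 h3 h4 h5 h6.
  move: dx => /(disc_tri _ un rr) dx; rewrite (tri_form4 _ _ un').
  have n j : r v j != 0 by rewrite gt_eqF//; case: (ri v j).
  set su := crd x u / r v u in dx; set sa := crd x a' / r v a' in dx; set sb := crd x b' / r v b' in dx.
  have xu : crd x u = su * r v u by rewrite divfK.
  have xa : crd x a' = sa * r v a' by rewrite divfK.
  have xb : crd x b' = sb * r v b' by rewrite divfK.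
  have xv : crd x v = su * (1 - r v u) + sa * (1 - r v a') + sb * (1 - r v b').
    by have := crd_sum4 x un; rewrite xu xa xb; lra.
  have p0 j : 0 <= crd x j / r v j by rewrite divr_ge0 ?crd_ge0// ltW//; case: (ri v j).
  have ruv : p u v < r u v by apply: lt; rewrite /sep !inE eqxx [u == v]eq_sym (negbTE vu).
  have Lu := lti _ ruv; rewrite (ar v u) in Lu.
  have [u1 u2] := lone _ _ (p0 u) Lu.
  have [s1 s2] := mixed _ _ _ _ (p0 a') (ri v a') (inv u v) (inv u a').
  have [t1 t2] := mixed _ _ _ _ (p0 b') (ri v b') (inv u v) (inv u b').
  have -> : crd x v / p u v + crd x a' / p u a' + crd x b' / p u b' =
     su * ((1 - r v u) * (p u v)^-1) + sa * ((1 - r v a') * (p u v)^-1 + r v a' * (p u a')^-1)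
      + sb * ((1 - r v b') * (p u v)^-1 + r v b' * (p u b')^-1) by rewrite xv xa xb; ring.
  rewrite -/su in u1 u2; rewrite -/sa in s1 s2; rewrite -/sb in t1 t2.
  case: (ltrP 0 su) => [/u2|h1]; first by move: dx s1 t1; clear; lra.
  case: (ltrP 0 sa) => [/s2|h2]; first by move: dx u1 t1; clear; lra.
  case: (ltrP 0 sb) => [/t2|h3]; first by move: dx u1 s1; clear; lra.
  by move: dx h1 h2 h3; clear; lra.
- case: uA => [uA|/eqP]; last by rewrite (negbTE c1).
  have c2 : #|A| == 2%N by move: tA; rewrite /dtype (negbTE c1).
  have [v [vu e]] : exists v, v != u /\ A = [set u; v]%SET.
    move/cards2P: c2 => [a [b [ab e]]]; subst A; move: uA; rewrite !inE => /orP[] /eqP ->.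
      by exists b; rewrite eq_sym.
    by exists a; rewrite finset.setUC.
  subst A.
  rewrite eq_sym in vu; have [a' [b' un]] := complete2 vu.
  have [[_ au bu] [av bv ba]] := uniq4 un.
  move: dx => /(disc_quad _ _ un)[w1 [w2 [w3 [w4 [[a1 a2 a3 a4] _ [xu xv] xa xb]]]]].
  rewrite (tri_form4 _ _ un).
  have L1 : 1 < r u a' * (p u a')^-1 by apply/lti/lt; rewrite /sep !inE eqxx (negbTE au) (negbTE av).
  have L2 : 1 < r u b' * (p u b')^-1 by apply/lti/lt; rewrite /sep !inE eqxx (negbTE bu) (negbTE bv).
  have [u1 u2] := lone _ _ a1 L1; have [v1 v2] := lone _ _ a2 L2.
  have [s1 s2] := mixed _ _ _ _ a3 (ri v a') (inv u v) (inv u a').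
  have [t1 t2] := mixed _ _ _ _ a4 (ri v b') (inv u v) (inv u b').
  have s : w1 + w2 + w3 + w4 = 1 by have := crd_sum4 x un; rewrite xu xv xa xb; clear; lra.
  have -> : crd x v / p u v + crd x a' / p u a' + crd x b' / p u b' =
     w1 * (r u a' * (p u a')^-1) + w2 * (r u b' * (p u b')^-1)
     + w3 * ((1 - r v a') * (p u v)^-1 + r v a' * (p u a')^-1)
     + w4 * ((1 - r v b') * (p u v)^-1 + r v b' * (p u b')^-1) by rewrite xv xa xb; ring.
  case: (ltrP 0 w1) => [/u2|h1]; first by move: s v1 s1 t1; clear; lra.
  case: (ltrP 0 w2) => [/v2|h2]; first by move: s u1 s1 t1; clear; lra.
  case: (ltrP 0 w3) => [/s2|h3]; first by move: s u1 v1 t1; clear; lra.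
  case: (ltrP 0 w4) => [/t2|h4]; first by move: s u1 v1 s1; clear; lra.
  by move: s h1 h2 h3 h4; clear; lra.
Qed.

End FaceTraces.

(** * Stacks of disjoint discs *)

Section Bands.
Variable R : realType.
Notation tet := (tetrahedron R).
Notation pos := ('I_4 -> 'I_4 -> R).
Implicit Types (A : {set 'I_4}) (x y : tet) (p q r : pos).

(** Selects the orientation of a quadrilateral type that contains [ord0]; the seven remaining sets
    are the seven types of normal discs. *)
Definition ntype A := dtype A && ((#|A| == 2%N) ==> (ord0 \in A)).

Lemma ntype_dtype A : ntype A -> dtype A. Proof. by case/andP. Qed.

Lemma ntype_cases A : ntype A -> (exists u, A = [set u]%SET) \/
  exists2 v, v != ord0 & A = [set ord0; v]%SET.
Proof.
move=> /andP[/orP[/cards1P[u ->]|c2]]; first by left; exists u.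
rewrite c2 /= => A0; right; move/cards2P: c2 => [a [b [ab e]]]; move: A0; rewrite e !inE.
by move=> /orP[] /eqP a0; [exists b|exists a; rewrite ?a0 1?finset.setUC//]; rewrite a0// eq_sym.
Qed.

Definition band A e p x := [/\ 0 < lam A x < 1,
  level A (disc A (pshift A (- e) p)) x <= lam A x
  & lam A x <= level A (disc A (pshift A e p)) x].

Lemma disc_shift0 A p : disc A (pshift A 0 p) = disc A p.
Proof. by apply: disc_ext => i j iA jA; rewrite shift_in// addr0. Qed.

Lemma disc_band A p x : dtype A -> unit_pos p -> disc A p x -> band A 0 p x.
Proof.
move=> tA pp dx; have sA := surface_disc tA pp.
by rewrite /band oppr0 disc_shift0 (level_lam sA dx); split=> //; exact: surface_lam sA _ dx.
Qed.

Lemma band_parallel A p q e f x : dtype A -> unit_pos (pshift A e p) -> unit_pos (pshift A (- f) q) ->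
  (forall i j, i \in A -> j \notin A -> p i j + e < q i j - f) ->
  band A e p x -> band A f q x -> False.
Proof.
move=> tA pp qq lt [l _ h1] [_ h2 _].
have : level A (disc A (pshift A e p)) x < level A (disc A (pshift A (- f) q)) x.
  by apply: level_disc_lt => // i j iA jA; rewrite !shift_in//; exact: lt.
by move=> h; have := le_lt_trans h1 (lt_le_trans h h2); rewrite ltxx.
Qed.

Lemma affine_between (a b m1 m2 l : R) : m1 <= l -> l <= m2 ->
  1 < (1 - m1) * a + m1 * b -> 1 < (1 - m2) * a + m2 * b -> 1 < (1 - l) * a + l * b.
Proof.
move=> h1 h2 c1 c2; have [ab|ab] := leP a b.
  have : 0 <= (l - m1) * (b - a) by rewrite mulr_ge0// subr_ge0.
  by lra.
have : 0 <= (m2 - l) * (a - b) by rewrite mulr_ge0// subr_ge0// ltW.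
by lra.
Qed.

(** In the collar of the triangle the form of its outer boundary is at most 1. On the two boundary
    surfaces of the other collar it exceeds 1, and being affine along the rays of type [A] it
    exceeds 1 between them. *)
Lemma band_tri u A p q e f x : dtype A -> A != [set u]%SET -> A != (~: [set u])%SET ->
  unit_pos (pshift [set u]%SET e p) -> unit_pos (pshift A (- f) q) -> unit_pos (pshift A f q) ->
  antisym q ->
  (forall j, sep A u j -> p u j + e < q u j - `|f|) ->
  band [set u]%SET e p x -> band A f q x -> False.
Proof.
move=> tA nA nA' pp qm qp aq lt [lu _ hu] [l h1 h2].
have tu : dtype [set u]%SET by rewrite /dtype cards1.
set P := pshift [set u]%SET e p in pp hu.
have [m01 dm] := levelP (surface_disc tu pp) lu.
have mi : 0 <= level [set u]%SET (disc [set u]%SET P) x <= 1 by case/andP: m01 => *; rewrite !ltW.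
have le1 : tri_form u P x <= 1.
  have /(disc_tri_form _ _ pp) := dm.
  rewrite tri_form_ray// big_pred0 => [|j]; last by rewrite inE andNb.
  rewrite mulr0 add0r (eq_bigl (fun j => j != u)) => [|j]; last by rewrite inE andbb.
  rewrite -/(tri_form u P x); set F := tri_form u P x; move: hu m01 lu.
  set m := level _ _ _; set L := lam _ _ => hu /andP[m0 m1] /andP[L0 L1] e1.
  have -> : F = L / m.
    by rewrite -invf_div -[RHS]mulr1 -e1 mulKf// mulf_neq0 ?invr_eq0 ?gt_eqF.
  by rewrite ler_pdivrMr// mul1r.
have Pu j : j != u -> P u j = p u j + e by move=> ju; rewrite /P shift_in ?inE.
have out g : `|g| = `|f| -> unit_pos (pshift A g q) -> forall y, disc A (pshift A g q) y -> 1 < tri_form u P y.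
  move=> gf qq y; apply: tri_outside => //; first exact: shift_antisym.
  move=> j sj; have ju : j != u by apply: contraTneq sj => ->; rewrite /sep eqxx.
  rewrite Pu//; apply: lt_le_trans (lt _ sj) _; rewrite -gf.
  have := ler_norm g; have := ler_norm (- g); rewrite normrN /pshift => n1 n2.
  by case: ifP => _; [lra|case: ifP => _; lra].
have [a01 da] := levelP (surface_disc tA qm) l; have [b01 db] := levelP (surface_disc tA qp) l.
have := out _ (normrN f) qm _ da; have := out _ erefl qp _ db.
rewrite !tri_form_ray; try by [|case/andP: a01 => *; rewrite !ltW|case/andP: b01 => *; rewrite !ltW].
set X := \sum_(j | _) _; set Y := \sum_(j | _) _ => o1 o2.
have : 1 < tri_form u P (ray A x (lam A x)).
  rewrite tri_form_ray ?lam_ge0 ?lam_le1// -/X -/Y.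
  rewrite !(mulrAC _ (_^-1)) -!mulrA; apply: affine_between h1 h2 _ _.
    by move: o2; rewrite !(mulrAC _ (_^-1)) -!mulrA.
  by move: o1; rewrite !(mulrAC _ (_^-1)) -!mulrA.
by rewrite ray_lam// => /lt_le_trans /(_ le1); rewrite ltxx.
Qed.

End Bands.

Section Stack.
Variable R : realType.
Notation tet := (tetrahedron R).
Notation pos := ('I_4 -> 'I_4 -> R).
Variable ty : set tet -> {set 'I_4}.
Implicit Types (x y : tet) (p q : set tet -> pos) (D E : set tet) (DD : set (set tet)).

(* The combinatorial content of the disjointness of the discs of type [ty D]
   with corners at [p D]. *)
Definition stack DD p : Prop :=
  [/\ forall D, DD D -> [/\ ntype (ty D), unit_pos (p D) & antisym (p D)],
      forall D E, DD D -> DD E -> D <> E -> ty D = ty E ->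
        (forall i j, i \in ty D -> j \notin ty D -> p D i j < p E i j) \/
        (forall i j, i \in ty D -> j \notin ty D -> p E i j < p D i j)
    & forall D E i j m, DD D -> DD E -> i != m -> j != m ->
        sep (ty D) i j -> sep (ty D) i m -> sep (ty E) j i -> sep (ty E) j m ->
        p D i j < p E i j].

Section one.
Variables (DD : set (set tet)) (p : set tet -> pos).
Hypothesis st : stack DD p.

Lemma stack_pos D : DD D -> unit_pos (p D). Proof. by case: st => h _ _ /h[]. Qed.
Lemma stack_ntype D : DD D -> ntype (ty D). Proof. by case: st => h _ _ /h[]. Qed.
Lemma stack_antisym D : DD D -> antisym (p D). Proof. by case: st => h _ _ /h[]. Qed.
Lemma stack_dtype D : DD D -> dtype (ty D). Proof. by move=> /stack_ntype/ntype_dtype. Qed.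

(** Two different quadrilateral types both cross the edge from [ord0] to some other vertex, and the
    two faces at this edge would impose opposite orders of their corners. *)
Lemma two_quads D E : DD D -> DD E -> #|ty D| = 2%N -> #|ty E| = 2%N -> ty D = ty E.
Proof.
move=> dD dE cD cE; have [h _ g2] := st.
have [nD _ _] := h _ dD; have [nE _ _] := h _ dE.
have [[u e]|[v v0 eD]] := ntype_cases nD; first by rewrite e cards1 in cD.
have [[u e]|[a a0 eE]] := ntype_cases nE; first by rewrite e cards1 in cE.
have [va|va] := eqVneq v a; first by rewrite eD eE va.
have [b0 [b [un]]] : exists b0 b, uniq [:: ord0; v; a; b] /\ b0 = b.
  have [c [d un]] : exists c d, uniq [:: v; a; c; d] by exact: complete2.
  have [[h1 h2 h3] [h4 h5 h6]] := uniq4 un.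
  have := all4P ord0 un; rewrite !inE ![ord0 == _]eq_sym (negbTE v0) (negbTE a0) /= => /orP[] /eqP e.
    by exists d, d; split=> //; rewrite -e /= !inE !negb_or h2 h4 ![_ == d]eq_sym h6 h3 h5 va.
  by exists c, c; split=> //; rewrite -e /= !inE !negb_or h3 h5 h6 ![_ == c]eq_sym h2 h4 va.
move=> e; subst b0; have [[h1 h2 h3] [h4 h5 h6]] := uniq4 un.
have [k1 k2 k3] : [/\ ord0 != v, ord0 != a & ord0 != b] by rewrite ![ord0 == _]eq_sym.
have l1 : p D ord0 b < p E ord0 b.
  by apply: (g2 D E ord0 b a) => //; rewrite /sep ?eD ?eE !inE ?eqxx ?(negbTE h1) ?(negbTE h2) ?(negbTE h3) ?(negbTE h4) ?(negbTE h5) ?(negbTE h6) ?[a == b]eq_sym ?(negbTE h6) ?orbT.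
have l2 : p E ord0 b < p D ord0 b.
  by apply: (g2 E D ord0 b v) => //; rewrite /sep ?eD ?eE !inE ?eqxx ?(negbTE h1) ?(negbTE h2) ?(negbTE h3) ?[v == a]eq_sym ?(negbTE h4) ?(negbTE h5) ?(negbTE h6) ?orbT.
by have := lt_trans l1 l2; rewrite ltxx.
Qed.

(** Some third vertex [m] is not separated from [u] by [E], for otherwise [E] would be a triangle at
    [u]. In the face with vertices [u], [j], [m] the arc of [D] surrounds [u] and that of [E]
    surrounds [j]. *)
Lemma tri_inside D E u j : DD D -> DD E -> ty D = [set u]%SET -> ty E <> ty D ->
  sep (ty E) u j -> p D u j < p E u j.
Proof.
move=> dD dE eD ne sj; have [h _ g2] := st.
have ju : j != u by apply: contraTneq sj => ->; rewrite /sep eqxx.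
have [m [mu mj sm]] : exists m, [/\ m != u, m != j & ~~ sep (ty E) u m].
  apply/not_existsP => H; apply: ne; rewrite eD.
  have sepm m : m != u -> sep (ty E) u m.
    move=> mu; have [->//|mj] := eqVneq m j; by case sm: (sep (ty E) u m) => //; case: (H m); rewrite sm.
  have nE := stack_ntype dE; have tE := ntype_dtype nE.
  have uE : u \in ty E.
    apply/negPn/negP => uE; have : ty E = (~: [set u])%SET.
      apply/finset.setP => m; rewrite !inE; have [->|mu] := eqVneq m u; first exact/negbTE.
      by have := sepm _ mu; rewrite /sep (negbTE uE); case: (m \in ty E).
    move=> e; move: tE; rewrite e /dtype; have := cardsC1 u; rewrite card_ord => ->.
    by [].
  apply/finset.setP => m; rewrite !inE; have [->//|mu] := eqVneq m u.
  by have := sepm _ mu; rewrite /sep uE; case: (m \in ty E).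
apply: (g2 D E u j m) => //; rewrite 1?eq_sym//.
- by rewrite eD /sep !inE eqxx (negbTE ju).
- by rewrite eD /sep !inE eqxx (negbTE mu).
- by rewrite sepC.
- by move: sj sm; rewrite /sep negbK => + /eqP <-; rewrite eq_sym.
Qed.

(** Different types crossing a common edge separate some third vertex differently, and then the
    third clause of [stack] orders their corners strictly. *)
Lemma stack_neq D E i j : DD D -> DD E -> D <> E -> sep (ty D) i j -> sep (ty E) i j ->
  p D i j != p E i j.
Proof.
move=> dD dE ne; have [h g1 g2] := st.
have [aD aE] := (stack_antisym dD, stack_antisym dE).
have [tt|tt] := pselect (ty D = ty E).
  have H i' j' : i' \in ty D -> j' \notin ty D -> p D i' j' != p E i' j'.
    by move=> iA jA; case: (g1 D E dD dE ne tt) => /(_ _ _ iA jA) l; rewrite ?(lt_eqF l) ?(gt_eqF l).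
  rewrite -tt /sep; case iA: (i \in ty D); case jA: (j \in ty D) => // _ _.
    by apply: H => //; rewrite jA.
  by rewrite (aD j i) (aE j i) (inj_eq (addrI _)) eqr_opp; apply: H; rewrite ?iA.
move=> s1 s2.
have ij : i != j by apply: contraTneq s1 => ->; rewrite /sep eqxx.
have [a [b un]] := complete2 ij; have [[h1 h2 h3] [h4 h5 h6]] := uniq4 un.
have K m : m != i -> m != j -> sep (ty D) i m != sep (ty E) i m -> p D i j != p E i j.
  move=> mi mj; rewrite ![m == _]eq_sym in mi mj.
  have X T : sep T i j -> ~~ sep T i m -> sep T j m.
    by rewrite /sep negbK => + /eqP <-; rewrite eq_sym.
  case sD: (sep (ty D) i m); case sE: (sep (ty E) i m) => // _.
    have l : p D i j < p E i j by apply: (g2 D E i j m) => //; [rewrite sepC|apply: X => //; rewrite sE].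
    by rewrite lt_eqF.
  have l : p E i j < p D i j by apply: (g2 E D i j m) => //; [rewrite sepC|apply: X => //; rewrite sD].
  by rewrite gt_eqF.
have [ea|/(K a h2 h4)//] := eqVneq (sep (ty D) i a) (sep (ty E) i a).
have [eb|/(K b h3 h5)//] := eqVneq (sep (ty D) i b) (sep (ty E) i b).
exfalso; apply: tt.
have sepE m : sep (ty D) i m = sep (ty E) i m.
  have := all4P m un; rewrite !inE => /or4P[] /eqP -> //; last by rewrite s1 s2.
  by rewrite /sep !eqxx.
have [c|c] := eqVneq (i \in ty D) (i \in ty E).
  apply/finset.setP => m; have := sepE m; rewrite /sep c.
  by case: (i \in ty E); case: (m \in ty D); case: (m \in ty E).
have e : ty E = (~: ty D)%SET.
  apply/finset.setP => m; rewrite inE; have := sepE m; move: c; rewrite /sep.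
  by case: (i \in ty E); case: (i \in ty D); case: (m \in ty D); case: (m \in ty E).
have nD := stack_ntype dD; have nE := stack_ntype dE.
have cc := cardsC (ty D); rewrite -e card_ord in cc.
have [[u eD]|[v v0 eD]] := ntype_cases nD.
  by move: cc (ntype_dtype nE); rewrite eD cards1 /dtype; case: #|ty E| => [|[|[|[|]]]].
move: nE; rewrite /ntype e inE; have -> : #|~: ty D| = 2%N.
  by move: cc; rewrite -e eD cards2 eq_sym v0; case: #|ty E| => [|[|[|[|]]]].
by rewrite eD !inE eqxx andbF.
Qed.

(** Collars of equal type are parallel. Otherwise one of the discs is a triangle by [two_quads], and
    it lies on the inner side of the other one. *)
Lemma band_disjoint D E e f x : DD D -> DD E -> D <> E -> 0 <= e -> 0 <= f ->
  unit_pos (pshift (ty D) e (p D)) -> unit_pos (pshift (ty D) (- e) (p D)) ->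
  unit_pos (pshift (ty E) f (p E)) -> unit_pos (pshift (ty E) (- f) (p E)) ->
  (forall i j, sep (ty D) i j -> sep (ty E) i j -> e + f < `|p D i j - p E i j|) ->
  band (ty D) e (p D) x -> band (ty E) f (p E) x -> False.
Proof.
move=> dD dE ne e0 f0 u1 u2 u3 u4 gap bD bE.
have [h g1 _] := st.
have [tt|tt] := pselect (ty D = ty E).
  have gap' i j : i \in ty D -> j \notin ty D -> e + f < `|p D i j - p E i j|.
    by move=> iA jA; apply: gap; rewrite -?tt; exact: sep_in.
  case: (g1 D E dD dE ne tt) => lt.
    apply: (band_parallel (stack_dtype dD) u1 _ _ bD); [by rewrite tt; exact: u4| |by rewrite tt; exact: bE].
    by move=> i j iA jA; have := gap' _ _ iA jA; rewrite distrC gtr0_norm ?subr_gt0 ?lt//; lra.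
  apply: (band_parallel (stack_dtype dE) u3 _ _ bE); [by rewrite -tt; exact: u2| |by rewrite -tt; exact: bD].
  by rewrite -tt => i j iA jA; have := gap' _ _ iA jA; rewrite gtr0_norm ?subr_gt0 ?lt//; lra.
have compl D' E' u : DD E' -> ty D' = [set u]%SET -> ty E' != (~: [set u])%SET.
  move=> /stack_dtype tE _; apply/eqP => e1; move: tE; rewrite e1 /dtype.
  by have := cardsC1 u; rewrite card_ord => ->.
have [[u eD]|[v v0 eD]] := ntype_cases (stack_ntype dD).
  apply: (@band_tri R u (ty E) (p D) (p E) e f x) => //; rewrite -?eD//.
  - exact: stack_dtype.
  - by apply/eqP => e1; apply: tt; rewrite e1.
  - by rewrite eD; apply: (compl D).
  - exact: stack_antisym.
  - move=> j sj; have lt := tri_inside dD dE eD (fun h => tt (esym h)) sj.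
    have ju : j != u by apply: contraTneq sj => ->; rewrite /sep eqxx.
    have := gap u j; rewrite {1}eD /sep !inE eqxx (negbTE ju) => /(_ isT sj).
    by rewrite distrC gtr0_norm ?subr_gt0// (ger0_norm f0); lra.
have [[u eE]|[w w0 eE]] := ntype_cases (stack_ntype dE); last first.
  by apply: tt; apply: two_quads => //; rewrite ?eD ?eE cards2 eq_sym ?v0 ?w0.
apply: (@band_tri R u (ty D) (p E) (p D) f e x) => //; rewrite -?eE//.
- exact: stack_dtype.
- by apply/eqP => e1; apply: tt; rewrite e1.
- by rewrite eE; apply: (compl E).
- exact: stack_antisym.
- move=> j sj; have lt := tri_inside dE dD eE tt sj.
  have ju : j != u by apply: contraTneq sj => ->; rewrite /sep eqxx.
  have := gap u j sj; rewrite {1}eE /sep !inE eqxx (negbTE ju) => /(_ isT).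
  by rewrite gtr0_norm ?subr_gt0// (ger0_norm e0); lra.
Qed.

End one.

Definition same_order DD p q := forall D E i j, DD D -> DD E -> sep (ty D) i j -> sep (ty E) i j ->
  p D i j < p E i j -> q D i j < q E i j.

(** Apart from the ranges of the positions, [stack] only compares positions on common edges, so it
    persists as long as their order does. *)
Lemma stack_same_order DD p q : stack DD p -> same_order DD p q ->
  (forall D, DD D -> unit_pos (q D) /\ antisym (q D)) -> stack DD q.
Proof.
move=> [h g1 g2] so hq; split.
- by move=> D dD; have [nD _ _] := h _ dD; have [? ?] := hq _ dD.
- move=> D E dD dE ne tt; case: (g1 D E dD dE ne tt) => lt; [left|right] => i j iA jA.
    by apply: so => //; [exact: sep_in|rewrite -tt; exact: sep_in|exact: lt].
  by apply: so => //; [rewrite -tt; exact: sep_in|exact: sep_in|exact: lt].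
- move=> D E i j m dD dE im jm s1 s2 s3 s4; apply: so => //; first by rewrite sepC.
  exact: g2 s1 s2 s3 s4.
Qed.

End Stack.

(** * Moving finitely many discs *)

Lemma tentmap01 (R : realType) (a b b' c l : R) : a < b < c -> a < b' < c ->
  0 < a -> c < 1 -> 0 <= l <= 1 -> 0 <= tentmap a b b' c l <= 1.
Proof.
move=> o1 o2 a0 c1 l01; have [h|h] := boolP (a < l < c); last by rewrite tentmap_out.
have /andP[h1 h2] := tentmap_in o1 o2 h.
by rewrite (ltW (lt_trans a0 h1)) (ltW (lt_trans h2 c1)).
Qed.

Lemma itv01C (R : realType) (r : R) : (0 < 1 - r < 1) = (0 < r < 1).
Proof. by apply/idP/idP; lra. Qed.

Lemma itv01Cc (R : realType) (r : R) : (0 <= 1 - r <= 1) = (0 <= r <= 1).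
Proof. by apply/idP/idP; lra. Qed.

Section TentStep.
Variables (R : realType) (n : nat) (Phi : set (face_isometry R n)).
Notation tet := (tetrahedron R).
Notation pos := ('I_4 -> 'I_4 -> R).
Notation quo := (quotient_map (R:=R) (n:=n) Phi).
Variables (ty : set tet -> {set 'I_4}) (DD : 'I_n -> set (set tet)) (p0 : 'I_n -> set tet -> pos).
Implicit Types (x y : tet) (p q : 'I_n -> set tet -> pos) (t : 'I_n) (D E : set tet).

Definition realize p : set (glued_space Phi) :=
  \bigcup_t (quo t @` (\bigcup_(D in DD t) disc (ty D) (p t D))).

(* D and E leave on the matched face f of t the same arc around the vertex k. *)
Definition mates t f t' (s : {perm 'I_4}) k l m D E : Prop :=
  [/\ matched Phi t f t' s, uniq [:: k; l; m; f],
      (DD t D /\ DD t' E),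
      [/\ sep (ty D) k l, sep (ty D) k m, sep (ty E) (s k) (s l) & sep (ty E) (s k) (s m)]
    & p0 t D k l = p0 t' E (s k) (s l) /\ p0 t D k m = p0 t' E (s k) (s m)].

(** The pairing of discs along arcs is fixed once and for all by [p0]; other positions are required
    to respect it. *)
Definition compatible p : Prop := forall t f t' s k l m D E, mates t f t' s k l m D E ->
  p t D k l = p t' E (s k) (s l) /\ p t D k m = p t' E (s k) (s m).

Definition has_mates : Prop := forall t f t' s k l m D, matched Phi t f t' s ->
  uniq [:: k; l; m; f] -> DD t D -> sep (ty D) k l -> sep (ty D) k m ->
  exists E, mates t f t' s k l m D E.

Lemma uniq_map4 (s : {perm 'I_4}) (k l m f : 'I_4) : uniq [:: k; l; m; f] ->
  uniq [:: s k; s l; s m; s f].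
Proof. by move=> un; rewrite -[[:: _; _; _; _]]/(map s [:: k; l; m; f]) map_inj_uniq//; exact: perm_inj. Qed.

Lemma face_arc A (f : 'I_4) : dtype A -> A != [set f]%SET -> exists k l m,
  [/\ uniq [:: k; l; m; f], sep A k l & sep A k m].
Proof.
move=> tA nf.
have [k [kf kA kO]] : exists k, [/\ k != f, around k f A \/ around k f (~: A)%SET & True].
  move: tA => /orP[/cards1P[u e]|/cards2P[u [v [uv e]]]].
    exists u; split=> //; first by apply: contraNneq nf => <-; rewrite e.
    by left; left.
  have [uf|uf] := eqVneq u f.
    exists v; split=> //; first by rewrite -uf eq_sym.
    by left; right; rewrite e uf finset.setUC.
  have [vf|vf] := eqVneq v f.
    by exists u; split=> //; left; right; rewrite e vf.
  have [a [b un]] := complete2 uv; have [[h1 h2 h3] [h4 h5 h6]] := uniq4 un.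
  have := all4P f un; rewrite !inE ![f == u]eq_sym ![f == v]eq_sym (negbTE uf) (negbTE vf) /= => /orP[] /eqP fE; subst f.
    exists b; split=> //; right; right; rewrite e; apply/finset.setP => i; rewrite !inE.
    have := all4P i un; rewrite !inE => /or4P[] /eqP ->; rewrite ?eqxx ?orbT ?[v == u]eq_sym ?(negbTE uv) ?(negbTE h2) ?(negbTE h4) ?(negbTE h3) ?(negbTE h5) ?[u == _]eq_sym ?[v == _]eq_sym ?(negbTE h2) ?(negbTE h4) ?(negbTE h3) ?(negbTE h5) //.
  exists a; split; [by rewrite eq_sym| |by []]; right; right; rewrite e; apply/finset.setP => i; rewrite !inE.
  have := all4P i un; rewrite !inE => /or4P[] /eqP ->; rewrite ?eqxx ?orbT ?[v == u]eq_sym ?(negbTE uv) ?(negbTE h2) ?(negbTE h4) ?(negbTE h3) ?(negbTE h5) ?[u == _]eq_sym ?[v == _]eq_sym ?(negbTE h2) ?(negbTE h4) ?(negbTE h3) ?(negbTE h5) //.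
have [l [m un0]] := complete2 kf.
have un : uniq [:: k; l; m; f].
  have [[h1 h2 h3] [h4 h5 h6]] := uniq4 un0.
  by rewrite /= !inE !negb_or ![k == _]eq_sym h2 h3 h1 ![_ == f]eq_sym ![f == _]eq_sym h4 h5 eq_sym h6.
exists k, l, m; split=> //; case: kA => ar; have [a b c] := around_in un ar.
- exact: sep_in.
- by rewrite -sep_setC; exact: sep_in.
- exact: sep_in.
- by rewrite -sep_setC; exact: sep_in.
Qed.

Section step.
Variables (p q : 'I_n -> set tet -> pos) (e : R) (M : 'I_n -> {fset (set tet)}).
Hypotheses (e0 : 0 < e) (stp : forall t, stack ty (DD t) (p t))
  (stq : forall t, stack ty (DD t) (q t)) (cp : compatible p) (cq : compatible q)
  (hm : has_mates).
Hypotheses (MD : forall t D, D \in M t -> DD t D)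
  (unmoved : forall t D, DD t D -> D \notin M t -> forall i j, i \in ty D -> j \notin ty D -> p t D i j = q t D i j)
  (close : forall t D i j, D \in M t -> i \in ty D -> j \notin ty D ->
     [/\ `|q t D i j - p t D i j| < e, 0 < p t D i j - e & p t D i j + e < 1])
  (gap : forall t D E i j, D \in M t -> DD t E -> D <> E -> sep (ty D) i j -> sep (ty E) i j ->
     e + e < `|p t D i j - p t E i j|).

Let K t D := tdisc (ty D) e (p t D) (q t D).

Let sh t D : D \in M t -> unit_pos (pshift (ty D) e (p t D)).
Proof.
move=> DM; have dD := MD DM; apply: shift_unit_pos; [exact: stack_pos (stp t) _ dD| |exact: stack_antisym (stp t) _ dD].
by move=> i j iA jA; have [_ h1 h2] := close DM iA jA; have h3 := e0; lra.
Qed.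

Let shm t D : D \in M t -> unit_pos (pshift (ty D) (- e) (p t D)).
Proof.
move=> DM; have dD := MD DM; apply: shift_unit_pos; [exact: stack_pos (stp t) _ dD| |exact: stack_antisym (stp t) _ dD].
by move=> i j iA jA; have [_ h1 h2] := close DM iA jA; have h3 := e0; lra.
Qed.

Let srf t D : D \in M t -> [/\ surface (ty D) (disc (ty D) (pshift (ty D) (- e) (p t D))),
  surface (ty D) (disc (ty D) (p t D)), surface (ty D) (disc (ty D) (q t D))
  & surface (ty D) (disc (ty D) (pshift (ty D) e (p t D)))].
Proof.
move=> DM; have dD := MD DM; have tD := stack_dtype (stp t) dD.
by split; apply: surface_disc => //; [exact: shm|exact: stack_pos (stp t) _ dD|exact: stack_pos (stq t) _ dD|exact: sh].
Qed.

Let lev t D x : D \in M t -> 0 < lam (ty D) x < 1 ->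
  level (ty D) (disc (ty D) (pshift (ty D) (- e) (p t D))) x < level (ty D) (disc (ty D) (p t D)) x
   < level (ty D) (disc (ty D) (pshift (ty D) e (p t D))) x /\
  level (ty D) (disc (ty D) (pshift (ty D) (- e) (p t D))) x < level (ty D) (disc (ty D) (q t D)) x
   < level (ty D) (disc (ty D) (pshift (ty D) e (p t D))) x.
Proof.
move=> DM l; have dD := MD DM; have tD := stack_dtype (stp t) dD.
have pD := stack_pos (stp t) dD; have qD := stack_pos (stq t) dD.
have s1 := sh DM; have s2 := shm DM; have h3 := e0.
have a i j : i \in ty D -> j \notin ty D -> - e < q t D i j - p t D i j < e.
  by move=> iA jA; have [h _ _] := close DM iA jA; rewrite -ltr_norml.
by split; apply/andP; split; apply: level_disc_lt => // i j iA jA; rewrite !shift_in//; have := a i j iA jA; lra.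
Qed.

Let tent01 t D y : D \in M t -> 0 < lam (ty D) y < 1 ->
  0 <= tentmap (level (ty D) (disc (ty D) (pshift (ty D) (- e) (p t D))) y) (level (ty D) (disc (ty D) (p t D)) y)
     (level (ty D) (disc (ty D) (q t D)) y) (level (ty D) (disc (ty D) (pshift (ty D) e (p t D))) y) (lam (ty D) y) <= 1.
Proof.
move=> DM l; have [s1 s2 s3 s4] := srf DM; have [ord1 ord2] := lev DM l.
have [/andP[a0 _] _] := levelP s1 l; have [/andP[_ c1] _] := levelP s4 l.
by apply: tentmap01 ord1 ord2 a0 c1 _; rewrite lam_ge0 lam_le1.
Qed.

Let ray_K t D : D \in M t -> ray_map (ty D) (K t D).
Proof.
move=> DM; have [s1 s2 s3 s4] := srf DM.
by apply: tent_slide_ray_map => // x l; have [] := lev DM l.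
Qed.

Let moved_band t D x : D \in M t -> K t D x <> x -> band (ty D) e (p t D) x.
Proof.
move=> DM mv; have [s1 s2 s3 s4] := srf DM.
have l : 0 < lam (ty D) x < 1.
  by apply/negPn/negP => nl; apply: mv; have [_ + _ _] := ray_K DM; exact.
have [ord1 ord2] := lev DM l.
have : level (ty D) (disc (ty D) (pshift (ty D) (- e) (p t D))) x < lam (ty D) x < level (ty D) (disc (ty D) (pshift (ty D) e (p t D))) x.
  apply/negPn/negP => h; apply: mv; apply: tent_slide_fixed => //.
    by move=> y ly; have [] := lev DM ly.
  by move=> _ h'; rewrite h' in h.
by move=> /andP[/ltW a /ltW b].
Qed.

(** The alternative [f = 0] is for discs that stay in place: the collars of the moved discs avoid
    them. *)
Let disjoint_bands t D E f x : D \in M t -> DD t E -> D <> E ->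
  (f = e /\ E \in M t \/ f = 0) ->
  band (ty D) e (p t D) x -> band (ty E) f (p t E) x -> False.
Proof.
move=> DM dE ne fE; have dD := MD DM.
have pE := stack_pos (stp t) dE.
have [f0 fe s1 s2] : [/\ 0 <= f, f <= e, unit_pos (pshift (ty E) f (p t E)) & unit_pos (pshift (ty E) (- f) (p t E))].
  have e0' := ltW e0; case: fE => [[-> EM]|->]; first by split=> //; [exact: sh|exact: shm].
  rewrite oppr0; split=> //; apply: shift_unit_pos => //; try exact: stack_antisym (stp t) _ dE.
    by move=> i j _ _; rewrite addr0.
  by move=> i j _ _; rewrite addr0.
apply: (band_disjoint (stp t) dD dE ne (ltW e0) f0) => //; [exact: sh|exact: shm|].
by move=> i j si sj; apply: le_lt_trans (gap DM dE ne si sj); rewrite lerD2l.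
Qed.

Let h t : tet -> tet := combine (fun D : M t => K t (fsval D)).

Let hA t (D : M t) : ray_map (ty (fsval D)) (K t (fsval D)).
Proof. exact/ray_K/fsvalP. Qed.

Let hdisj t (D E : M t) x : D != E -> K t (fsval D) x <> x -> K t (fsval E) x = x.
Proof.
move=> ne mv; apply: contrapT => mv'.
have ne' : fsval D <> fsval E by move=> h1; move/eqP: ne; apply; exact: val_inj.
apply: (@disjoint_bands t (fsval D) (fsval E) e x) => //; try exact: fsvalP.
- exact/MD/fsvalP.
- by left; split=> //; exact: fsvalP.
- by apply: moved_band => //; exact: fsvalP.
- by apply: moved_band => //; exact: fsvalP.
Qed.

Let h_moved t D x : D \in M t -> K t D x <> x -> h t x = K t D x.
Proof. by move=> DM mv; rewrite /h (combine_moved (@hdisj t) (i := [` DM]%fset)). Qed.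

Let h_fixed t x : (forall D, D \in M t -> K t D x = x) -> h t x = x.
Proof. by move=> H; apply: combine_fixed => D; apply: H; exact: fsvalP. Qed.

Let h_disc t D : DD t D -> h t @` disc (ty D) (p t D) = disc (ty D) (q t D).
Proof.
move=> dD; have tD := stack_dtype (stp t) dD; have pD := stack_pos (stp t) dD.
have others E x : disc (ty D) (p t D) x -> E \in M t -> E <> D -> K t E x = x.
  move=> dx EM ne; apply: contrapT => mv.
  by apply: (@disjoint_bands t E D 0 x) => //; [right|exact: moved_band|exact: disc_band].
have [DM|DM] := boolP (D \in M t); last first.
  rewrite -(disc_ext (unmoved dD DM)).
  rewrite -[RHS]image_id; apply: eq_imagel => x dx.
  by apply: h_fixed => E EM; apply: others => // ED; rewrite ED (negbTE DM) in EM.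
have [s1 s2 s3 s4] := srf DM.
rewrite -(tent_slide_image s1 s2 s3 s4 (fun x l => (@lev t D x DM l).1)).
apply: eq_imagel => x dx; have [fx|mv] := pselect (K t D x = x); last exact: h_moved.
rewrite -/(tdisc (ty D) e (p t D) (q t D) x) -/(K t D x) fx; apply: h_fixed => E EM.
by have [->//|ED] := pselect (E = D); exact: others.
Qed.

Let h_act1 t f t' (s : {perm 'I_4}) x : matched Phi t f t' s -> face f x -> h t x <> x ->
  h t' (act s x) = act s (h t x).
Proof.
move=> mt /face_crd xf hx.
have [D DM mv] : exists2 D, D \in M t & K t D x <> x.
  apply: contrapT => H; apply: hx; apply: h_fixed => D DM; apply: contrapT => mv.
  by apply: H; exists D.
have dD := MD DM; have tD := stack_dtype (stp t) dD.
have bD := moved_band DM mv.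
have nf : ty D != [set f]%SET.
  apply/eqP => eD; move: bD => [+ _ _]; rewrite eD -[lam _ _](subKr 1) -lamC (eq_bigl (pred1 f)) => [|i]; last by rewrite inE.
  by rewrite big_pred1_eq xf subr0 ltxx andbF.
have [k [l [m [un s1 s2]]]] := face_arc tD nf.
have [E mE] := hm mt un dD s1 s2.
have [_ _ [_ dE] [_ _ s3 s4] _] := mE.
have [c1 c2] := cp mE; have [c3 c4] := cq mE.
have tE := stack_dtype (stp t') dE.
have un' := uniq_map4 s un.
have [aD aE] := (stack_antisym (stp t) dD, stack_antisym (stp t') dE).
have [bD' bE'] := (stack_antisym (stq t) dD, stack_antisym (stq t') dE).
have [pD pE] := (stack_pos (stp t) dD, stack_pos (stp t') dE).
have [qD qE] := (stack_pos (stq t) dD, stack_pos (stq t') dE).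
(* If [E] stayed in place, both systems of positions would agree on the common arc, and the slide of
   [D] would fix [x]. *)
have EM : E \in M t'.
  apply: contrapT => /negP EM; apply: mv; apply: tent_slide_fixed.
    by move=> y ly; have [] := lev DM ly.
  move=> lx _.
  have un_p : p t D k l = q t D k l /\ p t D k m = q t D k m.
    rewrite c1 c2 c3 c4; have H i j : sep (ty E) i j -> p t' E i j = q t' E i j.
      rewrite /sep; case iE: (i \in ty E); case jE: (j \in ty E) => // _.
        by apply: unmoved => //; rewrite jE.
      by rewrite (aE j i) (bE' j i) (unmoved dE EM) ?iE.
    by split; exact: H.
  have lev_eq B : around k f B -> 0 < lam B x < 1 -> level B (disc B (p t D)) x = level B (disc B (q t D)) x.
    move=> aB lB; have tB := around_dtype un aB.
    have [m01 dm] := levelP (surface_disc tB pD) lB.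
    have mi : 0 <= level B (disc B (p t D)) x <= 1 by case/andP: m01 => *; rewrite !ltW.
    apply/esym/level_uniq => //; first exact: surface_disc.
    move: dm; rewrite !(disc_around un aB)//; try exact: ray_crd0.
    by case: un_p => -> ->.
  have [ar|ar] := around_orient un tD s1 s2; first exact: lev_eq.
  have := lev_eq _ ar; rewrite lam_setC !disc_setC//.
  rewrite !level_setC//; try exact: surface_disc.
  have lx' : 0 < 1 - lam (ty D) x < 1 by rewrite itv01C.
  by move=> /(_ lx') /(congr1 (fun r => 1 - r)); rewrite !subKr.
have KE : K t' E (act s x) = act s (K t D x).
  rewrite /K.
  (* The orientations of both discs are changed, where necessary, to those that surround the glued
     vertex; a tent slide does not depend on the orientation. *)
  have H B B' pB qB pB' qB' : B = ty D \/ B = (~: ty D)%SET -> B' = ty E \/ B' = (~: ty E)%SET ->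
      around k f B -> around (s k) (s f) B' -> pB = p t D -> qB = q t D -> pB' = p t' E -> qB' = q t' E ->
      tdisc B' e pB' qB' (act s x) = act s (tdisc B e pB qB x).
    move=> eB eB' ar ar' -> -> -> ->.
    apply: (@tdisc_around R k l m f B B' s x e) => //.
    - by case: eB => ->; rewrite ?shift_setC; [exact: sh|exact: shm].
    - by case: eB => ->; rewrite ?shift_setC ?opprK; [exact: shm|exact: sh].
    - by case: eB' => ->; rewrite ?shift_setC; [exact: sh|exact: shm].
    - by case: eB' => ->; rewrite ?shift_setC ?opprK; [exact: shm|exact: sh].
    - move=> y; case: eB => ->; first exact: tent01.
      have [r1 r2 r3 r4] := srf DM.
      rewrite lam_setC itv01C => ly'.
      rewrite !shift_setC opprK !disc_setC//; try exact: shift_antisym.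
      by rewrite !level_setC// tentmap_sym itv01Cc; exact: tent01 DM ly'.
  have TD B : B = ty D \/ B = (~: ty D)%SET -> tdisc B e (p t D) (q t D) x = tdisc (ty D) e (p t D) (q t D) x.
    by case=> -> //; have [r1 r2 r3 r4] := srf DM; exact: tdisc_setC.
  have TE B : B = ty E \/ B = (~: ty E)%SET -> tdisc B e (p t' E) (q t' E) (act s x) = tdisc (ty E) e (p t' E) (q t' E) (act s x).
    by case=> -> //; have [r1 r2 r3 r4] := srf EM; exact: tdisc_setC.
  have [B eB ar] : exists2 B, B = ty D \/ B = (~: ty D)%SET & around k f B.
    by have [ar|ar] := around_orient un tD s1 s2; [exists (ty D); [left|]|exists (~: ty D)%SET; [right|]].
  have [B' eB' ar'] : exists2 B, B = ty E \/ B = (~: ty E)%SET & around (s k) (s f) B.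
    by have [ar'|ar'] := around_orient un' tE s3 s4; [exists (ty E); [left|]|exists (~: ty E)%SET; [right|]].
  by rewrite -(TD _ eB) -(TE _ eB'); exact: H.
rewrite (h_moved DM mv) (h_moved EM) KE// => k1; apply: mv.
by rewrite -[LHS](actK s) k1 actK.
Qed.

Lemma tent_step : normally_isotopic (realize p) (realize q).
Proof.
have -> : realize q = \bigcup_t (quo t @` (h t @` (\bigcup_(D in DD t) disc (ty D) (p t D)))).
  apply: eq_bigcupr => t _; congr image; rewrite image_bigcup.
  by apply: eq_bigcupr => D dD; rewrite h_disc.
apply: sliding_normally_isotopic.
  by move=> t; exact: combine_sliding (@hA t) (@hdisj t).
move=> t f t' s x mt fx.
have [fix1|] := pselect (h t x = x); last exact: (h_act1 mt fx).
have [fix2|mv2] := pselect (h t' (act s x) = act s x); first by rewrite fix1 fix2.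
(* If only the image of [x] is moved, the equality is obtained through the inverse gluing. *)
have := h_act1 (matched_inv mt) (face_act (s := s) fx) mv2.
rewrite actK => ->. by rewrite actKV.
Qed.

End step.
End TentStep.

(** * Moving an infinite stack of triangles *)

Section Interpolation.
Variable R : realType.
Implicit Types (a : nat -> R) (r s : R).

(** The piecewise linear function through the points [(k, a k)], as a sum of ramps; beyond [N] it is
    constant. *)
Definition interp_to (N : nat) a r : R := a 0%N + \sum_(k < N) clamp (r - k%:R) * (a k.+1 - a k).

Definition interp a r : R := interp_to (Num.truncn r).+1 a r.

Lemma clamp_le0 r : r <= 0 -> clamp r = 0.
Proof. by move=> r0; rewrite /clamp max_l// ge_min r0 orbT. Qed.

Lemma clamp_ge1 r : 1 <= r -> clamp r = 1.
Proof. by move=> r1; rewrite /clamp min_l// max_r. Qed.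

Lemma clamp_homo r s : r <= s -> clamp r <= clamp s.
Proof.
move=> rs; rewrite /clamp ge_max le_max lexx/= le_max; apply/orP; right.
by rewrite le_min !ge_min lexx rs orbT.
Qed.

Lemma interp_toE N M a r : r <= N%:R -> (N <= M)%N -> interp_to M a r = interp_to N a r.
Proof.
move=> rN NM; rewrite /interp_to; congr (_ + _).
rewrite -!(big_mkord xpredT (fun k => clamp (r - k%:R) * (a k.+1 - a k))).
rewrite (big_cat_nat (leq0n N) NM)/=.
rewrite [X in _ + X]big_nat_cond [X in _ + X]big1 ?addr0// => k /andP[/andP[Nk _] _].
by rewrite clamp_le0 ?mul0r// subr_le0 (le_trans rN)// ler_nat.
Qed.

Lemma interpE N a r : 0 <= r -> r <= N%:R -> interp a r = interp_to N a r.
Proof.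
move=> r0 rN; rewrite /interp; have rt : r <= (Num.truncn r).+1%:R by rewrite ltW// truncnS_gt.
by case: (leqP N (Num.truncn r).+1) => h; [rewrite (interp_toE a rN)|rewrite -(interp_toE a rt (ltnW h))].
Qed.

Lemma interp_strip a (k : nat) r : 0 <= r <= 1 ->
  interp a (k%:R + r) = (1 - r) * a k + r * a k.+1.
Proof.
move=> /andP[r0 r1]; rewrite (@interpE k.+1) ?addr_ge0//; last by rewrite -natr1 lerD2l.
rewrite /interp_to big_ord_recr /= [_ - k%:R]addrAC subrr add0r clamp_id ?r0//.
rewrite (eq_bigr (fun i : 'I_k => a i.+1 - a i)) => [|i _].
  rewrite -(big_mkord xpredT (fun i => a i.+1 - a i)) telescope_sumr//; ring.
rewrite clamp_ge1 ?mul1r// -addrA addrCA addrA.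
have : (i.+1)%:R <= k%:R :> R by rewrite ler_nat.
by rewrite -natr1; lra.
Qed.

(** Near each point a fixed number of ramps suffices. The composed form restricts attention to
    nonnegative parameters. *)
Lemma interp_continuous a r : 0 <= r -> forall (T : topologicalType) (f : T -> R) t,
  (forall z, 0 <= f z) -> f t = r -> continuous_at t f -> continuous_at t (fun z => interp a (f z)).
Proof.
move=> r0 T f t f0 ft cf; pose N := (Num.truncn r).+1.
have rN : f t < N%:R by rewrite ft truncnS_gt.
have e : \forall z \near t, interp a (f z) = interp_to N a (f z).
  by apply: filterS (cont_lt cf rN) => z /ltW h; exact: interpE.
apply: cont_near e _; apply: contD; first exact: contc.
apply: cont_sum => k _; apply: contM; last exact: contc.
apply: (@continuous_comp _ _ _ (fun z => f z - k%:R) (@clamp R)); last exact: clamp_continuous.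
by apply: contB; [exact: cf|exact: contc].
Qed.

Lemma interp_incr a r s : (forall k, a k < a k.+1) -> 0 <= r -> r < s -> interp a r < interp a s.
Proof.
move=> inc r0 rs; have s0 := le_trans r0 (ltW rs).
pose N := (Num.truncn s).+1; have sN : s <= N%:R by rewrite ltW// truncnS_gt.
rewrite (@interpE N a r)// ?(@interpE N a s)//; last by rewrite ltW// (lt_le_trans rs).
rewrite ltrD2l.
(* The ramp that is rising at [r] gives the strict inequality, the other ones a weak inequality. *)
have rN : (Num.truncn r < N)%N by rewrite ltnS; exact: le_truncn (ltW rs).
rewrite (bigD1 (Ordinal rN))//= [ltRHS](bigD1 (Ordinal rN))//=.
rewrite ltr_leD//.
  rewrite ltr_pM2r ?subr_gt0//.
  have /andP[t1 t2] := truncn_itv r0.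
  have [h|h] := leP s (Num.truncn r).+1%:R.
    rewrite !clamp_id; [lra| |]; rewrite -natr1 in h t2; apply/andP; split; lra.
  rewrite (@clamp_ge1 (s - _)); last by rewrite -natr1 in h; lra.
  rewrite clamp_id; last by rewrite -natr1 in t2; apply/andP; split; lra.
  by rewrite -natr1 in t2; lra.
by apply: ler_sum => k _; rewrite ler_wpM2r ?subr_ge0 ?(ltW (inc _))// clamp_homo// lerD2r ltW.
Qed.

Lemma interp0 a : interp a 0 = a 0%N.
Proof. by have := @interp_strip a 0%N 0; rewrite lexx ler01 addr0 subr0 mul1r mul0r addr0 => ->. Qed.

Lemma interp_nat a k : interp a k%:R = a k.
Proof. by have := @interp_strip a k 0; rewrite lexx ler01 addr0 subr0 mul1r mul0r addr0 => ->. Qed.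

End Interpolation.

Section Chain.
Variable R : realType.
Notation tet := (tetrahedron R).
Variables (u : 'I_4) (a a' : nat -> 'I_4 -> R).
Implicit Types (x y : tet).
Hypotheses (a_incr : forall k j, a k j < a k.+1 j) (a'_incr : forall k j, a' k j < a' k.+1 j)
  (a_gt1 : forall k j, 1 < a k j) (a'_gt1 : forall k j, 1 < a' k j)
  (a_unb : forall C, exists k, forall j, C < a k j) (a'_unb : forall C, exists k, forall j, C < a' k j)
  (aa' : forall j, a 0%N j = a' 0%N j).

Notation A := [set u]%SET.

(** For inverses of positions, [cform b x r = 1] is the intercept equation of the triangle at [u]
    with interpolated intercepts. *)
Definition cform (b : nat -> 'I_4 -> R) x r : R := \sum_(j | j != u) crd x j * interp (b^~ j) r.

Lemma lam1 x : lam A x = \sum_(j | j != u) crd x j.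
Proof. by apply: eq_bigl => j; rewrite inE. Qed.

Lemma form_nat b x k : cform b x k%:R = \sum_(j | j != u) crd x j * b k j.
Proof. by apply: eq_bigr => j _; rewrite interp_nat. Qed.

Lemma form_strip b x k r : 0 <= r <= 1 ->
  cform b x (k%:R + r) = (1 - r) * cform b x k%:R + r * cform b x k.+1%:R.
Proof.
move=> r01; rewrite !form_nat !mulr_sumr -big_split/=; apply: eq_bigr => j _.
by rewrite interp_strip//; ring.
Qed.

Lemma form_ray b x m r : 0 < lam A x < 1 -> 0 <= m <= 1 ->
  cform b (ray A x m) r = m / lam A x * cform b x r.
Proof.
move=> l m01; rewrite /cform mulr_sumr; apply: eq_bigr => j ju.
by rewrite crd_ray// inE (negbTE ju); ring.
Qed.

Lemma form_continuous b r : continuous (fun x => cform b x r).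
Proof.
move=> x; apply: (@cont_sum R tet) => j _; apply: (@contM R tet); last exact: (@contc R tet).
exact: crd_continuous.
Qed.

Lemma form_incr b x r s : (forall k j, b k j < b k.+1 j) -> 0 < lam A x -> 0 <= r -> r < s ->
  cform b x r < cform b x s.
Proof.
move=> inc l0 r0 rs; rewrite lam1 in l0.
have [j ju xj] : exists2 j, j != u & 0 < crd x j.
  apply: contrapT => h; move: l0; rewrite big1 ?ltxx// => j ju; apply/eqP.
  by rewrite eq_le crd_ge0 andbT leNgt; apply/negP => xj; apply: h; exists j.
rewrite /cform (bigD1 j)//= [ltRHS](bigD1 j)//= ltr_leD//.
  by rewrite ltr_pM2l// interp_incr.
by apply: ler_sum => i _; rewrite ler_wpM2l ?crd_ge0// ltW// interp_incr.
Qed.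

Lemma form_le b x r s : (forall k j, b k j < b k.+1 j) -> 0 < lam A x -> 0 <= r -> r <= s ->
  cform b x r <= cform b x s.
Proof.
by move=> inc l0 r0; rewrite le_eqVlt => /predU1P[->//|rs]; apply/ltW/form_incr.
Qed.

Lemma form_gt b x C k : 0 < lam A x -> (forall j, C < b k j) -> C * lam A x < cform b x k%:R.
Proof.
move=> l0 h; rewrite lam1 in l0 *; rewrite form_nat mulr_sumr.
have [j ju xj] : exists2 j, j != u & 0 < crd x j.
  apply: contrapT => h'; move: l0; rewrite big1 ?ltxx// => j ju; apply/eqP.
  by rewrite eq_le crd_ge0 andbT leNgt; apply/negP => xj; apply: h'; exists j.
rewrite (bigD1 j)//= [ltRHS](bigD1 j)//= ltr_leD//.
  by rewrite mulrC ltr_pM2l.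
by apply: ler_sum => i _; rewrite mulrC ler_wpM2l ?crd_ge0// ltW.
Qed.

(* With [a k j] the inverse of the position of the k-th triangle on the edge towards j,
   the sets [leaf = r] interpolate between the triangles, which are the sets [leaf = k]. *)
Definition leaf x : R := xget 0 [set r | 0 <= r /\ cform a x r = 1].

Lemma leaf_ge0 x : 0 <= leaf x.
Proof. by rewrite /leaf; case: xgetP => // r -> []. Qed.

(** The default value of [xget] is 0 for this reason: beyond the first triangle the map must
    continue by the identity, and at parameter 0 the two stacks agree. *)
Lemma leaf_outer x : 0 < lam A x -> 1 <= cform a x 0 -> leaf x = 0.
Proof.
move=> l0 h; rewrite /leaf; case: xgetP => // r -> [r0 e]; apply/eqP.
rewrite eq_le r0 andbT leNgt; apply/negP => r1.
by have := form_incr a_incr l0 (lexx 0) r1; rewrite e ltNge h.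
Qed.

Lemma leaf_uniq x r : 0 < lam A x -> 0 <= r -> cform a x r = 1 -> leaf x = r.
Proof.
move=> l0 r0 e; rewrite /leaf; case: xgetP => [s _ [s0 e']|/(_ r)]; last by case.
apply/eqP; rewrite eq_le; apply/andP; split; rewrite leNgt; apply/negP => h.
  by have := form_incr a_incr l0 r0 h; rewrite e e' ltxx.
by have := form_incr a_incr l0 s0 h; rewrite e e' ltxx.
Qed.

(** Since [a] is unbounded uniformly in the directions, the form passes the value 1 as the parameter
    grows. *)
Lemma leaf_inner x : 0 < lam A x -> cform a x 0 <= 1 -> cform a x (leaf x) = 1.
Proof.
move=> l0 h; suff [r r0 e] : exists2 r, 0 <= r & cform a x r = 1 by rewrite (leaf_uniq l0 r0 e).
have [k hk] := a_unb (lam A x)^-1.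
have h1 : 1 <= cform a x k%:R.
  by have := form_gt l0 hk; rewrite mulVf ?gt_eqF// => /ltW.
pose f r := cform a x (Num.max 0 r).
have cf : continuous f.
  move=> r; apply: cont_sum => j _; apply: contM; first exact: contc.
  apply: (@interp_continuous R (a^~ j) (Num.max 0 r)) => //; first by rewrite le_max lexx.
    by move=> z; rewrite le_max lexx.
  by apply: contmax; [exact: contc|exact: cvg_id].
have k0 : (0 : R) <= k%:R by rewrite ler0n.
have [||r r01 fr] := @IVT R f 0 k%:R 1 k0.
- exact: continuous_subspaceT.
- by rewrite /f maxxx (max_r k0) ge_min h le_max h1 orbT.
by move: r01; rewrite in_itv/= => /andP[r0 _]; exists r => //; rewrite -fr /f max_r.
Qed.

(** Comparing the leaf with a fixed parameter amounts to comparing with 1 the form at this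
    parameter, which is continuous in the point. *)
Lemma leaf_continuous x : 0 < lam A x -> continuous_at x leaf.
Proof.
move=> l0; have cl := @lam_continuous R A x.
have nl := @cont_gt R tet _ _ _ cl l0.
have up e : 0 < e -> \forall y \near x, leaf y < leaf x + e.
  move=> e0; have h : 1 < cform a x (leaf x + e).
    have [ge1|/ltW i] := leP 1 (cform a x 0).
      rewrite (leaf_outer l0 ge1) add0r; apply: le_lt_trans ge1 _.
      by apply: form_incr.
    by rewrite -(leaf_inner l0 i); apply: form_incr => //; [exact: leaf_ge0|rewrite ltrDl].
  apply: filterS2 nl (@cont_gt R tet _ _ _ (@form_continuous a (leaf x + e) x) h) => y ly hy.
  rewrite ltNge; apply/negP => c; have lp : 0 < leaf x + e by rewrite ltr_wpDl ?leaf_ge0.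
  have [ge1|/ltW i] := leP 1 (cform a y 0).
    by move: c; rewrite (leaf_outer ly ge1) leNgt lp.
  by have := form_le a_incr ly (ltW lp) c; rewrite (leaf_inner ly i) leNgt hy.
have dn e : 0 < e -> \forall y \near x, leaf x - e < leaf y.
  move=> e0; have [neg|pos] := ltP (leaf x - e) 0.
    by apply: filterS nl => y _; apply: lt_le_trans neg (leaf_ge0 y).
  have h : cform a x (leaf x - e) < 1.
    have [ge1|/ltW i] := leP 1 (cform a x 0).
      by move: pos; rewrite (leaf_outer l0 ge1) sub0r oppr_ge0 leNgt e0.
    rewrite -(leaf_inner l0 i); apply: form_incr => //.
    by rewrite ltrBlDr ltrDl.
  apply: filterS2 nl (@cont_lt R tet _ _ _ (@form_continuous a (leaf x - e) x) h) => y ly hy.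
  rewrite ltNge; apply/negP => c.
  have i : cform a y 0 <= 1 by apply: le_trans (ltW hy); exact: form_le a_incr ly (lexx 0) pos.
  by have := form_le a_incr ly (leaf_ge0 y) c; rewrite (leaf_inner ly i) leNgt hy.
apply: (@contP R tet) => e e0; apply: filterS2 (up e e0) (dn e e0) => y h1 h2.
by rewrite ltr_distlC h1 h2.
Qed.

(* The height on the ray of x of the point of level [leaf x] for the stack a'. *)
Definition newlam x : R := lam A x * (cform a x (leaf x) / cform a' x (leaf x)).

Definition chain_slide x : tet := if 0 < lam A x < 1 then ray A x (newlam x) else x.

Notation K := chain_slide.

Lemma form0 x : cform a x 0 = cform a' x 0.
Proof. by apply: eq_bigr => j _; rewrite !interp0 aa'. Qed.

Lemma cform'_gt x r : 0 < lam A x -> 0 <= r -> lam A x < cform a' x r.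
Proof.
move=> l0 r0; apply: lt_le_trans (form_le a'_incr l0 (lexx 0) r0).
by have := @form_gt a' x 1 0%N l0 (a'_gt1 0%N); rewrite mul1r.
Qed.

Lemma newlam_outer x : 0 < lam A x -> 1 <= cform a x 0 -> newlam x = lam A x.
Proof.
move=> l0 ge1; rewrite /newlam (leaf_outer l0 ge1) -form0 divff ?mulr1// gt_eqF//.
exact: lt_le_trans ge1.
Qed.

Lemma newlam_inner x : 0 < lam A x -> cform a x 0 <= 1 -> newlam x = lam A x / cform a' x (leaf x).
Proof. by move=> l0 i; rewrite /newlam (leaf_inner l0 i) mul1r. Qed.

Lemma newlam01 x : 0 < lam A x < 1 -> 0 < newlam x < 1.
Proof.
move=> /andP[l0 l1]; have [ge1|/ltW i] := leP 1 (cform a x 0); first by rewrite newlam_outer// l0.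
have h := cform'_gt l0 (leaf_ge0 x); have h0 := lt_trans l0 h.
by rewrite newlam_inner// divr_gt0// ltr_pdivrMr// mul1r.
Qed.

Lemma newlam01c x : 0 < lam A x < 1 -> 0 <= newlam x <= 1.
Proof. by move=> /newlam01/andP[? ?]; rewrite !ltW. Qed.

Lemma lam_chain x : 0 < lam A x < 1 -> lam A (K x) = newlam x.
Proof. by move=> l; rewrite /K l lam_ray// newlam01c. Qed.

Lemma chain_outer x : (0 < lam A x < 1 -> 1 <= cform a x 0) -> K x = x.
Proof.
rewrite /K; case: ifP => // l /(_ isT) h; rewrite newlam_outer ?ray_lam//.
by case/andP: l.
Qed.

(** Between two consecutive triangles the map depends on these two only, a local formula that can be
    compared across a glued face. *)
Lemma chain_strip x k r : 0 < lam A x < 1 -> 0 <= r <= 1 ->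
  (1 - r) * cform a x k%:R + r * cform a x k.+1%:R = 1 ->
  K x = ray A x (lam A x / ((1 - r) * cform a' x k%:R + r * cform a' x k.+1%:R)).
Proof.
move=> l r01 e; have /andP[l0 l1] := l; rewrite -form_strip// in e.
have kr0 : 0 <= k%:R + r by case/andP: r01 => r0 _; rewrite addr_ge0.
have lf := leaf_uniq l0 kr0 e.
rewrite /K l -form_strip// newlam_inner ?lf//.
by rewrite -e; apply: form_le => //.
Qed.

Lemma chain_strip_ex x : 0 < lam A x < 1 -> cform a x 0 <= 1 -> exists k r, 0 <= r <= 1 /\
  (1 - r) * cform a x k%:R + r * cform a x k.+1%:R = 1.
Proof.
move=> /andP[l0 _] i; exists (Num.truncn (leaf x)), (leaf x - (Num.truncn (leaf x))%:R).
have /andP[t1 t2] := truncn_itv (leaf_ge0 x).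
have r01 : 0 <= leaf x - (Num.truncn (leaf x))%:R <= 1.
  by rewrite subr_ge0 t1 lerBlDl natr1 ltW.
by split=> //; rewrite -form_strip// addrC subrK leaf_inner.
Qed.

Lemma chain_ray_map : ray_map A K.
Proof.
split.
- move=> x; case: (boolP (0 < lam A x < 1)) => l.
    have /andP[l0 l1] := l; have cl := @lam_continuous R A x; have cf := leaf_continuous l0.
    have cform b : continuous_at x (fun y => cform b y (leaf y)).
      apply: (@cont_sum R tet) => j _; apply: (@contM R tet); first exact: crd_continuous.
      apply: (@interp_continuous R (b^~ j) (leaf x) _ tet) => //; [exact: leaf_ge0|exact: leaf_ge0].
    have cn : continuous_at x newlam.
      apply: (@contM R tet) => //; apply: (@contM R tet) => //; apply: (@contV R tet) => //.
      by rewrite gt_eqF// (lt_trans l0)// cform'_gt// leaf_ge0.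
    have cr : (fun y => ray A y (clamp (newlam y))) @ x --> ray A x (clamp (newlam x)).
      apply: (@continuous_comp _ _ _ (fun y => (y, newlam y)) (fun z : tet * R => ray A z.1 (clamp z.2))).
        exact: (cvg_pair cvg_id cn).
      exact: (ray_continuous (z := (x, newlam x)) l).
    apply: (@cont_near tet tet) cr; apply: filterS (lam_near l) => y ly.
    by rewrite /K ly clamp_id// newlam01c.
  have [lx|lx] : lam A x = 0 \/ lam A x = 1.
    move: l; rewrite negb_and -!leNgt => /orP[] h; [left|right]; apply/le_anti.
      by rewrite h lam_ge0.
    by rewrite h lam_le1.
  + have Kx : K x = x by apply: chain_outer; rewrite lx ltxx.
    have xj j : j != u -> crd x j = 0.
      by move: lx; rewrite lam1 => /psumr_eq0P H ju; apply: H => // i _; exact: crd_ge0.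
    (* Continuity at the vertex [u]: close to it the leaf is large, and there the triangles of the
       stack [a'] are small. *)
    have small e : 0 < e -> \forall y \near x, lam A (K y) < e.
      move=> e0; have [k hk] := a'_unb e^-1.
      have fx : cform a x k%:R < 1 by rewrite form_nat big1 ?ltr01// => j ju; rewrite xj// mul0r.
      have lxe : lam A x < Num.min e 1 by rewrite lx lt_min e0 ltr01.
      apply: filterS2 (@cont_lt R tet _ _ _ (@form_continuous a k%:R x) fx)
        (@cont_lt R tet _ _ _ (@lam_continuous R A x) lxe) => y fy.
      rewrite lt_min => /andP[ly ly1].
      have [l0|l0] := ltP 0 (lam A y); last first.
        have -> : K y = y by apply: chain_outer => /andP[]; rewrite ltNge l0.
        exact: le_lt_trans e0.
      have ll : 0 < lam A y < 1 by rewrite l0.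
      have i : cform a y 0 <= 1.
        by apply: le_trans (ltW fy); apply: form_le => //.
      rewrite lam_chain// newlam_inner//.
      have kl : k%:R <= leaf y.
        rewrite leNgt; apply/negP => c; have := form_incr a_incr l0 (leaf_ge0 y) c.
        by rewrite (leaf_inner l0 i) ltNge (ltW fy).
      have h := cform'_gt l0 (leaf_ge0 y); have h0 := lt_trans l0 h.
      rewrite ltr_pdivrMr// mulrC -ltr_pdivrMr// mulrC.
      apply: lt_le_trans (form_gt l0 hk) _; apply: form_le => //.
    apply: (@tet_cvg R tet) => i; apply: (@contP R tet) => e e0; rewrite Kx.
    apply: filterS (small _ e0) => y hy.
    have [->|iu] := eqVneq i u.
      have cu z : crd z u = 1 - lam A z.
        by rewrite -lamC (eq_bigl (pred1 u)) ?big_pred1_eq// => j; rewrite inE.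
      rewrite !cu lx; have -> : 1 - 0 - (1 - lam A (K y)) = lam A (K y) by ring.
      by rewrite ger0_norm ?lam_ge0.
    rewrite xj// sub0r normrN ger0_norm ?crd_ge0//; apply: le_lt_trans hy.
    rewrite lam1 (bigD1 i)//= lerDl sumr_ge0// => j _; exact: crd_ge0.
  + have h : 1 < cform a x 0.
      have l0 : 0 < lam A x by rewrite lx.
      by have := @form_gt a x 1 0%N l0 (a_gt1 0%N); rewrite lx mul1r.
    have e : \forall y \near x, K y = y.
      apply: filterS (@cont_gt R tet _ _ _ (@form_continuous a 0 x) h) => y hy.
      by apply: chain_outer => _; exact: ltW.
    by apply: (@cont_near tet tet) e _; exact: cvg_id.
- by move=> x l; rewrite /K (negbTE l).
- by move=> x l; rewrite lam_chain// newlam01//; split=> //; rewrite /K l.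
- move=> x m l /andP[m0 m1]; have /andP[l0 l1] := l.
  have ms : 0 < m < 1 by rewrite (lt_trans l0 m0).
  have ms' : 0 <= m <= 1 by case/andP: ms => *; rewrite !ltW.
  have ly : 0 < lam A (ray A x m) < 1 by rewrite lam_ray.
  have ly0 : 0 < lam A (ray A x m) by case/andP: ly.
  have mp : 0 < m by case/andP: ms.
  have fr b r := form_ray b r l ms'.
  have mm : 1 < m / lam A x by rewrite ltr_pdivlMr// mul1r.
  rewrite !lam_chain//.
  have [xout|xin] := leP 1 (cform a x 0).
    have yout : 1 <= cform a (ray A x m) 0 by rewrite fr; rewrite (le_trans xout)// ler_peMl ?(ltW mm)// (le_trans _ xout).
    by rewrite !newlam_outer// lam_ray.
  rewrite (newlam_inner l0 (ltW xin)).
  have h := cform'_gt l0 (leaf_ge0 x); have h0 := lt_trans l0 h.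
  have [yout|yin] := leP 1 (cform a (ray A x m) 0).
    rewrite newlam_outer// lam_ray// ltr_pdivrMr//.
    rewrite fr in yout.
    have lp : 0 < leaf x.
      rewrite lt_def leaf_ge0 andbT; apply/eqP => e; have := leaf_inner l0 (ltW xin).
      by rewrite e => e'; rewrite e' ltxx in xin.
    have i1 : cform a x 0 < cform a' x (leaf x) by rewrite form0; apply: form_incr => //.
    have i2 : lam A x <= m * cform a x 0.
      by move: yout; rewrite mulrAC ler_pdivlMr// mul1r.
    by apply: le_lt_trans i2 _; rewrite ltr_pM2l.
  rewrite (newlam_inner ly0 (ltW yin)) lam_ray// fr.
  set s := leaf (ray A x m).
  have hs := cform'_gt l0 (leaf_ge0 (ray A x m)); rewrite -/s in hs; have hs0 := lt_trans l0 hs.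
  have -> : m / (m / lam A x * cform a' x s) = lam A x / cform a' x s by field; rewrite !gt_eqF.
  rewrite ltr_pM2l// ltf_pV2 ?posrE//; apply: form_incr => //; [exact: leaf_ge0|].
  (* Moving away from [u] multiplies the form by a factor above 1, so the value 1 is reached at a
     smaller parameter. *)
  rewrite ltNge; apply/negP => c.
  have e1 : m / lam A x * cform a x s = 1 by rewrite -fr leaf_inner// ltW.
  have e2 := leaf_inner l0 (ltW xin).
  have := form_le a_incr l0 (leaf_ge0 x) c; rewrite e2 => c1.
  have : 1 < m / lam A x * cform a x s by rewrite (lt_le_trans mm)// ler_peMr// ltW// (lt_trans _ mm).
  by rewrite e1 ltxx.
Qed.

End Chain.

Lemma id_ray_map (R : realType) A : ray_map A (id : tetrahedron R -> tetrahedron R).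
Proof.
split=> //.
- by move=> x; exact: cvg_id.
- by move=> x l; rewrite ray_lam.
- move=> x m l /andP[m0 m1]; rewrite /= lam_ray//.
  by case/andP: l => l0 _; rewrite (ltW (lt_trans l0 m0)) ltW.
Qed.

Lemma tri_form_tri (R : realType) (u : 'I_4) (p : 'I_4 -> 'I_4 -> R) x m :
  0 < lam [set u]%SET x < 1 -> 0 <= m <= 1 ->
  tri_form u p (ray [set u]%SET x m) = m / lam [set u]%SET x * tri_form u p x.
Proof.
move=> l m01; rewrite tri_form_ray// big_pred0 => [|j]; last by rewrite inE andNb.
by rewrite mulr0 add0r; congr (_ * _); apply: eq_bigl => j; rewrite inE andbb.
Qed.

Lemma crd_lam1 (R : realType) (v : 'I_4) (x : tetrahedron R) : crd x v = 1 - lam [set v]%SET x.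
Proof. by rewrite -lamC (eq_bigl (pred1 v)) ?big_pred1_eq// => j; rewrite inE. Qed.

(** * Rescaling of chains compatible with the gluing *)

Section ChainStep.
Variables (R : realType) (n : nat) (Phi : set (face_isometry R n)).
Notation tet := (tetrahedron R).
Notation pos := ('I_4 -> 'I_4 -> R).
Notation quo := (quotient_map (R:=R) (n:=n) Phi).
Variables (ty : set tet -> {set 'I_4}) (DD : 'I_n -> set (set tet)) (p0 : 'I_n -> set tet -> pos).
Implicit Types (x y : tet) (t : 'I_n) (D E : set tet).

Section tritri.
Variables (p : 'I_n -> set tet -> pos) (t : 'I_n).
Hypothesis stp : stack ty (DD t) (p t).

Lemma tri_outer D E u x : DD t D -> DD t E -> ty D = [set u]%SET -> ty E <> [set u]%SET ->
  disc (ty E) (p t E) x -> 1 < tri_form u (p t D) x.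
Proof.
move=> dD dE eD ne; apply: tri_outside.
- exact: stack_dtype stp _ dE.
- exact/eqP.
- apply/eqP => e; have := stack_dtype stp dE; rewrite e /dtype.
  by have := cardsC1 u; rewrite card_ord => ->.
- exact: stack_pos stp _ dD.
- exact: stack_pos stp _ dE.
- exact: stack_antisym stp _ dE.
- by move=> j sj; apply: (tri_inside stp dD dE eD) => //; rewrite eD.
Qed.

(** On the ray from [v] through [x], the form at [u] exceeds 1 both at [v] and where the ray meets
    the triangle [E], hence also at [x], which lies in between. This keeps the chains at different
    vertices apart. *)
Lemma tri_tri_outside D E u v x : DD t D -> DD t E -> ty D = [set u]%SET -> ty E = [set v]%SET ->
  u != v -> 0 < lam [set v]%SET x < 1 -> tri_form u (p t D) x < 1 -> tri_form v (p t E) x < 1 -> False.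
Proof.
move=> dD dE eD eE uv l hD hE.
have tv : dtype [set v]%SET by rewrite /dtype cards1.
have [pD pE] := (stack_pos stp dD, stack_pos stp dE).
have sE := surface_disc tv pE; have [m01 dm] := levelP sE l.
set m := level _ _ _ in m01 dm; have mi : 0 <= m <= 1 by case/andP: m01 => *; rewrite !ltW.
have o1 : 1 < tri_form u (p t D) (ray [set v]%SET x m).
  apply: (tri_outer dD dE eD) => //; last by rewrite eE.
  by rewrite eE => /setP/(_ v); rewrite !inE eqxx eq_sym (negbTE uv).
have lm : lam [set v]%SET x <= m.
  have := dm; rewrite (disc_tri_form _ _ pE) tri_form_tri// => e.
  have l0 : 0 < lam [set v]%SET x by case/andP: l.
  have F0 : 0 <= tri_form v (p t E) x.
    by apply: sumr_ge0 => j _; rewrite divr_ge0 ?crd_ge0// ltW//; case/andP: (pE v j).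
  rewrite leNgt; apply/negP => lt.
  have h1 : m / lam [set v]%SET x < 1 by rewrite ltr_pdivrMr// mul1r.
  have h2 : 0 <= m / lam [set v]%SET x by rewrite divr_ge0 ?ltW//; case/andP: m01.
  have : m / lam [set v]%SET x * tri_form v (p t E) x < 1.
    by apply: le_lt_trans hE; rewrite ler_piMl// ltW.
  by rewrite e ltxx.
have o2 : 1 < tri_form u (p t D) (ray [set v]%SET x 0).
  rewrite tri_form_ray ?lexx ?ler01// mul0r mul0r addr0 subr0 (big_pred1 v) => [|j]; last first.
    by rewrite inE andbC /=; case: eqVneq => //= ->; rewrite eq_sym uv.
  rewrite crd_lam1 mul1r mulKf; last by rewrite subr_eq0 gt_eqF//; case/andP: l.
  by rewrite invf_gt1//; case/andP: (pD u v).
move: o1 o2; rewrite !tri_form_ray ?lexx ?ler01//.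
set X := \sum_(j | _) _; set Y := \sum_(j | _) _ => o1 o2.
have : 1 < tri_form u (p t D) (ray [set v]%SET x (lam [set v]%SET x)).
  rewrite tri_form_ray ?lam_ge0 ?lam_le1// -/X -/Y.
  rewrite !(mulrAC _ (_^-1)) -!mulrA; apply: (@affine_between R _ _ 0 m) => //; first exact: lam_ge0.
    by move: o2; rewrite !(mulrAC _ (_^-1)) -!mulrA.
  by move: o1; rewrite !(mulrAC _ (_^-1)) -!mulrA.
by rewrite ray_lam// ltNge (ltW hD).
Qed.

End tritri.

Section step.
Variables (p q : 'I_n -> set tet -> pos) (inf : 'I_n -> 'I_4 -> bool)
  (Dn : 'I_n -> 'I_4 -> nat -> set tet).
Hypotheses (stp : forall t, stack ty (DD t) (p t)) (stq : forall t, stack ty (DD t) (q t))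
  (cp : compatible Phi ty DD p0 p) (cq : compatible Phi ty DD p0 q) (hm : has_mates Phi ty DD p0).
Hypotheses
  (DnD : forall t u k, inf t u -> DD t (Dn t u k) /\ ty (Dn t u k) = [set u]%SET)
  (Dn_surj : forall t u D, inf t u -> DD t D -> ty D = [set u]%SET -> exists k, D = Dn t u k)
  (p_decr : forall t u k j, inf t u -> j != u -> p t (Dn t u k.+1) u j < p t (Dn t u k) u j)
  (q_decr : forall t u k j, inf t u -> j != u -> q t (Dn t u k.+1) u j < q t (Dn t u k) u j)
  (p_lim : forall t u e, inf t u -> 0 < e -> exists k, forall j, j != u -> p t (Dn t u k) u j < e)
  (q_lim : forall t u e, inf t u -> 0 < e -> exists k, forall j, j != u -> q t (Dn t u k) u j < e)
  (unmoved : forall t D, DD t D -> (forall u k, inf t u -> D <> Dn t u k.+1) ->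
     forall i j, sep (ty D) i j -> p t D i j = q t D i j).

(** The entry [k + 2] at [j = u] is a filler that is above 1, increasing and unbounded like the
    others; [cform] sums over the other indices. *)
Definition inverses (r : 'I_n -> set tet -> pos) t u k j : R :=
  if j == u then k%:R + 2 else (r t (Dn t u k) u j)^-1.

Let K t u : tet -> tet :=
  if inf t u then chain_slide u (inverses p t u) (inverses q t u) else id.

Section inverses.
Variables (r : 'I_n -> set tet -> pos) (t : 'I_n) (u : 'I_4).
Hypotheses (r_pos : forall k j, j != u -> 0 < r t (Dn t u k) u j < 1)
  (r_decr : forall k j, j != u -> r t (Dn t u k.+1) u j < r t (Dn t u k) u j)
  (r_lim : forall e, 0 < e -> exists k, forall j, j != u -> r t (Dn t u k) u j < e).

Lemma inverses_incr k j : inverses r t u k j < inverses r t u k.+1 j.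
Proof.
rewrite /inverses; case: eqVneq => [_|ju]; first by rewrite ltrD2r ltr_nat.
have /andP[a0 _] := r_pos k ju; have /andP[b0 _] := r_pos k.+1 ju.
by rewrite ltf_pV2 ?posrE//; exact: r_decr.
Qed.

Lemma inverses_gt1 k j : 1 < inverses r t u k j.
Proof.
rewrite /inverses; case: eqVneq => [_|ju].
  by rewrite ltr_wpDl ?ler0n// ltr1n.
by have /andP[a0 a1] := r_pos k ju; rewrite invf_gt1.
Qed.

Lemma inverses_unb C : exists k, forall j, C < inverses r t u k j.
Proof.
have e0 : 0 < (Num.max C 1)^-1 by rewrite invr_gt0 lt_max ltr01 orbT.
have [k hk] := r_lim e0; pose N := Num.truncn (Num.max C 1).
have mono m j : inverses r t u k j <= inverses r t u (m + k)%N j.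
  by elim: m => [//|m IH]; apply: le_trans IH (ltW _); rewrite addSn; exact: inverses_incr.
exists (N + k)%N => j; have [->|ju] := eqVneq j u.
  rewrite /inverses eqxx; apply: le_lt_trans (_ : Num.max C 1 < _); first by rewrite le_max lexx.
  apply: lt_le_trans (truncnS_gt _) _; rewrite -/N -natr1 natrD.
  by have h := ler0n R k; lra.
apply: lt_le_trans (mono N j); rewrite /inverses (negbTE ju).
have /andP[a0 a1] := r_pos k ju.
apply: le_lt_trans (_ : Num.max C 1 < _); first by rewrite le_max lexx.
by rewrite -[ltLHS]invrK ltf_pV2 ?posrE//; exact: hk.
Qed.

Lemma form_inverses x k : cform u (inverses r t u) x k%:R = tri_form u (r t (Dn t u k)) x.
Proof.
by rewrite form_nat; apply: eq_bigr => j ju; rewrite /inverses (negbTE ju).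
Qed.

Lemma form_inverses0 x : cform u (inverses r t u) x 0 = tri_form u (r t (Dn t u 0%N)) x.
Proof. exact: (form_inverses x 0). Qed.

End inverses.

Let ppos t u k j : inf t u -> j != u -> 0 < p t (Dn t u k) u j < 1.
Proof. by move=> i _; exact: (stack_pos (stp t) (DnD k i).1 u j). Qed.

Let qpos t u k j : inf t u -> j != u -> 0 < q t (Dn t u k) u j < 1.
Proof. by move=> i _; exact: (stack_pos (stq t) (DnD k i).1 u j). Qed.

Let tri_index t D u v k : ty D = [set u]%SET -> inf t v -> D = Dn t v k -> v = u.
Proof.
move=> eD i e; have [_] := DnD k i; rewrite -e eD => /setP/(_ v).
by rewrite !inE eqxx => /eqP.
Qed.

(** Positions decrease strictly along the chain, so its head differs from all the discs
    [Dn t v k.+1] that may move. *)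
Let head_fixed t u j : inf t u -> j != u -> p t (Dn t u 0%N) u j = q t (Dn t u 0%N) u j.
Proof.
move=> i ju; have [dD eD] := DnD 0%N i; apply: unmoved => //; last first.
  by rewrite eD /sep !inE eqxx (negbTE ju).
move=> v k iv e; have vu := tri_index eD iv e; subst v.
have inc m : (0 < m)%N -> p t (Dn t u m) u j < p t (Dn t u 0%N) u j.
  elim: m => // -[_ _|m IH _]; first exact: p_decr.
  by apply: lt_trans (IH isT); exact: p_decr.
by have := inc k.+1 isT; rewrite -e ltxx.
Qed.

Let Kdata t u : inf t u ->
  [/\ (forall k j, inverses p t u k j < inverses p t u k.+1 j),
      (forall k j, inverses q t u k j < inverses q t u k.+1 j),
      (forall k j, 1 < inverses p t u k j), (forall k j, 1 < inverses q t u k j) &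
   [/\ (forall C, exists k, forall j, C < inverses p t u k j),
       (forall C, exists k, forall j, C < inverses q t u k j) &
       (forall j, inverses p t u 0%N j = inverses q t u 0%N j)]].
Proof.
move=> i; split; [| | | |split].
- by apply: inverses_incr => [k j ju|k j ju]; [exact: ppos|exact: p_decr].
- by apply: inverses_incr => [k j ju|k j ju]; [exact: qpos|exact: q_decr].
- by apply: inverses_gt1 => k j ju; exact: ppos.
- by apply: inverses_gt1 => k j ju; exact: qpos.
- by apply: inverses_unb => [k j ju|k j ju|e e0]; [exact: ppos|exact: p_decr|exact: p_lim].
- by apply: inverses_unb => [k j ju|k j ju|e e0]; [exact: qpos|exact: q_decr|exact: q_lim].
- by move=> j; rewrite /inverses; case: eqVneq => // ju; rewrite head_fixed.
Qed.

Let K_ray t u : ray_map [set u]%SET (K t u).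
Proof.
rewrite /K; case: ifP => [i|_]; last exact: id_ray_map.
by have [a1 a2 a3 a4 [a5 a6 a7]] := Kdata i; exact: chain_ray_map.
Qed.

Let K_moved t u x : K t u x <> x ->
  [/\ inf t u, 0 < lam [set u]%SET x < 1 & tri_form u (p t (Dn t u 0%N)) x < 1].
Proof.
rewrite /K; case: ifP => // i mv; have [a1 a2 a3 a4 [a5 a6 a7]] := Kdata i.
split=> //; first by apply/negPn/negP => nl; apply: mv; rewrite /chain_slide (negbTE nl).
rewrite ltNge; apply/negP => h; apply: mv; apply: chain_outer => // _.
by rewrite form_inverses0.
Qed.

Let h t : tet -> tet := combine (K t).

Let hdisj t (u v : 'I_4) x : u != v -> K t u x <> x -> K t v x = x.
Proof.
move=> uv mu; apply: contrapT => mv.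
have [iu lu hu] := K_moved mu; have [iv lv hv] := K_moved mv.
have [du eu] := DnD 0%N iu; have [dv ev] := DnD 0%N iv.
exact: (tri_tri_outside (stp t) du dv eu ev uv lv hu hv).
Qed.

Let outer_fix t u D x : DD t D -> ty D <> [set u]%SET -> disc (ty D) (p t D) x -> K t u x = x.
Proof.
move=> dD ne dx; apply: contrapT => mv; have [i l hl] := K_moved mv.
have [d0 e0] := DnD 0%N i.
by have := tri_outer (stp t) d0 dD e0 ne dx; rewrite ltNge (ltW hl).
Qed.

Let K_disc t u k x : inf t u -> disc [set u]%SET (p t (Dn t u k)) x ->
  K t u x = ray [set u]%SET x (lam [set u]%SET (K t u x)) /\ disc [set u]%SET (q t (Dn t u k)) (K t u x).
Proof.
move=> i dx; have [a1 a2 a3 a4 [a5 a6 a7]] := Kdata i.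
have [dD eD] := DnD k i; have pD := stack_pos (stp t) dD; have qD := stack_pos (stq t) dD.
have tu : dtype [set u]%SET by rewrite /dtype cards1.
have l := surface_lam (surface_disc tu pD) dx.
have [rl re] : 0 < lam [set u]%SET (K t u x) < 1 /\ K t u x = ray [set u]%SET x (lam [set u]%SET (K t u x)).
  by have [_ _ + _] := K_ray t u; exact.
split=> //; have f1 : cform u (inverses p t u) x k%:R = 1 by rewrite form_inverses; apply/(disc_tri_form _ _ pD).
have := @chain_strip R u _ (inverses q t u) a1 a5 x k 0 l.
rewrite lexx ler01 subr0 !mul1r !mul0r !addr0 f1 => /(_ isT erefl).
rewrite form_inverses => e; apply/(disc_tri_form _ _ qD); rewrite re tri_form_tri//; last first.
  by case/andP: rl => *; rewrite !ltW.
have Kl : lam [set u]%SET (K t u x) = lam [set u]%SET x / tri_form u (q t (Dn t u k)) x.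
  rewrite {1}/K i e lam_ray//.
  have F1 : 1 < (tri_form u (q t (Dn t u k)) x) / lam [set u]%SET x.
    rewrite -form_inverses ltr_pdivlMr; last by case/andP: l.
    rewrite mul1r; have := @form_gt R u (inverses q t u) x 1 k; rewrite mul1r; apply; last exact: a4.
    by case/andP: l.
  have l0 : 0 < lam [set u]%SET x by case/andP: l.
  have F0 : 0 < tri_form u (q t (Dn t u k)) x.
    by move: F1; rewrite ltr_pdivlMr// mul1r; exact: lt_trans.
  by rewrite divr_ge0 ?(ltW l0) ?(ltW F0)//= ler_pdivrMr// mul1r; move: F1; rewrite ltr_pdivlMr// mul1r => /ltW.
rewrite Kl; have l0 : lam [set u]%SET x != 0 by rewrite gt_eqF//; case/andP: l.
have F0 : tri_form u (q t (Dn t u k)) x != 0.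
  apply/eqP => F0; move: rl; rewrite Kl F0 invr0 mulr0 ltxx.
  by [].
by field; rewrite F0 l0.
Qed.

Let K_disc_image t u k : inf t u ->
  K t u @` disc [set u]%SET (p t (Dn t u k)) = disc [set u]%SET (q t (Dn t u k)).
Proof.
move=> i; have [dD eD] := DnD k i; have pD := stack_pos (stp t) dD; have qD := stack_pos (stq t) dD.
have tu : dtype [set u]%SET by rewrite /dtype cards1.
have [sp sq] := (surface_disc tu pD, surface_disc tu qD).
apply/seteqP; split=> [_ [x dx <-]|y dy]; first exact: (K_disc i dx).2.
have l := surface_lam sq dy; have [m01 dm] := levelP sp l.
exists (ray [set u]%SET y (level [set u]%SET (disc [set u]%SET (p t (Dn t u k))) y)) => //.
set x := ray _ _ _ in dm *; have [re dK] := K_disc i dm.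
have mi : 0 <= level [set u]%SET (disc [set u]%SET (p t (Dn t u k))) y <= 1 by case/andP: m01 => *; rewrite !ltW.
have lx : 0 < lam [set u]%SET x < 1 by rewrite lam_ray.
have lK := surface_lam sq dK.
have := level_uniq sq lx lK; rewrite -re => /(_ dK).
rewrite level_ray// (level_lam sq dy) => e.
by rewrite re -e ray_ray ?ray_lam ?lam_ge0 ?lam_le1.
Qed.

Let h_disc t D : DD t D -> h t @` disc (ty D) (p t D) = disc (ty D) (q t D).
Proof.
move=> dD; have [[u [i eD]]|nu] := pselect (exists u, inf t u /\ ty D = [set u]%SET).
  have [k ek] := Dn_surj i dD eD; rewrite eD ek -K_disc_image//.
  apply: eq_imagel => x dx; have [fx|mv] := pselect (K t u x = x).
    rewrite fx; apply: combine_fixed => v; have [->//|vu] := eqVneq v u.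
    apply: (@outer_fix t v D) => //; last by rewrite eD ek.
    by rewrite eD => /setP/(_ v); rewrite !inE eqxx (negbTE vu).
  exact: (combine_moved (@hdisj t)).
rewrite -(@disc_ext _ _ (p t D)) => [|i j iA jA].
  rewrite -[RHS]image_id; apply: eq_imagel => x dx; apply: combine_fixed => v.
  apply: contrapT => mv; have [i _ _] := K_moved mv; apply: mv.
  by apply: outer_fix dx => // e; apply: nu; exists v.
apply: unmoved => //; last exact: sep_in.
by move=> u k iu e; apply: nu; exists u; split=> //; rewrite e; exact: (DnD _ iu).2.
Qed.

Let decr t u i j k : inf t u -> j != u -> (i < k)%N -> p t (Dn t u k) u j < p t (Dn t u i) u j.
Proof.
move=> iu ju; elim: k => // k IH; rewrite ltnS leq_eqVlt => /predU1P[->|/IH lt]; first exact: p_decr.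
by apply: lt_trans lt; exact: p_decr.
Qed.

(** A triangle at [u] is a member of the chain, and a disc of any other type crosses the edge beyond
    every triangle at [u]. *)
Let no_between t u i D l m f : inf t u -> uniq [:: u; l; m; f] -> DD t D -> sep (ty D) u l ->
  p t (Dn t u i.+1) u l < p t D u l -> p t D u l < p t (Dn t u i) u l -> False.
Proof.
move=> iu un dD s1 lt1 lt2; have [[lu _ _] _] := uniq4 un.
have [eD|ne] := pselect (ty D = [set u]%SET).
  have [k e] := Dn_surj iu dD eD; subst D.
  case: (ltngtP k i) => [ki|ik|ki].
  - by have := lt_trans lt2 (decr iu lu ki); rewrite ltxx.
  - move: ik; rewrite leq_eqVlt => /predU1P[ki|ki].
      by rewrite -ki ltxx in lt1.
    by have := lt_trans lt1 (decr iu lu ki); rewrite ltxx.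
  - by rewrite ki ltxx in lt2.
have [di ei] := DnD i iu.
have := tri_inside (stp t) di dD ei; rewrite ei => /(_ l ne s1) lt3.
by have := lt_trans lt2 lt3; rewrite ltxx.
Qed.

Let around_tri (k l m f : 'I_4) A w : uniq [:: k; l; m; f] -> sep A k l -> sep A k m ->
  A = [set w]%SET -> w = k.
Proof.
move=> un s1 s2 e; subst A; have [[lk mk fk] [ml fl fm]] := uniq4 un.
move: s1 s2; rewrite /sep !inE; have [//|kw] := eqVneq k w.
have [<-|//] := eqVneq l w; by rewrite (negbTE ml).
Qed.

(** A moved point lies in a strip between two consecutive triangles. The discs glued to them turn
    out to be consecutive in a chain on the other side, so both maps are given by the same strip
    formula. *)
Let h_act1 t f t' (s : {perm 'I_4}) x : matched Phi t f t' s -> face f x -> h t x <> x ->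
  h t' (act s x) = act s (h t x).
Proof.
move=> mt /face_crd xf hx.
have [u mv] : exists u, K t u x <> x.
  by apply: contrapT => H; apply: hx; apply: combine_fixed => u; apply: contrapT => mv; apply: H; exists u.
have [iu lx hx1] := K_moved mv.
have uf : u != f.
  apply/eqP => e; subst u; move: lx; rewrite -[lam _ _](subKr 1) -crd_lam1 xf subr0 ltxx andbF.
  by [].
have [l [m un0]] := complete2 uf.
have un : uniq [:: u; l; m; f].
  have [[h1 h2 h3] [h4 h5 h6]] := uniq4 un0.
  by rewrite /= !inE !negb_or ![u == _]eq_sym h2 h3 h1 ![_ == f]eq_sym ![f == _]eq_sym h4 h5 eq_sym h6.
have un' := uniq_map4 s un.
have [[lu mu fu] _] := uniq4 un; have [[lu' mu' fu'] _] := uniq4 un'.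
have [a1 a2 a3 a4 [a5 a6 a7]] := Kdata iu.
have in0 : cform u (inverses p t u) x 0 <= 1.
  by rewrite form_inverses0 ltW.
have [i [r [r01 er]]] := chain_strip_ex a1 a5 lx in0.
have Kx := chain_strip (inverses q t u) a1 a5 lx r01 er.
have [dD eD] := DnD i iu; have [dD' eD'] := DnD i.+1 iu.
have su (b : 'I_4) : b != u -> sep [set u]%SET u b by move=> bu; rewrite /sep !inE eqxx (negbTE bu).
have [E mE] : exists E, mates Phi ty DD p0 t f t' s u l m (Dn t u i) E.
  by apply: hm => //; rewrite eD; exact: su.
have [E' mE'] : exists E', mates Phi ty DD p0 t f t' s u l m (Dn t u i.+1) E'.
  by apply: hm => //; rewrite eD'; exact: su.
have [_ _ [_ dE] [_ _ s3 s4] _] := mE; have [_ _ [_ dE'] [_ _ s3' s4'] _] := mE'.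
have [c1 c2] := cp mE; have [c3 c4] := cq mE.
have [c1' c2'] := cp mE'; have [c3' c4'] := cq mE'.
(* If both mates stayed in place, the old and new forms of the two triangles would agree at [x], and
   [x] would be fixed. *)
have mvE : ~ ((forall w k, inf t' w -> E <> Dn t' w k.+1) /\ (forall w k, inf t' w -> E' <> Dn t' w k.+1)).
  move=> [fE fE']; apply: mv; rewrite /K iu Kx.
  have e1 := unmoved dE fE s3; have e2 := unmoved dE fE s4.
  have e3 := unmoved dE' fE' s3'; have e4 := unmoved dE' fE' s4'.
  have ff k : p t (Dn t u k) u l = q t (Dn t u k) u l -> p t (Dn t u k) u m = q t (Dn t u k) u m ->
      cform u (inverses p t u) x k%:R = cform u (inverses q t u) x k%:R.
    by move=> g1 g2; rewrite !form_inverses !(tri_form4 _ _ un) g1 g2 xf !mul0r.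
  rewrite -!ff ?er ?divr1 ?ray_lam//; first by rewrite c1' c3'.
  - by rewrite c2' c4'.
  - by rewrite c1 c3.
  - by rewrite c2 c4.
(* No arc lies between those of [E'] and [E], since its mate would lie between two consecutive
   triangles. *)
have back G : DD t' G -> sep (ty G) (s u) (s l) -> sep (ty G) (s u) (s m) ->
    p t' E' (s u) (s l) < p t' G (s u) (s l) -> p t' G (s u) (s l) < p t' E (s u) (s l) -> False.
  move=> dG g1 g2 lt1 lt2.
  have [G0 mG] := hm (matched_inv mt) un' dG g1 g2.
  have [_ _ [_ dG0] [_ _ t1 t2] _] := mG; have [b1 _] := cp mG.
  rewrite !permK in t1 b1; rewrite b1 -c1' in lt1; rewrite b1 -c1 in lt2.
  exact: (no_between iu un dG0 t1 lt1 lt2).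
have ltE : p t' E' (s u) (s l) < p t' E (s u) (s l) by rewrite -c1 -c1'; exact: p_decr.
(* If [E] were of another type, then [E'] would be a moved triangle [Dn k.+1], and its predecessor
   [Dn k] would lie between [E'] and [E]. *)
have tyE : ty E = [set s u]%SET.
  apply: contrapT => ne; apply: mvE; split=> w k iw e.
    have [_ ew] := DnD k.+1 iw; rewrite -e in ew.
    by apply: ne; rewrite ew (around_tri un' s3 s4 ew).
  have [_ ew] := DnD k.+1 iw; rewrite -e in ew.
  have wE := around_tri un' s3' s4' ew; subst w.
  have [dG eG] := DnD k iw.
  have suG (b : 'I_4) : b != s u -> sep [set s u]%SET (s u) b by move=> bu; rewrite /sep !inE eqxx (negbTE bu).
  apply: (back (Dn t' (s u) k)) => //; try by rewrite eG; exact: suG.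
    by rewrite e; exact: p_decr.
  by apply: (tri_inside (stp t') dG dE eG) => //; rewrite eG.
have tyE' : ty E' = [set s u]%SET.
  apply: contrapT => ne.
  have := tri_inside (stp t') dE dE' tyE; rewrite tyE => /(_ (s l) ne s3') lt3.
  by have := lt_trans ltE lt3; rewrite ltxx.
have iu' : inf t' (s u).
  apply/negPn/negP => ni; apply: mvE; split=> w k iw e; have [_ ew] := DnD k.+1 iw; rewrite -e in ew.
    by rewrite (around_tri un' s3 s4 ew) (negbTE ni) in iw.
  by rewrite (around_tri un' s3' s4' ew) (negbTE ni) in iw.
have [b eb] := Dn_surj iu' dE tyE; have [b' eb'] := Dn_surj iu' dE' tyE'.
(* A larger gap between the indices would leave the triangle [Dn b.+1] between [E'] and [E]. *)
have bb' : b' = b.+1.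
  rewrite eb eb' in ltE.
  case: (ltngtP b' b.+1) => // lt.
    move: lt; rewrite ltnS leq_eqVlt => /predU1P[e|lt]; first by rewrite e ltxx in ltE.
    by have := lt_trans ltE (decr iu' lu' lt); rewrite ltxx.
  exfalso; have [dG eG] := DnD b.+1 iu'.
  have suG (c : 'I_4) : c != s u -> sep [set s u]%SET (s u) c by move=> bu; rewrite /sep !inE eqxx (negbTE bu).
  apply: (back (Dn t' (s u) b.+1)) => //; try by rewrite eG; exact: suG.
    by rewrite eb'; exact: decr.
  by rewrite eb; exact: p_decr.
subst b' E E'.
have ar : around u f [set u]%SET by left. have ar' : around (s u) (s f) [set s u]%SET by left.
have formE (g : 'I_n -> set tet -> pos) k k' :
    g t (Dn t u k) u l = g t' (Dn t' (s u) k') (s u) (s l) -> g t (Dn t u k) u m = g t' (Dn t' (s u) k') (s u) (s m) ->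
    cform (s u) (inverses g t' (s u)) (act s x) k'%:R = cform u (inverses g t u) x k%:R.
  move=> g1 g2; rewrite !form_inverses (tri_form4 _ _ un) (tri_form4 _ _ un') !crd_act g1 g2 xf !mul0r.
  by [].
have [_ _ rK _] := K_ray t u.
have [lK Kr] := rK x lx.
have K01 : 0 <= lam [set u]%SET (K t u x) <= 1 by case/andP: lK => z0 z1; rewrite (ltW z0) (ltW z1).
have [b1 b2 b3 b4 [b5 b6 b7]] := Kdata iu'.
have lE := (ray_act un ar ar' xf lx K01).1.
have lx' : 0 < lam [set s u]%SET (act s x) < 1 by rewrite lE.
have er' : (1 - r) * cform (s u) (inverses p t' (s u)) (act s x) b%:R
    + r * cform (s u) (inverses p t' (s u)) (act s x) b.+1%:R = 1.
  by rewrite (formE p i b)// (formE p i.+1 b.+1).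
have KE : K t' (s u) (act s x) = act s (K t u x).
  have Kl : lam [set u]%SET (K t u x) =
      lam [set u]%SET x / ((1 - r) * cform u (inverses q t u) x i%:R + r * cform u (inverses q t u) x i.+1%:R).
    have l0 : 0 < lam [set u]%SET x by case/andP: lx.
    have ir0 : 0 <= i%:R + r by case/andP: r01 => r0 _; rewrite addr_ge0.
    have := cform'_gt a2 a4 l0 ir0; rewrite form_strip// => w1.
    have w0 := lt_trans l0 w1; have {}w1 := ltW w1.
    rewrite /K iu Kx lam_ray//.
    by rewrite divr_ge0 ?lam_ge0 ?(ltW w0)//= ler_pdivrMr// mul1r.
  rewrite /K iu' (chain_strip (inverses q t' (s u)) b1 b5 lx' r01 er') lE.
  rewrite (formE q i b)// (formE q i.+1 b.+1)// -Kl (ray_act un ar ar' xf lx K01).2 -Kr.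
  by rewrite /K iu.
rewrite /h (combine_moved (@hdisj t) mv) (combine_moved (@hdisj t') (i := s u)) ?KE// => k1.
by apply: mv; rewrite -[LHS](actK s) k1 actK.
Qed.

Lemma chain_step : normally_isotopic (@realize R n Phi ty DD p) (@realize R n Phi ty DD q).
Proof.
have -> : @realize R n Phi ty DD q = \bigcup_t (quo t @` (h t @` (\bigcup_(D in DD t) disc (ty D) (p t D)))).
  apply: eq_bigcupr => t _; congr image; rewrite image_bigcup.
  by apply: eq_bigcupr => D dD; rewrite h_disc.
apply: sliding_normally_isotopic.
  by move=> t; exact: combine_sliding (@K_ray t) (@hdisj t).
move=> t f t' s x mt fx.
have [fix1|] := pselect (h t x = x); last exact: (h_act1 mt fx).
have [fix2|mv2] := pselect (h t' (act s x) = act s x); first by rewrite fix1 fix2.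
have := h_act1 (matched_inv mt) (face_act (s := s) fx) mv2.
by rewrite actK => ->; rewrite actKV.
Qed.

End step.
End ChainStep.

(** * Shape of a normal disc *)

Section PuncturedCircle.
Variable R : realType.

(** Stereographic parametrisation, by the whole line, of the circle without [z]: the point [z]
    turned by the angle with cosine [c] and sine [s]. *)
Definition stereo (z : R * R) (r : R) : R * R :=
  let c := (r ^+ 2 - 1) / (r ^+ 2 + 1) in let s := 2 * r / (r ^+ 2 + 1) in
  (z.1 * c - z.2 * s, z.1 * s + z.2 * c).

Lemma sqr1_gt0 (r : R) : 0 < r ^+ 2 + 1.
Proof. by rewrite ltr_wpDl ?sqr_ge0. Qed.

Lemma stereo_continuous z : continuous (stereo z).
Proof.
have cs (r : R) : continuous_at r (fun r => r ^+ 2) by exact: exprn_continuous.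
have ci (r : R) : continuous_at r (fun r => (r ^+ 2 + 1)^-1).
  by apply: contV; [rewrite gt_eqF ?sqr1_gt0|apply: contD; [exact: cs|exact: contc]].
have cc (r : R) : continuous_at r (fun r => (r ^+ 2 - 1) / (r ^+ 2 + 1)).
  by apply: contM; [apply: contB; [exact: cs|exact: contc]|exact: ci].
have csn (r : R) : continuous_at r (fun r => 2 * r / (r ^+ 2 + 1)).
  by apply: contM; [apply: contM; [exact: contc|exact: cvg_id]|exact: ci].
move=> r.
have c1 : continuous_at r (fun r => z.1 * ((r ^+ 2 - 1) / (r ^+ 2 + 1)) - z.2 * (2 * r / (r ^+ 2 + 1))).
  by apply: contB; (apply: contM; first exact: contc).
have c2 : continuous_at r (fun r => z.1 * (2 * r / (r ^+ 2 + 1)) + z.2 * ((r ^+ 2 - 1) / (r ^+ 2 + 1))).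
  by apply: contD; (apply: contM; first exact: contc).
exact: (cvg_pair c1 c2).
Qed.

Lemma stereo_circle z r : circle z -> circle (stereo z r).
Proof.
rewrite /circle /stereo /= => e; have n : r ^+ 2 + 1 != 0 by rewrite gt_eqF ?sqr1_gt0.
have -> : (z.1 * ((r ^+ 2 - 1) / (r ^+ 2 + 1)) - z.2 * (2 * r / (r ^+ 2 + 1))) ^+ 2 +
  (z.1 * (2 * r / (r ^+ 2 + 1)) + z.2 * ((r ^+ 2 - 1) / (r ^+ 2 + 1))) ^+ 2 = z.1 ^+ 2 + z.2 ^+ 2 by field.
by [].
Qed.

Lemma stereo_neq z r : circle z -> stereo z r <> z.
Proof.
rewrite /circle /stereo /= => e h; have n : r ^+ 2 + 1 != 0 by rewrite gt_eqF ?sqr1_gt0.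
have e1 := congr1 fst h; have e2 := congr1 snd h; rewrite /= in e1 e2.
have : z.1 * (z.1 * ((r ^+ 2 - 1) / (r ^+ 2 + 1)) - z.2 * (2 * r / (r ^+ 2 + 1))) +
  z.2 * (z.1 * (2 * r / (r ^+ 2 + 1)) + z.2 * ((r ^+ 2 - 1) / (r ^+ 2 + 1))) = 1.
  by rewrite e1 e2 -e; ring.
have -> : z.1 * (z.1 * ((r ^+ 2 - 1) / (r ^+ 2 + 1)) - z.2 * (2 * r / (r ^+ 2 + 1))) +
  z.2 * (z.1 * (2 * r / (r ^+ 2 + 1)) + z.2 * ((r ^+ 2 - 1) / (r ^+ 2 + 1)))
  = (z.1 ^+ 2 + z.2 ^+ 2) * (r ^+ 2 - 1) / (r ^+ 2 + 1) by field.
rewrite e mul1r => /(canRL (divfK n)); rewrite mul1r => h'; lra.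
Qed.

Lemma stereo_surj z w : circle z -> circle w -> w <> z -> exists r, stereo z r = w.
Proof.
rewrite /circle /= => ez ew ne.
pose c := z.1 * w.1 + z.2 * w.2; pose s := z.1 * w.2 - z.2 * w.1.
have cs : c ^+ 2 + s ^+ 2 = 1.
  have -> : c ^+ 2 + s ^+ 2 = (z.1 ^+ 2 + z.2 ^+ 2) * (w.1 ^+ 2 + w.2 ^+ 2) by rewrite /c /s; ring.
  by rewrite ez ew mulr1.
have w1 : w.1 = z.1 * c - z.2 * s.
  have -> : z.1 * c - z.2 * s = (z.1 ^+ 2 + z.2 ^+ 2) * w.1 by rewrite /c /s; ring.
  by rewrite ez mul1r.
have w2 : w.2 = z.1 * s + z.2 * c.
  have -> : z.1 * s + z.2 * c = (z.1 ^+ 2 + z.2 ^+ 2) * w.2 by rewrite /c /s; ring.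
  by rewrite ez mul1r.
have c1 : 1 - c != 0.
  apply/eqP => e; apply: ne; have ce : c = 1 by lra.
  have s0 : s = 0 by apply/eqP; rewrite -sqrf_eq0; apply/eqP; move: cs; rewrite ce expr1n; lra.
  by rewrite (surjective_pairing w) w1 w2 ce s0 !mulr1 !mulr0 subr0 add0r -surjective_pairing.
(* The cotangent of half the angle from [z] to [w]. *)
exists (s / (1 - c)).
have c1' : (1 - c) ^+ 2 != 0 by rewrite expf_neq0.
have s2 : s ^+ 2 = (1 - c) * (1 + c).
  by rewrite (_ : (1 - c) * (1 + c) = 1 - c ^+ 2); [lra|ring].
have e1 : (s / (1 - c)) ^+ 2 = (1 + c) / (1 - c) by rewrite expr_div_n s2; field.
have k1 : ((s / (1 - c)) ^+ 2 - 1) / ((s / (1 - c)) ^+ 2 + 1) = c.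
  rewrite e1; have -> : (1 + c) / (1 - c) - 1 = 2 * c / (1 - c) by field.
  have -> : (1 + c) / (1 - c) + 1 = 2 / (1 - c) by field.
  by field.
have k2 : 2 * (s / (1 - c)) / ((s / (1 - c)) ^+ 2 + 1) = s.
  rewrite e1; have -> : (1 + c) / (1 - c) + 1 = 2 / (1 - c) by field.
  by field.
by rewrite /stereo k1 k2 -w1 -w2 -surjective_pairing.
Qed.

End PuncturedCircle.

Section Segments.
Variable R : realType.
Notation tet := (tetrahedron R).
Implicit Types (x y z : tet).

Definition seg x y : set tet := segment (bary x) (bary y).

Lemma segP x y z : seg x y z <-> exists2 s, 0 <= s <= 1 & forall i, crd z i = (1 - s) * crd x i + s * crd y i.
Proof.
split=> [[s s01 e]|[s s01 e]]; exists s => //.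
  by move=> i; rewrite /crd e !mxE.
by apply/rowP => i; rewrite !mxE; exact: e.
Qed.

Lemma seg_image x y : seg x y = (fun s => slide (fun=> y) (clamp s) x) @` `[0, 1]%classic.
Proof.
apply/seteqP; split=> [z /segP[s s01 e]|_ [s s01 <-]].
  exists s; first by rewrite /= in_itv.
  by apply: crd_inj => i; rewrite crd_slide ?clamp_id// e.
have {}s01 : 0 <= s <= 1 by move: s01; rewrite /= in_itv.
by apply/segP; exists s => // i; rewrite crd_slide ?clamp_id.
Qed.

Lemma seg_closed x y : closed (seg x y).
Proof.
apply: compact_closed; first exact: tet_hausdorff.
rewrite seg_image; apply: continuous_compact; last exact: segment_compact.
apply: continuous_subspaceT => s.
apply: (@continuous_comp _ _ _ (fun s : R => (x, s)) (fun z : tet * R => slide (fun=> y) (clamp z.2) z.1)).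
  exact: pairr_continuous.
by apply: (@slide_continuous R (fun=> y)) => z; exact: cst_continuous.
Qed.

Lemma segC x y : seg x y = seg y x.
Proof.
suff H a b : seg a b `<=` seg b a by apply/seteqP; split; exact: H.
move=> z /segP[s s01 e]; apply/segP; exists (1 - s); first by rewrite itv01Cc.
by move=> i; rewrite e; ring.
Qed.

Lemma seg_l x y : seg x y x.
Proof. by apply/segP; exists 0; [rewrite lexx ler01|move=> i; ring]. Qed.

Lemma seg_r x y : seg x y y. Proof. by rewrite segC; exact: seg_l. Qed.

Lemma open_supp (e : {set 'I_4}) x : open_subsimplex e x <-> supp x = e.
Proof.
split=> [[h1 h2]|<-]; last first.
  split=> [i|i]; rewrite inE; first by rewrite negbK => /eqP.
  by move=> h; rewrite lt_def crd_ge0 andbT.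
apply/finset.setP => i; rewrite inE; case ie : (i \in e).
  by rewrite gt_eqF// h2.
by apply/negbTE; rewrite negbK; apply/eqP/h1; rewrite ie.
Qed.

Lemma seg_supp x y z : seg x y z -> z <> x -> z <> y -> supp z = (supp x :|: supp y)%SET.
Proof.
move=> /segP[s /andP[s0 s1] e] zx zy.
have s0' : s != 0 by apply/eqP => s0'; apply: zx; apply: crd_inj => i; rewrite e s0'; ring.
have s1' : s != 1 by apply/eqP => s1'; apply: zy; apply: crd_inj => i; rewrite e s1'; ring.
have sp : 0 < s by rewrite lt_def s0' s0.
have sp1 : 0 < 1 - s by rewrite subr_gt0 lt_def eq_sym s1' s1.
apply/finset.setP => i; rewrite !inE e.
rewrite paddr_eq0 ?mulr_ge0 ?crd_ge0 ?(ltW sp) ?(ltW sp1)//.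
by rewrite !mulf_eq0 (gt_eqF sp) (gt_eqF sp1) negb_and.
Qed.

End Segments.

Section NormalDiscEnds.
Variable R : realType.
Notation tet := (tetrahedron R).
Variables (J : {set 'I_4}) (a b : 'I_4 -> tet) (f : R * R -> tet).
Let bd := \bigcup_(i in [set` J]) seg (a i) (b i).
Hypotheses (ends : forall i, i \in J -> normal_arc_ends i (a i) (b i))
  (cf : {within @disk R, continuous f}) (fi : {in @disk R &, injective f}) (fc : f @` @circle R = bd).

Lemma ends_supp i : i \in J -> [/\ #|supp (a i)| = 2%N, #|supp (b i)| = 2%N, supp (a i) != supp (b i),
  i \notin supp (a i) & i \notin supp (b i)].
Proof.
move=> /ends[e [e' [[c c'] ee' [s s'] /open_supp -> /open_supp ->]]]; split=> //.
  by apply/negP => /(fintype.subsetP s); rewrite !inE eqxx.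
by apply/negP => /(fintype.subsetP s'); rewrite !inE eqxx.
Qed.

Lemma ends_suppU i : i \in J -> (supp (a i) :|: supp (b i))%SET = (~: [set i])%SET.
Proof.
move=> iJ; have [c c' ne ni ni'] := ends_supp iJ.
apply/eqP; rewrite eqEcard; apply/andP; split.
  apply/fintype.subsetP => j; rewrite finset.in_setU finset.in_setC finset.in_set1 => h.
  by apply/eqP => e; move: h; rewrite e (negbTE ni) (negbTE ni').
have -> : #|(~: [set i])%SET| = 3%N by have := cardsC1 i; rewrite card_ord.
rewrite ltnNge; apply/negP => h; move/eqP: ne; apply; apply/eqP.
have e1 : (supp (a i) :|: supp (b i))%SET = supp (a i).
  by apply/esym/eqP; rewrite eqEcard finset.subsetUl c.
by rewrite eq_sym eqEcard c c' leqnn andbT -e1 finset.subsetUr.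
Qed.

(* Otherwise the half of the arc i ending at [a i] would be open and closed in the
   circle without the midpoint of this arc. *)
Lemma end_shared i : i \in J -> exists2 k, k \in J & k != i /\ (a i = a k \/ a i = b k).
Proof.
move=> iJ; apply: contrapT => H.
have {}H k : k \in J -> k != i -> a i <> a k /\ a i <> b k.
  by move=> kJ ki; split=> e; apply: H; exists k => //; split=> //; [left|right].
have [c c' ne ni ni'] := ends_supp iJ; have sU := ends_suppU iJ.
(* The coordinate at [j] decreases to 0 along the arc, so it tells the two halves of the arc
   apart. *)
have [j ja jb] : exists2 j, 0 < crd (a i) j & crd (b i) j = 0.
  have /subsetPn[j ja jb] : ~~ (supp (a i) \subset supp (b i)).
    by apply: contra ne => s; rewrite eqEcard s c c'.
  exists j; first by move: ja; rewrite inE lt_def crd_ge0 andbT.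
  by move: jb; rewrite inE negbK => /eqP.
pose m := slide (fun=> b i) 2^-1 (a i).
have h01 : 0 <= (2^-1 : R) <= 1 by rewrite invr_ge0 ler0n invf_le1// ler1n.
have mc l : crd m l = (1 - 2^-1) * crd (a i) l + 2^-1 * crd (b i) l by rewrite crd_slide.
have mseg : seg (a i) (b i) m by apply/segP; exists 2^-1.
have mj : crd m j = crd (a i) j / 2 by rewrite mc jb; lra.
have mbd : bd m by exists i.
have [z0 z0c fz0] : (f @` @circle R) m by rewrite fc.
have cd : @circle R `<=` @disk R by move=> z; rewrite /circle /disk /= => ->.
pose g r := f (stereo z0 r).
have cg : continuous g.
  move=> r; have /subspace_continuousP/(_ (stereo z0 r)) := cf.
  move=> /(_ (cd _ (stereo_circle r z0c))) h U hU.
  have h' : \forall w \near stereo z0 r, @disk R w -> U (f w) by exact: (h U hU).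
  have h3 : \forall s \near r, @disk R (stereo z0 s) -> U (f (stereo z0 s)) by exact: (@stereo_continuous R z0 r _ h').
  by move: h3; apply: filterS => s; apply; exact/cd/stereo_circle.
have gbd r : bd (g r) by rewrite -fc; exists (stereo z0 r) => //; exact: stereo_circle.
have gm r : g r <> m.
  rewrite -fz0 => e; apply: (stereo_neq z0c); apply: fi e; apply/mem_set/cd => //.
  exact: stereo_circle.
have gsurj x : bd x -> x <> m -> exists r, g r = x.
  rewrite -fc => -[w wc <-] ne'; have [r e] := @stereo_surj R z0 w z0c wc (fun e => ne' (etrans (congr1 f e) fz0)).
  by exists r; rewrite /g e.
pose C1 := seg (a i) (b i) `&` [set x | crd (a i) j / 2 <= crd x j].
pose C2 := (seg (a i) (b i) `&` [set x | crd x j <= crd (a i) j / 2]) `|`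
   \bigcup_(k in [set` (J :\ i)%SET]) seg (a k) (b k).
have clC1 : closed C1.
  apply: closedI; first exact: seg_closed.
  apply: (@preimage_closed _ _ (fun x : tet => crd x j) [set r | crd (a i) j / 2 <= r]); last exact: closed_ge.
  by move=> x _; exact: crd_continuous.
have clC2 : closed C2.
  apply: closedU.
    apply: closedI; first exact: seg_closed.
    apply: (@preimage_closed _ _ (fun x : tet => crd x j) [set r | r <= crd (a i) j / 2]); last exact: closed_le.
    by move=> x _; exact: crd_continuous.
  by apply: closed_bigcup => [|k _]; [exact: finite_finset|exact: seg_closed].
have cover r : C1 (g r) \/ C2 (g r).
  have [k kJ sk] := gbd r; have [ki|ki] := eqVneq k i.
    subst k; have [h|h] := leP (crd (a i) j / 2) (crd (g r) j); [by left|by right; left; split=> //=; exact: ltW].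
  by right; right; exists k => //=; rewrite !inE ki.
have disj x : C1 x -> C2 x -> x = m.
  move=> [sx hx] [[_ hx']|[k /=]].
    have xj : crd x j = crd (a i) j / 2 by apply/le_anti; rewrite hx hx'.
    move: sx => /segP[s s01 e]; have : (1 - s) * crd (a i) j = crd (a i) j / 2 by rewrite -xj e jb mulr0 addr0.
    rewrite mulrC => /mulfI; rewrite gt_eqF// => /(_ isT) s2.
    by apply: crd_inj => l; rewrite e mc (_ : s = 2^-1)//; lra.
  (* Arcs in the face [k] have coordinate 0 at [k], whereas a point of the arc [i] other than its
     ends has coordinate 0 at [i] only. *)
  rewrite !inE => /andP[ki kJ] sk.
  have kx : crd x k = 0.
    have [_ _ _ nk nk'] := ends_supp kJ.
    move: sk => /segP[s _ ->]; move: nk nk'; rewrite !inE !negbK => /eqP -> /eqP ->; ring.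
  have xb : x <> b i by move=> e; move: hx; rewrite /= e jb leNgt divr_gt0.
  have [xa|xa] := pselect (x = a i).
    have [h1 h2] := H _ kJ ki; subst x.
    have := seg_supp sk h1 h2; rewrite (ends_suppU kJ) => e; have := c; rewrite e.
    by have := cardsC1 k; rewrite card_ord => ->.
  have := seg_supp sx xa xb; rewrite sU => /finset.setP/(_ k); rewrite !inE kx eqxx ki.
  by [].
have : g @^-1` C1 = [set: R].
  have cR : connected [set: R] by apply/connected_intervalP => x y _ _ z _.
  apply: cR.
  - have [||r e] := gsurj (a i).
    + by exists i => //; exact: seg_l.
    + by move=> e; have := mj; rewrite -e => e'; move: ja; lra.
    exists r; rewrite /= e; split; first exact: seg_l.
    by rewrite /= ler_pdivrMr// ler_pMr// ler1n.
  - exists (~` (g @^-1` C2)); first by apply: closed_openC; apply: preimage_closed => // x _; exact: cg.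
    rewrite setTI; apply/seteqP; split=> r /=.
      by move=> h1 h2; apply: (gm r); exact: disj.
    by case: (cover r).
  - exists (g @^-1` C1); last by rewrite setTI.
    by apply: preimage_closed => // x _; exact: cg.
have [||r e] := gsurj (b i).
- by exists i => //; exact: seg_r.
- by move=> e; have := mj; rewrite -e jb => e'; move: ja; lra.
by move=> /seteqP[_ /(_ r Logic.I)]; rewrite /= e => -[_] /=; rewrite jb leNgt divr_gt0.
Qed.

End NormalDiscEnds.

(** * Cones over triangles and quadrangles *)

Section Cones.
Variable R : realType.
Notation tet := (tetrahedron R).
Implicit Types (x y X Y P Q : tet) (m u v w : R).

(** Here [V] is the sum of the [N] corners and [m] the weight common to all; [u + v] is the
    parameter on the segment from the barycentre and [v / (u + v)] the one on the arc. *)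
Lemma cone_point (N : nat) (V : 'rV[R]_4) X Y x m u v :(0 < N)%N -> 0 <= m -> 0 <= u -> 0 <= v ->
  N%:R * m + u + v = 1 -> bary x = m *: V + u *: bary X + v *: bary Y ->
  exists2 y, seg X Y y & segment (N%:R^-1 *: V) (bary y) x.
Proof.
move=> N0 m0 u0 v0 e ex; have Nn : (N%:R : R) != 0 by rewrite pnatr_eq0 -lt0n.
have mE : (1 - (u + v)) * N%:R^-1 = m by rewrite (_ : 1 - (u + v) = m * N%:R) ?mulfK//; lra.
have Nm0 : 0 <= N%:R * m by rewrite mulr_ge0.
have [uv|uv] := eqVneq (u + v) 0.
  have u1 : u = 0 by lra. have v1 : v = 0 by lra.
  exists X; first exact: seg_l.
  exists 0; first by rewrite lexx ler01.
  by rewrite ex scale0r addr0 scalerA u1 v1 !scale0r !addr0 -mE uv.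
have uvp : 0 < u + v by rewrite lt_def uv addr_ge0.
have r01 : 0 <= v / (u + v) <= 1 by rewrite divr_ge0 ?(ltW uvp)//= ler_pdivrMr// mul1r lerDr.
exists (slide (fun=> Y) (v / (u + v)) X).
  by apply/segP; exists (v / (u + v)) => // i; rewrite crd_slide.
exists (u + v); first by apply/andP; split; lra.
apply/rowP => i; have -> : bary (slide (fun=> Y) (v / (u + v)) X) = (u / (u + v)) *: bary X + (v / (u + v)) *: bary Y.
  apply/rowP => k; rewrite !mxE; have := crd_slide (fun=> Y) X r01 k; rewrite /crd => ->.
  by congr (_ * _ + _); field.
rewrite ex scalerA mE !mxE; field. by [].
Qed.

Lemma cone_tri P Q P' x :
  cone (3%:R^-1 *: (bary P + bary Q + bary P')) (seg P Q `|` seg P P' `|` seg Q P') x <->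
  exists w1 w2 w3, [/\ 0 <= w1, 0 <= w2, 0 <= w3, w1 + w2 + w3 = 1 &
    forall i, crd x i = w1 * crd P i + w2 * crd Q i + w3 * crd P' i].
Proof.
split.
  move=> [y hy [s s01 e]]; have E i : crd x i = (1 - s) / 3 * (crd P i + crd Q i + crd P' i) + s * crd y i.
    by rewrite /crd e !mxE; field.
  move: s01 => /andP[s0 s1].
  have c0 : 0 <= (1 - s) / 3 by rewrite divr_ge0 ?subr_ge0.
  case: hy => [[|]|] /segP[r /andP[r0 r1] er].
  - exists ((1 - s) / 3 + s * (1 - r)), ((1 - s) / 3 + s * r), ((1 - s) / 3).
    split=> //; rewrite ?addr_ge0 ?mulr_ge0 ?subr_ge0//; first by field.
    by move=> i; rewrite E er; ring.
  - exists ((1 - s) / 3 + s * (1 - r)), ((1 - s) / 3), ((1 - s) / 3 + s * r).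
    split=> //; rewrite ?addr_ge0 ?mulr_ge0 ?subr_ge0//; first by field.
    by move=> i; rewrite E er; ring.
  - exists ((1 - s) / 3), ((1 - s) / 3 + s * (1 - r)), ((1 - s) / 3 + s * r).
    split=> //; rewrite ?addr_ge0 ?mulr_ge0 ?subr_ge0//; first by field.
    by move=> i; rewrite E er; ring.
move=> [w1 [w2 [w3 [h1 h2 h3 s e]]]].
have F m u v X Y : seg X Y `<=` seg P Q `|` seg P P' `|` seg Q P' -> 0 <= m -> 0 <= u -> 0 <= v ->
    3%:R * m + u + v = 1 -> (forall i, crd x i = m * (crd P i + crd Q i + crd P' i) + u * crd X i + v * crd Y i) ->
    cone (3%:R^-1 *: (bary P + bary Q + bary P')) (seg P Q `|` seg P P' `|` seg Q P') x.
  move=> sub m0 u0 v0 se ex; have [//|y y1 y2] := @cone_point 3 (bary P + bary Q + bary P') X Y x m u v isT m0 u0 v0 se _.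
    by apply/rowP => i; rewrite !mxE; exact: ex.
  by exists y => //; exact: sub.
(* The least weight is the share of the barycentre; the excesses of the other two lie on the
   opposite side of the triangle. *)
have [h12|h12] := leP w1 w2.
  have [h13|h13] := leP w1 w3.
    by apply: (F w1 (w2 - w1) (w3 - w1) Q P'); [move=> z; right|lra|lra|lra|lra|move=> i; rewrite e; ring].
  by apply: (F w3 (w1 - w3) (w2 - w3) P Q); [move=> z; left; left|lra|lra|lra|lra|move=> i; rewrite e; ring].
have [h23|h23] := leP w2 w3.
  by apply: (F w2 (w1 - w2) (w3 - w2) P P'); [move=> z; left; right|lra|lra|lra|lra|move=> i; rewrite e; ring].
by apply: (F w3 (w1 - w3) (w2 - w3) P Q); [move=> z; left; left|lra|lra|lra|lra|move=> i; rewrite e; ring].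
Qed.

(** A point of the cone over a side exceeds the common weight only at the two ends of this side, so
    two consecutive corners carry the least weight. As P, Q' and Q, P' are the diagonals, this is
    the equality of the two minima. *)
Lemma cone_quad P Q P' Q' x :
  cone (4%:R^-1 *: (bary P + bary Q + bary P' + bary Q')) (seg P Q `|` seg P P' `|` seg Q Q' `|` seg P' Q') x <->
  exists w1 w2 w3 w4, [/\ [/\ 0 <= w1, 0 <= w2, 0 <= w3 & 0 <= w4], w1 + w2 + w3 + w4 = 1,
    Num.min w1 w4 = Num.min w2 w3 &
    forall i, crd x i = w1 * crd P i + w2 * crd Q i + w3 * crd P' i + w4 * crd Q' i].
Proof.
split.
  move=> [y hy [s s01 e]]; have E i : crd x i = (1 - s) / 4 * (crd P i + crd Q i + crd P' i + crd Q' i) + s * crd y i.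
    by rewrite /crd e !mxE; field.
  move: s01 => /andP[s0 s1].
  have c0 : 0 <= (1 - s) / 4 by rewrite divr_ge0 ?subr_ge0.
  have mn a b : 0 <= a -> 0 <= b -> Num.min ((1 - s) / 4 + a) ((1 - s) / 4) = Num.min ((1 - s) / 4) ((1 - s) / 4 + b).
    by move=> a0 b0; rewrite min_r ?lerDl// min_l ?lerDl.
  have mn' a b : 0 <= a -> 0 <= b -> Num.min ((1 - s) / 4) ((1 - s) / 4 + a) = Num.min ((1 - s) / 4 + b) ((1 - s) / 4).
    by move=> a0 b0; rewrite min_l ?lerDl// min_r ?lerDl.
  have mn1 a b : 0 <= a -> 0 <= b -> Num.min ((1 - s) / 4 + a) ((1 - s) / 4) = Num.min ((1 - s) / 4 + b) ((1 - s) / 4).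
    by move=> a0 b0; rewrite !min_r ?lerDl.
  have mn2 a b : 0 <= a -> 0 <= b -> Num.min ((1 - s) / 4) ((1 - s) / 4 + a) = Num.min ((1 - s) / 4) ((1 - s) / 4 + b).
    by move=> a0 b0; rewrite !min_l ?lerDl.
  case: hy => [[[|]|]|] /segP[r /andP[r0 r1] er].
  - exists ((1 - s) / 4 + s * (1 - r)), ((1 - s) / 4 + s * r), ((1 - s) / 4), ((1 - s) / 4).
    split; [by split; rewrite ?addr_ge0 ?mulr_ge0 ?subr_ge0|by field|by apply: mn1; rewrite mulr_ge0 ?subr_ge0|].
    by move=> i; rewrite E er; ring.
  - exists ((1 - s) / 4 + s * (1 - r)), ((1 - s) / 4), ((1 - s) / 4 + s * r), ((1 - s) / 4).
    split; [by split; rewrite ?addr_ge0 ?mulr_ge0 ?subr_ge0|by field|by apply: mn; rewrite mulr_ge0 ?subr_ge0|].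
    by move=> i; rewrite E er; ring.
  - exists ((1 - s) / 4), ((1 - s) / 4 + s * (1 - r)), ((1 - s) / 4), ((1 - s) / 4 + s * r).
    split; [by split; rewrite ?addr_ge0 ?mulr_ge0 ?subr_ge0|by field|by apply: mn'; rewrite mulr_ge0 ?subr_ge0|].
    by move=> i; rewrite E er; ring.
  - exists ((1 - s) / 4), ((1 - s) / 4), ((1 - s) / 4 + s * (1 - r)), ((1 - s) / 4 + s * r).
    split; [by split; rewrite ?addr_ge0 ?mulr_ge0 ?subr_ge0|by field|by apply: mn2; rewrite mulr_ge0 ?subr_ge0|].
    by move=> i; rewrite E er; ring.
move=> [w1 [w2 [w3 [w4 [[h1 h2 h3 h4] s mE e]]]]].
pose B := seg P Q `|` seg P P' `|` seg Q Q' `|` seg P' Q'.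
have F m u v X Y : seg X Y `<=` B -> 0 <= m -> 0 <= u -> 0 <= v ->
    4%:R * m + u + v = 1 -> (forall i, crd x i = m * (crd P i + crd Q i + crd P' i + crd Q' i) + u * crd X i + v * crd Y i) ->
    cone (4%:R^-1 *: (bary P + bary Q + bary P' + bary Q')) B x.
  move=> sub m0 u0 v0 se ex; have [//|y y1 y2] := @cone_point 4 (bary P + bary Q + bary P' + bary Q') X Y x m u v isT m0 u0 v0 se _.
    by apply/rowP => i; rewrite !mxE; exact: ex.
  by exists y => //; exact: sub.
move: mE; rewrite !minEle; case: (leP w1 w4) => h14; case: (leP w2 w3) => h23 mE.
- apply: (F w1 (w3 - w1) (w4 - w1) P' Q'); [by move=> z; right|lra|lra|lra|lra|].
  by move=> i; rewrite e -mE; ring.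
- apply: (F w1 (w2 - w1) (w4 - w1) Q Q'); [by move=> z; left; right|lra|lra|lra|lra|].
  by move=> i; rewrite e -mE; ring.
- apply: (F w4 (w1 - w4) (w3 - w4) P P'); [by move=> z; left; left; right|lra|lra|lra|lra|].
  by move=> i; rewrite e -mE; ring.
- apply: (F w4 (w1 - w4) (w2 - w4) P Q); [by move=> z; left; left; left|lra|lra|lra|lra|].
  by move=> i; rewrite e -mE; ring.
Qed.

Definition edge_point i j x : Prop := supp x = [set i; j]%SET.

Lemma edge_point_crd i j x : i != j -> edge_point i j x ->
  [/\ forall k, k != i -> k != j -> crd x k = 0, crd x i = 1 - crd x j, 0 < crd x i & 0 < crd x j].
Proof.
move=> ij e; have e' := (e : supp x = [set i; j]%SET).
have z k : k != i -> k != j -> crd x k = 0.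
  by move=> ki kj; move/finset.setP: e' => /(_ k); rewrite !inE (negbTE ki) (negbTE kj) /= => /negbFE/eqP.
split=> //.
- have := crd_sum x; rewrite (bigD1 i)//= (bigD1 j) 1?eq_sym//= big1; last by move=> k /andP[ki kj]; exact: z.
  by lra.
- by move/finset.setP: e' => /(_ i); rewrite !inE eqxx /= lt_def crd_ge0 andbT.
- by move/finset.setP: e' => /(_ j); rewrite !inE eqxx orbT lt_def crd_ge0 andbT.
Qed.

(** Edges without a corner get the midpoint, which keeps [unit_pos] and [antisym] valid on all
    pairs. *)
Definition corner_pos (s : seq tet) (i j : 'I_4) : R :=
  if [seq X <- s | supp X == [set i; j]%SET] is X :: _ then crd X j else 2^-1.

Lemma corner_posE s i j X : X \in s -> edge_point i j X -> (forall Y, Y \in s -> supp Y = supp X -> Y = X) ->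
  corner_pos s i j = crd X j.
Proof.
move=> Xs Xe u; rewrite /corner_pos; case E : (seq.filter _ _) => [|Y r].
  suff h : X \in [seq X <- s | supp X == [set i; j]%SET] by rewrite E in h.
  by rewrite mem_filter Xe eqxx.
have : Y \in [seq X <- s | supp X == [set i; j]%SET] by rewrite E mem_head.
by rewrite mem_filter => /andP[/eqP eY Ys]; rewrite (u Y)// Xe.
Qed.

Lemma corner_pos_cases s i j : (forall X, X \in s -> #|supp X| = 2%N) ->
  (corner_pos s i j = 2^-1 /\ corner_pos s j i = 2^-1) \/
  exists X, [/\ i != j, edge_point i j X, corner_pos s i j = crd X j & corner_pos s j i = crd X i].
Proof.
move=> c2; rewrite /corner_pos (finset.setUC [set j]%SET); case E : (seq.filter _ _) => [|X r]; first by left.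
right; exists X; have : X \in [seq X <- s | supp X == [set i; j]%SET] by rewrite E mem_head.
rewrite mem_filter => /andP[/eqP eX Xs]; split=> //.
by apply/eqP => ij; have := c2 _ Xs; rewrite eX ij finset.setUid cards1.
Qed.

Lemma corner_pos_unit s : (forall X, X \in s -> #|supp X| = 2%N) -> unit_pos (corner_pos s).
Proof.
move=> c2 i j; have [[-> _]|[X [ij eX -> _]]] := corner_pos_cases i j c2; first by apply/andP; split; lra.
by have [_ h1 h2 h3] := edge_point_crd ij eX; apply/andP; split; lra.
Qed.

Lemma corner_pos_antisym s : (forall X, X \in s -> #|supp X| = 2%N) -> antisym (corner_pos s).
Proof.
move=> c2 i j; have [[-> ->]|[X [ij eX -> ->]]] := corner_pos_cases i j c2; first by lra.
by have [_ h1 h2 h3] := edge_point_crd ij eX.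
Qed.

Lemma edge_point_card i j x : i != j -> edge_point i j x -> #|supp x| = 2%N.
Proof. by move=> ij ->; rewrite cards2 ij. Qed.

Lemma edge_point_neq i j k x : k != i -> k != j -> edge_point i j x -> k \notin supp x.
Proof. by move=> ki kj ->; rewrite !inE negb_or ki kj. Qed.

Lemma edge_point_l i j x : edge_point i j x -> i \in supp x.
Proof. by move=> ->; rewrite !inE eqxx. Qed.

Lemma edge_point_r i j x : edge_point i j x -> j \in supp x.
Proof. by move=> ->; rewrite !inE eqxx orbT. Qed.

Lemma triangle_disc (u v a b : 'I_4) P Q P' : uniq [:: u; v; a; b] -> edge_point u v P -> edge_point u a Q -> edge_point u b P' ->
  exists p, [/\ unit_pos p, antisym p &
   cone (3%:R^-1 *: (bary P + bary Q + bary P')) (seg P Q `|` seg P P' `|` seg Q P') = disc [set u]%SET p].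
Proof.
move=> un eP eQ eP'; have [[vu au bu] [av bv ba]] := uniq4 un.
have [uv [ua ub]] : u != v /\ (u != a /\ u != b) by rewrite ![u == _]eq_sym.
have [va [vb ab]] : v != a /\ (v != b /\ a != b) by rewrite ![v == _]eq_sym [a == b]eq_sym.
pose s := [:: P; Q; P']; have c2 X : X \in s -> #|supp X| = 2%N.
  rewrite !inE => /or3P[] /eqP ->.
  + exact: (edge_point_card uv eP).
  + exact: (edge_point_card ua eQ).
  + exact: (edge_point_card ub eP').
have pu : unit_pos (corner_pos s) by exact: corner_pos_unit.
exists (corner_pos s); split=> //; first exact: corner_pos_antisym.
have nsupp X Y k : k \in supp X -> k \notin supp Y -> supp Y = supp X -> Y = X by move=> h1 h2 e; move: h2; rewrite e h1.
have pv : corner_pos s u v = crd P v.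
  apply: corner_posE; [by rewrite !inE eqxx|exact: eP|].
  move=> Y; rewrite !inE => /or3P[] /eqP -> //; apply: (@nsupp _ _ v (edge_point_r eP)).
    exact: (edge_point_neq vu va eQ).
  exact: (edge_point_neq vu vb eP').
have pa : corner_pos s u a = crd Q a.
  apply: corner_posE; [by rewrite !inE eqxx orbT|exact: eQ|].
  move=> Y; rewrite !inE => /or3P[] /eqP -> //; apply: (@nsupp _ _ a (edge_point_r eQ)).
    exact: (edge_point_neq au av eP).
  exact: (edge_point_neq au ab eP').
have pb : corner_pos s u b = crd P' b.
  apply: corner_posE; [by rewrite !inE eqxx !orbT|exact: eP'|].
  move=> Y; rewrite !inE => /or3P[] /eqP -> //; apply: (@nsupp _ _ b (edge_point_r eP')).
    exact: (edge_point_neq bu bv eP).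
  exact: (edge_point_neq bu ba eQ).
have [zP sP P1 P2] := edge_point_crd uv eP; have [zQ sQ Q1 Q2] := edge_point_crd ua eQ.
have [zP' sP' P'1 P'2] := edge_point_crd ub eP'.
apply/seteqP; split=> x.
  move=> /cone_tri[w1 [w2 [w3 [h1 h2 h3 s1 e]]]]; apply/(disc_tri x un pu); rewrite pv pa pb.
  rewrite !e (zQ v)// (zP' v)// (zP a)// (zP' a)// (zP b)// (zQ b)// !mulr0 !addr0 !add0r !mulfK ?gt_eqF//.
move=> /(disc_tri x un pu); rewrite pv pa pb => e.
apply/cone_tri; exists (crd x v / crd P v), (crd x a / crd Q a), (crd x b / crd P' b).
split=> //; rewrite ?divr_ge0 ?crd_ge0// => i.
have sx := crd_sum4 x un.
have := all4P i un; rewrite !inE => /or4P[] /eqP ->.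
- rewrite sP sQ sP' !mulrBr !mulr1 !divfK ?gt_eqF//; lra.
- by rewrite (zQ v)// (zP' v)// divfK ?gt_eqF//; lra.
- by rewrite (zP a)// (zP' a)// divfK ?gt_eqF//; lra.
- by rewrite (zP b)// (zQ b)// divfK ?gt_eqF//; lra.
Qed.

Lemma quad_disc (u v a b : 'I_4) P Q P' Q' : uniq [:: u; v; a; b] -> edge_point u a P -> edge_point v a Q ->
  edge_point u b P' -> edge_point v b Q' ->
  exists p, [/\ unit_pos p, antisym p &
   cone (4%:R^-1 *: (bary P + bary Q + bary P' + bary Q')) (seg P Q `|` seg P P' `|` seg Q Q' `|` seg P' Q')
   = disc [set u; v]%SET p].
Proof.
move=> un eP eQ eP' eQ'; have [[vu au bu] [av bv ba]] := uniq4 un.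
have [uv [ua ub]] : u != v /\ (u != a /\ u != b) by rewrite ![u == _]eq_sym.
have [va [vb ab]] : v != a /\ (v != b /\ a != b) by rewrite ![v == _]eq_sym [a == b]eq_sym.
pose s := [:: P; Q; P'; Q']; have c2 X : X \in s -> #|supp X| = 2%N.
  rewrite !inE => /or4P[] /eqP ->.
  + exact: (edge_point_card ua eP).
  + exact: (edge_point_card va eQ).
  + exact: (edge_point_card ub eP').
  + exact: (edge_point_card vb eQ').
have pu : unit_pos (corner_pos s) by exact: corner_pos_unit.
exists (corner_pos s); split=> //; first exact: corner_pos_antisym.
have nsupp X Y k : k \in supp X -> k \notin supp Y -> supp Y = supp X -> Y = X by move=> h1 h2 e; move: h2; rewrite e h1.
have pua : corner_pos s u a = crd P a.
  apply: corner_posE; [by rewrite !inE eqxx|exact: eP|].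
  move=> Y; rewrite !inE => /or4P[] /eqP -> //.
  - by apply: (@nsupp _ _ u (edge_point_l eP)); exact: (edge_point_neq uv ua eQ).
  - by apply: (@nsupp _ _ a (edge_point_r eP)); exact: (edge_point_neq au ab eP').
  - by apply: (@nsupp _ _ u (edge_point_l eP)); exact: (edge_point_neq uv ub eQ').
have pva : corner_pos s v a = crd Q a.
  apply: corner_posE; [by rewrite !inE eqxx !orbT|exact: eQ|].
  move=> Y; rewrite !inE => /or4P[] /eqP -> //.
  - by apply: (@nsupp _ _ v (edge_point_l eQ)); exact: (edge_point_neq vu va eP).
  - by apply: (@nsupp _ _ v (edge_point_l eQ)); exact: (edge_point_neq vu vb eP').
  - by apply: (@nsupp _ _ a (edge_point_r eQ)); exact: (edge_point_neq av ab eQ').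
have pub : corner_pos s u b = crd P' b.
  apply: corner_posE; [by rewrite !inE eqxx !orbT|exact: eP'|].
  move=> Y; rewrite !inE => /or4P[] /eqP -> //.
  - by apply: (@nsupp _ _ b (edge_point_r eP')); exact: (edge_point_neq bu ba eP).
  - by apply: (@nsupp _ _ u (edge_point_l eP')); exact: (edge_point_neq uv ua eQ).
  - by apply: (@nsupp _ _ u (edge_point_l eP')); exact: (edge_point_neq uv ub eQ').
have pvb : corner_pos s v b = crd Q' b.
  apply: corner_posE; [by rewrite !inE eqxx !orbT|exact: eQ'|].
  move=> Y; rewrite !inE => /or4P[] /eqP -> //.
  - by apply: (@nsupp _ _ v (edge_point_l eQ')); exact: (edge_point_neq vu va eP).
  - by apply: (@nsupp _ _ b (edge_point_r eQ')); exact: (edge_point_neq bv ba eQ).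
  - by apply: (@nsupp _ _ v (edge_point_l eQ')); exact: (edge_point_neq vu vb eP').
have [zP sP P1 P2] := edge_point_crd ua eP; have [zQ sQ Q1 Q2] := edge_point_crd va eQ.
have [zP' sP' P'1 P'2] := edge_point_crd ub eP'; have [zQ' sQ' Q'1 Q'2] := edge_point_crd vb eQ'.
have Z := (zQ u uv ua, zQ' u uv ub, zP v vu va, zP' v vu vb, zP' a au ab, zQ' a av ab, zP b bu ba, zQ b bv ba).
apply/seteqP; split=> x.
  move=> /cone_quad[w1 [w2 [w3 [w4 [[h1 h2 h3 h4] s1 mE e]]]]]; apply/(disc_quad _ x un); rewrite pua pva pub pvb.
  (* The cone lists the corners in the order ua, va, ub, vb, and [disc_quad] in the order ua, ub,
     va, vb. *)
  exists w1, w3, w2, w4; split=> //; first by rewrite mE minC.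
  - by rewrite !e !Z sP sQ sP' sQ'; split; ring.
  - by rewrite !e !Z; ring.
  - by rewrite !e !Z; ring.
move=> /(disc_quad _ x un); rewrite pua pva pub pvb => -[w1 [w2 [w3 [w4 [[h1 h2 h3 h4] mE [eu ev] ea eb]]]]].
have sx := crd_sum4 x un.
apply/cone_quad; exists w1, w3, w2, w4; split=> //.
- have : w1 * (1 - crd P a) + w2 * (1 - crd P' b) + (w3 * (1 - crd Q a) + w4 * (1 - crd Q' b)) + (w1 * crd P a + w3 * crd Q a)
    + (w2 * crd P' b + w4 * crd Q' b) = w1 + w3 + w2 + w4 by ring.
  by move=> <-; rewrite -eu -ev -ea -eb.
- by rewrite mE minC.
move=> i; have := all4P i un; rewrite !inE => /or4P[] /eqP ->.
- by rewrite eu !Z sP sP'; ring.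
- by rewrite ev !Z sQ sQ'; ring.
- by rewrite ea !Z; ring.
- by rewrite eb !Z; ring.
Qed.

End Cones.

Section NormalDiscShape.
Variable R : realType.
Notation tet := (tetrahedron R).
Variables (J : {set 'I_4}) (a b : 'I_4 -> tet).
Hypotheses (ends : forall i, i \in J -> normal_arc_ends i (a i) (b i)).
Hypothesis shared : forall i, i \in J ->
  (exists2 k, k \in J & k != i /\ (a i = a k \/ a i = b k)) /\
  (exists2 k, k \in J & k != i /\ (b i = b k \/ b i = a k)).

Definition arc i P Q := i \in J /\ ((P = a i /\ Q = b i) \/ (P = b i /\ Q = a i)).

Lemma arcC i P Q : arc i P Q -> arc i Q P.
Proof. by move=> [iJ [[-> ->]|[-> ->]]]; split=> //; [right|left]. Qed.

Lemma arc_supp i P Q : arc i P Q -> [/\ #|supp P| = 2%N, supp P != supp Q, i \notin supp P & i \notin supp Q].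
Proof. by move=> [iJ [[-> ->]|[-> ->]]]; have [h1 h2 h3 h4 h5] := ends_supp ends iJ; split=> //; rewrite eq_sym. Qed.

(** A corner common to arcs in two faces lies on the edge common to these faces. *)
Lemma arc_end i P Q k P' : arc i P Q -> arc k P P' -> k != i -> supp P = (~: [set i; k])%SET.
Proof.
move=> h1 h2 ki; have [c _ iP _] := arc_supp h1; have [_ _ kP _] := arc_supp h2.
apply/eqP; rewrite eqEcard; apply/andP; split.
  apply/fintype.subsetP => j jP; rewrite !inE negb_or; apply/andP; split.
    by apply: contraNneq iP => <-.
  by apply: contraNneq kP => <-.
by have := cardsC [set i; k]%SET; rewrite cards2 eq_sym ki card_ord c => /eqP; rewrite eqn_add2l => /eqP ->.
Qed.

Lemma arc_shared i P Q : arc i P Q -> exists k P', k != i /\ arc k P P'.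
Proof.
by move=> [iJ [[-> _]|[-> _]]]; have [[k kJ [ki h]] [k' k'J [ki' h']]] := shared iJ;
  [exists k|exists k']; [case: h|case: h'] => e;
  [exists (b k)|exists (a k)|exists (a k')|exists (b k')]; split=> //; split=> //; rewrite e; tauto.
Qed.

Lemma arc_uniq i P Q P' Q' : arc i P Q -> arc i P' Q' -> (P = P' /\ Q = Q') \/ (P = Q' /\ Q = P').
Proof. by move=> [iJ [[-> ->]|[-> ->]]] [_ [[-> ->]|[-> ->]]]; tauto. Qed.

(** The boundary is followed from the arc [i] in both directions, each end being shared with an arc
    in another face; as a face carries at most one arc, the four faces leave two possibilities. *)
Lemma arcs_shape i P Q : arc i P Q -> exists k l o, uniq [:: o; l; k; i] /\
  ((exists P', [/\ J = (~: [set o])%SET, arc k P P', arc l Q P' &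
       [/\ edge_point o l P, edge_point o k Q & edge_point o i P']]) \/
   (exists P' Q', [/\ J = finset.setT, arc k P P', arc l Q Q', arc o P' Q' &
       [/\ edge_point l o P, edge_point k o Q, edge_point l i P' & edge_point k i Q']])).
Proof.
move=> h; have [k [P' [ki hk]]] := arc_shared h; have [l [Q' [li hl]]] := arc_shared (arcC h).
have sP := arc_end h hk ki; have sQ := arc_end (arcC h) hl li.
have [_ nPQ iP iQ] := arc_supp h.
have kl : k != l by apply: contraNneq nPQ => e; rewrite sP sQ e.
have [ o o4] : exists o, uniq [:: o; l; k; i].
  have [x [y un]] := complete2 kl; have := all4P i un; rewrite !inE ![i == _]eq_sym (negbTE li) (negbTE ki) /=.
  move: un => + /orP[] /eqP ix; rewrite ?ix; [move=> un; exists y|move=> un; exists x]; have [[h1 h2 h3] [h4 h5 h6]] := uniq4 un.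
    by rewrite /= !inE !negb_or h5 h3 h6 h1 (eq_sym l i) h4 (eq_sym k i) h2.
  by rewrite /= !inE !negb_or h4 h2 (eq_sym x i) h6 h1 (eq_sym l i) h5 (eq_sym k i) h3.
exists k, l, o; split=> //.
have all4 j : j \in [:: o; l; k; i] by exact: all4P.
have [[lo ko io] [kl' il ik]] := uniq4 o4.
have [ ol [ ok oi]] : o != l /\ (o != k /\ o != i) by rewrite ![ o == _]eq_sym.
have [lk [ki' li']] : l != k /\ (k != i /\ l != i) by rewrite ![_ == i]eq_sym [l == k]eq_sym.
have E := (eqxx, negbTE lo, negbTE ko, negbTE io, negbTE kl', negbTE il, negbTE ik, negbTE ol, negbTE ok, negbTE oi,
  negbTE lk, negbTE ki', negbTE li', orbT, orbF).
have set4 (A B : {set 'I_4}) : (o \in A) = (o \in B) -> (l \in A) = (l \in B) -> (k \in A) = (k \in B) -> (i \in A) = (i \in B) -> A = B.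
  by move=> e1 e2 e3 e4; apply/finset.setP => j; have := all4 j; rewrite !inE => /or4P[] /eqP ->.
have [m [P'' [mk hm]]] := arc_shared (arcC hk).
have sP' := arc_end (arcC hk) hm mk.
have [_ nPP' kP kP'] := arc_supp hk.
have mi : m != i by apply: contraNneq nPP' => e; rewrite sP' sP e finset.setUC.
have iJ : i \in J by case: h. have kJ : k \in J by case: hk. have lJ : l \in J by case: hl.
(* If the arc continuing [k] is in the face [l], the boundary closes up after three arcs; if it is
   in the face [o], it runs through all four faces. *)
have := all4 m; rewrite !inE (negbTE mk) (negbTE mi) !orbF /= => /orP[] /eqP mE; subst m; last first.
  have nP'Q : P' <> Q.
    by move=> e; have /negP := kP'; apply; rewrite e sQ !inE !E.
  left; exists P'; have hl' : arc l Q P'.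
    by have [[e _]|[-> _]] := arc_uniq hm hl.
  split=> //; last by split; [rewrite /edge_point sP|rewrite /edge_point sQ|rewrite /edge_point sP']; apply: set4; rewrite !inE !E.
  (* A fourth arc would share an end with one of the three others, but these ends have nonzero
     coordinate at [o]. *)
  apply: set4; rewrite !inE !E //; apply/negP => oJ.
  have ho : arc o (a o) (b o) by split=> //; left.
  have [n [T [no hn]]] := arc_shared ho.
  have [_ _ oT _] := arc_supp ho.
  have := all4 n; rewrite !inE (negbTE no) /= => /or3P[] /eqP nE; subst n; move/negP: oT; apply.
  - by have [[-> _]|[-> _]] := arc_uniq hn hl'; rewrite ?sQ ?sP' !inE !E.
  - by have [[-> _]|[-> _]] := arc_uniq hn hk; rewrite ?sP ?sP' !inE !E.
  - by have [[-> _]|[-> _]] := arc_uniq hn h; rewrite ?sP ?sQ !inE !E.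
right; exists P', Q'.
have [m' [Q'' [ml hm']]] := arc_shared (arcC hl).
have sQ' := arc_end (arcC hl) hm' ml; have [_ nQQ' lQ lQ'] := arc_supp hl.
have mi' : m' != i by apply: contraNneq nQQ' => e; rewrite sQ' sQ e finset.setUC.
have := all4 m'; rewrite !inE (negbTE ml) (negbTE mi') !orbF /= => /orP[] /eqP mE; subst m'; last first.
  have [[e _]|[e _]] := arc_uniq hm' hk.
    by exfalso; move/finset.setP/(_ l): sQ'; rewrite e sP !inE !E.
  by exfalso; move/finset.setP/(_ l): sQ'; rewrite e sP' !inE !E.
have ho : arc o P' Q'.
  have [[e _]|[_ <-]] // := arc_uniq hm hm'.
  by exfalso; move/finset.setP/(_ l): sQ'; rewrite -e sP' !inE !E.
split=> //; last by split; [rewrite /edge_point sP|rewrite /edge_point sQ|rewrite /edge_point sP'|rewrite /edge_point sQ']; apply: set4; rewrite !inE !E.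
by have [oJ _] := ho; apply: set4; rewrite finset.in_setT.
Qed.

End NormalDiscShape.

Section NormalDiscs.
Variable R : realType.
Notation tet := (tetrahedron R).
Implicit Types D : set tet.

Lemma barycentre_undup (s t : seq 'rV[R]_4) : uniq t -> s =i t ->
  barycentre (undup s) = (size t)%:R^-1 *: \sum_(x <- t) x.
Proof.
move=> ut st; have p : perm_eq (undup s) t.
  by apply: uniq_perm => // [|x]; rewrite ?undup_uniq// mem_undup st.
by rewrite /barycentre (perm_size p) (perm_big _ p).
Qed.

Lemma bary_inj : injective (@bary R).
Proof. by move=> x y e; apply: crd_inj => i; rewrite /crd e. Qed.

(** As a cone from the barycentre of its corners, a normal disc is determined by its arcs, which
    [arcs_shape] lists. *)
Lemma normal_disc_shape D : normal_disc D -> exists A p, [/\ ntype A, unit_pos p, antisym p & D = disc A p].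
Proof.
move=> [J [a [b /= [ends [f [cf fi fD fc]] _ De]]]].
set bd := \bigcup_(i in _) _ in fc De.
have sh : forall i, i \in J -> (exists2 k, k \in J & k != i /\ (a i = a k \/ a i = b k)) /\
  (exists2 k, k \in J & k != i /\ (b i = b k \/ b i = a k)).
  move=> i iJ; split; first exact: (end_shared ends cf fi fc).
  apply: (@end_shared R J b a f) => //.
    by move=> j /ends[e [e' [[c c'] ee [s s'] h h']]]; exists e', e; rewrite eq_sym.
  by rewrite fc; apply: eq_bigcupr => j _; exact: segC.
have [i iJ] : exists i, i \in J.
  have : bd (f (1, 0)) by rewrite -fc; exists (1, 0) => //; rewrite /circle /= expr1n expr0n addr0.
  by move=> [i iJ _]; exists i.
have ha : arc J a b i (a i) (b i) by split=> //; left.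
have bdE k P Q : arc J a b k P Q -> seg P Q `<=` bd.
  by move=> [kJ h] x sx; exists k => //; case: h sx => -[-> ->] //; rewrite segC.
have arcS k P Q : arc J a b k P Q -> seg (a k) (b k) = seg P Q.
  by move=> [_ [[-> ->]|[-> ->]]] //; exact: segC.
have cE x : (x \in [seq bary (a i) | i <- enum J] ++ [seq bary (b i) | i <- enum J]) <->
    exists k P Q, arc J a b k P Q /\ x = bary P.
  rewrite mem_cat; split=> [/orP[] /mapP[k]|[k [P [Q [[kJ h] ->]]]]].
  - by rewrite mem_enum => kJ ->; exists k, (a k), (b k); split=> //; split=> //; left.
  - by rewrite mem_enum => kJ ->; exists k, (b k), (a k); split=> //; split=> //; right.
  by apply/orP; case: h => -[-> _]; [left|right]; apply/mapP; exists k; rewrite ?mem_enum.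
have [k [l [ o [un]]]] := arcs_shape ends sh ha.
have all4 j : j \in [:: o; l; k; i] by exact: all4P.
have [[lo ko io] [kl' il ik]] := uniq4 un.
have neq (P Q : tet) c : c \in supp P -> c \notin supp Q -> bary P != bary Q.
  by move=> h1 h2; apply/eqP => /bary_inj e; move: h2; rewrite -e h1.
move=> [[P' [JE hk hl [eP eQ eP']]]|[P' [Q' [JE hk hl ho [eP eQ eP' eQ']]]]].
  have bdU : bd = seg (a i) (b i) `|` seg (a i) P' `|` seg (b i) P'.
    apply/seteqP; split=> x.
      move=> [j /=]; rewrite JE !inE => jo; have := all4 j; rewrite !inE (negbTE jo) /= => /or3P[] /eqP ->.
      - by rewrite -/(seg _ _) (arcS _ _ _ hl); right.
      - by rewrite -/(seg _ _) (arcS _ _ _ hk); left; right.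
      - by left; left.
    by move=> [[]|]; [exact: bdE ha _|exact: bdE hk _|exact: bdE hl _].
  have [p [up ap e]] := triangle_disc un eP eQ eP'.
  exists [set o]%SET, p; split=> //; first by rewrite /ntype /dtype cards1.
  rewrite De -e bdU; congr cone.
  rewrite (@barycentre_undup _ [:: bary (a i); bary (b i); bary P']).
  - by rewrite !big_cons big_nil addr0 !addrA.
  - rewrite /= !inE negb_or andbT; apply/andP; split; first (apply/andP; split).
    + by apply: (neq _ _ l); rewrite ?(edge_point_r eP)// (edge_point_neq _ _ eQ)// eq_sym.
    + by apply: (neq _ _ l); rewrite ?(edge_point_r eP)// (edge_point_neq _ _ eP')// eq_sym.
    + by apply: (neq _ _ k); rewrite ?(edge_point_r eQ)// (edge_point_neq _ _ eP')// eq_sym.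
  - move=> x; apply/idP/idP.
      move=> /cE[j [P [Q [hj ->]]]]; have jJ : j \in J by case: hj.
      move: jJ; rewrite JE !inE => jo; have := all4 j; rewrite !inE (negbTE jo) /= => /or3P[] /eqP jE; subst j.
      + by have [[-> _]|[-> _]] := arc_uniq hj hl; rewrite eqxx ?orbT.
      + by have [[-> _]|[-> _]] := arc_uniq hj hk; rewrite eqxx ?orbT.
      + by have [[-> _]|[-> _]] := arc_uniq hj ha; rewrite eqxx ?orbT.
    rewrite !inE => /or3P[] /eqP ->; apply/cE.
    + by exists i, (a i), (b i).
    + by exists l, (b i), P'.
    + by exists l, P', (b i); split=> //; exact: arcC.
have bdU : bd = seg (a i) (b i) `|` seg (a i) P' `|` seg (b i) Q' `|` seg P' Q'.
  apply/seteqP; split=> x.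
    move=> [j /= _]; have := all4 j; rewrite !inE => /or4P[] /eqP ->.
    - by rewrite -/(seg _ _) (arcS _ _ _ ho); right.
    - by rewrite -/(seg _ _) (arcS _ _ _ hl); left; right.
    - by rewrite -/(seg _ _) (arcS _ _ _ hk); left; left; right.
    - by left; left; left.
  by move=> [[[]|]|]; [exact: bdE ha _|exact: bdE hk _|exact: bdE hl _|exact: bdE ho _].
have un' : uniq [:: l; k; o; i].
  rewrite /= !inE !negb_or; have := un; rewrite /= !inE !negb_or => /and4P[/and3P[h1 h2 h3] /andP[h4 h5] h6 _].
  by rewrite h4 h5 h6 h3 (eq_sym l) h1 (eq_sym k) h2.
have [p [up ap e]] := quad_disc un' eP eQ eP' eQ'.
have DE : D = disc [set l; k]%SET p.
  rewrite De -e bdU; congr cone.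
  rewrite (@barycentre_undup _ [:: bary (a i); bary (b i); bary P'; bary Q']).
  - by rewrite !big_cons big_nil addr0 !addrA.
  - rewrite /= !inE !negb_or andbT; apply/and3P; split; [apply/and3P; split|apply/andP; split|].
    + by apply: (neq _ _ l); rewrite ?(edge_point_l eP)// (edge_point_neq _ _ eQ)// eq_sym.
    + by apply: (neq _ _ o); rewrite ?(edge_point_r eP)// (edge_point_neq _ _ eP')// eq_sym.
    + by apply: (neq _ _ l); rewrite ?(edge_point_l eP)// (edge_point_neq _ _ eQ')// eq_sym.
    + by apply: (neq _ _ k); rewrite ?(edge_point_l eQ)// (edge_point_neq _ _ eP')// eq_sym.
    + by apply: (neq _ _ o); rewrite ?(edge_point_r eQ)// (edge_point_neq _ _ eQ')// eq_sym.
    + by apply: (neq _ _ l); rewrite ?(edge_point_l eP')// (edge_point_neq _ _ eQ')// eq_sym.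
  - move=> x; apply/idP/idP.
      move=> /cE[j [P [Q [hj ->]]]]; have := all4 j; rewrite !inE /= => /or4P[] /eqP jE; subst j.
      + by have [[-> _]|[-> _]] := arc_uniq hj ho; rewrite eqxx ?orbT.
      + by have [[-> _]|[-> _]] := arc_uniq hj hl; rewrite eqxx ?orbT.
      + by have [[-> _]|[-> _]] := arc_uniq hj hk; rewrite eqxx ?orbT.
      + by have [[-> _]|[-> _]] := arc_uniq hj ha; rewrite eqxx ?orbT.
    rewrite !inE => /or4P[] /eqP ->; apply/cE.
    + by exists i, (a i), (b i).
    + by exists l, (b i), Q'.
    + by exists o, P', Q'.
    + by exists l, Q', (b i); split=> //; exact: arcC.
have c2 : #|[set l; k]%SET| = 2%N by rewrite cards2 eq_sym kl'.
have [z|z] := boolP (ord0 \in [set l; k]%SET).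
  by exists [set l; k]%SET, p; split=> //; rewrite /ntype /dtype c2 z.
exists (~: [set l; k])%SET, p; split=> //; last by rewrite disc_setC.
have c2' : #|(~: [set l; k])%SET| = 2%N.
  by have := cardsC [set l; k]%SET; rewrite c2 card_ord => /eqP; rewrite (eqn_add2l 2 _ 2) => /eqP.
by rewrite /ntype /dtype c2' inE z.
Qed.

End NormalDiscs.

(** * Order of disjoint discs *)

(* Two arcs a x + b y = 1 and a' x + b' y = 1 whose ends are not in the same order cross. *)
Lemma lines_cross (R : realFieldType) (a b a' b' : R) : 1 < a -> 1 < b -> 1 < a' -> 1 < b' ->
  a' <= a -> b <= b' -> exists x y, [/\ 0 <= x, 0 <= y, x + y <= 1, a * x + b * y = 1 & a' * x + b' * y = 1].
Proof.
move=> a1 b1 a'1 b'1 aa bb.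
have [e|ne] := eqVneq a a'.
  exists a^-1, 0; have a0 : 0 < a by lra. have i0 : 0 <= a^-1 by rewrite invr_ge0 ltW.
  by split=> //; rewrite ?mulr0 ?addr0 -?e ?divff ?gt_eqF// invf_le1 ?ltW.
have [e|ne'] := eqVneq b b'.
  exists 0, b^-1; have b0 : 0 < b by lra. have i0 : 0 <= b^-1 by rewrite invr_ge0 ltW.
  by split=> //; rewrite ?mulr0 ?add0r -?e ?divff ?gt_eqF// invf_le1 ?ltW.
have l1 : a' < a by rewrite lt_neqAle eq_sym ne.
have d0 : 0 < a * b' - a' * b by nra.
have dn : a * b' - a' * b != 0 by rewrite gt_eqF.
exists ((b' - b) / (a * b' - a' * b)), ((a - a') / (a * b' - a' * b)); split.
- by rewrite divr_ge0 ?(ltW d0)// subr_ge0.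
- by rewrite divr_ge0 ?(ltW d0)// subr_ge0.
- by rewrite -mulrDl ler_pdivrMr//; nra.
- by field.
- by field.
Qed.

(** Arcs around two vertices of a face whose ends overlap on the common edge cross. The equations
    give the third coordinate [(a + c - 1) / (a / b + c / d - 1)]; the others are nonnegative
    because it is at most [b] and [d]. *)
Lemma lines_cross2 (R : realFieldType) (a b c d : R) : 0 < a < 1 -> 0 < b < 1 -> 0 < c < 1 -> 0 < d < 1 ->
  1 - c <= a -> exists x y z, [/\ 0 <= x, 0 <= y & 0 <= z] /\ [/\ x + y + z = 1, y / a + z / b = 1 & x / c + z / d = 1].
Proof.
move=> /andP[a0 a1] /andP[b0 b1] /andP[c0 c1] /andP[d0 d1] h.
have [an bn cn dn] : [/\ a != 0, b != 0, c != 0 & d != 0] by rewrite !gt_eqF.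
have ab : a < a / b by rewrite ltr_pdivlMr// gtr_pMr.
have cd : c < c / d by rewrite ltr_pdivlMr// gtr_pMr.
have D0 : 0 < a / b + c / d - 1 by lra.
have [w ew w0] : exists2 w, w * (a / b + c / d - 1) = a + c - 1 & 0 <= w.
  by exists ((a + c - 1) / (a / b + c / d - 1)); [rewrite divfK// gt_eqF|rewrite divr_ge0 ?(ltW D0)//; lra].
have [u eu] : exists u, u = a / b by exists (a / b).
have [v ev] : exists v, v = c / d by exists (c / d).
have aE : a = u * b by rewrite eu divfK.
have cE : c = v * d by rewrite ev divfK.
rewrite -eu -ev in ew D0 ab cd.
have wb : w <= b.
  have : w * (u + v - 1) <= b * (u + v - 1).
    rewrite ew mulrBr mulrDr (mulrC b u) -aE mulr1; have : b * v > b * c by rewrite ltr_pM2l.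
    by nra.
  by rewrite ler_pM2r.
have wd : w <= d.
  have : w * (u + v - 1) <= d * (u + v - 1).
    rewrite ew mulrBr mulrDr (mulrC d v) -cE mulr1; have : d * u > d * a by rewrite ltr_pM2l.
    by nra.
  by rewrite ler_pM2r.
exists (c * (1 - w / d)), (a * (1 - w / b)), w; split; [split=> //|split].
- by rewrite mulr_ge0 ?(ltW c0)// subr_ge0 ler_pdivrMr// mul1r.
- by rewrite mulr_ge0 ?(ltW a0)// subr_ge0 ler_pdivrMr// mul1r.
- have -> : c * (1 - w / d) + a * (1 - w / b) + w = a + c - w * (a / b + c / d - 1) by ring.
  by rewrite -eu -ev ew; ring.
- by field; rewrite an bn.
- by field; rewrite cn dn.
Qed.

Section DisjointDiscs.
Variable R : realType.
Notation tet := (tetrahedron R).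
Notation pos := ('I_4 -> 'I_4 -> R).
Implicit Types (A B : {set 'I_4}) (p q : pos).

Lemma face_point (k l m f : 'I_4) (x y z : R) : uniq [:: k; l; m; f] -> 0 <= x -> 0 <= y -> 0 <= z -> x + y + z = 1 ->
  exists X : tet, [/\ crd X k = x, crd X l = y, crd X m = z & crd X f = 0].
Proof.
move=> un x0 y0 z0 s; pose g (i : 'I_4) := if i == k then x else if i == l then y else if i == m then z else 0.
have [[h1 h2 h3] [h4 h5 h6]] := uniq4 un.
have g0 i : 0 <= g i by rewrite /g; do 3 (case: ifP => _ //).
have g1 : \sum_i g i = 1.
  rewrite (sum4P _ _ un) !big_cons big_nil /g /= !eqxx (negbTE h1) (negbTE h2) (negbTE h3) (negbTE h4) (negbTE h5) (negbTE h6).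
  by rewrite -s; ring.
exists (mkt g); rewrite !(crd_mkt g0 g1) /g !eqxx (negbTE h1) (negbTE h2) (negbTE h3) (negbTE h4) (negbTE h5) (negbTE h6).
by [].
Qed.

Section pair.
Variables (A B : {set 'I_4}) (p q : pos) (k l m f : 'I_4).
Hypotheses (tA : dtype A) (tB : dtype B) (up : unit_pos p) (uq : unit_pos q) (ap : antisym p) (aq : antisym q)
  (dis : disc A p `&` disc B q = set0) (un : uniq [:: k; l; m; f]).

(** Arcs around [k] whose ends are not strictly in the same order cross in the face, at a common
    point of the two discs. *)
Lemma parallel_arcs : sep A k l -> sep A k m -> sep B k l -> sep B k m ->
  p k l <= q k l -> p k l < q k l /\ p k m < q k m.
Proof.
move=> s1 s2 s3 s4.
have one (r : R) : 0 < r < 1 -> 1 < r^-1 by move=> /andP[r0 r1]; rewrite invf_gt1.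
have cr (x y : R) : 0 <= x -> 0 <= y -> x + y <= 1 -> (p k l)^-1 * x + (p k m)^-1 * y = 1 ->
    (q k l)^-1 * x + (q k m)^-1 * y = 1 -> False.
  move=> x0 y0 xy e1 e2; have [X [_ h2 h3 h4]] := @face_point k l m f (1 - x - y) x y un ltac:(lra) x0 y0 ltac:(lra).
  suff : (disc A p `&` disc B q) X by rewrite dis.
  split; apply/(disc_face un) => //; rewrite h2 h3.
    by rewrite ![_ / _]mulrC.
  by rewrite ![_ / _]mulrC.
have pos (r : pos) (ur : unit_pos r) i j : 0 < r i j by have /andP[] := ur i j.
have [h|h] := ltP (p k m) (q k m); last first.
  move=> h'; exfalso.
  have [||||||x [y [x0 y0 xy e1 e2]]] := @lines_cross R (p k l)^-1 (p k m)^-1 (q k l)^-1 (q k m)^-1; try exact: one.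
  - by rewrite lef_pV2 ?posrE ?pos.
  - by rewrite lef_pV2 ?posrE ?pos.
  exact: (cr x y).
have [h'|h' _] := ltP (p k l) (q k l); first by split.
exfalso; have [||||||x [y [x0 y0 xy e1 e2]]] := @lines_cross R (q k l)^-1 (q k m)^-1 (p k l)^-1 (p k m)^-1; try exact: one.
- by rewrite lef_pV2 ?posrE ?pos.
- by rewrite lef_pV2 ?posrE ?pos ?ltW.
exact: (cr x y).
Qed.

Lemma crossing_arcs : sep A k l -> sep A k m -> sep B l k -> sep B l m -> p k l < q k l.
Proof.
move=> s1 s2 s3 s4; rewrite ltNge; apply/negP => h.
have [|x [y [z [[x0 y0 z0] [s e1 e2]]]]] := @lines_cross2 R (p k l) (p k m) (q l k) (q l m) (up _ _) (up _ _) (uq _ _) (uq _ _).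
  by rewrite (aq k l); lra.
have [X [h1 h2 h3 h4]] := face_point un x0 y0 z0 s.
have un' : uniq [:: l; k; m; f].
  by move: un; rewrite /= !inE !negb_or => /and4P[/and3P[a1 a2 a3] /andP[a4 a5] a6 _]; rewrite eq_sym a1 a2 a3 a4 a5 a6.
suff : (disc A p `&` disc B q) X by rewrite dis.
split; first by apply/(disc_face un) => //; rewrite h2 h3.
by apply/(disc_face un') => //; rewrite h1 h3.
Qed.

End pair.

(** The conditional form turns type and corners into total functions on sets. *)
Lemma shape_exists (D : set tet) : exists s : {set 'I_4} * pos,
  normal_disc D -> [/\ ntype s.1, unit_pos s.2, antisym s.2 & D = disc s.1 s.2].
Proof.
have [nD|nD] := pselect (normal_disc D); last by exists (finset.set0, fun _ _ => 0).
by have [A [p h]] := normal_disc_shape nD; exists (A, p).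
Qed.

Definition disc_type (D : set tet) : {set 'I_4} := (projT1 (cid (shape_exists D))).1.
Definition corner (D : set tet) : pos := (projT1 (cid (shape_exists D))).2.

Lemma corner_disc D : normal_disc D -> D = disc (disc_type D) (corner D).
Proof. by move=> nD; rewrite /disc_type /corner; case: cid => s /= /(_ nD)[]. Qed.

Lemma disc_type_ntype D : normal_disc D -> ntype (disc_type D).
Proof. by move=> nD; rewrite /disc_type; case: cid => s /= /(_ nD)[]. Qed.

Lemma corner_unit D : normal_disc D -> unit_pos (corner D).
Proof. by move=> nD; rewrite /corner; case: cid => s /= /(_ nD)[]. Qed.

Lemma corner_antisym D : normal_disc D -> antisym (corner D).
Proof. by move=> nD; rewrite /corner; case: cid => s /= /(_ nD)[]. Qed.

(** Only the arcs in the faces are used: in a face, disjoint arcs around one vertex are nested, and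
    disjoint arcs around two vertices leave the order of their ends no choice. *)
Lemma disjoint_stack (DD : set (set tet)) : (forall D, DD D -> normal_disc D) -> trivIset DD id ->
  stack disc_type DD corner.
Proof.
move=> nD tI.
have dj D E : DD D -> DD E -> D <> E -> disc (disc_type D) (corner D) `&` disc (disc_type E) (corner E) = set0.
  move=> dD dE ne; rewrite -!corner_disc; try exact: nD.
  have [//|/eqP/set0P[x [xD xE]]] := pselect (D `&` E = set0).
  by case: ne; apply: tI => //; exists x.
split.
- by move=> D /nD h; split; [exact: disc_type_ntype|exact: corner_unit|exact: corner_antisym].
- move=> D E dD dE ne tt.
  have [hD hE] := (nD _ dD, nD _ dE).
  have nt := disc_type_ntype hD; have t1 := ntype_dtype nt; have t2 := ntype_dtype (disc_type_ntype hE).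
  have [[u1 u2] [a1 a2]] := ((corner_unit hD, corner_unit hE), (corner_antisym hD, corner_antisym hE)).
  have H D' E' : DD D' -> DD E' -> D' <> E' -> disc_type D' = disc_type E' -> disc_type D' = disc_type D ->
      forall k l m f, uniq [:: k; l; m; f] -> sep (disc_type D) k l -> sep (disc_type D) k m ->
      corner D' k l <= corner E' k l -> corner D' k l < corner E' k l /\ corner D' k m < corner E' k m.
    move=> dD' dE' ne' tt' tD k l m f un s1 s2 le.
    have [hD' hE'] := (nD _ dD', nD _ dE').
    apply: (@parallel_arcs (disc_type D') (disc_type E') (corner D') (corner E') k l m f) => //.
    + exact/ntype_dtype/disc_type_ntype. + exact/ntype_dtype/disc_type_ntype.
    + exact: corner_unit. + exact: corner_unit. + exact: corner_antisym. + exact: corner_antisym.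
    + exact: dj.
    + by rewrite tD. + by rewrite tD. + by rewrite -tt' tD. + by rewrite -tt' tD.
  have [u [v [a [b [un Ae]]]]] := dtypeP t1.
  have [[h1 h2 h3] [h4 h5 h6]] := uniq4 un.
  have [k1 k2 k3] : [/\ u != v, u != a & u != b] by rewrite ![u == _]eq_sym.
  have [k4 k5 k6] : [/\ v != a, v != b & a != b] by rewrite ![v == _]eq_sym ![a == b]eq_sym.
  have H' := H E D dE dD (fun e => ne (esym e)) (esym tt) (esym tt); have {}H := H D E dD dE ne tt erefl.
  have perm4 k l m f : uniq [:: k; l; m; f] -> uniq [:: k; l; f; m].
    by rewrite /= !inE !negb_or (eq_sym f) => /and4P[/and3P[-> -> ->] /andP[-> ->] -> _].
  have NE := (eqxx, negbTE h1, negbTE h2, negbTE h3, negbTE h4, negbTE h5, negbTE h6,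
     negbTE k1, negbTE k2, negbTE k3, negbTE k4, negbTE k5, negbTE k6).
  case: Ae => Ae.
    have s j : j != u -> sep (disc_type D) u j by move=> ju; rewrite /sep Ae !inE eqxx (negbTE ju).
    have K (D' E' : set tet) : (forall k l m f, uniq [:: k; l; m; f] -> sep (disc_type D) k l -> sep (disc_type D) k m ->
        corner D' k l <= corner E' k l -> corner D' k l < corner E' k l /\ corner D' k m < corner E' k m) ->
        corner D' u v <= corner E' u v -> forall i j, i \in disc_type D -> j \notin disc_type D -> corner D' i j < corner E' i j.
      move=> HH le i j; rewrite Ae !inE => /eqP -> ju.
      have := all4P j un; rewrite !inE (negbTE ju) /= => /or3P[] /eqP ->.
      - by have [] := HH u v a b un (s _ h1) (s _ h2) le.
      - by have [] := HH u v a b un (s _ h1) (s _ h2) le.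
      - by have [] := HH u v b a (perm4 _ _ _ _ _ un) (s _ h1) (s _ h3) le.
    have [le|/ltW le] := leP (corner D u v) (corner E u v); [left|right]; exact: K.
  have un1 : uniq [:: u; a; b; v] by rewrite /= !inE !NE.
  have un2 : uniq [:: b; u; v; a] by rewrite /= !inE !NE.
  have un3 : uniq [:: a; u; v; b] by rewrite /= !inE !NE.
  have K (D' E' : set tet) : antisym (corner D') -> antisym (corner E') ->
      (forall k l m f, uniq [:: k; l; m; f] -> sep (disc_type D) k l -> sep (disc_type D) k m ->
      corner D' k l <= corner E' k l -> corner D' k l < corner E' k l /\ corner D' k m < corner E' k m) ->
      (forall k l m f, uniq [:: k; l; m; f] -> sep (disc_type D) k l -> sep (disc_type D) k m ->
      corner E' k l <= corner D' k l -> corner E' k l < corner D' k l /\ corner E' k m < corner D' k m) ->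
      corner D' u a <= corner E' u a -> forall i j, i \in disc_type D -> j \notin disc_type D -> corner D' i j < corner E' i j.
    (* The comparison passes from edge to edge around the quadrilateral; at [a] and [b] the edges
       are read from their other ends, which reverses it. *)
    move=> aD' aE' HH HH' le.
    have [l1 l2] : corner D' u a < corner E' u a /\ corner D' u b < corner E' u b.
      by apply: (HH u a b v) => //; rewrite /sep Ae !inE !NE.
    have [_ l3] : corner E' b u < corner D' b u /\ corner E' b v < corner D' b v.
      by apply: (HH' b u v a) => //; rewrite ?/sep ?Ae ?inE ?NE //= (aD' u b) (aE' u b) lerD2l lerN2 ltW.
    have [_ l4] : corner E' a u < corner D' a u /\ corner E' a v < corner D' a v.
      by apply: (HH' a u v b) => //; rewrite ?/sep ?Ae ?inE ?NE //= (aD' u a) (aE' u a) lerD2l lerN2 ltW.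
    rewrite (aE' v b) (aD' v b) ltrD2l ltrN2 in l3; rewrite (aE' v a) (aD' v a) ltrD2l ltrN2 in l4.
    move=> i j; rewrite Ae !inE => /orP[] /eqP -> /norP[ju jv]; have := all4P j un; rewrite !inE (negbTE ju) (negbTE jv) /= => /orP[] /eqP ->; assumption.
  by have [le|/ltW le] := leP (corner D u a) (corner E u a); [left|right]; apply: K.
- move=> D E i j m dD dE im jm s1 s2 s3 s4.
  have ij : i != j by apply: contraTneq s1 => ->; rewrite /sep eqxx.
  have ne : D <> E.
    by move=> e; move: s1 s2 s4; rewrite e /sep; case: (i \in _); case: (j \in _); case: (m \in _).
  have [a [b un]] := complete2 ij.
  have [f un'] : exists f, uniq [:: i; j; m; f].
    have [[h1 h2 h3] [h4 h5 h6]] := uniq4 un.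
    have [k1 k2 k3] : [/\ i != j, i != a & i != b] by rewrite ![i == _]eq_sym.
    have [k4 k5 k6] : [/\ j != a, j != b & a != b] by rewrite ![j == _]eq_sym ![a == b]eq_sym.
    have := all4P m un; rewrite !inE ![m == _]eq_sym (negbTE im) (negbTE jm) /= ![_ == m]eq_sym => /orP[] /eqP ->; [exists b|exists a].
      by rewrite /= !inE !negb_or k1 k2 k3 k4 k5 k6.
    by rewrite /= !inE !negb_or k1 k2 k3 k4 k5 h6.
  have [hD hE] := (nD _ dD, nD _ dE).
  apply: (@crossing_arcs (disc_type D) (disc_type E) (corner D) (corner E) i j m f) => //.
  + exact/ntype_dtype/disc_type_ntype. + exact/ntype_dtype/disc_type_ntype.
  + exact: corner_unit. + exact: corner_unit. + exact: corner_antisym. + exact: corner_antisym.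
  + exact: dj.
Qed.

End DisjointDiscs.

(** * Local finiteness *)

Section Sets.

Lemma all_finite (T : finType) (X : set T) : finite_set X.
Proof. by apply: (@sub_finite_set _ _ [set: T]) => //; exact: finite_setT. Qed.

End Sets.

Section LocalFiniteness.
Variables (R : realType) (n : nat) (Phi : set (face_isometry R n)).
Notation tet := (tetrahedron R).
Notation q := (quotient_map (R:=R) (n:=n) Phi).
Variables (S : set (glued_space Phi)) (DD : 'I_n -> set (set tet)).
Hypotheses (pm : pseudo_manifold Phi)
  (nD : forall t D, DD t D -> normal_disc D) (tI : forall t, trivIset (DD t) id)
  (SD : forall t, q t @^-1` S = \bigcup_(D in DD t) D)
  (ax2 : limit_point (S `&` @skeleton R n Phi 1) `<=` @skeleton R n Phi 0)
  (ax3 : forall x : nat -> glued_space Phi, range x `<=` S -> limit_point (range x) `<=` S `|` @skeleton R n Phi 0).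
Implicit Types (t : 'I_n) (D E : set tet) (i j k l m : 'I_4).

Let st t : stack (@disc_type R) (DD t) (@corner R).
Proof. by apply: disjoint_stack => // D; exact: nD. Qed.

(** The gluing preserves the number of nonzero coordinates, and a vertex has only one. *)
Lemma skeleton0 t x : (1 < #|supp x|)%N -> ~ @skeleton R n Phi 0 (q t x).
Proof.
move=> c [t' [J [cJ [y Jy e]]]]; have := q_supp e => e'.
have : (#|supp y| <= #|J|)%N.
  apply: subset_leq_card; apply/fintype.subsetP => i; rewrite inE; apply: contraNT => iJ.
  by apply/eqP; exact: Jy.
by move=> h; move: c; rewrite -e' ltnNge (leq_trans h cJ).
Qed.

Definition edge_pt i j (r : R) : tet := slide (fun=> vtx R j) (clamp r) (vtx R i).

Lemma edge_pt_crd i j r : 0 <= r <= 1 -> i != j ->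
  [/\ crd (edge_pt i j r) i = 1 - r, crd (edge_pt i j r) j = r & forall k, k != i -> k != j -> crd (edge_pt i j r) k = 0].
Proof.
move=> r01 ij; have E k : crd (edge_pt i j r) k = (1 - r) * (k == i)%:R + r * (k == j)%:R.
  by rewrite crd_slide clamp_id// !crd_vtx.
split=> [||k ki kj]; rewrite E ?eqxx.
- by rewrite (negbTE ij) mulr1 mulr0 addr0.
- by rewrite eq_sym (negbTE ij) mulr1 mulr0 add0r.
- by rewrite (negbTE ki) (negbTE kj) !mulr0 addr0.
Qed.

Lemma edge_pt_continuous i j : continuous (edge_pt i j).
Proof.
move=> s; apply: (@continuous_comp _ _ _ (fun s : R => (vtx R i, s)) (fun z : tet * R => slide (fun=> vtx R j) (clamp z.2) z.1)).
  exact: pairr_continuous.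
by apply: (@slide_continuous R (fun=> vtx R j)) => z; exact: cst_continuous.
Qed.

Lemma edge_pt_supp i j r : 0 < r < 1 -> i != j -> supp (edge_pt i j r) = [set i; j]%SET.
Proof.
move=> /andP[r0 r1] ij; have [|h1 h2 h3] := @edge_pt_crd i j r _ ij; first by rewrite !ltW.
apply/finset.setP => k; rewrite !inE; have [->|ki] := eqVneq k i; first by rewrite h1 gt_eqF// subr_gt0.
have [->|kj] := eqVneq k j; first by rewrite h2 gt_eqF.
by rewrite h3// eqxx.
Qed.

Lemma disc_edge A p i j r : dtype A -> unit_pos p -> antisym p -> sep A i j -> 0 <= r <= 1 ->
  disc A p (edge_pt i j r) <-> r = p i j.
Proof.
move=> tA up ap s r01; have ij : i != j by apply: contraTneq s => ->; rewrite /sep eqxx.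
have [h1 h2 h3] := edge_pt_crd r01 ij.
have [a [b un]] := complete2 ij; have [[k1 k2 k3] [k4 k5 k6]] := uniq4 un.
have pn k l : p k l != 0 by have /andP[h _] := up k l; rewrite gt_eqF.
have [sa|sa] := boolP (sep A i a).
  have un' : uniq [:: i; j; a; b] by [].
  apply: (iff_trans (disc_face un' tA up ap s sa (h3 b k3 k5))).
  rewrite h2 (h3 a)// mul0r addr0; split=> [/(canRL (divfK (pn _ _)))|->]; last by rewrite divff.
  by rewrite mul1r.
have s' : sep A j a by move: s sa; rewrite /sep negbK => + /eqP <-; rewrite eq_sym.
have un' : uniq [:: j; i; a; b].
  by move: un; rewrite /= !inE !negb_or => /and4P[/and3P[a1 a2 a3] /andP[a4 a5] a6 _]; rewrite eq_sym a1 a2 a3 a4 a5 a6.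
have sji : sep A j i by rewrite sepC.
apply: (iff_trans (disc_face un' tA up ap sji s' (h3 b k3 k5))).
rewrite h1 (h3 a)// mul0r addr0 (ap i j); have pj : 1 - p i j != 0 by rewrite -(ap i j).
split=> [/(canRL (divfK pj))|->]; last by rewrite divff.
by rewrite mul1r; lra.
Qed.

Lemma corner_in D i j : normal_disc D -> sep (disc_type D) i j -> D (edge_pt i j (corner D i j)).
Proof.
move=> h s; have := corner_unit h i j => /andP[c0 c1].
have c01 : 0 <= corner D i j <= 1 by rewrite !ltW.
rewrite {1}(corner_disc h); apply/(disc_edge _ _ _ s c01) => //.
- exact/ntype_dtype/disc_type_ntype.
- exact: corner_unit.
- exact: corner_antisym.
Qed.

Lemma locally_finite t i j (a b : R) : 0 < a -> b < 1 ->
  finite_set [set D | [/\ DD t D, sep (disc_type D) i j & a <= corner D i j <= b]].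
Proof.
move=> a0 b1; set X := [set D | _].
have [ij|ij] := eqVneq i j.
  by rewrite (_ : X = set0)//; apply/seteqP; split=> // D [_]; rewrite ij /sep eqxx.
apply: contrapT => infX.
pose V := (fun D => corner D i j) @` X.
have injc : {in X &, injective (fun D => corner D i j)}.
  move=> D E /set_mem[dD sD _] /set_mem[dE sE _] e; apply: contrapT => ne.
  by have := stack_neq (st t) dD dE ne sD sE; rewrite e eqxx.
have infV : infinite_set V.
  by move=> fV; apply: infX; rewrite -(eq_finite_set (inj_card_eq injc)).
have bV : bounded_set V.
  exists 1; split; first exact: num_real.
  move=> M M1 _ [D [_ _ /andP[h1 h2]] <-]; rewrite /= ger0_norm; first by apply: ltW; lra.
  by lra.
have [r rV] := infinite_bounded_limit_point_nonempty infV bV.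
have rab : a <= r <= b.
  apply/andP; split; rewrite leNgt; apply/negP => h.
    have [_ [_ [D [_ _ /andP[h1 _]] <-] h2]] := rV _ (lt_nbhsl h).
    by move: h2; rewrite ltNge h1.
  have [_ [_ [D [_ _ /andP[_ h1]] <-] h2]] := rV _ (lt_nbhsr h).
  by move: h2; rewrite ltNge h1.
have r01 : 0 < r < 1 by move: rab => /andP[h1 h2]; apply/andP; split; lra.
have cr : #|supp (edge_pt i j r)| = 2%N by rewrite edge_pt_supp// cards2 ij.
apply: (@skeleton0 t (edge_pt i j r)); first by rewrite cr.
apply: ax2 => U hU.
have hU' : nbhs r [set s | U (q t (edge_pt i j s))].
  have c1 : continuous (q t \o edge_pt i j).
    by move=> s; apply: continuous_comp; [exact: edge_pt_continuous|exact: q_continuous].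
  exact: (c1 r U hU).
have [v [vr [D [dD sD /andP[h1 h2]] ev] /= Uv]] := rV _ hU'; rewrite -ev in vr Uv.
have v01 : 0 < corner D i j < 1 by apply/andP; split; lra.
exists (q t (edge_pt i j (corner D i j))); split=> //.
  (* Distinct points of the open edge stay distinct in the quotient by the defining property of a
     pseudo-manifold. *)
  apply/eqP => e; move/eqP: vr; apply.
  have c2 : #|[set i; j]%SET| = 2%N by rewrite cards2 ij.
  have : edge_pt i j (corner D i j) = edge_pt i j r.
    by apply: (pm.2 t [set i; j]%SET c2) e; apply/mem_set/open_supp; rewrite edge_pt_supp.
  move=> /(congr1 (fun x => crd x j)).
  have vc : 0 <= corner D i j <= 1 by case/andP: v01 => *; rewrite !ltW.
  have rc : 0 <= r <= 1 by case/andP: r01 => *; rewrite !ltW.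
  by have [_ -> _] := edge_pt_crd vc ij; have [_ -> _] := edge_pt_crd rc ij.
split.
  have : (q t @^-1` S) (edge_pt i j (corner D i j)) by rewrite SD; exists D => //; exact: corner_in (nD dD) sD.
  by [].
exists t, [set i; j]%SET; split; first by rewrite cards2 ij.
exists (edge_pt i j (corner D i j)) => // k; rewrite !inE negb_or => /andP[ki kj].
have [|_ _ h3] := @edge_pt_crd i j (corner D i j) _ ij; first by case/andP: v01 => *; rewrite !ltW.
exact: h3.
Qed.

End LocalFiniteness.

(** The height of a point of a disc is the mean of the positions of the corners with respect to its
    weights. *)
Lemma lam_disc_ge (R : realType) (A : {set 'I_4}) (p : 'I_4 -> 'I_4 -> R) x c : disc A p x ->
  (forall i j, i \in A -> j \notin A -> c <= p i j) -> c <= lam A x.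
Proof.
move=> [w [w0 hA hB _]] le; rewrite -subr_ge0.
have -> : lam A x - c = lam A x * (1 - c) - (1 - lam A x) * c by ring.
rewrite -lamC /lam !mulr_suml (eq_bigr (fun j => \sum_(i in A) w i j * p i j * (1 - c))); last first.
  by move=> j jA; rewrite hB// mulr_suml.
rewrite [X in _ - X](eq_bigr (fun i => \sum_(j | j \notin A) w i j * (1 - p i j) * c)); last first.
  by move=> i iA; rewrite hA// mulr_suml.
rewrite exchange_big /= -sumrB sumr_ge0// => i iA; rewrite -sumrB sumr_ge0// => j jA.
have -> : w i j * p i j * (1 - c) - w i j * (1 - p i j) * c = w i j * (p i j - c) by ring.
by rewrite mulr_ge0// subr_ge0 le.
Qed.

Lemma eps_finite (R : realFieldType) (T : Type) (X : set T) (P : T -> R -> Prop) : finite_set X ->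
  (forall x, X x -> exists2 e, 0 < e & P x e) -> (forall x e e', X x -> 0 < e' -> e' <= e -> P x e -> P x e') ->
  exists2 e, 0 < e & forall x, X x -> P x e.
Proof.
move=> fX H mono; elim/Pchoice: T => T in X P fX H mono *.
have /finite_seqP[s sE] := fX.
suff : exists2 e : R, 0 < e & forall x, x \in s -> P x e.
  by move=> [e e0 h]; exists e => // x xX; apply: h; move: xX; rewrite sE.
have : forall x, x \in s -> X x by move=> x; rewrite sE.
elim: s {sE} => [_|a s IH sub]; first by exists 1 => [|x]; rewrite ?ltr01 ?in_nil.
have [x xs|e e0 he] := IH; first by apply: sub; rewrite inE xs orbT.
have Xa : X a by apply: sub; rewrite mem_head.
have [e' e'0 he'] := H _ Xa.
have m0 : 0 < Num.min e e' by rewrite lt_min e0.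
exists (Num.min e e') => // x; rewrite inE => /orP[/eqP ->|xs].
  by apply: (mono a e' _ Xa m0 _ he'); rewrite ge_min lexx orbT.
have Xx : X x by apply: sub; rewrite inE xs orbT.
by apply: (mono x e _ Xx m0 _ (he _ xs)); rewrite ge_min lexx.
Qed.

Lemma inv_nat_lt (R : realType) (d : R) : 0 < d -> exists k : nat, k.+1%:R^-1 < d.
Proof.
move=> d0; exists (Num.truncn d^-1); have h := real_truncnS_gt (num_real d^-1).
by rewrite -[ltRHS]invrK ltf_pV2 ?posrE ?invr_gt0 ?ltr0n.
Qed.

Section Stacks.
Variables (R : realType) (n : nat) (Phi : set (face_isometry R n)).
Notation tet := (tetrahedron R).
Notation q := (quotient_map (R:=R) (n:=n) Phi).

Definition decomposed (S : set (glued_space Phi)) (DD : 'I_n -> set (set tet)) : Prop :=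
  [/\ forall t D, DD t D -> normal_disc D, forall t, trivIset (DD t) id,
      forall t, q t @^-1` S = \bigcup_(D in DD t) D,
      limit_point (S `&` @skeleton R n Phi 1) `<=` @skeleton R n Phi 0
    & forall x : nat -> glued_space Phi, range x `<=` S -> limit_point (range x) `<=` S `|` @skeleton R n Phi 0].

Variables (S : set (glued_space Phi)) (DD : 'I_n -> set (set tet)).
Hypotheses (pm : pseudo_manifold Phi) (dS : decomposed S DD).
Implicit Types (t : 'I_n) (D E : set tet) (i j k l m : 'I_4) (B : {set 'I_4}).

Lemma dec_normal t D : DD t D -> normal_disc D. Proof. by case: dS => h _ _ _ _; exact: h. Qed.

Lemma dec_stack t : stack (@disc_type R) (DD t) (@corner R).
Proof. by case: dS => h tI _ _ _; apply: disjoint_stack => // D; exact: h. Qed.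

Lemma dec_finite t i j (a b : R) : 0 < a -> b < 1 ->
  finite_set [set D | [/\ DD t D, sep (disc_type D) i j & a <= corner D i j <= b]].
Proof. by case: dS => h1 h2 h3 h4 h5; exact: (locally_finite pm h1 h2 h3 h4). Qed.

Let st := dec_stack.

(** The height of a point of a normal disc is strictly between 0 and 1, so its positive coordinates
    do not all lie on one side of the type. *)
Lemma sep_face_point B x E : normal_disc E -> E x -> (forall j, (0 < crd x j) = (j \notin B)) ->
  exists j j', [/\ j \notin B, j' \notin B & sep (disc_type E) j j'].
Proof.
move=> nE Ex hx; set T := disc_type E.
have tT : dtype T by exact/ntype_dtype/disc_type_ntype.
have sx : 0 < lam T x < 1.
  apply: (surface_lam (surface_disc tT (corner_unit nE))); by rewrite -corner_disc.
have x0 j : j \in B -> crd x j = 0.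
  by move=> jB; apply/le_anti; rewrite crd_ge0 andbT leNgt hx jB.
have [j jB jT] : exists2 j, j \notin B & j \in T.
  apply: contrapT => H; move: sx; rewrite -[lam T x](subKr 1) -lamC big1 ?subr0 ?ltxx ?andbF// => j jT.
  by have [/x0//|jB] := boolP (j \in B); case: H; exists j.
have [j' j'B j'T] : exists2 j, j \notin B & j \notin T.
  apply: contrapT => H; move: sx; rewrite /lam big1 ?ltxx// => k kT.
  by have [/x0//|kB] := boolP (k \in B); case: H; exists k.
by exists j, j'; split=> //; exact: sep_in.
Qed.

(* Discs whose corners all tend to the side opposite to B accumulate at interior
   points of this side, which S must then contain; a disc of S through such a point
   crosses the edges towards B and thus bounds the corners. *)
Lemma no_collapse t B : dtype B -> (1 < #|~: B|)%N ->
  exists2 e : R, 0 < e & forall D, DD t D -> disc_type D = B \/ disc_type D = (~: B)%SET ->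
    exists i j, [/\ i \in B, j \notin B & corner D i j <= 1 - e].
Proof.
move=> tB cB; apply: contrapT => H.
have {}H (e : R) : 0 < e -> exists D, [/\ DD t D, disc_type D = B \/ disc_type D = (~: B)%SET &
    forall i j, i \in B -> j \notin B -> 1 - e < corner D i j].
  move=> e0; apply: contrapT => H'; apply: H; exists e => // D dD tD; apply: contrapT => H''.
  apply: H'; exists D; split=> // i j iB jB; rewrite ltNge; apply/negP => le.
  by apply: H''; exists i, j.
have sepB D i j : disc_type D = B \/ disc_type D = (~: B)%SET -> i \in B -> j \notin B -> sep (disc_type D) i j.
  by move=> [->|->] iB jB; rewrite ?sep_setC; exact: sep_in.
have [i0 i0B] : exists i, i \in B by apply/set0Pn; rewrite -card_gt0; case/orP: tB => /eqP ->.
have g0 (i : 'I_4) : 0 <= (4^-1 : R) by rewrite invr_ge0.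
have g1 : \sum_(i < 4) (4^-1 : R) = 1 by rewrite sumr_const card_ord -[LHS]mulr_natr mulVf ?pnatr_eq0.
pose x0 := mkt (fun _ : 'I_4 => 4^-1 : R).
have x0E i : crd x0 i = 4^-1 by exact: (crd_mkt g0 g1).
have l0 : 0 < lam B x0 < 1.
  apply/andP; split.
    have [j jB] : exists j, j \in (~: B)%SET by apply/set0Pn; rewrite -card_gt0 (ltn_trans _ cB).
    rewrite /lam (bigD1 j) /=; last by move: jB; rewrite inE.
    by rewrite ltr_pwDl ?sumr_ge0// ?x0E ?invr_gt0// => i _; rewrite x0E.
  rewrite -subr_gt0 -lamC (bigD1 i0)//=.
  by rewrite ltr_pwDl ?sumr_ge0// ?x0E ?invr_gt0// => i _; rewrite x0E.
(* The end, in the interior of the side opposite to [B], of the ray through the barycentre of the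
   tetrahedron. *)
pose beta := ray B x0 1.
have l0' : 0 < lam B x0 by case/andP: l0.
have bE j : (0 < crd beta j) = (j \notin B).
  rewrite crd_ray ?ler01 ?lexx//; case: ifP => _; first by rewrite subrr mul0r mulr0 ltxx.
  by rewrite x0E mulr_gt0 ?invr_gt0// divr_gt0.
have sb : supp beta = (~: B)%SET.
  by apply/finset.setP => j; rewrite !inE -bE lt_def crd_ge0 andbT.
have dB D : DD t D -> disc_type D = B \/ disc_type D = (~: B)%SET -> D = disc B (corner D).
  move=> dD tD; have nD := dec_normal dD; rewrite {1}(corner_disc nD); case: tD => -> //.
  by rewrite disc_setC//; exact: corner_antisym.
have e0 (k : nat) : 0 < (k.+1%:R^-1 : R) by rewrite invr_gt0 ltr0n.
have /choice[D hD] : forall k : nat, exists D, [/\ DD t D, disc_type D = B \/ disc_type D = (~: B)%SET &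
    forall i j, i \in B -> j \notin B -> 1 - k.+1%:R^-1 < corner D i j] by move=> k; exact: H.
pose mu (k : nat) := level B (disc B (corner (D k))) x0.
have muP (k : nat) : [/\ 0 < mu k < 1, 1 - k.+1%:R^-1 <= mu k & D k (ray B x0 (mu k))].
  have [dD tD h] := hD k; have nD := dec_normal dD.
  have sD := surface_disc tB (corner_unit nD).
  have [m01 dm] := levelP sD l0; split=> //; last by rewrite {1}(dB _ dD tD).
  have m01' : 0 <= mu k <= 1 by case/andP: m01 => *; rewrite !ltW.
  rewrite -(lam_ray l0 m01'); apply: (lam_disc_ge dm) => i j iB jB; apply: ltW; exact: h.
pose xs (k : nat) := q t (ray B x0 (mu k)).
have xsS : range xs `<=` S.
  move=> _ [k _ <-]; have [_ _ dk] := muP k; have [dD _ _] := hD k.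
  suff : (q t @^-1` S) (ray B x0 (mu k)) by [].
  by case: dS => _ _ -> _ _; exists (D k).
have lim : limit_point (range xs) (q t beta).
  move=> U hU; have hU' : nbhs (1 : R) [set m : R | U (q t (ray B x0 (clamp m)))].
    have c1 : {for (1 : R), continuous (fun m : R => q t (ray B x0 (clamp m)))}.
      apply: (@continuous_comp _ _ _ (fun m : R => ray B x0 (clamp m))); last exact: q_continuous.
      apply: (@continuous_comp _ _ _ (fun m : R => (x0, m)) (fun z : tet * R => ray B z.1 (clamp z.2))).
        exact: pairr_continuous.
      exact: ray_continuous.
    by apply: c1; rewrite clamp_id ?lexx ?ler01.
  have [d /= d0 hd] := hU'.
  have [k kd] : exists k : nat, k.+1%:R^-1 < d.
    exact: inv_nat_lt.
  have [/andP[m0 m1] mk dk] := muP k.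
  exists (xs k); split; last 2 first.
  - by exists k.
  - have := hd (mu k); rewrite /= clamp_id ?ltW// => h; apply: h.
    by rewrite /ball/= ger0_norm ?subr_ge0 ?(ltW m1)//; apply: le_lt_trans kd; rewrite lerBlDr -lerBlDl.
  (* The approximating points are interior to the tetrahedron, hence are not identified with their
     limit. *)
  apply/eqP => /q_supp; rewrite sb.
  have -> : supp (ray B x0 (mu k)) = finset.setT.
    apply/finset.setP => i; rewrite !inE crd_ray// ?ltW// x0E.
    case: ifP => _; apply/eqP/nesym/eqP; rewrite lt_eqF// mulr_gt0 ?invr_gt0//.
      by rewrite divr_gt0// subr_gt0//; case/andP: l0.
    by rewrite divr_gt0.
  rewrite cardsT => e; have := cardsC B; rewrite -e card_ord => /eqP.
  by rewrite -[X in _ == X]add0n eqn_add2r; case/orP: tB => /eqP ->.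
case: dS => _ _ Spre _ ax3; case: (ax3 _ xsS _ lim) => [Sb|]; last first.
  by apply: skeleton0; rewrite sb.
have [E dE Eb] : (\bigcup_(D in DD t) D) beta by rewrite -Spre.
have nE := dec_normal dE.
have [j [j' [jB j'B sj]]] := sep_face_point nE Eb bE.
(* In the face with vertices [i0], [k], [k'] the arc of [E] surrounds [k] and those of the
   collapsing discs surround [i0]; disjointness bounds their corners by that of [E], which one of
   them exceeds. *)
have K k k' : k \notin B -> k' \notin B -> sep (disc_type E) k k' -> sep (disc_type E) k i0 -> False.
  move=> kB k'B s1 s2.
  have := corner_unit nE i0 k => /andP[_ c1].
  have [D' [dD' tD' h]] := H (1 - corner E i0 k) (etrans (subr_gt0 _ _) c1).
  have := h i0 k i0B kB; rewrite opprB addrC subrK.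
  have [_ _ g2] := st t.
  have ik : i0 != k' by apply: contraNneq k'B => <-.
  have kk : k != k' by apply: contraTneq s1 => ->; rewrite /sep eqxx.
  have := g2 D' E i0 k k' dD' dE ik kk (sepB _ _ _ tD' i0B kB) (sepB _ _ _ tD' i0B k'B) s2 s1.
  by move=> l1 l2; have := lt_trans l1 l2; rewrite ltxx.
have [s|s] := boolP (sep (disc_type E) j i0); first exact: (K j j').
apply: (K j' j) => //; first by rewrite sepC.
by move: sj s; rewrite /sep negbK => + /eqP <-; rewrite eq_sym.
Qed.

End Stacks.

Section Types.

(** Separation determines a set up to complement, and [ntype] excludes one of the two. *)
Lemma ntype_sep (A B : {set 'I_4}) : ntype A -> ntype B -> (forall i j, sep A i j = sep B i j) -> A = B.
Proof.
move=> nA nB s; have [c|c] := eqVneq (ord0 \in A) (ord0 \in B).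
  apply/finset.setP => m; have := s ord0 m; rewrite /sep c.
  by case: (ord0 \in B); case: (m \in A); case: (m \in B).
have e : B = (~: A)%SET.
  apply/finset.setP => m; rewrite inE; have := s ord0 m; move: c; rewrite /sep.
  by case: (ord0 \in B); case: (ord0 \in A); case: (m \in A); case: (m \in B).
have cc := cardsC A; rewrite -e card_ord in cc.
have [[u eA]|[v v0 eA]] := ntype_cases nA.
  by move: cc (ntype_dtype nB); rewrite eA cards1 /dtype; case: #|B| => [|[|[|[|]]]].
move: nB; rewrite /ntype e inE; have -> : #|~: A| = 2%N.
  by move: cc; rewrite -e eA cards2 eq_sym v0; case: #|B| => [|[|[|[|]]]].
by rewrite eA !inE eqxx andbF.
Qed.

End Types.

(** Bounds halfway to the ends of the edge: the collar used to move a disc directly onto another one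
    of its type. *)
Lemma between_bounds (R : realFieldType) (a b : R) : 0 < a < 1 -> 0 < b < 1 ->
  [/\ 0 < Num.min a b / 2 < 1, 0 < (Num.max a b + 1) / 2 < 1,
   Num.min a b / 2 < a < (Num.max a b + 1) / 2 & Num.min a b / 2 < b < (Num.max a b + 1) / 2].
Proof.
by have [h|h] := leP a b => /andP[h1 h2] /andP[h3 h4]; split; apply/andP; split; lra.
Qed.

(** * Types as invariants of normal isotopy *)

Section DiscTopology.
Variable R : realType.
Notation tet := (tetrahedron R).
Notation pos := ('I_4 -> 'I_4 -> R).
Implicit Types (A B : {set 'I_4}) (p : pos) (x y c : tet).

Lemma lam_disc_le A p x (c : R) : antisym p -> disc A p x ->
  (forall i j, i \in A -> j \notin A -> p i j <= c) -> lam A x <= c.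
Proof.
move=> ap dx le; rewrite -[lam A x](subKr 1) lerBlDr -lerBlDl -lam_setC.
apply: (@lam_disc_ge R _ p); first by rewrite disc_setC.
by move=> i j; rewrite !inE negbK => iA jA; rewrite (ap j i) lerB// le.
Qed.

(* c is the barycentre of the corners. *)
Lemma disc_star A p : dtype A -> unit_pos p -> exists c, [/\ disc A p c, forall i, 0 < crd c i &
  forall x s y, disc A p x -> 0 <= s <= 1 -> (forall i, crd y i = (1 - s) * crd x i + s * crd c i) -> disc A p y].
Proof.
move=> tA up; have pos i j : 0 < p i j by have /andP[] := up i j.
have pos' i j : 0 < 1 - p i j by have /andP[_] := up i j; rewrite subr_gt0.
have cA : (0 < #|A|)%N by case/orP: tA => /eqP ->.
have cA' : (0 < #|~: A|)%N.
  by have := cardsC A; rewrite card_ord; case/orP: tA => /eqP ->; case: #|~: A|.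
pose N : R := (#|A| * #|~: A|)%:R.
have N0 : 0 < N by rewrite ltr0n muln_gt0 cA.
have Ni : 0 < N^-1 by rewrite invr_gt0.
pose g i := if i \in A then \sum_(j | j \notin A) N^-1 * (1 - p i j) else \sum_(k | k \in A) N^-1 * p k i.
have [a aA] : exists a, a \in A by apply/set0Pn; rewrite -card_gt0.
have [b bA] : exists b, b \notin A.
  have : (~: A)%SET != finset.set0 by rewrite -card_gt0.
  by move=> /set0Pn[b]; rewrite inE; exists b.
have gp i : 0 < g i.
  rewrite /g; case: ifP => iA.
    by rewrite (bigD1 b)//= ltr_pwDl ?mulr_gt0// sumr_ge0// => j _; rewrite mulr_ge0 ?ltW.
  by rewrite (bigD1 a)//= ltr_pwDl ?mulr_gt0// sumr_ge0// => j _; rewrite mulr_ge0 ?ltW.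
have g0 i : 0 <= g i by exact: ltW.
have g1 : \sum_i g i = 1.
  rewrite (bigID (mem A))/= (eq_bigr (fun i => \sum_(j | j \notin A) N^-1 * (1 - p i j))); last by move=> i iA; rewrite /g iA.
  rewrite [X in _ + X](eq_bigr (fun i => \sum_(k in A) N^-1 * p k i)); last by move=> i iA; rewrite /g (negbTE iA).
  rewrite [X in _ + X]exchange_big /= -big_split /=.
  rewrite (eq_bigr (fun=> #|~: A|%:R * N^-1)); last first.
    move=> i iA; rewrite -big_split /= (eq_bigr (fun=> N^-1)); last by move=> j _; ring.
    rewrite sumr_const -[LHS]mulr_natl; congr (_%:R * _); apply: eq_card => j.
    by rewrite !inE.
  rewrite sumr_const -[LHS]mulr_natl mulrA -natrM divff// gt_eqF//.
have cE := crd_mkt g0 g1.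
have dc : disc A p (mkt g).
  exists (fun _ _ => N^-1); split => //.
  - by move=> _ _; exact: ltW.
  - by move=> i iA; rewrite cE /g iA.
  - by move=> j jA; rewrite cE /g (negbTE jA).
exists (mkt g); split=> // [i|x s y [w [w0 hA hB hm]] /andP[s0 s1] e]; first by rewrite cE.
have s1' : 0 <= 1 - s by rewrite subr_ge0.
exists (fun i j => (1 - s) * w i j + s * N^-1); split.
- by move=> i j; rewrite addr_ge0 ?mulr_ge0// ltW.
- move=> i iA; rewrite e hA// cE /g iA !mulr_sumr -big_split /=; apply: eq_bigr => j _; ring.
- move=> j jA; rewrite e hB// cE /g (negbTE jA) !mulr_sumr -big_split /=; apply: eq_bigr => i _; ring.
- move=> i i' j j' iA i'A jA j'A ii jj; rewrite -!addr_minl -!minr_pMr//.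
  by rewrite hm.
Qed.

Lemma seg_connected x y : connected (seg x y).
Proof.
rewrite seg_image; apply: connected_continuous_connected.
  exact: segment_connected.
apply: continuous_subspaceT => s.
apply: (@continuous_comp _ _ _ (fun s : R => (x, s)) (fun z : tet * R => slide (fun=> y) (clamp z.2) z.1)).
  exact: pairr_continuous.
by apply: (@slide_continuous R (fun=> y)) => z; exact: cst_continuous.
Qed.

Lemma normal_closed (D : set tet) : normal_disc D -> closed D.
Proof.
move=> nD; rewrite (corner_disc nD); have [h _ _] := surface_disc (ntype_dtype (disc_type_ntype nD)) (corner_unit nD).
exact: h.
Qed.

Lemma normal_lt1 (D : set tet) x i : normal_disc D -> D x -> crd x i < 1.
Proof.
move=> nD Dx; have := Dx; rewrite {1}(corner_disc nD) => dx.
have l := surface_lam (surface_disc (ntype_dtype (disc_type_ntype nD)) (corner_unit nD)) dx.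
rewrite lt_neqAle crd_le1 andbT; apply/eqP => e.
have z k : k != i -> crd x k = 0.
  move=> ki; have := crd_sum x; rewrite (bigD1 i)//= e -[RHS]addr0 => /addrI h.
  apply/le_anti; rewrite crd_ge0 andbT -h (bigD1 k)//= lerDl sumr_ge0// => l' _; exact: crd_ge0.
move: l; have [iA|iA] := boolP (i \in disc_type D).
  by rewrite /lam big1 ?ltxx// => k kA; apply: z; apply: contraNneq kA => ->.
rewrite -[lam _ _](subKr 1) -lamC big1 ?subr0 ?ltxx ?andbF// => k kA; apply: z.
by apply: contraNneq iA => <-.
Qed.

Lemma normal_star (D : set tet) : normal_disc D -> exists c, [/\ D c, forall i, 0 < crd c i &
  forall x, D x -> seg x c `<=` D].
Proof.
move=> nD; have [c [h1 h2 h3]] := disc_star (ntype_dtype (disc_type_ntype nD)) (corner_unit nD).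
exists c; split=> // [|x dx y /segP[s s01 e]]; first by rewrite (corner_disc nD).
by rewrite (corner_disc nD); apply: (h3 x s) => //; rewrite -corner_disc.
Qed.

(** On the segment from a point of [D] to a star centre all points but possibly the first are
    interior to the tetrahedron; as [D'] is closed, it contains the first one too. *)
Lemma normal_sub_interior (D D' : set tet) : normal_disc D -> normal_disc D' ->
  (forall x, (forall i, crd x i != 0) -> D x -> D' x) -> D `<=` D'.
Proof.
move=> nD nD' H x Dx; apply: contrapT => D'x.
have [c [Dc c0 cs]] := normal_star nD.
pose g (s : R) := slide (fun=> c) (clamp s) x.
have cg : continuous g.
  move=> s; apply: (@continuous_comp _ _ _ (fun s : R => (x, s)) (fun z : tet * R => slide (fun=> c) (clamp z.2) z.1)).
    exact: pairr_continuous.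
  by apply: (@slide_continuous R (fun=> c)) => z; exact: cst_continuous.
have g0 : g 0 = x by rewrite /g clamp_id ?lexx ?ler01// slide0.
have oD : open (~` D') by apply: closed_openC; exact: normal_closed nD'.
have nb : nbhs (g 0) (~` D') by apply: open_nbhs_nbhs; split=> //; rewrite g0.
have [d /= d0 hd] : nbhs (0 : R) (g @^-1` (~` D')) by exact: cg nb.
pose s := Num.min (d / 2) 1.
have s0 : 0 < s by rewrite lt_min ltr01 divr_gt0.
have s1 : s <= 1 by rewrite ge_min lexx orbT.
have sd : s < d by rewrite gt_min ltr_pdivrMr// ltr_pMr// ltr1n.
have s01 : 0 <= s <= 1 by rewrite ltW.
have gE i : crd (g s) i = (1 - s) * crd x i + s * crd c i by rewrite /g clamp_id// crd_slide.
apply: (hd s) => /=; first by rewrite sub0r normrN gtr0_norm.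
apply: H.
  by move=> i; rewrite gE gt_eqF// ltr_wpDl ?mulr_gt0// mulr_ge0 ?crd_ge0// subr_ge0.
by apply: (cs x Dx); apply/segP; exists s.
Qed.

(** Describes the type by the edges that the disc meets, a property preserved by isotopies that keep
    the subsimplices. *)
Lemma normal_meets (D : set tet) i j : normal_disc D ->
  (exists2 x, D x & subsimplex [set i; j]%SET x) <-> sep (disc_type D) i j.
Proof.
move=> nD; split=> [[x Dx sx]|s]; last first.
  exists (edge_pt i j (corner D i j)); first exact: corner_in.
  have ij : i != j by apply: contraTneq s => ->; rewrite /sep eqxx.
  have c01 : 0 <= corner D i j <= 1 by have /andP[h1 h2] := corner_unit nD i j; rewrite !ltW.
  have [_ _ h] := edge_pt_crd c01 ij.
  by move=> k; rewrite !inE negb_or => /andP[ki kj]; exact: h.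
have dx : disc (disc_type D) (corner D) x by rewrite -corner_disc.
have l := surface_lam (surface_disc (ntype_dtype (disc_type_ntype nD)) (corner_unit nD)) dx.
rewrite /sep; apply/negP => /eqP e; move: l.
have z k : k != i -> k != j -> crd x k = 0 by move=> ki kj; apply: sx; rewrite !inE negb_or ki.
have [iA|iA] := boolP (i \in disc_type D).
  rewrite /lam big1 ?ltxx// => k kA; apply: z; first by apply: contraNneq kA => ->.
  by apply: contraNneq kA => ->; rewrite -e.
rewrite -[lam _ _](subKr 1) -lamC big1 ?subr0 ?ltxx ?andbF// => k kA; apply: z.
  by apply: contraNneq iA => <-.
by apply: contraNneq iA => h; rewrite e -h.
Qed.

Lemma isotopic_type (D D' : set tet) : normal_disc D -> normal_disc D' ->
  isotopic_preserving (R := R) (@subsimplices R) D D' -> disc_type D = disc_type D'.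
Proof.
move=> nD nD' [H [[_ _ hH] Hs] HD]; have h1 : 0 <= (1 : R) <= 1 by rewrite ler01 lexx.
have sub i j : subsimplices (subsimplex (R := R) [set i; j]%SET).
  by exists [set i; j]%SET => //=; rewrite -card_gt0 cards2.
apply: ntype_sep; try exact: disc_type_ntype.
move=> i j; apply/idP/idP => /normal_meets => [/(_ nD)|/(_ nD')] [x Dx sx].
  apply/(normal_meets _ _ nD'); exists (H 1 x); first by rewrite -HD; exists x.
  by rewrite -(Hs _ (sub i j) 1 h1); exists x.
move: Dx sx; rewrite -HD -{1}(Hs _ (sub i j) 1 h1) => -[y Dy <-] [z sz].
have [g [gK _ _ _]] := hH 1 h1 => /(can_inj gK) e; subst z.
by apply/(normal_meets _ _ nD); exists y.
Qed.

Lemma type_isotopic (D D' : set tet) : normal_disc D -> normal_disc D' -> disc_type D = disc_type D' ->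
  isotopic_preserving (R := R) (@subsimplices R) D D'.
Proof.
move=> nD nD' e; set A := disc_type D; set p := corner D; set p' := corner D'.
have tA : dtype A by exact/ntype_dtype/disc_type_ntype.
have up : unit_pos p by exact: corner_unit. have up' : unit_pos p' by exact: corner_unit.
pose lo : pos := fun i j => Num.min (p i j) (p' i j) / 2.
pose hi : pos := fun i j => (Num.max (p i j) (p' i j) + 1) / 2.
have mP := @between_bounds R.
have ulo : unit_pos lo by move=> i j; have [] := mP _ _ (up i j) (up' i j).
have uhi : unit_pos hi by move=> i j; have [] := mP _ _ (up i j) (up' i j).
have sl := surface_disc tA ulo; have sp := surface_disc tA up; have sp' := surface_disc tA up'.
have sh := surface_disc tA uhi.
have lev x : 0 < lam A x < 1 -> level A (disc A lo) x < level A (disc A p) x < level A (disc A hi) x /\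
    level A (disc A lo) x < level A (disc A p') x < level A (disc A hi) x.
  move=> l; split; apply/andP; split; apply: level_disc_lt => // i j _ _;
    by have [_ _ /andP[h1 h2] /andP[h3 h4]] := mP _ _ (up i j) (up' i j).
(* A family indexed by one element, so that [combine_sliding] applies. *)
pose K (_ : unit) := tent_slide A (disc A lo) (disc A p) (disc A p') (disc A hi).
have rK (k : unit) : ray_map A (K k) by apply: tent_slide_ray_map => // x l; have [] := lev x l.
have dj (k l : unit) x : k != l -> K k x <> x -> K l x = x by case: k l => -[].
have sK := combine_sliding rK dj.
have -> : D' = combine K @` D.
  rewrite [D'](corner_disc nD') -e -/A -/p' (corner_disc nD) -/A -/p.
  rewrite -(tent_slide_image sl sp sp' sh (fun x l => (lev x l).1)).
  apply: eq_imagel => x dx; have [fx|mv] := pselect (K tt x = x).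
    by rewrite -/(K tt x) fx combine_fixed// => -[].
  by rewrite (combine_moved dj mv).
exact: sliding_isotopic.
Qed.

End DiscTopology.

(** * Finiteness and counting of discs *)

Section Finiteness.
Variables (R : realType) (n : nat) (Phi : set (face_isometry R n)).
Notation tet := (tetrahedron R).
Notation q := (quotient_map (R:=R) (n:=n) Phi).
Variables (S : set (glued_space Phi)) (DD : 'I_n -> set (set tet)).
Hypotheses (pm : pseudo_manifold Phi) (dS : decomposed S DD).
Implicit Types (t : 'I_n) (D E : set tet) (i j k l m : 'I_4) (B : {set 'I_4}).

Let nD t D : DD t D -> normal_disc D. Proof. exact: (dec_normal dS). Qed.
Let st t : stack (@disc_type R) (DD t) (@corner R). Proof. exact: (dec_stack dS). Qed.

Definition outside B D0 D : Prop := disc_type D = disc_type D0 /\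
  forall i j, i \in B -> j \notin B -> corner D0 i j < corner D i j.

(** On every edge [D0] bounds the corners on the side of [B], and [no_collapse] bounds one of them
    on the far side; local finiteness is then applied on each of the finitely many edges. *)
Lemma outside_finite t B D0 : dtype B -> (1 < #|~: B|)%N -> DD t D0 ->
  disc_type D0 = B \/ disc_type D0 = (~: B)%SET ->
  finite_set [set D | DD t D /\ outside B D0 D].
Proof.
move=> tB cB d0 tD0; have [e e0 he] := no_collapse dS t tB cB.
pose F (ij : 'I_4 * 'I_4) := [set D | [/\ DD t D, sep (disc_type D) ij.1 ij.2 & corner D0 ij.1 ij.2 <= corner D ij.1 ij.2 <= 1 - e]].
apply: (@sub_finite_set _ _ (\bigcup_(ij in [set: 'I_4 * 'I_4]) F ij)); last first.
  apply: bigcup_finite; first exact: all_finite.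
  move=> ij _; apply: (dec_finite pm dS) => //; last by rewrite ltrBlDr ltrDl.
  by have /andP[] := corner_unit (nD d0) ij.1 ij.2.
move=> D [dD [tD h]]; have tDB : disc_type D = B \/ disc_type D = (~: B)%SET by rewrite tD.
have [i [j [iB jB le]]] := he D dD tDB; exists (i, j) => //; split=> //=.
  by case: tDB => ->; rewrite ?sep_setC; exact: sep_in.
by rewrite le andbT ltW// h.
Qed.

(** With one triangle [D0] at [u] fixed, the others are either outside of it or have a corner
    between [e] and that of [D0]. *)
Lemma tri_finite t u (e : R) : 0 < e ->
  finite_set [set D | [/\ DD t D, disc_type D = [set u]%SET & exists2 j, j != u & e <= corner D u j]].
Proof.
move=> e0; set X := [set D | _]; have [->|/set0P[D0 [d0 t0 _]]] := eqVneq X set0; first exact: finite_set0.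
pose F (j : 'I_4) := [set D | [/\ DD t D, sep (disc_type D) u j & e <= corner D u j <= corner D0 u j]].
apply: (@sub_finite_set _ _ ([set D0] `|` [set D | DD t D /\ outside [set u]%SET D0 D] `|` \bigcup_(j in [set: 'I_4]) F j)).
  move=> D [dD tD [j ju ej]]; have [->|ne] := pselect (D = D0); first by left; left.
  have [_ g1 _] := st t; case: (g1 D D0 dD d0 ne); first by rewrite tD t0.
    move=> lt; right; exists j => //; split=> //; first by rewrite tD /sep !inE eqxx (negbTE ju).
    by rewrite ej /= ltW// lt// tD !inE ?eqxx.
  move=> lt; left; right; split=> //; split; first by rewrite tD t0.
  by move=> i k iu ku; apply: lt; rewrite tD.
rewrite !finite_setU; split; first split; first exact: finite_set1.
  apply: outside_finite => //; [by rewrite /dtype cards1|by rewrite cardsC1 card_ord|by left].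
apply: bigcup_finite; first exact: all_finite.
move=> j _; apply: (dec_finite pm dS) => //.
by have /andP[] := corner_unit (nD d0) u j.
Qed.

(** A quadrilateral has no vertex alone on either side, so [outside_finite] applies with both
    orientations. *)
Lemma quad_finite t : finite_set [set D | DD t D /\ #|disc_type D| = 2%N].
Proof.
set X := [set D | _]; have [->|/set0P[D0 [d0 t0]]] := eqVneq X set0; first exact: finite_set0.
pose A := disc_type D0.
have cA : #|~: A| = 2%N by have := cardsC A; rewrite t0 card_ord; case: #|~: A| => [|[|[|]]].
apply: (@sub_finite_set _ _ ([set D0] `|` [set D | DD t D /\ outside A D0 D] `|` [set D | DD t D /\ outside (~: A)%SET D0 D])).
  move=> D [dD tD]; have [->|ne] := pselect (D = D0); first by left; left.
  have tE := two_quads (st t) dD d0 tD t0.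
  have [_ g1 _] := st t; case: (g1 D D0 dD d0 ne tE) => lt.
    right; split=> //; split=> // i j; rewrite !inE negbK => iA jA.
    rewrite (corner_antisym (nD dD) j i) (corner_antisym (nD d0) j i) ltrD2l ltrN2.
    by apply: lt; rewrite tE.
  by left; right; split=> //; split=> // i j iA jA; apply: lt; rewrite tE.
rewrite !finite_setU; split; first split; first exact: finite_set1.
  by apply: outside_finite => //; [rewrite /dtype t0|rewrite cA|left].
by apply: outside_finite => //; [rewrite /dtype cA|rewrite finset.setCK t0|right; rewrite finset.setCK].
Qed.

Lemma big_finite t (e : R) : 0 < e -> finite_set [set D | DD t D /\
  ~ exists2 u, disc_type D = [set u]%SET & forall j, j != u -> corner D u j < e].
Proof.
move=> e0; apply: (@sub_finite_set _ _ ([set D | DD t D /\ #|disc_type D| = 2%N] `|` \bigcup_(u in [set: 'I_4])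
  [set D | [/\ DD t D, disc_type D = [set u]%SET & exists2 j, j != u & e <= corner D u j]])); last first.
  rewrite finite_setU; split; first exact: quad_finite.
  by apply: bigcup_finite => [|u _]; [exact: all_finite|exact: tri_finite].
move=> D [dD H]; have tD := ntype_dtype (disc_type_ntype (nD dD)).
case/orP: tD => [/cards1P[u tu]|/eqP c2]; last by left.
right; exists u => //; split=> //; apply: contrapT => H'; apply: H; exists u => // j ju.
by rewrite ltNge; apply/negP => le; apply: H'; exists j.
Qed.

Lemma corner_crd_le D u x (e : R) : normal_disc D -> D x -> disc_type D = [set u]%SET ->
  (forall j, j != u -> corner D u j <= e) -> 1 - e <= crd x u.
Proof.
move=> h Dx tD le; have dx : disc (disc_type D) (corner D) x by rewrite -corner_disc.
have : lam (disc_type D) x <= e.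
  apply: (lam_disc_le (corner_antisym h) dx) => i j; rewrite tD !inE => /eqP ->; exact: le.
have := lamC [set u]%SET x; rewrite tD (eq_bigl (pred1 u)) => [|i]; last by rewrite inE.
by rewrite big_pred1_eq => -> ?; rewrite lerD2l lerN2.
Qed.

(* Only finitely many discs come near a segment without vertices. *)
Lemma seg_in_disc t X Y : (forall i, crd X i < 1) -> (forall i, crd Y i < 1) ->
  seg X Y `<=` q t @^-1` S -> exists2 E, DD t E & seg X Y `<=` E.
Proof.
move=> X1 Y1 sub.
have [e e0 he] : exists2 e : R, 0 < e & forall i : 'I_4, [set: 'I_4] i -> crd X i < 1 - e /\ crd Y i < 1 - e.
  apply: eps_finite; first exact: all_finite.
    move=> i _; exists (Num.min (1 - crd X i) (1 - crd Y i) / 2).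
      by rewrite divr_gt0// lt_min !subr_gt0 X1 Y1.
    have := X1 i; have := Y1 i; have [h|h] := leP (1 - crd X i) (1 - crd Y i) => h1 h2; split; lra.
  by move=> i e e' _ _ le [h1 h2]; split; lra.
have far x : seg X Y x -> forall u, crd x u < 1 - e.
  move=> /segP[s /andP[s0 s1] ex] u; rewrite ex; have [h1 h2] := he u Logic.I.
  have -> : 1 - e = (1 - s) * (1 - e) + s * (1 - e) by ring.
  have [->|s'] := eqVneq s 0; first by rewrite subr0 !mul1r !mul0r !addr0.
  by apply: ler_ltD; [rewrite ler_wpM2l ?subr_ge0// ltW|rewrite ltr_pM2l// lt_def s'].
pose F := [set D | DD t D /\ ~ exists2 u, disc_type D = [set u]%SET & forall j, j != u -> corner D u j < e].
have fF : finite_set F by exact: big_finite.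
have sS : q t @^-1` S = \bigcup_(D in DD t) D by case: dS.
have cov x : seg X Y x -> exists2 D, F D & D x.
  move=> sx; have := sub x sx; rewrite sS => -[D dD Dx]; exists D => //; split=> // -[u tu le].
  have := corner_crd_le (nD dD) Dx tu (fun j ju => ltW (le j ju)).
  by rewrite leNgt far.
have [E FE EX] := cov X (@seg_l R X Y); have [dE _] := FE.
have tI : trivIset (DD t) id by case: dS.
have uniqE D x : DD t D -> D x -> E x -> D = E by move=> dD Dx Ex; apply: tI => //; exists x.
have clF : closed (\bigcup_(D in F `&` [set D | D <> E]) D).
  by apply: closed_bigcup => [|D [[dD _] _]]; [apply: sub_finite_set fF; exact: subIsetl|exact: (normal_closed (nD dD))].
(* The other discs near the segment are closed and finite in number, so the part of the segment in
   [E] is open and closed in it. *)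
exists E => //; suff <- : seg X Y `&` E = seg X Y by exact: subIsetr.
apply: (@seg_connected R X Y).
- by exists X; split=> //; exact: seg_l.
- exists (~` (\bigcup_(D in F `&` [set D | D <> E]) D)); first exact: closed_openC.
  apply/seteqP; split=> x [sx h]; split=> //.
    by move=> [D [[dD _] ne] Dx]; apply: ne; exact: uniqE h.
  have [D FD Dx] := cov x sx; have [<-//|ne] := pselect (D = E).
  by case: h; exists D.
- by exists E => //; exact: (normal_closed (nD dE)).
Qed.

(** Each segment from the star centre lies in one disc of the decomposition, always the one through
    the centre. Hence [D] is contained in [E], and the corners of [D] are corners of [E]. *)
Lemma disc_in t D : normal_disc D -> D `<=` q t @^-1` S -> DD t D.
Proof.
move=> hD sub; have [c [Dc c0 cs]] := normal_star hD.
have tI : trivIset (DD t) id by case: dS.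
have [E dE Ec] : exists2 E, DD t E & E c.
  have [E dE h] := @seg_in_disc t c c (fun i => normal_lt1 i hD Dc) (fun i => normal_lt1 i hD Dc) (subset_trans (cs _ Dc) sub).
  by exists E => //; apply: h; exact: seg_l.
have DE : D `<=` E.
  move=> x Dx; have [E' dE' h] := @seg_in_disc t x c (fun i => normal_lt1 i hD Dx) (fun i => normal_lt1 i hD Dc) (subset_trans (cs _ Dx) sub).
  have -> : E = E' by apply: tI => //; exists c; split=> //; apply: h; exact: seg_r.
  by apply: h; exact: seg_l.
have hE := nD dE.
have p_eq i j : sep (disc_type D) i j -> sep (disc_type E) i j /\ corner D i j = corner E i j.
  move=> s; have Ee := DE _ (corner_in hD s); have c01 : 0 <= corner D i j <= 1.
    by have /andP[h1 h2] := corner_unit hD i j; rewrite !ltW.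
  have ij : i != j by apply: contraTneq s => ->; rewrite /sep eqxx.
  have sE : sep (disc_type E) i j.
    apply/(normal_meets _ _ hE); exists (edge_pt i j (corner D i j)) => //.
    have [_ _ h] := edge_pt_crd c01 ij.
    by move=> k; rewrite !inE negb_or => /andP[ki kj]; exact: h.
  split=> //; apply/(disc_edge (ntype_dtype (disc_type_ntype hE)) (corner_unit hE) (corner_antisym hE) sE c01).
  by rewrite -corner_disc.
have tt : disc_type D = disc_type E.
  have nTD := disc_type_ntype hD; have nTE := disc_type_ntype hE.
  apply: ntype_sep => // i j; apply/idP/idP => [/p_eq[]//|s].
  apply: contraT => ns.
  (* an edge separated by E and not by D lies in a triangle where D separates
     the other two edges, of which E separates just one *)
  have ij : i != j by apply: contraTneq s => ->; rewrite /sep eqxx.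
  have [k ik] : exists k, sep (disc_type D) i k.
    have [u [v [a [b [un Ae]]]]] := dtypeP (ntype_dtype nTD).
    have [[h1 h2 h3] [h4 h5 h6]] := uniq4 un.
    have [h|h] := boolP (i \in disc_type D); [exists a|exists u]; rewrite /sep.
      by rewrite h; case: Ae => ->; rewrite !inE ?(negbTE h2) ?(negbTE h4).
    by rewrite (negbTE h); case: Ae => ->; rewrite !inE eqxx.
  have jk : sep (disc_type D) j k by move: ns ik; rewrite /sep negbK => /eqP ->.
  have [s1 _] := p_eq _ _ ik; have [s2 _] := p_eq _ _ jk.
  by move: s s1 s2; rewrite /sep; case: (i \in _); case: (j \in _); case: (k \in _).
suff -> : D = E by [].
rewrite (corner_disc hD) (corner_disc hE) tt; apply: disc_ext => i j iA jA.
by have [] := p_eq i j; first by rewrite tt; exact: sep_in.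
Qed.

(** Interior points of a tetrahedron are not identified with anything, and they determine a normal
    disc. *)
Lemma q_disc_inj t t' D D' : normal_disc D -> normal_disc D' -> q t @` D = q t' @` D' -> t = t' /\ D = D'.
Proof.
move=> hD hD' e; have [c [Dc c0 _]] := normal_star hD.
have K t1 t2 D1 D2 x : q t1 @` D1 = q t2 @` D2 -> (forall i, crd x i != 0) -> D1 x -> t1 = t2 /\ D2 x.
  move=> e12 x0 D1x; have : (q t2 @` D2) (q t1 x) by rewrite -e12; exists x.
  by move=> [y D2y /esym/(q_interior x0)[-> ->]].
have [tt _] := K t t' D D' c e (fun i => lt0r_neq0 (c0 i)) Dc.
split=> //; apply/seteqP; split; apply: normal_sub_interior => // x x0 Dx.
  by have [] := K t t' D D' x e x0 Dx.
by have [] := K t' t D' D x (esym e) x0 Dx.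
Qed.

(** By [disc_in] the normal discs contained in [S] are exactly the given ones, and by [q_disc_inj]
    no two of them have the same image; counting may be done in one tetrahedron. *)
Lemma discs_of_type_card t D : normal_disc D ->
  (discs_of_type (q t @` D) S #= [set D' | DD t D' /\ disc_type D' = disc_type D])%card.
Proof.
move=> hD; have -> : discs_of_type (q t @` D) S = (fun D' => q t @` D') @` [set D' | DD t D' /\ disc_type D' = disc_type D].
  apply/seteqP; split=> [E' [nE' [t1 [D1 [D2 [h1 h2 e1 e2 iso]]]] sub]|_ [D' [dD' tD'] <-]].
    have [tt DD1] := q_disc_inj hD h1 e1; subst t1 D1.
    exists D2; rewrite ?e2//; split; last by rewrite (isotopic_type h1 h2 iso).
    by apply: disc_in => // x D2x; apply: sub; rewrite e2; exists x.
  split.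
  - by exists t, D' => //; exact: (nD dD').
  - exists t, D, D'; split=> //; first exact: (nD dD').
    by apply: type_isotopic => //; exact: (nD dD').
  - move=> _ [x D'x <-]; suff : (q t @^-1` S) x by [].
    by case: dS => _ _ -> _ _; exists D'.
apply: inj_card_eq => D1 D2 /set_mem[d1 _] /set_mem[d2 _] e.
by have [] := q_disc_inj (nD d1) (nD d2) e.
Qed.

End Finiteness.

(** * Matching the discs by rank *)

Section Ranks.
Variable R : realType.
Implicit Types (V W : set R) (r s : R).

Definition upper V r := V `&` [set s | r < s].

Definition upper_finite V : Prop := forall r, V r -> finite_set (upper V r).

Definition rank V r : nat := #|` fset_set (upper V r)|.

Lemma min_finite V : finite_set V -> V !=set0 -> exists2 s, V s & forall r, V r -> s <= r.
Proof.
move=> /finite_seqP[l ->] [x xl]; elim: l x xl => [x|a l IH x _]; first by rewrite /= in_nil.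
case: l IH => [_|b l IH].
  by exists a; rewrite /= ?mem_head// => r; rewrite inE => /eqP ->.
have [s sl hs] := IH b (mem_head _ _).
have [h|h] := leP a s.
  exists a; rewrite /= ?mem_head// => r; rewrite inE => /orP[/eqP ->//|rl].
  exact: le_trans h (hs _ rl).
exists s; first by rewrite /= inE sl orbT.
move=> r; rewrite /= inE => /orP[/eqP ->|rl]; [exact: ltW|exact: hs].
Qed.

Lemma rank_lt V r s : upper_finite V -> V r -> V s -> r < s -> (rank V s < rank V r)%N.
Proof.
move=> fV Vr Vs rs; apply: fproper_ltn_card; rewrite /fproper; apply/andP; split.
  apply/fsubsetP => x; rewrite !in_fset_set ?inE; try exact: fV.
  by move=> [Vx sx]; split=> //; exact: lt_trans rs sx.
apply/negP => /fsubsetP/(_ s); rewrite !in_fset_set ?inE; try exact: fV.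
by move=> /(_ (conj Vs rs))[_]; rewrite /= ltxx.
Qed.

Lemma rank_inj V r s : upper_finite V -> V r -> V s -> rank V r = rank V s -> r = s.
Proof.
move=> fV Vr Vs e; have [h|h|//] := ltgtP r s.
  by have := rank_lt fV Vr Vs h; rewrite e ltnn.
by have := rank_lt fV Vs Vr h; rewrite e ltnn.
Qed.

Lemma rank_lt_inv V r s : upper_finite V -> V r -> V s -> (rank V s < rank V r)%N -> r < s.
Proof.
move=> fV Vr Vs h; have [//|h'|e] := ltgtP r s.
  by have := ltn_trans h (rank_lt fV Vs Vr h'); rewrite ltnn.
by move: h; rewrite e ltnn.
Qed.

Lemma rank_pred V r k : upper_finite V -> V r -> rank V r = k.+1 -> exists2 s, V s & rank V s = k.
Proof.
move=> fV Vr e; have [] := @min_finite (upper V r) (fV _ Vr).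
  apply/set0P/eqP => U0; by move: e; rewrite /rank U0 fset_set0 cardfs0.
move=> s [Vs rs] hs; exists s => //; apply: succn_inj; rewrite -e /rank.
have -> : fset_set (upper V r) = (s |` fset_set (upper V s))%fset.
  apply/fsetP => x; rewrite in_fset_set ?in_fset1U ?in_fset_set; try exact: fV.
  apply/idP/idP => [/set_mem[Vx rx]|/orP[/eqP ->|/set_mem[Vx sx]]].
  - have := hs x (conj Vx rx); rewrite le_eqVlt => /orP[/eqP ->|h]; first by rewrite eqxx.
    by apply/orP; right; apply/mem_set.
  - exact/mem_set.
  - by apply/mem_set; split=> //; exact: lt_trans rs sx.
rewrite cardfsU1 in_fset_set; last exact: fV.
by rewrite memNset// => -[_]; rewrite /= ltxx.
Qed.

Lemma rank_down V r k : upper_finite V -> V r -> (k <= rank V r)%N -> exists2 s, V s & rank V s = k.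
Proof.
move=> fV; move e : (rank V r) => m; elim: m r e => [|m IH] r e Vr; first by rewrite leqn0 => /eqP ->; exists r.
rewrite leq_eqVlt => /orP[/eqP ->|]; first by exists r.
rewrite ltnS; have [s Vs es] := rank_pred fV Vr e; exact: IH es Vs.
Qed.

(** The ranks attained form an initial segment. If [k] were not attained in [W], then [W], and with
    it [V], would have at most [k] elements, but [V] contains [r] and the [k] elements above it.
    This covers finite and infinite sets alike. *)
Lemma rank_image V W r : upper_finite V -> upper_finite W -> (V #= W)%card -> V r ->
  exists2 s, W s & rank W s = rank V r.
Proof.
move=> fV fW VW Vr; apply: contrapT => H; set k := rank V r in H.
have lt s : W s -> (rank W s < k)%N.
  move=> Ws; rewrite ltnNge; apply/negP => le; apply: H; exact: rank_down fW Ws le.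
have Wk : (W #<= `I_k)%card.
  have e : (rank W @` W #= W)%card.
    by apply: inj_card_eq => x y /set_mem Wx /set_mem Wy; exact: rank_inj.
  by rewrite -(card_le_eql e); apply: subset_card_le => _ [s Ws <-]; exact: lt.
have Vk : (V #<= `I_k)%card by rewrite (card_le_eql VW).
have finV : finite_set V by apply: card_le_finite Vk _; exact: finite_II.
have : (#|` (r |` fset_set (upper V r))%fset| <= #|` fset_set V|)%N.
  apply: fsubset_leq_card; apply/fsubsetP => x; rewrite in_fset1U in_fset_set; last exact: fV.
  rewrite in_fset_set// => /orP[/eqP ->|/set_mem[Vx _]]; exact/mem_set.
rewrite cardfsU1 in_fset_set; last exact: fV.
rewrite memNset; last by move=> -[_]; rewrite /= ltxx.
by move=> h; have := leq_trans h (geq_card_fset_set Vk); rewrite -/(rank V r) -/k add1n ltnn.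
Qed.

Lemma rank_transport (T : Type) (C : set T) (v w : T -> R) (D : T) : C D ->
  {in C &, injective v} -> {in C &, injective w} ->
  (forall D E, C D -> C E -> (v D < v E) = (w D < w E)) ->
  upper_finite (v @` C) -> upper_finite (w @` C) ->
  rank (v @` C) (v D) = rank (w @` C) (w D).
Proof.
move=> CD vi wi vw fv fw.
have U (u : T -> R) : upper (u @` C) (u D) = u @` (C `&` [set E | u D < u E]).
  apply/seteqP; split=> [_ [[E CE <-] h]|_ [E [CE h] <-]]; first by exists E.
  by split=> //; exists E.
have e : C `&` [set E | v D < v E] = C `&` [set E | w D < w E].
  by apply/seteqP; split=> E [CE /= h]; split=> //=; [rewrite -vw|rewrite vw].
apply/fcard_eq; [by apply: fv; exists D|by apply: fw; exists D|].
rewrite !U; apply: (card_eq_trans (B := C `&` [set E | v D < v E])).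
  by apply: inj_card_eq => x y /set_mem[Cx _] /set_mem[Cy _]; apply: vi; exact/mem_set.
rewrite card_eq_sym e; apply: inj_card_eq => x y /set_mem[Cx _] /set_mem[Cy _]; apply: wi; exact/mem_set.
Qed.

End Ranks.

Section Matching.
Variables (R : realType) (n : nat) (Phi : set (face_isometry R n)).
Notation tet := (tetrahedron R).
Notation q := (quotient_map (R:=R) (n:=n) Phi).
Notation ty := (@disc_type R).
Implicit Types (t : 'I_n) (D E : set tet) (i j k l m : 'I_4) (A B : {set 'I_4}).

(** One edge crossed by the type suffices to compare parallel discs. *)
Definition type_edge A : 'I_4 * 'I_4 := odflt (ord0, ord0) [pick ij | (ij.1 \in A) && (ij.2 \notin A)].

Lemma type_edgeP A : dtype A -> (type_edge A).1 \in A /\ (type_edge A).2 \notin A.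
Proof.
move=> tA; rewrite /type_edge; case: pickP => [ij /andP[]//|H].
have [a aA] : exists a, a \in A by apply/set0Pn; rewrite -card_gt0; case/orP: tA => /eqP ->.
have [b] : exists b, b \in (~: A)%SET.
  apply/set0Pn; rewrite -card_gt0; have := cardsC A; rewrite card_ord.
  by case/orP: tA => /eqP ->; case: #|~: A|.
by rewrite inE => bA; have := H (a, b); rewrite /= aA bA.
Qed.

(** In the face with third vertex [m] one of the arcs surrounds [i] and the other one [j], which
    decides the order of their corners. *)
Lemma type_sepE A B i j : ntype A -> ntype B -> A <> B -> sep A i j -> sep B i j ->
  exists m, [/\ m != i, m != j & (sep A i m /\ sep B j m) \/ (sep B i m /\ sep A j m)].
Proof.
move=> nA nB ne sA sB.
have [m hm] : exists m, sep A i m != sep B i m.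
  apply: contrapT => H; apply: ne; apply: ntype_sep => // k l.
  have E m : sep A i m = sep B i m by apply: contrapT => /eqP h; apply: H; exists m.
  have := E k; have := E l; rewrite /sep.
  by case: (i \in A); case: (i \in B); case: (k \in A); case: (k \in B); case: (l \in A); case: (l \in B).
exists m; split.
- by apply: contraNneq hm => ->; rewrite /sep !eqxx.
- by apply: contraNneq hm => ->; rewrite sA sB.
- move: hm sA sB; rewrite /sep.
  by case: (i \in A); case: (i \in B); case: (j \in A); case: (j \in B); case: (m \in A); case: (m \in B) => //= _ _ _; (try by left); right.
Qed.

Section one.
Variables (S : set (glued_space Phi)) (DD : 'I_n -> set (set tet)).
Hypotheses (pm : pseudo_manifold Phi) (dS : decomposed S DD).

Definition typed t A := [set D | DD t D /\ ty D = A].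
Definition value A D : R := corner D (type_edge A).1 (type_edge A).2.

Lemma value_inj t A : dtype A -> {in typed t A &, injective (value A)}.
Proof.
move=> tA D E /set_mem[dD tD] /set_mem[dE tE] e; apply: contrapT => ne.
have [h1 h2] := type_edgeP tA.
have s : sep A (type_edge A).1 (type_edge A).2 by exact: sep_in.
have := stack_neq (dec_stack dS t) dD dE ne (i := (type_edge A).1) (j := (type_edge A).2).
by rewrite tD tE => /(_ s s); rewrite -/(value A D) e eqxx.
Qed.

Lemma value_lt t A D E : dtype A -> typed t A D -> typed t A E -> value A D < value A E ->
  forall i j, i \in A -> j \notin A -> corner D i j < corner E i j.
Proof.
move=> tA [dD tD] [dE tE] lt.
have ne : D <> E by move=> e; move: lt; rewrite e ltxx.
have [h1 h2] := type_edgeP tA.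
have [_ g _] := dec_stack dS t; case: (g D E dD dE ne (etrans tD (esym tE))); rewrite tD// => H.
by have := lt_trans lt (H _ _ h1 h2); rewrite ltxx.
Qed.

Lemma value_upper_finite t A : dtype A -> upper_finite (value A @` typed t A).
Proof.
move=> tA _ [D0 D0t <-].
have cA : (1 < #|~: A|)%N by have := cardsC A; rewrite card_ord; case/orP: tA => /eqP ->; case: #|~: A| => [|[]].
apply: (@sub_finite_set _ _ (value A @` [set D | DD t D /\ outside A D0 D])).
  move=> _ [[D Dt <-] h]; exists D => //; split; first by case: Dt.
  by split; [case: Dt D0t => _ -> [_ ->]|exact: (value_lt tA D0t Dt h)].
apply: finite_image; case: D0t => d0 t0; apply: (outside_finite pm dS) => //; by left.
Qed.

End one.

Variables (S0 S1 : set (glued_space Phi)) (DD0 DD1 : 'I_n -> set (set tet)).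
Hypotheses (pm : pseudo_manifold Phi) (dS0 : decomposed S0 DD0) (dS1 : decomposed S1 DD1).
Hypothesis card01 : forall t A, (typed DD0 t A #= typed DD1 t A)%card.

Let V0 t A := value A @` typed DD0 t A.
Let V1 t A := value A @` typed DD1 t A.

Let V01 t A : dtype A -> (V0 t A #= V1 t A)%card.
Proof.
move=> tA; apply: (card_eq_trans (B := typed DD0 t A)); first by apply: inj_card_eq; exact: (value_inj dS0).
apply: card_eq_trans (card01 t A) _; rewrite card_eq_sym.
by apply: inj_card_eq; exact: (value_inj dS1).
Qed.

Theorem match_exists : exists beta : 'I_n -> set tet -> set tet, forall t,
  [/\ forall D, DD0 t D -> DD1 t (beta t D) /\ ty (beta t D) = ty D,
      forall D', DD1 t D' -> exists2 D, DD0 t D & beta t D = D'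
    & same_order ty (DD0 t) (@corner R) (fun D => corner (beta t D))].
Proof.
have dt0 t D : DD0 t D -> dtype (ty D) by move=> dD; exact/ntype_dtype/disc_type_ntype/(dec_normal dS0 dD).
have dt1 t D : DD1 t D -> dtype (ty D) by move=> dD; exact/ntype_dtype/disc_type_ntype/(dec_normal dS1 dD).
have uf0 t A : dtype A -> upper_finite (V0 t A) by exact: (value_upper_finite pm dS0).
have uf1 t A : dtype A -> upper_finite (V1 t A) by exact: (value_upper_finite pm dS1).
have : forall tD : 'I_n * set tet, exists D', DD0 tD.1 tD.2 -> typed DD1 tD.1 (ty tD.2) D' /\
    rank (V1 tD.1 (ty tD.2)) (value (ty tD.2) D') = rank (V0 tD.1 (ty tD.2)) (value (ty tD.2) tD.2).
  move=> [t D] /=; have [dD|nd] := pselect (DD0 t D); last by exists D.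
  have tA := dt0 _ _ dD.
  have [|_ [D' D't <-] e] := rank_image (uf0 t _ tA) (uf1 t _ tA) (V01 t tA) (r := value (ty D) D).
    by exists D.
  by exists D'.
move=> /choice[b hb]; exists (fun t D => b (t, D)) => t.
have {}hb D : DD0 t D -> [/\ DD1 t (b (t, D)), ty (b (t, D)) = ty D &
    rank (V1 t (ty D)) (value (ty D) (b (t, D))) = rank (V0 t (ty D)) (value (ty D) D)].
  by move=> /(hb (t, D))[[]].
have ord D E : DD0 t D -> DD0 t E -> ty D = ty E -> value (ty D) D < value (ty D) E ->
    value (ty D) (b (t, D)) < value (ty D) (b (t, E)).
  move=> dD dE tt lt; have tA := dt0 _ _ dD.
  have [d1 t1 r1] := hb _ dD; have [d2 t2 r2] := hb _ dE; rewrite -tt in t2 r2.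
  have v1 : V1 t (ty D) (value (ty D) (b (t, D))) by exists (b (t, D)).
  have v2 : V1 t (ty D) (value (ty D) (b (t, E))) by exists (b (t, E)).
  have w1 : V0 t (ty D) (value (ty D) D) by exists D.
  have w2 : V0 t (ty D) (value (ty D) E) by exists E.
  apply: (rank_lt_inv (uf1 t _ tA) v1 v2); rewrite r1 r2.
  exact: (rank_lt (uf0 t _ tA) w1 w2 lt).
split.
- by move=> D /hb[].
- move=> D' d'; have tA := dt1 _ _ d'.
  have V10 : (V1 t (ty D') #= V0 t (ty D'))%card by rewrite card_eq_sym; exact: V01.
  have [|_ [D [dD tD] <-] e] := rank_image (uf1 t _ tA) (uf0 t _ tA) V10 (r := value (ty D') D').
  + by exists D'.
  exists D => //; have [d1 t1 r1] := hb _ dD; rewrite tD in t1 r1.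
  apply: (@value_inj S1 DD1 dS1 t (ty D') tA); try exact/mem_set.
  by apply: (rank_inj (uf1 t _ tA)); rewrite ?r1 ?e//; [exists (b (t, D)) => //; split|exists D' => //; split].
- move=> D E i j dD dE sD sE lt.
  have [d1 t1 _] := hb _ dD; have [d2 t2 _] := hb _ dE.
  have [tt|tt] := pselect (ty D = ty E).
    have tA := dt0 _ _ dD; have [h1 h2] := type_edgeP tA.
    have ne : D <> E by move=> e; move: lt; rewrite e ltxx.
    have nv : value (ty D) D != value (ty D) E.
      by apply/eqP => e; apply: ne; apply: (@value_inj S0 DD0 dS0 t (ty D) tA); try exact/mem_set.
    have K D2 E2 k l : DD0 t D2 -> DD0 t E2 -> ty D2 = ty D -> ty E2 = ty D -> value (ty D) D2 < value (ty D) E2 ->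
        k \in ty D -> l \notin ty D -> corner D2 k l < corner E2 k l /\ corner (b (t, D2)) k l < corner (b (t, E2)) k l.
      move=> dD2 dE2 tD2 tE2 lv kA lA; split.
        exact: (value_lt dS0 tA (conj dD2 tD2) (conj dE2 tE2)).
      have [d3 t3 _] := hb _ dD2; have [d4 t4 _] := hb _ dE2.
      apply: (value_lt dS1 tA (conj d3 (etrans t3 tD2)) (conj d4 (etrans t4 tE2))) => //.
      by have := ord D2 E2 dD2 dE2; rewrite tD2 tE2; apply.
    have aD := corner_antisym (dec_normal dS0 dD); have aE := corner_antisym (dec_normal dS0 dE).
    have bD := corner_antisym (dec_normal dS1 d1); have bE := corner_antisym (dec_normal dS1 d2).
    move: sD; rewrite /sep; case iA: (i \in ty D); case jA: (j \in ty D) => // _.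
      have [lv|lv|/eqP] := ltgtP (value (ty D) D) (value (ty D) E); last by rewrite (negbTE nv).
        by have [] := K D E i j dD dE erefl (esym tt) lv iA (negbT jA).
      have [l1 _] := K E D i j dE dD (esym tt) erefl lv iA (negbT jA).
      by have := lt_trans lt l1; rewrite ltxx.
    move: lt; rewrite (aD j i) (aE j i) (bD j i) (bE j i) !ltrD2l !ltrN2 => lt.
    have [lv|lv|/eqP] := ltgtP (value (ty D) D) (value (ty D) E); last by rewrite (negbTE nv).
      have [l1 _] := K D E j i dD dE erefl (esym tt) lv jA (negbT iA).
      by have := lt_trans lt l1; rewrite ltxx.
    by have [] := K E D j i dE dD (esym tt) erefl lv jA (negbT iA).
  (* For different types the order is imposed by the types, in the same way in both subsets. *)
  have nD := disc_type_ntype (dec_normal dS0 dD); have nE := disc_type_ntype (dec_normal dS0 dE).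
  have [m [mi mj [[s1 s2]|[s1 s2]]]] := type_sepE nD nE tt sD sE.
    have [_ _ g] := dec_stack dS1 t; apply: (g _ _ i j m) => //; rewrite ?t1 ?t2 1?eq_sym//; by rewrite sepC.
  have [_ _ g] := dec_stack dS0 t.
  have : corner E i j < corner D i j.
    by apply: (g _ _ i j m) => //; rewrite 1?eq_sym//; rewrite sepC.
  by move=> l1; have := lt_trans lt l1; rewrite ltxx.
Qed.

End Matching.

(** * Matching across glued faces *)

Section Mates.
Variables (R : realType) (n : nat) (Phi : set (face_isometry R n)).
Notation tet := (tetrahedron R).
Notation q := (quotient_map (R:=R) (n:=n) Phi).
Notation ty := (@disc_type R).
Implicit Types (t : 'I_n) (D E : set tet) (i j k l m f : 'I_4) (A B : {set 'I_4}) (s : {perm 'I_4}).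

Lemma act_edge_pt s k l (r : R) : 0 <= r <= 1 -> k != l -> act s (edge_pt k l r) = edge_pt (s k) (s l) r.
Proof.
move=> r01 kl; have kl' : s k != s l by rewrite (inj_eq perm_inj).
have [h1 h2 h3] := edge_pt_crd r01 kl; have [h1' h2' h3'] := edge_pt_crd r01 kl'.
apply: crd_inj => i; rewrite -[i](permKV s); set j := (s^-1)%g i; rewrite crd_act.
have [->|jk] := eqVneq j k; first by rewrite h1 h1'.
have [->|jl] := eqVneq j l; first by rewrite h2 h2'.
by rewrite h3// h3' // (inj_eq perm_inj).
Qed.

Lemma act_seg s (X Y : tet) : act s @` seg X Y = seg (act s X) (act s Y).
Proof.
apply/seteqP; split=> [_ [z /segP[r r01 e] <-]|z /segP[r r01 e]].
  by apply/segP; exists r => // i; rewrite !crd_actV e.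
exists (act (s^-1)%g z); last by rewrite actKV.
apply/segP; exists r => // i; have := e (s i); rewrite !crd_act => <-.
by rewrite crd_actV invgK.
Qed.

Section one.
Variables (S : set (glued_space Phi)) (DD : 'I_n -> set (set tet)).
Hypotheses (pm : pseudo_manifold Phi) (dS : decomposed S DD).

(** The arc of [D] becomes, after gluing, a segment in the preimage of [S] that avoids the vertices.
    By [seg_in_disc] it lies in a single disc, whose corners are the ends of the segment. *)
Lemma decomposed_mates : @has_mates R n Phi ty DD (fun _ => @corner R).
Proof.
move=> t f t' s k l m D mt un dD s1 s2; have hD := dec_normal dS dD.
have [[h1 h2 h3] [h4 h5 h6]] := uniq4 un.
have kl : k != l by rewrite eq_sym. have km : k != m by rewrite eq_sym.
have c1 : 0 <= corner D k l <= 1 by have /andP[a b] := corner_unit hD k l; rewrite !ltW.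
have c2 : 0 <= corner D k m <= 1 by have /andP[a b] := corner_unit hD k m; rewrite !ltW.
set X := edge_pt k l (corner D k l); set Y := edge_pt k m (corner D k m).
have [Xk Xl Xz] := edge_pt_crd c1 kl; have [Yk Ym Yz] := edge_pt_crd c2 km.
have segD : seg X Y `<=` D.
  move=> z /segP[r r01 e]; rewrite (corner_disc hD).
  have zf : crd z f = 0 by rewrite e Xz// Yz// !mulr0 addr0.
  apply/(disc_face un (ntype_dtype (disc_type_ntype hD)) (corner_unit hD) (corner_antisym hD) s1 s2 zf).
  rewrite !e Xl Ym (Xz m)// (Yz l)//; last by rewrite eq_sym.
  rewrite !mulr0 addr0 add0r !mulfK ?subrK//.
    by have /andP[a _] := corner_unit hD k m; rewrite gt_eqF.
  by have /andP[a _] := corner_unit hD k l; rewrite gt_eqF.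
have segf z : seg X Y z -> face f z.
  by move=> /segP[r _ e]; apply/face_crd; rewrite e Xz// Yz// !mulr0 addr0.
have DX : D X by apply: segD; exact: seg_l. have DY : D Y by apply: segD; exact: seg_r.
have a1 i : crd (act s X) i < 1 by rewrite crd_actV; exact: normal_lt1 hD DX.
have a2 i : crd (act s Y) i < 1 by rewrite crd_actV; exact: normal_lt1 hD DY.
have sub : seg (act s X) (act s Y) `<=` q t' @^-1` S.
  rewrite -act_seg => _ [z sz <-]; have sS : q t @^-1` S = \bigcup_(D in DD t) D by case: dS.
  rewrite /= -(mt z (segf z sz)); suff : (q t @^-1` S) z by [].
  by rewrite sS; exists D => //; exact: segD.
have [E dE sE] := seg_in_disc pm dS a1 a2 sub; have hE := dec_normal dS dE.
have K j (r : R) : 0 <= r <= 1 -> k != j -> E (act s (edge_pt k j r)) -> sep (ty E) (s k) (s j) /\ r = corner E (s k) (s j).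
  move=> r01 kj; rewrite act_edge_pt// => Ee.
  have kj' : s k != s j by rewrite (inj_eq perm_inj).
  have sS : sep (ty E) (s k) (s j).
    apply/(normal_meets _ _ hE); exists (edge_pt (s k) (s j) r) => //.
    have [_ _ h] := edge_pt_crd r01 kj'.
    by move=> i; rewrite !inE negb_or => /andP[ki kj0]; exact: h.
  split=> //; apply/(disc_edge (ntype_dtype (disc_type_ntype hE)) (corner_unit hE) (corner_antisym hE) sS r01).
  by rewrite -corner_disc.
have [s3 e3] := K l _ c1 kl (sE _ (@seg_l R _ _)).
have [s4 e4] := K m _ c2 km (sE _ (@seg_r R _ _)).
by exists E; split.
Qed.

Definition face_discs t k l m := [set D | [/\ DD t D, sep (ty D) k l & sep (ty D) k m]].

Lemma face_value_inj t k l m : {in face_discs t k l m &, injective (fun D => corner D k l)}.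
Proof.
move=> D E /set_mem[dD s1 _] /set_mem[dE s2 _] e; apply: contrapT => ne.
by have := stack_neq (dec_stack dS t) dD dE ne s1 s2; rewrite e eqxx.
Qed.

(** Arcs around [k] come from quadrilaterals, which are finite in number, or from triangles at
    [k]. *)
Lemma face_upper_finite t k l m : l != m -> upper_finite ((fun D => corner D k l) @` face_discs t k l m).
Proof.
move=> lm _ [D0 [d0 _ _] <-]; have /andP[e0 _] := corner_unit (dec_normal dS d0) k l.
apply: (@sub_finite_set _ _ ((fun D => corner D k l) @` ([set D | DD t D /\ #|ty D| = 2%N] `|`
  [set D | [/\ DD t D, ty D = [set k]%SET & exists2 j, j != k & corner D0 k l <= corner D k j]]))); last first.
  apply: finite_image; rewrite finite_setU; split; first exact: (quad_finite pm dS).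
  exact: (tri_finite pm dS).
move=> _ [[D [dD s1 s2] <-] h]; exists D => //.
have tD := ntype_dtype (disc_type_ntype (dec_normal dS dD)).
case/orP: tD => [/cards1P[u tu]|/eqP c2]; last by left.
right; have lk : l != k by apply: contraTneq s1 => ->; rewrite /sep eqxx.
split=> //; last by exists l => //; exact: ltW.
rewrite tu; congr [set _]%SET; apply/eqP; apply: contraT => uk; exfalso.
move: s1 s2; rewrite /sep tu !inE (eq_sym k) (negbTE uk) /=.
by have [lu|//] := eqVneq l u; rewrite -lu (eq_sym m) (negbTE lm).
Qed.

Lemma face_values t f t' s k l m : matched Phi t f t' s -> uniq [:: k; l; m; f] ->
  (fun D => corner D k l) @` face_discs t k l m = (fun D => corner D (s k) (s l)) @` face_discs t' (s k) (s l) (s m).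
Proof.
have H u g u' v a b c : matched Phi u g u' v -> uniq [:: a; b; c; g] ->
    (fun D => corner D a b) @` face_discs u a b c `<=` (fun D => corner D (v a) (v b)) @` face_discs u' (v a) (v b) (v c).
  move=> mt un _ [D [dD s1 s2] <-]; have [E [_ _ [_ dE] [_ _ s3 s4] [e1 e2]]] := decomposed_mates mt un dD s1 s2.
  by exists E.
move=> mt un; apply/seteqP; split; first exact: H mt un.
have := H _ _ _ _ (s k) (s l) (s m) (matched_inv mt) (uniq_map4 s un).
by rewrite !permK.
Qed.

End one.

Variables (S0 S1 : set (glued_space Phi)) (DD0 DD1 : 'I_n -> set (set tet)).
Hypotheses (pm : pseudo_manifold Phi) (dS0 : decomposed S0 DD0) (dS1 : decomposed S1 DD1).
Variable beta : 'I_n -> set tet -> set tet.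
Hypothesis hbeta : forall t,
  [/\ forall D, DD0 t D -> DD1 t (beta t D) /\ ty (beta t D) = ty D,
      forall D', DD1 t D' -> exists2 D, DD0 t D & beta t D = D'
    & same_order ty (DD0 t) (@corner R) (fun D => corner (beta t D))].

Lemma beta_image t k l m : (fun D => corner (beta t D) k l) @` face_discs DD0 t k l m =
  (fun D => corner D k l) @` face_discs DD1 t k l m.
Proof.
have [b1 b2 _] := hbeta t; apply/seteqP; split=> [_ [D [dD s1 s2] <-]|_ [D' [dD' s1 s2] <-]].
  have [d1 t1] := b1 _ dD; exists (beta t D) => //; split=> //; by rewrite t1.
have [D dD e] := b2 _ dD'; have [_ t1] := b1 _ dD; exists D; last by rewrite e.
by split=> //; rewrite -t1 e.
Qed.

Lemma beta_inj t D E : DD0 t D -> DD0 t E -> beta t D = beta t E -> D = E.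
Proof.
move=> dD dE e; apply: contrapT => ne; have [b1 b2 b3] := hbeta t.
have st := dec_stack dS0 t; have nD := ntype_dtype (stack_ntype st dD).
have tt : ty D = ty E by have [_ <-] := b1 _ dD; have [_ <-] := b1 _ dE; rewrite e.
have [h1 h2] := type_edgeP nD; have s := sep_in h1 h2.
have s' : sep (ty E) (type_edge (ty D)).1 (type_edge (ty D)).2 by rewrite -tt.
have [_ g _] := st; case: (g D E dD dE ne tt) => /(_ _ _ h1 h2) lt.
  by have := b3 D E _ _ dD dE s s' lt; rewrite e ltxx.
by have := b3 E D _ _ dE dD s' s lt; rewrite e ltxx.
Qed.

(** Discs of several types leave arcs around [k]. As the matching keeps the order across types as
    well, the same arcs are counted before and after. *)
Lemma beta_rank t k l m D : l != m -> face_discs DD0 t k l m D ->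
  rank ((fun D => corner D k l) @` face_discs DD0 t k l m) (corner D k l) =
  rank ((fun D => corner D k l) @` face_discs DD1 t k l m) (corner (beta t D) k l).
Proof.
move=> lm fD; rewrite -beta_image; have [b1 b2 b3] := hbeta t.
have lt_iff E F : face_discs DD0 t k l m E -> face_discs DD0 t k l m F ->
    (corner E k l < corner F k l) = (corner (beta t E) k l < corner (beta t F) k l).
  move=> [dE s1 _] [dF s2 _]; apply/idP/idP; first exact: b3.
  move=> h; rewrite ltNge le_eqVlt negb_or; apply/andP; split.
    apply/eqP => e; have : E = F.
      apply: contrapT => ne; have := stack_neq (dec_stack dS0 t) dE dF ne s1 s2; by rewrite e eqxx.
    by move=> EF; move: h; rewrite EF ltxx.
  by apply/negP => h'; have := lt_trans h (b3 F E k l dF dE s2 s1 h'); rewrite ltxx.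
apply: (rank_transport fD) => //.
- exact: (face_value_inj dS0).
- move=> E F /set_mem[dE s1 s2] /set_mem[dF s3 s4] e; apply: (beta_inj dE dF).
  have [d1 t1] := b1 _ dE; have [d2 t2] := b1 _ dF.
  by apply: (face_value_inj dS1 (t := t) (k := k) (l := l) (m := m)) e; apply/mem_set; split; rewrite ?t1 ?t2.
- exact: (face_upper_finite pm dS0).
- rewrite beta_image; exact: (face_upper_finite pm dS1).
Qed.

(** By [face_values] the two sides of a glued face carry the same set of positions; the images of
    two mates have the same rank in it, hence the same position. *)
Lemma beta_compatible : @compatible R n Phi ty DD0 (fun _ => @corner R) (fun t D => corner (beta t D)).
Proof.
have half t f t' s k l m D E : @mates R n Phi ty DD0 (fun _ => @corner R) t f t' s k l m D E ->
    corner (beta t D) k l = corner (beta t' E) (s k) (s l).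
  move=> [mt un [dD dE] [s1 s2 s3 s4] [e1 e2]].
  have [[h1 h2 h3] [h4 h5 h6]] := uniq4 un.
  have lm : l != m by rewrite eq_sym. have lm' : s l != s m by rewrite (inj_eq perm_inj).
  have fD : face_discs DD0 t k l m D by []. have fE : face_discs DD0 t' (s k) (s l) (s m) E by [].
  have r1 := beta_rank lm fD; have r2 := beta_rank lm' fE.
  rewrite (face_values pm dS0 mt un) e1 r2 (face_values pm dS1 mt un) in r1.
  have [b1 _ _] := hbeta t; have [b1' _ _] := hbeta t'.
  have [d1 t1] := b1 _ dD; have [d2 t2] := b1' _ dE.
  apply: (rank_inj (face_upper_finite pm dS1 (t := t') (k := s k) lm')) (esym r1).
  - rewrite -(face_values pm dS1 mt un); exists (beta t D) => //; split=> //; by rewrite t1.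
  - by exists (beta t' E) => //; split=> //; rewrite t2.
move=> t f t' s k l m D E mE; split; first exact: half mE.
case: mE => mt un [dD dE] [s1 s2 s3 s4] [e1 e2].
apply: (half t f t' s k m l D E); split=> //.
move: un; rewrite /= !inE !negb_or (eq_sym m l) => /and4P[/and3P[-> -> ->] /andP[-> ->] -> _] //.
Qed.

End Mates.

(** * Straightening *)

Section IsotopyComposition.
Variables (R : realType) (X : topologicalType).
Implicit Types (F : set (set X)) (A B C : set X).

Lemma within_comp (U V W : topologicalType) (A : set U) (B : set V) (phi : U -> V) (f : V -> W) :
  continuous phi -> (forall x, A x -> B (phi x)) -> {within B, continuous f} -> {within A, continuous (f \o phi)}.
Proof.
move=> cphi AB /subspace_continuousP cf; apply/subspace_continuousP => x Ax N hN.
have h1 : \forall w \near phi x, B w -> N (f w) by exact: (cf (phi x) (AB x Ax) N hN).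
have h2 : \forall z \near x, B (phi z) -> N (f (phi z)) by exact: (cphi x _ h1).
by move: h2; apply: filterS => z h Az; exact/h/AB.
Qed.

Lemma homeomorphism_id : homeomorphism (@id X).
Proof. by exists id; split=> // x; exact: cvg_id. Qed.

Lemma homeomorphism_comp (g h : X -> X) : homeomorphism g -> homeomorphism h -> homeomorphism (h \o g).
Proof.
move=> [g' [k1 k2 cg cg']] [h' [k3 k4 ch ch']]; exists (g' \o h'); split.
- exact: can_comp k3 k1.
- exact: can_comp k2 k4.
- by move=> x; apply: continuous_comp; [exact: cg|exact: ch].
- by move=> x; apply: continuous_comp; [exact: ch'|exact: cg'].
Qed.

Lemma isotopic_refl F A : isotopic_preserving (R := R) F A A.
Proof.
exists (fun _ => id); last by rewrite image_id.
split; last by move=> B _ t _; rewrite image_id.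
split=> // [|t _]; last exact: homeomorphism_id.
by apply: continuous_subspaceT => z; exact: cvg_fst.
Qed.

(** Concatenation at time 1/2, the two pieces of the homotopy being pasted along closed sets. *)
Lemma isotopic_trans F A B C : isotopic_preserving (R := R) F A B -> isotopic_preserving (R := R) F B C ->
  isotopic_preserving (R := R) F A C.
Proof.
move=> [H [[cH H0 hH] fH] HA] [K [[cK K0 hK] fK] KB].
have one01 : 0 <= (1 : R) <= 1 by rewrite ler01 lexx.
have t1 (t : R) : 0 <= t <= 1 -> t <= 2^-1 -> 0 <= 2 * t <= 1.
  by move=> /andP[a b] c; apply/andP; split; lra.
have t2 (t : R) : 0 <= t <= 1 -> 2^-1 <= t -> 0 <= 2 * t - 1 <= 1.
  by move=> /andP[a b] c; apply/andP; split; lra.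
pose L (t : R) (x : X) := if t <= 2^-1 then H (2 * t) x else K (2 * t - 1) (H 1 x).
have LH t : t <= 2^-1 -> L t = H (2 * t) by move=> h; apply/funext => x; rewrite /L h.
have LK t : 2^-1 <= t -> L t = K (2 * t - 1) \o H 1.
  rewrite le_eqVlt => /orP[/eqP <-|h]; last by apply/funext => x; rewrite /L leNgt h.
  by apply/funext => x; rewrite /L lexx /= divff ?pnatr_eq0// subrr K0.
have cH1 : continuous (H 1) by have [g []] := hH 1 one01.
exists L; last first.
  have h : 2^-1 <= (1 : R) by rewrite invf_le1 ?ler1n.
  rewrite LK// -image_comp HA mulr1 (_ : 2 - 1 = 1 :> R)//; lra.
split; last first.
  move=> G FG t t01; have [h|/ltW h] := leP t 2^-1.
    by rewrite LH// fH// t1.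
  by rewrite LK// -image_comp fH// fK// t2.
split.
- have -> : [set: X] `*` `[0 : R, 1] = [set: X] `*` `[0 : R, 2^-1] `|` [set: X] `*` `[2^-1 : R, 1].
    apply/seteqP; split=> [[x t] [_ /=]|[x t] [] [_ /=]]; rewrite !in_itv /=.
    + move=> /andP[a b]; have [h|/ltW h] := leP t 2^-1; [left|right]; split; rewrite //= ?in_itv /= ?a ?b ?h//.
    + by move=> /andP[a b]; split=> //=; rewrite ?in_itv /= a (le_trans b)// invf_le1 ?ler1n.
    + by move=> /andP[a b]; split=> //=; rewrite ?in_itv /= b andbT (le_trans _ a)// invr_ge0.
  have cl (a b : R) : closed ([set: X] `*` `[a, b]).
    have -> : [set: X] `*` `[a, b] = (@snd X R) @^-1` `[a, b] by apply/seteqP; split=> [[x t] [_ h]|[x t] h].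
    by apply: preimage_closed => [z _|]; [exact: cvg_snd|exact: interval_closed].
  apply: withinU_continuous; [exact: cl|exact: cl| |].
    have c1 : {within [set: X] `*` `[0 : R, 2^-1], continuous ((fun z : X * R => H z.2 z.1) \o (fun z : X * R => (z.1, 2 * z.2)))}.
      apply: within_comp cH; last first.
        by move=> [x t] [_ /=]; rewrite in_itv /= => /andP[a b]; split=> //=; rewrite ?in_itv /=; apply: t1 => //; rewrite a (le_trans b)// invf_le1 ?ler1n.
      move=> z; have k1 : (fun z : X * R => z.1) @ z --> z.1 by exact: cvg_fst.
      have k2 : (fun z : X * R => 2 * z.2) @ z --> 2 * z.2.
        apply: (@contM R _ (fun=> 2) (fun z : X * R => z.2) z); [exact: (@contc R)|exact: cvg_snd].
      exact: (cvg_pair k1 k2).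
    move: c1; apply: subspace_eq_continuous => -[x t] /set_mem[_ /=]; rewrite in_itv /= => /andP[_ b].
    by rewrite -[RHS]/(L t x) LH.
  have c1 : {within [set: X] `*` `[2^-1 : R, 1], continuous ((fun z : X * R => K z.2 z.1) \o (fun z : X * R => (H 1 z.1, 2 * z.2 - 1)))}.
    apply: within_comp cK; last first.
      by move=> [x t] [_ /=]; rewrite in_itv /= => /andP[a b]; split=> //=; rewrite ?in_itv /=; apply: t2 => //; rewrite b andbT (le_trans _ a)// invr_ge0.
    move=> z; have k1 : (fun z : X * R => H 1 z.1) @ z --> H 1 z.1.
      by apply: (@continuous_comp _ _ _ (@fst X R) (H 1)); [exact: cvg_fst|exact: cH1].
    have k2 : (fun z : X * R => 2 * z.2 - 1) @ z --> 2 * z.2 - 1.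
      apply: (@contB R _ (fun z : X * R => 2 * z.2) (fun=> 1) z); last exact: (@contc R).
      apply: (@contM R _ (fun=> 2) (fun z : X * R => z.2) z); [exact: (@contc R)|exact: cvg_snd].
    exact: (cvg_pair k1 k2).
  move: c1; apply: subspace_eq_continuous => -[x t] /set_mem[_ /=]; rewrite in_itv /= => /andP[a _].
  by rewrite -[RHS]/(L t x) LK.
- by rewrite LH ?invr_ge0// mulr0 H0.
- move=> t t01; have [h|/ltW h] := leP t 2^-1.
    by rewrite LH//; apply: hH; exact: t1.
  by rewrite LK//; apply: homeomorphism_comp; [exact: hH|apply: hK; exact: t2].
Qed.

End IsotopyComposition.

(* The common value, near the ends of the interval, of two positions a and b;
   it is a otherwise. *)
Section Blend.
Variable R : realType.
Implicit Types (th a b : R).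

Definition blend th a b : R :=
  if a < th then Num.min a b else if 1 - th < a then Num.max a b else a.

Lemma blend01 th a b : 0 < a < 1 -> 0 < b < 1 -> 0 < blend th a b < 1.
Proof.
rewrite /blend minEle maxEle => h1 h2; case: ifP => _; first by case: ifP.
by case: ifP => _ //; case: ifP.
Qed.

(** The bound on [th] keeps the two end zones disjoint, so that reversing the edge exchanges minimum
    and maximum. *)
Lemma blend_opp th a b : th <= 2^-1 -> blend th (1 - a) (1 - b) = 1 - blend th a b.
Proof.
move=> h; rewrite /blend (_ : (1 - a < th) = (1 - th < a)); last by apply/idP/idP; lra.
rewrite (_ : (1 - th < 1 - a) = (a < th)); last by apply/idP/idP; lra.
case: (ltP a th) => h1; case: (ltP (1 - th) a) => h2 //.
- by exfalso; lra.
- by have [h3|h3] := leP a b; have [h4|h4] := leP (1 - a) (1 - b) => //; lra.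
- by have [h3|h3] := leP a b; have [h4|h4] := leP (1 - a) (1 - b) => //; lra.
Qed.

Lemma blend_lt th a b a' b' : a < a' -> b < b' -> blend th a b < blend th a' b'.
Proof.
move=> ha hb; rewrite /blend; case: (ltP a th) => h1.
  case: (ltP a' th) => h2; first by rewrite lt_min !gt_min ha hb orbT.
  by case: ifP => _; rewrite gt_min ?lt_max ha.
rewrite [a' < th]ltNge (ltW (le_lt_trans h1 ha)) /=.
case: (ltP (1 - th) a) => h3; first by rewrite (lt_trans h3 ha) gt_max !lt_max ha hb orbT.
by case: ifP => _; rewrite ?lt_max ha.
Qed.

Lemma blendC th a b : a < th -> b < th -> blend th a b = blend th b a.
Proof. by move=> h1 h2; rewrite /blend h1 h2 minC. Qed.

Lemma blend_le th a b : a < th -> blend th a b <= a.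
Proof. by move=> h1; rewrite /blend h1 ge_min lexx. Qed.

Lemma blend_id th a b : th < a -> a < 1 - th -> blend th a b = a.
Proof. by move=> h1 h2; rewrite /blend ltNge (ltW h1) /= ltNge (ltW h2). Qed.

End Blend.

Section Straighten.
Variables (R : realType) (n : nat) (Phi : set (face_isometry R n)).
Notation tet := (tetrahedron R).
Notation pos := ('I_4 -> 'I_4 -> R).
Variables (ty : set tet -> {set 'I_4}) (DD : 'I_n -> set (set tet)) (p0 : 'I_n -> set tet -> pos).
Implicit Types (t : 'I_n) (D E : set tet) (p q r : 'I_n -> set tet -> pos).

Definition tiny (r : set tet -> pos) (e : R) D : Prop :=
  exists2 u, ty D = [set u]%SET & forall j, j != u -> r D u j < e.

Definition locally_small r : Prop := forall t (e : R), 0 < e -> finite_set [set D | DD t D /\ ~ tiny (r t) e D].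

Lemma tiny_sep (r : set tet -> pos) (e : R) D i j : antisym (r D) -> tiny r e D -> sep (ty D) i j ->
  r D i j < e \/ 1 - e < r D i j.
Proof.
move=> ar [u tu h]; rewrite /sep tu !inE; have [->|iu] := eqVneq i u; have [->|ju] := eqVneq j u => // _.
  by left; exact: h.
by right; rewrite (ar u i) ltrD2l ltrN2; exact: h.
Qed.

(** All but finitely many discs are so small that their corners are near the ends of the edge; to
    the finitely many others the distance is positive. *)
Lemma isolated r t D i j : (forall t, stack ty (DD t) (r t)) -> locally_small r -> DD t D -> sep (ty D) i j ->
  exists2 e : R, 0 < e & forall E, DD t E -> D <> E -> sep (ty E) i j -> e < `|r t D i j - r t E i j|.
Proof.
move=> st sm dD sD; have /andP[c0 c1] := stack_pos (st t) dD i j; set c := r t D i j in c0 c1 *.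
pose d := Num.min c (1 - c) / 2.
have d0 : 0 < d by rewrite divr_gt0// lt_min c0 subr_gt0.
have [dc dc'] : d + d <= c /\ d + d <= 1 - c.
  by rewrite /d -splitr; split; rewrite ge_min lexx ?orbT.
have [e e0 he] : exists2 e : R, 0 < e & forall E, [set E | DD t E /\ ~ tiny (r t) d E] E ->
    (D <> E /\ sep (ty E) i j -> e < `|c - r t E i j|).
  apply: eps_finite; first exact: sm.
    move=> E [dE _]; have [[ne sE]|h] := pselect (D <> E /\ sep (ty E) i j); last by exists 1.
    exists (`|c - r t E i j| / 2).
      by rewrite divr_gt0// normr_gt0 subr_eq0; exact: (stack_neq (st t) dD dE ne sD sE).
    by move=> _; rewrite ltr_pdivrMr// ltr_pMr ?ltr1n// normr_gt0 subr_eq0; exact: (stack_neq (st t) dD dE ne sD sE).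
  by move=> E e e' _ _ le h h'; exact: le_lt_trans le (h h').
exists (Num.min e d); first by rewrite lt_min e0.
move=> E dE ne sE; have [h|h] := pselect (tiny (r t) d E); last first.
  by apply: le_lt_trans (he E (conj dE h) (conj ne sE)); rewrite ge_min lexx.
apply: (@le_lt_trans _ _ d); first by rewrite ge_min lexx orbT.
rewrite lter_normr; have [h1|h1] := tiny_sep (stack_antisym (st t) dE) h sE; apply/orP; [left|right]; lra.
Qed.

Lemma enumeration p t u : stack ty (DD t) (p t) -> locally_small p ->
  infinite_set [set D | DD t D /\ ty D = [set u]%SET] ->
  exists Dn : nat -> set tet, [/\ forall k, DD t (Dn k) /\ ty (Dn k) = [set u]%SET,
    forall D, DD t D -> ty D = [set u]%SET -> exists k, D = Dn k
    & forall k j, j != u -> p t (Dn k.+1) u j < p t (Dn k) u j].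
Proof.
move=> st sm; set T := [set D | _] => infT.
have tu : dtype [set u]%SET by rewrite /dtype cards1.
have [_ ju] := type_edgeP tu; set j := (type_edge [set u]%SET).2 in ju.
have {}ju : j != u by move: ju; rewrite inE.
pose v D := p t D u j.
have lt D E : T D -> T E -> v D < v E -> forall k, k != u -> p t D u k < p t E u k.
  move=> [dD tD] [dE tE] l k ku; have [_ g _] := st.
  have ne : D <> E by move=> e; move: l; rewrite e ltxx.
  case: (g D E dD dE ne (etrans tD (esym tE))) => h; first by apply: h; rewrite tD !inE ?eqxx.
  by have := lt_trans l (h u j _ _); rewrite tD !inE eqxx ju ltxx => /(_ isT isT).
have vi : {in T &, injective v}.
  move=> D E /set_mem[dD tD] /set_mem[dE tE] e; apply: contrapT => ne.
  have s A : A = [set u]%SET -> sep A u j by move=> ->; rewrite /sep !inE eqxx (negbTE ju).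
  by have := stack_neq st dD dE ne (s _ tD) (s _ tE); rewrite -/(v D) e eqxx.
have uf : upper_finite (v @` T).
  move=> _ [D0 [d0 t0] <-]; have /andP[e0 _] := stack_pos st d0 u j.
  apply: (@sub_finite_set _ _ (v @` [set D | DD t D /\ ~ tiny (p t) (v D0) D])); last exact/finite_image/sm.
  move=> _ [[D [dD tD] <-] h]; exists D => //; split=> // -[u' tu' hu'].
  have uu : u' = u by apply/esym/finset.set1_inj; rewrite -tD tu'.
  by have := hu' j; rewrite uu ju => /(_ isT) l; have := lt_trans h l; rewrite ltxx.
(* If a rank were missing, all ranks would be below it by [rank_down], and there would be finitely
   many triangles. *)
have ranks k : exists2 D, T D & rank (v @` T) (v D) = k.
  apply: contrapT => H; apply: infT; rewrite -(eq_finite_set (inj_card_eq vi)).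
  have Tk : (v @` T #<= `I_k)%card.
    have e : (rank (v @` T) @` (v @` T) #= v @` T)%card.
      by apply: inj_card_eq => x y /set_mem Wx /set_mem Wy; exact: rank_inj.
    rewrite -(card_le_eql e); apply: subset_card_le => _ [_ [D TD <-] <-] /=; rewrite ltnNge; apply/negP => le.
    have [|_ [E TE <-] rE] := rank_down uf _ le; first by exists D.
    by apply: H; exists E.
  by apply: card_le_finite Tk _; exact: finite_II.
have /choice[Dn hDn] : forall k, exists D, T D /\ rank (v @` T) (v D) = k.
  by move=> k; have [D] := ranks k; exists D.
exists Dn; split=> [k|D dD tD|k i iu]; first by have [] := hDn k.
  exists (rank (v @` T) (v D)); have [TE rE] := hDn (rank (v @` T) (v D)).
  apply: vi; [exact/mem_set|exact/mem_set|apply: (rank_inj uf); first by exists D].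
    by exists (Dn (rank (v @` T) (v D))).
  by rewrite rE.
have [T1 r1] := hDn k; have [T2 r2] := hDn k.+1; apply: lt => //.
apply: (rank_lt_inv uf); [by exists (Dn k.+1)|by exists (Dn k)|by rewrite r1 r2].
Qed.

Variables (p q : 'I_n -> set tet -> pos).
Hypotheses (stp : forall t, stack ty (DD t) (p t)) (stq : forall t, stack ty (DD t) (q t))
  (so : forall t, same_order ty (DD t) (p t) (q t))
  (cp : compatible Phi ty DD p0 p) (cq : compatible Phi ty DD p0 q) (hm : has_mates Phi ty DD p0)
  (smp : locally_small p) (smq : locally_small q).

Definition path (a b : 'I_n -> set tet -> pos) (s : R) : 'I_n -> set tet -> pos :=
  fun t D i j => (1 - s) * a t D i j + s * b t D i j.

Lemma convex_lt (s a b a' b' : R) : 0 <= s <= 1 -> a < a' -> b < b' -> (1 - s) * a + s * b < (1 - s) * a' + s * b'.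
Proof.
move=> /andP[s0 s1] h1 h2; have [->|s'] := eqVneq s 0; first by rewrite subr0 !mul1r !mul0r !addr0.
by apply: ler_ltD; [rewrite ler_wpM2l ?subr_ge0// ltW|rewrite ltr_pM2l// lt_def s'].
Qed.

Section between.
Variables (a b : 'I_n -> set tet -> pos).
Hypotheses (sta : forall t, stack ty (DD t) (a t)) (stb : forall t, stack ty (DD t) (b t))
  (ab : forall t, same_order ty (DD t) (a t) (b t))
  (ca : compatible Phi ty DD p0 a) (cb : compatible Phi ty DD p0 b)
  (sma : locally_small a) (smb : locally_small b)
  (moved_finite : forall t, finite_set [set D | DD t D /\ exists i j, sep (ty D) i j /\ a t D i j <> b t D i j]).

Let st_path s t : 0 <= s <= 1 -> stack ty (DD t) (path a b s t).
Proof.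
move=> s01; apply: (stack_same_order (sta t)).
  by move=> D E i j dD dE s1 s2 h; apply: convex_lt => //; exact: ab.
move=> D dD; split=> [i j|i j].
  have /andP[a0 a1] := stack_pos (sta t) dD i j; have /andP[b0 b1] := stack_pos (stb t) dD i j.
  apply/andP; split.
    by have := convex_lt s01 a0 b0; rewrite !mulr0 addr0.
  by have := convex_lt s01 a1 b1; rewrite !mulr1 subrK.
by rewrite /path (stack_antisym (sta t) dD i j) (stack_antisym (stb t) dD i j); ring.
Qed.

Let compat_path s : compatible Phi ty DD p0 (path a b s).
Proof. by move=> t f t' v k l m D E mE; have [e1 e2] := ca mE; have [e3 e4] := cb mE; rewrite /path e1 e2 e3 e4. Qed.

Let moved t := [set D | DD t D /\ exists i j, sep (ty D) i j /\ a t D i j <> b t D i j].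

Let sep_ok t D (e : R) : Prop := forall i j, sep (ty D) i j ->
  [/\ e < a t D i j < 1 - e, e < b t D i j < 1 - e &
   forall E, DD t E -> D <> E -> sep (ty E) i j -> e + e < `|a t D i j - a t E i j| /\ e + e < `|b t D i j - b t E i j| ].

Let sep_ok_mono t D e e' : 0 < e' -> e' <= e -> sep_ok t D e -> sep_ok t D e'.
Proof.
move=> e'0 le h i j s; have [/andP[h1 h2] /andP[h3 h4] h5] := h i j s; split.
- by apply/andP; split; lra.
- by apply/andP; split; lra.
- by move=> E dE ne sE; have [h6 h7] := h5 E dE ne sE; split; lra.
Qed.

Let sep_ok_exists t D : DD t D -> exists2 e : R, 0 < e & sep_ok t D e.
Proof.
move=> dD; pose P (ij : 'I_4 * 'I_4) (e : R) := sep (ty D) ij.1 ij.2 ->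
  [/\ e < a t D ij.1 ij.2 < 1 - e, e < b t D ij.1 ij.2 < 1 - e &
   forall E, DD t E -> D <> E -> sep (ty E) ij.1 ij.2 -> e + e < `|a t D ij.1 ij.2 - a t E ij.1 ij.2| /\ e + e < `|b t D ij.1 ij.2 - b t E ij.1 ij.2| ].
have [e e0 he] : exists2 e : R, 0 < e & forall ij, [set: 'I_4 * 'I_4] ij -> P ij e.
  apply: eps_finite; first exact: all_finite.
    move=> [i j] _; have [s|ns] := boolP (sep (ty D) i j); last by exists 1 => // s; rewrite s in ns.
    have [e1 e10 h1] := isolated sta sma dD s; have [e2 e20 h2] := isolated stb smb dD s.
    have /andP[a0 a1] := stack_pos (sta t) dD i j; have /andP[b0 b1] := stack_pos (stb t) dD i j.
    pose m := Num.min (Num.min e1 e2) (Num.min (Num.min (a t D i j) (1 - a t D i j)) (Num.min (b t D i j) (1 - b t D i j))).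
    have m0 : 0 < m by rewrite !lt_min e10 e20 a0 b0 !subr_gt0 a1 b1.
    have [[m1 m2] [m3 m4] [m5 m6]] : [/\ m <= e1 /\ m <= e2, m <= a t D i j /\ m <= 1 - a t D i j & m <= b t D i j /\ m <= 1 - b t D i j].
      by rewrite /m !ge_min !lexx !orbT.
    exists (m / 2); first by rewrite divr_gt0.
    have m2' : m / 2 < m by rewrite ltr_pdivrMr// ltr_pMr// ltr1n.
    move=> _ /=; split.
    - by apply/andP; split; lra.
    - by apply/andP; split; lra.
    - move=> E dE ne sE; rewrite -splitr; split.
        exact: le_lt_trans m1 (h1 E dE ne sE).
      exact: le_lt_trans m2 (h2 E dE ne sE).
  move=> [i j] e e' _ e'0 le h s; have [/andP[h1 h2] /andP[h3 h4] h5] := h s; split.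
  - by apply/andP; split; lra.
  - by apply/andP; split; lra.
  - by move=> E dE ne sE; have [h6 h7] := h5 E dE ne sE; split; lra.
by exists e => // i j s; exact: (he (i, j) Logic.I s).
Qed.

(** Gaps of more than [2 * e] at both ends of the path persist along it, as the order does not
    change; steps shorter than [e] thus have disjoint collars. *)
Lemma straight_path : normally_isotopic (@realize R n Phi ty DD a) (@realize R n Phi ty DD b).
Proof.
have [e e0 he] : exists2 e : R, 0 < e & forall t, [set: 'I_n] t -> forall D, moved t D -> sep_ok t D e.
  apply: eps_finite; first exact: all_finite.
    move=> t _; apply: eps_finite; first exact: moved_finite.
      by move=> D [dD _]; exact: sep_ok_exists.
    by move=> D e e' _ e'0 le; exact: sep_ok_mono.
  by move=> t e e' _ e'0 le h D mD; apply: sep_ok_mono (h D mD).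
(* Positions differ by at most 1, so [N.+1] equal steps move each corner by less than [e]. *)
have [N Ne] := inv_nat_lt e0.
have N0 : (0 : R) < N.+1%:R by rewrite ltr0n.
pose r k := path a b (k%:R / N.+1%:R).
have k01 (k : nat) : (k <= N.+1)%N -> 0 <= (k%:R / N.+1%:R : R) <= 1.
  by move=> kN; rewrite divr_ge0//= ler_pdivrMr// mul1r ler_nat.
have rE k t D i j : r k t D i j = (1 - k%:R / N.+1%:R) * a t D i j + k%:R / N.+1%:R * b t D i j by [].
have -> : a = r 0%N by apply/funext => t; apply/funext => D; apply/funext => i; apply/funext => j; rewrite rE mul0r subr0 mul1r mul0r addr0.
have -> : @realize R n Phi ty DD b = @realize R n Phi ty DD (r N.+1).
  by congr realize; apply/funext => t; apply/funext => D; apply/funext => i; apply/funext => j; rewrite rE divff ?gt_eqF// subrr mul0r add0r mul1r.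
suff H k : (k <= N.+1)%N -> normally_isotopic (@realize R n Phi ty DD (r 0%N)) (@realize R n Phi ty DD (r k)) by exact: H.
elim: k => [_|k IH kN]; first exact: isotopic_refl.
apply: isotopic_trans (IH (ltnW kN)) _.
pose M t := fset_set (moved t).
have MP t D : D \in M t -> moved t D by rewrite in_fset_set; [move=> /set_mem|exact: moved_finite].
have sa := k01 k (ltnW kN); have sb := k01 k.+1 kN.
apply: (tent_step e0 (M := M) (p0 := p0)).
- by move=> t; exact: st_path.
- by move=> t; exact: st_path.
- exact: compat_path.
- exact: compat_path.
- exact: hm.
- by move=> t D /MP[].
- move=> t D dD DM i j iA jA; rewrite !rE.
  have -> : a t D i j = b t D i j; last by rewrite -!mulrDl !subrK.
  apply: contrapT => ne; move/negP: DM; apply; rewrite in_fset_set; last exact: moved_finite.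
  apply/mem_set; split=> //.
  by exists i, j; split=> //; exact: sep_in.
- move=> t D i j /MP mD iA jA; have s : sep (ty D) i j by exact: sep_in.
  have [/andP[h1 h2] /andP[h3 h4] _] := he t Logic.I D mD i j s; have [dD _] := mD.
  have /andP[a0 a1] := stack_pos (sta t) dD i j; have /andP[b0 b1] := stack_pos (stb t) dD i j.
  split.
  + rewrite !rE.
    have -> : (1 - k.+1%:R / N.+1%:R) * a t D i j + k.+1%:R / N.+1%:R * b t D i j -
       ((1 - k%:R / N.+1%:R) * a t D i j + k%:R / N.+1%:R * b t D i j) = (b t D i j - a t D i j) * N.+1%:R^-1.
      by rewrite -natr1; ring.
    rewrite normrM [X in _ * X]ger0_norm ?invr_ge0 ?(ltW N0)//.
    apply: le_lt_trans Ne; rewrite ler_piMl ?invr_ge0 ?(ltW N0)//.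
    by rewrite ler_norml; apply/andP; split; lra.
  + by rewrite rE subr_gt0; have := convex_lt sa h1 h3; rewrite -mulrDl subrK mul1r.
  + by rewrite rE -ltrBrDr; have := convex_lt sa h2 h4; rewrite -[X in _ < X -> _]mulrDl subrK mul1r.
(* The differences at the two ends of the path have the same sign, so their absolute values
   interpolate linearly. *)
- move=> t D E i j /MP mD dE ne s sE; have [dD _] := mD.
  have [_ _ h] := he t Logic.I D mD i j s; have {h} [ga gb] := h E dE ne sE.
  rewrite !rE; have [l|l|/eqP] := ltgtP (a t D i j) (a t E i j).
  + have l' := ab dD dE s sE l.
    move: ga gb; rewrite ltr0_norm ?subr_lt0// ltr0_norm ?subr_lt0// => ga gb.
    rewrite ltr0_norm ?subr_lt0 ?convex_lt//.
    have := convex_lt sa ga gb; rewrite -mulrDl subrK mul1r => /lt_le_trans; apply.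
    by rewrite le_eqVlt; apply/orP; left; apply/eqP; ring.
  + have l' := ab dE dD sE s l.
    move: ga gb; rewrite gtr0_norm ?subr_gt0// gtr0_norm ?subr_gt0// => ga gb.
    rewrite gtr0_norm ?subr_gt0 ?convex_lt//.
    have := convex_lt sa ga gb; rewrite -mulrDl subrK mul1r => /lt_le_trans; apply.
    by rewrite le_eqVlt; apply/orP; left; apply/eqP; ring.
  + by rewrite (negbTE (stack_neq (sta t) dD dE ne s sE)).
Qed.

End between.
End Straighten.

Section Merging.
Variables (R : realType) (n : nat) (Phi : set (face_isometry R n)).
Notation tet := (tetrahedron R).
Notation pos := ('I_4 -> 'I_4 -> R).
Variables (ty : set tet -> {set 'I_4}) (DD : 'I_n -> set (set tet)) (p0 : 'I_n -> set tet -> pos).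
Implicit Types (t : 'I_n) (D E : set tet) (p q r : 'I_n -> set tet -> pos).

Lemma same_order_sym p q t : stack ty (DD t) (p t) -> same_order ty (DD t) (p t) (q t) -> same_order ty (DD t) (q t) (p t).
Proof.
move=> st so D E i j dD dE s1 s2 lt; have ne : D <> E by move=> e; move: lt; rewrite e ltxx.
have [//|h|/eqP] := ltgtP (p t D i j) (p t E i j); last by rewrite (negbTE (stack_neq st dD dE ne s1 s2)).
by have := lt_trans lt (so E D i j dE dD s2 s1 h); rewrite ltxx.
Qed.

Variable th : R.
Hypotheses (th0 : 0 < th) (th2 : th <= 2^-1).

Definition blended p q : 'I_n -> set tet -> pos := fun t D i j => blend th (p t D i j) (q t D i j).

Lemma blended_order p q t : same_order ty (DD t) (p t) (q t) -> same_order ty (DD t) (p t) (blended p q t).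
Proof. by move=> so D E i j dD dE s1 s2 lt; apply: blend_lt => //; exact: so. Qed.

Lemma blended_stack p q t : stack ty (DD t) (p t) -> stack ty (DD t) (q t) -> same_order ty (DD t) (p t) (q t) ->
  stack ty (DD t) (blended p q t).
Proof.
move=> st stq so; apply: (stack_same_order st (blended_order so)) => D dD; split=> i j.
  by apply: blend01; [exact: stack_pos st _ dD _ _|exact: stack_pos stq _ dD _ _].
by rewrite /blended (stack_antisym st dD i j) (stack_antisym stq dD i j) blend_opp.
Qed.

Lemma blended_compatible p q : compatible Phi ty DD p0 p -> compatible Phi ty DD p0 q -> compatible Phi ty DD p0 (blended p q).
Proof. by move=> cp cq t f t' s k l m D E mE; have [e1 e2] := cp _ _ _ _ _ _ _ _ _ mE; have [e3 e4] := cq _ _ _ _ _ _ _ _ _ mE; rewrite /blended e1 e2 e3 e4. Qed.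

Lemma blended_tiny p q t D (e : R) : e <= th -> tiny ty (p t) e D -> tiny ty (blended p q t) e D.
Proof.
move=> eth [u tu h]; exists u => // j ju; have l := h j ju.
by apply: le_lt_trans l; apply: blend_le; exact: lt_le_trans (h j ju) eth.
Qed.

Lemma blended_small p q : locally_small ty DD p -> locally_small ty DD (blended p q).
Proof.
move=> sm t e e0; have m0 : 0 < Num.min e th by rewrite lt_min e0.
apply: sub_finite_set (sm t _ m0) => D [dD H]; split=> // tD; apply: H.
have [|u tu h] := @blended_tiny p q t D (Num.min e th) _ tD; first by rewrite ge_min lexx orbT.
by exists u => // j ju; apply: lt_le_trans (h j ju) _; rewrite ge_min lexx.
Qed.

(** Where a triangle is small for both [p] and [q], the blend takes minima or maxima of the two and
    is symmetric in them. *)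
Lemma blended_moved_finite p q t : (forall D, DD t D -> antisym (p t D) /\ antisym (q t D)) ->
  locally_small ty DD p -> locally_small ty DD q ->
  finite_set [set D | DD t D /\ exists i j, sep (ty D) i j /\ blended p q t D i j <> blended q p t D i j].
Proof.
move=> an smp smq; apply: (@sub_finite_set _ _ ([set D | DD t D /\ ~ tiny ty (p t) th D] `|` [set D | DD t D /\ ~ tiny ty (q t) th D])).
  move=> D [dD [i [j [s ne]]]]; have [tp|tp] := pselect (tiny ty (p t) th D); last by left.
  have [tq|tq] := pselect (tiny ty (q t) th D); last by right.
  exfalso; apply: ne; have [ap aq] := an D dD.
  move: tp tq => [u tu h] [v tv h']; have uv : v = u by apply/esym/finset.set1_inj; rewrite -tu tv.
  subst v; move: s; rewrite /sep tu !inE; have [->|iu] := eqVneq i u; have [->|ju] := eqVneq j u => // _.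
    by apply: blendC; [exact: h|exact: h'].
  rewrite /blended (ap u i) (aq u i) !blend_opp//; congr (1 - _).
  by apply: blendC; [exact: h|exact: h'].
by rewrite finite_setU; split; [exact: smp|exact: smq].
Qed.

End Merging.

Section Straightening.
Variables (R : realType) (n : nat) (Phi : set (face_isometry R n)).
Notation tet := (tetrahedron R).
Notation pos := ('I_4 -> 'I_4 -> R).
Variables (ty : set tet -> {set 'I_4}) (DD : 'I_n -> set (set tet)) (p0 : 'I_n -> set tet -> pos).
Implicit Types (t : 'I_n) (D E : set tet).
Variables (p q : 'I_n -> set tet -> pos).
Hypotheses (stp : forall t, stack ty (DD t) (p t)) (stq : forall t, stack ty (DD t) (q t))
  (so : forall t, same_order ty (DD t) (p t) (q t))
  (cp : compatible Phi ty DD p0 p) (cq : compatible Phi ty DD p0 q) (hm : has_mates Phi ty DD p0)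
  (smp : locally_small ty DD p) (smq : locally_small ty DD q).

(* The infinite tails of triangles are first moved, by rescaling at the vertices, to
   positions m1 of p and m2 of q that agree near the vertices; only finitely many
   discs then remain to be moved from m1 to m2. *)
Theorem straighten : normally_isotopic (@realize R n Phi ty DD p) (@realize R n Phi ty DD q).
Proof.
pose T t u := [set D | DD t D /\ ty D = [set u]%SET].
pose inf t u := `[< infinite_set (T t u) >].
have /choice[Dn0 hDn0] : forall tu : 'I_n * 'I_4, exists Dn : nat -> set tet, inf tu.1 tu.2 ->
    [/\ forall k, T tu.1 tu.2 (Dn k), forall D, DD tu.1 D -> ty D = [set tu.2]%SET -> exists k, D = Dn k
    & forall k j, j != tu.2 -> p tu.1 (Dn k.+1) tu.2 j < p tu.1 (Dn k) tu.2 j].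
  move=> [t u]; have [i|i] := boolP (inf t u); last by exists (fun _ => set0).
  by have [Dn h] := enumeration (stp t) smp (asboolW i); exists Dn.
pose Dn t u := Dn0 (t, u).
have hDn t u : inf t u -> [/\ forall k, T t u (Dn t u k), forall D, DD t D -> ty D = [set u]%SET -> exists k, D = Dn t u k
    & forall k j, j != u -> p t (Dn t u k.+1) u j < p t (Dn t u k) u j] by exact: (hDn0 (t, u)).
have lim r t u (e : R) : locally_small ty DD r -> inf t u -> 0 < e -> exists k, forall j, j != u -> r t (Dn t u k) u j < e.
  move=> sm i e0; have [h1 h2 _] := hDn t u i.
  have [D [TD tD]] : exists D, T t u D /\ tiny ty (r t) e D.
    apply: contrapT => H; apply: (asboolW i); apply: sub_finite_set (sm t e e0) => D TD; split; first by case: TD.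
    by move=> tD; apply: H; exists D.
  have [dD uD] := TD; have [k Dk] := h2 D dD uD; exists k => j ju.
  have [v tv h] := tD; have uv : v = u by apply/esym/finset.set1_inj; rewrite -uD tv.
  by rewrite -Dk; move: h; rewrite uv; apply.
(* The discs that a rescaling must not move: the quadrilaterals, the finite chains and the heads of
   the infinite ones. *)
pose frozen t := [set D | DD t D /\ forall u k, inf t u -> D <> Dn t u k.+1].
have frozen_finite t : finite_set (frozen t).
  pose G u := if inf t u then [set Dn t u 0%N] else T t u.
  apply: (@sub_finite_set _ _ ([set D | DD t D /\ ~ tiny ty (p t) 1 D] `|` \bigcup_(u in [set: 'I_4]) G u)); last first.
    rewrite finite_setU; split; first exact: smp.
    apply: bigcup_finite => [|u _]; first exact: all_finite.
    rewrite /G; have [i|i] := boolP (inf t u); first exact: finite_set1.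
    by apply: contrapT => h; move/negP: i; apply; apply/asboolP.
  move=> D [dD hD]; have [[u tu _]|nt] := pselect (tiny ty (p t) 1 D); last by left.
  right; exists u => //; rewrite /G; have [i|i] := boolP (inf t u); last by split.
  have [_ h2 _] := hDn t u i; have [[|k] Dk] := h2 D dD tu; first by rewrite Dk.
  by case: (hD u k i).
pose ok t D (e : R) := forall i j, e < p t D i j < 1 - e /\ e < q t D i j < 1 - e.
(* A threshold below all positions of the finitely many frozen discs, and below their complements to
   1; there the blend does not alter its first argument. *)
have [th1 th10 hth] : exists2 e : R, 0 < e & forall t, [set: 'I_n] t -> forall D, frozen t D -> ok t D e.
  apply: eps_finite; first exact: all_finite.
    move=> t _; apply: eps_finite; first exact: frozen_finite.
      move=> D [dD _].
      have [e e0 he] : exists2 e : R, 0 < e & forall ij, [set: 'I_4 * 'I_4] ij ->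
          e < p t D ij.1 ij.2 < 1 - e /\ e < q t D ij.1 ij.2 < 1 - e.
        apply: eps_finite; first exact: all_finite.
          move=> [i j] _ /=; have /andP[a0 a1] := stack_pos (stp t) dD i j; have /andP[b0 b1] := stack_pos (stq t) dD i j.
          pose m := Num.min (Num.min (p t D i j) (1 - p t D i j)) (Num.min (q t D i j) (1 - q t D i j)).
          have m0 : 0 < m by rewrite !lt_min a0 b0 !subr_gt0 a1 b1.
          have [[m3 m4] [m5 m6]] : (m <= p t D i j /\ m <= 1 - p t D i j) /\ (m <= q t D i j /\ m <= 1 - q t D i j).
            by rewrite /m !ge_min !lexx !orbT.
          have m2' : m / 2 < m by rewrite ltr_pdivrMr// ltr_pMr// ltr1n.
          by exists (m / 2); [rewrite divr_gt0|split; apply/andP; split; lra].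
        by move=> [i j] e e' _ e'0 le [/andP[h1 h2] /andP[h3 h4]]; split; apply/andP; split; lra.
      by exists e => // i j; exact: (he (i, j) Logic.I).
    move=> D e e' _ e'0 le h i j; have [/andP[h1 h2] /andP[h3 h4]] := h i j.
    by split; apply/andP; split; lra.
  move=> t e e' _ e'0 le h D FD i j; have [/andP[h1 h2] /andP[h3 h4]] := h D FD i j.
  by split; apply/andP; split; lra.
pose th := Num.min th1 2^-1.
have th0 : 0 < th by rewrite lt_min th10 invr_gt0 ltr0n.
have th2 : th <= 2^-1 by rewrite ge_min lexx orbT.
have th1' : th <= th1 by rewrite ge_min lexx.
have os t : same_order ty (DD t) (q t) (p t) by exact: same_order_sym.
have st1 t : stack ty (DD t) (blended th p q t) by exact: blended_stack.
have st2 t : stack ty (DD t) (blended th q p t) by exact: blended_stack.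
have c1 : compatible Phi ty DD p0 (blended th p q) by exact: blended_compatible.
have c2 : compatible Phi ty DD p0 (blended th q p) by exact: blended_compatible.
have sm1 : locally_small ty DD (blended th p q) by exact: blended_small.
have sm2 : locally_small ty DD (blended th q p) by exact: blended_small.
have DnD t u k : inf t u -> DD t (Dn t u k) /\ ty (Dn t u k) = [set u]%SET.
  by move=> i; have [h _ _] := hDn t u i; have [] := h k.
have Dns t u D : inf t u -> DD t D -> ty D = [set u]%SET -> exists k, D = Dn t u k.
  by move=> i; have [_ h _] := hDn t u i; exact: h.
have decp t u k j : inf t u -> j != u -> p t (Dn t u k.+1) u j < p t (Dn t u k) u j.
  by move=> i; have [_ _ h] := hDn t u i; exact: h.
have decr r : (forall t, same_order ty (DD t) (p t) (r t)) -> forall t u k j, inf t u -> j != u ->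
    r t (Dn t u k.+1) u j < r t (Dn t u k) u j.
  move=> so' t u k j i ju; have [d1 t1] := DnD t u k i; have [d2 t2] := DnD t u k.+1 i.
  have s A : A = [set u]%SET -> sep A u j by move=> ->; rewrite /sep !inE eqxx (negbTE ju).
  apply: so' => //; [exact: s|exact: s|exact: decp].
have o1 t : same_order ty (DD t) (p t) (blended th p q t) by exact: blended_order.
have o2 t : same_order ty (DD t) (p t) (blended th q p t).
  by move=> D E i j dD dE s1 s2 l; apply: (blended_order th (os t)) => //; exact: so.
have o12 t : same_order ty (DD t) (blended th p q t) (blended th q p t).
  have h := same_order_sym (stp t) (o1 t).
  by move=> D E i j dD dE s1 s2 l; apply: o2 => //; exact: h.
apply: (isotopic_trans (B := @realize R n Phi ty DD (blended th p q))).
  apply: (chain_step (p0 := p0) (inf := inf) (Dn := Dn)) => //.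
  - exact: decr.
  - by move=> t u e; exact: lim.
  - by move=> t u e; exact: lim.
  - move=> t D dD hD i j _; have [/andP[h1 h2] _] := hth t Logic.I D (conj dD hD) i j.
    by rewrite /blended blend_id//; [exact: le_lt_trans th1' h1|apply: lt_le_trans h2 _; rewrite lerD2l lerN2].
apply: (isotopic_trans (B := @realize R n Phi ty DD (blended th q p))).
  apply: (straight_path (p0 := p0)) => //.
  move=> t; apply: blended_moved_finite => // D dD.
  by split; [exact: (stack_antisym (stp t) dD)|exact: (stack_antisym (stq t) dD)].
apply: (chain_step (p0 := p0) (inf := inf) (Dn := Dn)) => //.
- exact: decr.
- exact: decr.
- by move=> t u e; exact: lim.
- by move=> t u e; exact: lim.
- move=> t D dD hD i j _; have [_ /andP[h1 h2]] := hth t Logic.I D (conj dD hD) i j.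
  by rewrite /blended blend_id//; [exact: le_lt_trans th1' h1|apply: lt_le_trans h2 _; rewrite lerD2l lerN2].
Qed.

End Straightening.

Section Decompositions.
Variables (R : realType) (n : nat) (Phi : set (face_isometry R n)).
Notation tet := (tetrahedron R).
Notation q := (quotient_map (R:=R) (n:=n) Phi).

Lemma normal_decomposed (S : set (glued_space Phi)) : normal_subset S -> exists DD, decomposed S DD.
Proof.
move=> [/choice[DD h] ax2 ax3]; exists DD; split=> // t; by have [] := h t.
Qed.

Lemma realize_preimage (S : set (glued_space Phi)) (DD : 'I_n -> set (set tet)) :
  decomposed S DD -> S = \bigcup_t (q t @` (\bigcup_(D in DD t) D)).
Proof.
move=> [_ _ pre _ _]; apply/seteqP; split=> [y Sy|_ [t _ [x hx <-]]].
  by have [t [x e]] := q_surj y; exists t => //; exists x => //; rewrite -pre /= -e.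
by move: hx; rewrite -pre.
Qed.

End Decompositions.

(** The hypothesis counts discs of the type of a given normal disc, so a representative of the type
    is taken from [S0] or [S1]; if there is none, both sides are empty. *)
Lemma typed_card (R : realType) (n : nat) (Phi : set (face_isometry R n)) (S0 S1 : set (glued_space Phi))
    (DD0 DD1 : 'I_n -> set (set (tetrahedron R))) t A :
  pseudo_manifold Phi -> decomposed S0 DD0 -> decomposed S1 DD1 ->
  (forall E : set (glued_space Phi), normal_disc_in E -> (discs_of_type E S0 #= discs_of_type E S1)%card) ->
  (typed DD0 t A #= typed DD1 t A)%card.
Proof.
move=> pm dS0 dS1 h.
have K (D : set (tetrahedron R)) : normal_disc D -> disc_type D = A -> (typed DD0 t A #= typed DD1 t A)%card.
  move=> nD tD; have hE : normal_disc_in (quotient_map Phi t @` D) by exists t, D.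
  have k0 := discs_of_type_card pm dS0 t nD; have k1 := discs_of_type_card pm dS1 t nD.
  rewrite tD in k0 k1; rewrite card_eq_sym in k0.
  exact: card_eq_trans k0 (card_eq_trans (h _ hE) k1).
have [e0|/set0P[D [dD tD]]] := eqVneq (typed DD0 t A) set0; last exact: K (dec_normal dS0 dD) tD.
have [e1|/set0P[D [dD tD]]] := eqVneq (typed DD1 t A) set0; last exact: K (dec_normal dS1 dD) tD.
by rewrite e0 e1 card_eq00.
Qed.

Local Open Scope card_scope.

Theorem lemma1p19 (R : realType) (n : nat) (Phi : set (face_isometry R n))
    (P_pseudo : pseudo_manifold Phi) (S0 S1 : set (glued_space Phi))
    (S0_normal : normal_subset S0) (S1_normal : normal_subset S1)
    (same_number : forall E : set (glued_space Phi), normal_disc_in E ->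
       discs_of_type E S0 #= discs_of_type E S1) :
  normally_isotopic S0 S1.
Proof.
have [DD0 dS0] := normal_decomposed S0_normal; have [DD1 dS1] := normal_decomposed S1_normal.
have card01 t A := typed_card t A P_pseudo dS0 dS1 same_number.
have [beta hb] := match_exists P_pseudo dS0 dS1 card01.
have st0 := dec_stack dS0.
have so t : same_order (@disc_type R) (DD0 t) (@corner R) (fun D => corner (beta t D)) by have [] := hb t.
have st1 t : stack (@disc_type R) (DD0 t) (fun D => corner (beta t D)).
  apply: (stack_same_order (st0 t) (so t)) => D dD; have [b1 _ _] := hb t; have [d1 _] := b1 D dD.
  by split; [exact: (corner_unit (dec_normal dS1 d1))|exact: (corner_antisym (dec_normal dS1 d1))].
have sm0 : locally_small (@disc_type R) DD0 (fun _ => @corner R).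
  by move=> t e e0; exact: (big_finite P_pseudo dS0 t e0).
have sm1 : locally_small (@disc_type R) DD0 (fun t D => corner (beta t D)).
  move=> t e e0; have [b1 _ _] := hb t; have := big_finite P_pseudo dS1 t e0; set F := [set D | _] => fF.
  apply: (@sub_finite_set _ _ (DD0 t `&` beta t @^-1` F)).
    move=> D [dD nt]; have [d1 t1] := b1 D dD; split=> //; split=> // -[u tu h].
    by apply: nt; exists u; rewrite -?t1.
  (* The matching is injective, so finiteness of the large discs of [S1] is pulled back. *)
  have inj : {in DD0 t `&` beta t @^-1` F &, injective (beta t)}.
    by move=> D E /set_mem[dD _] /set_mem[dE _]; exact: (beta_inj dS0 hb dD dE).
  rewrite -(eq_finite_set (inj_card_eq inj)); apply: sub_finite_set fF => _ [D [_ h] <-]; exact: h.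
have main := straighten st0 st1 so (p0 := fun _ => @corner R) _ (beta_compatible P_pseudo dS0 dS1 hb)
  (decomposed_mates P_pseudo dS0) sm0 sm1.
have -> : S0 = @realize R n Phi (@disc_type R) DD0 (fun _ => @corner R).
  rewrite {1}(realize_preimage dS0); apply: eq_bigcupr => t _; congr image.
  by apply: eq_bigcupr => D dD; exact: (corner_disc (dec_normal dS0 dD)).
have -> : S1 = @realize R n Phi (@disc_type R) DD0 (fun t D => corner (beta t D)).
  rewrite {1}(realize_preimage dS1); apply: eq_bigcupr => t _; congr image; have [b1 b2 _] := hb t.
  apply/seteqP; split=> [x [D' dD' D'x]|x [D dD Dx]].
    have [D dD e] := b2 D' dD'; have [d1 t1] := b1 D dD; exists D => //.
    by rewrite -t1 -(corner_disc (dec_normal dS1 d1)) e.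
  have [d1 t1] := b1 D dD; exists (beta t D) => //.
  by rewrite (corner_disc (dec_normal dS1 d1)) t1.
(* The initial positions are compatible with themselves by the last clause of [mates]. *)
by apply: main => t f t' s k l m D E [_ _ _ _ ].
Qed.
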